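(* Assume the Riemann hypothesis and assume that all nontrivial zeros of the Riemann zeta function $\zeta(s)$ are simple. For $n\in\mathbb{N}$ let $\gamma_n$ denote the imaginary part of the $n$-th zero of $\zeta(s)$ in the upper half plane (ordered by increasing imaginary part). For $\xi>0$ and $k\in\mathbb{N}$ define \[ S(\xi,k)=\frac{1}{\xi}\sqrt{\frac{k}{2\pi}}\sum_{n=1}^\infty \exp\Big\{-2\frac{k}{\xi^2}(\gamma_n-\xi)^2\Big\}. \] Then \[ S(\xi,k)=\frac{1}{4\pi}\log\frac{\xi}{2\pi}-c_2\sum_{n=1}^\infty \frac{\Lambda(n)}{\sqrt{n}}\exp\Big\{-\frac{\xi^2}{4k}\log^2 n\Big\}\,H_{2k}\Big(\xi\frac{\log n}{2\sqrt{k}}\Big)+E, \] where \[ c_2=\frac{1}{2\sqrt{\pi}}\,\frac{(-1/4)^k}{\Gamma(k+1/2)}, \] and the error term satisfies $E\ll\big(\sqrt{k}/\xi^2+\exp\{-\sqrt{k}/\xi\}\big)\log\xi$ as $\xi\to\infty$.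
   Context: $\Lambda(n)$ is the von Mangoldt function. $H_m(x)=(-1)^m e^{x^2}\frac{d^m}{dx^m}e^{-x^2}$ is the $m$-th (physicists') Hermite polynomial. $\Gamma$ is the Gamma function. *)

(* Defs.v *)
From Stdlib Require Import Reals.
From Coquelicot Require Import Coquelicot.
From mathcomp Require Import all_boot.

Local Open Scope R_scope.

Definition von_Mangoldt (n : nat) : R :=
  let p := pdiv n in
  if (1 < n)%N && (n == p ^ logn p n)%N then ln (INR p) else 0.

Definition Hermite (m : nat) (x : R) : R :=
  (- 1) ^ m * exp (x ^ 2) * Derive_n (fun y => exp (- y ^ 2)) m x.

(* Euler's integral; it converges, and so defines Gamma, only for x > 0. *)
Definition Gamma (x : R) : R :=
  RInt_gen (fun t => Rpower t (x - 1) * exp (- t))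
    (at_right 0) (Rbar_locally p_infty).

(* n ^ s = exp (s log n), meaningful for n > 0. *)
Definition natCpow (n : nat) (s : C) : C :=
  (RtoC (exp (Re s * ln (INR n))) *
   (cos (Im s * ln (INR n)), sin (Im s * ln (INR n))))%C.

Definition complex_derivable (f : C -> C) (s : C) : Prop :=
  ex_derive (K := C_AbsRing) (V := C_NormedModule) f s.

(* By the identity theorem these two clauses determine zeta on C \ {1}; the
   value at the pole s = 1 is left unspecified. *)
Definition is_Riemann_zeta (zeta : C -> C) : Prop :=
  (forall s : C, 1 < Re s ->
     is_series (K := C_AbsRing) (V := C_NormedModule)
       (fun n : nat => Cinv (natCpow n.+1 s)) (zeta s)) /\
  (forall s : C, s <> RtoC 1 -> complex_derivable zeta s).

Definition nontrivial_zero (zeta : C -> C) (s : C) : Prop :=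
  s <> RtoC 1 /\ zeta s = RtoC 0 /\
  ~ (exists n : nat, s = RtoC (- 2 * INR n.+1)).

Definition Riemann_hypothesis (zeta : C -> C) : Prop :=
  forall s : C, nontrivial_zero zeta s -> Re s = 1 / 2.

Definition all_nontrivial_zeros_simple (zeta : C -> C) : Prop :=
  forall s : C, nontrivial_zero zeta s -> C_derive zeta s <> RtoC 0.

(* rho 0, rho 1, ... lists each zero in the upper half plane exactly once; the
   indices are shifted by one, so that gamma_n = Im (rho (n - 1)). *)
Definition upper_zero_enumeration (zeta : C -> C) (rho : nat -> C) : Prop :=
  (forall n : nat, 0 < Im (rho n) /\ zeta (rho n) = RtoC 0) /\
  (forall s : C, 0 < Im s -> zeta s = RtoC 0 -> exists n : nat, rho n = s) /\
  (forall m n : nat, rho m = rho n -> m = n) /\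
  (forall m n : nat, (m <= n)%N -> Im (rho m) <= Im (rho n)).

Definition zero_term (gamma : nat -> R) (xi : R) (k n : nat) : R :=
  exp (- 2 * (INR k / xi ^ 2) * (gamma n - xi) ^ 2).

Definition S_sum (gamma : nat -> R) (xi : R) (k : nat) : R :=
  1 / xi * sqrt (INR k / (2 * PI)) * Series (zero_term gamma xi k).

Definition prime_term (xi : R) (k n : nat) : R :=
  von_Mangoldt n / sqrt (INR n) * exp (- (xi ^ 2 / (4 * INR k)) * ln (INR n) ^ 2)
  * Hermite (2 * k)%N (xi * (ln (INR n) / (2 * sqrt (INR k)))).

Definition c2 (k : nat) : R :=
  1 / (2 * sqrt PI) * ((- 1 / 4) ^ k / Gamma (INR k + 1 / 2)).

(* Main.v *)
(* By the functional equation of theta, the completed zeta function is an entire function of z = (s - 1/2)^2 of order at most 3/4; under RH its zeros are the simple points -gamma_n^2, so Hadamard's theorem and the Dirichlet series of zeta'/zeta give, for w = s - 1/2 with Re w > 1/2,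
     sum_n 2w / (w^2 + gamma_n^2) = 2w / (w^2 - 1/4) + (psi(s/2) - log pi) / 2 - sum_n Lambda(n) n^(-s).
   Integrating against (-1)^k w^(2k) exp(a w^2), a = k / xi^2, along Re w = 1 yields an explicit formula: each zero contributes the weight t^(2k) exp(-a t^2) at t = gamma_n, each prime power a Hermite function of log n, and moving the archimedean integral to Re w = 0 averages log(t / 2 pi) / 2 against the same weight. Dividing by the total mass Gamma(k + 1/2) a^(-k - 1/2) of the weight, only the pole term, of size exp(k / (4 xi^2)) (xi^2)^(-k), and two comparisons remain: the weight is concentrated at t = xi, which gives log(xi / 2 pi), and in the variable x = t / xi it is close to exp(-2k (x - 1)^2), up to O(k^(-1/2)) / (1 + k (x - 1)^2); that error is summed over the zeros through the real part of the identity above at w = sigma + i xi. *)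

Require Import Defs.
From Stdlib Require Import Reals Lra Lia Psatz ClassicalEpsilon Factorial.
From Coquelicot Require Import Coquelicot.
From HB Require Import structures.
From mathcomp Require all_boot.
From Corelib Require Import ssreflect.
Set Implicit Arguments.
Unset Strict Implicit.
Local Open Scope R_scope.

(** * Complex differentiation and line integrals *)

(** No contour is ever moved across a zero. On Re w = 1 the Dirichlet series converges, and the
    partial fraction 2w / (w^2 + g^2) integrated there against the Gaussian weight returns, up to 2
    pi, the weight at g; this comes from a differential equation in the position of the pole. The
    complex Gamma factor does not arise as an integral: only real Mellin transforms occur, and the
    complex factor is the exponential of a primitive of the digamma series. The identities for zeta
    are carried from the real axis by the identity theorem. The obstacle is uniformity in k. The
    real part of the zero identity at sigma + i xi measures the zeros in a window of width sigma,
    but it is available only for sigma >= 1, whereas the weight has width xi / sqrt k. Hence sigma =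
    max(1, xi / sqrt k). If sqrt k >= xi, all errors are of size sqrt k / xi^2 times log xi;
    otherwise they are O(log xi), and exp(-sqrt k / xi) >= 1/e pays for that. *)

Definition ccont (f : C -> C) (z : C) : Prop :=
  forall eps, 0 < eps -> exists d, 0 < d /\
    forall y, Cmod (y - z) < d -> Cmod (f y - f z) < eps.

(** Caratheodory's form of the derivative: a globally defined slope function [phi], continuous at
    the point. Product, chain and sum rules become algebra on [phi], and the same [phi] is later the
    integrand in Cauchy's formula. *)
Definition cderiv (f : C -> C) (z l : C) : Prop :=
  exists phi : C -> C, phi z = l /\ ccont phi z /\
    forall y, f y = (f z + phi y * (y - z))%C.

Definition rcont (f : R -> C) (t : R) : Prop :=
  forall eps, 0 < eps -> exists d, 0 < d /\
    forall u, Rabs (u - t) < d -> Cmod (f u - f t) < eps.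

Definition rderiv (f : R -> C) (t : R) (l : C) : Prop :=
  exists phi : R -> C, phi t = l /\ rcont phi t /\
    forall u, f u = (f t + phi u * RtoC (u - t))%C.

Lemma Cmod_minus_sym (x y : C) : Cmod (x - y) = Cmod (y - x).
Proof. rewrite -Cmod_opp. congr Cmod. ring. Qed.

Lemma Cmod_triangle_minus (x y : C) : Cmod (x - y) <= Cmod x + Cmod y.
Proof.
apply: Rle_trans (Cmod_triangle _ _) _. rewrite Cmod_opp. lra.
Qed.

Lemma Cmod_triangle_inv (x y : C) : Cmod x - Cmod y <= Cmod (x - y).
Proof.
have h := Cmod_triangle (x - y) y.
replace (x - y + y)%C with x in h by ring. lra.
Qed.

Lemma Cmod_triangle_mid (x y z : C) : Cmod (x - z) <= Cmod (x - y) + Cmod (y - z).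
Proof.
have h := Cmod_triangle (x - y) (y - z).
by replace (x - y + (y - z))%C with (x - z)%C in h by ring.
Qed.

Lemma Cmod_self (x : C) : Cmod (x - x) = 0.
Proof. replace (x - x)%C with (RtoC 0) by ring. exact: Cmod_0. Qed.

Lemma Cminus_neq0 (x y : C) : x <> y -> (x - y)%C <> RtoC 0.
Proof. move=> h e. apply: h. by apply/Ceq_minus. Qed.

Lemma Cmod_minus_gt0 (x y : C) : x <> y -> 0 < Cmod (x - y).
Proof. move=> h. apply/Cmod_gt_0. exact: Cminus_neq0. Qed.

Lemma Ceq_of_eps (x y : C) : (forall eps, 0 < eps -> Cmod (x - y) <= eps) -> x = y.
Proof.
move=> h. case: (Ceq_dec x y) => // n.
have p := Cmod_minus_gt0 n. have := h (Cmod (x - y) / 2) ltac:(lra). lra.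
Qed.

Lemma ccont_const (a z : C) : ccont (fun _ => a) z.
Proof. move=> e he. exists 1; split; first lra. move=> y _. by rewrite Cmod_self. Qed.

Lemma ccont_id (z : C) : ccont (fun x => x) z.
Proof. move=> e he. exists e; split => //. Qed.

Lemma ccont_comp (f g : C -> C) (z : C) :
  ccont g z -> ccont f (g z) -> ccont (fun x => f (g x)) z.
Proof.
move=> hg hf e he. case: (hf e he) => d [hd h1]. case: (hg d hd) => d' [hd' h2].
exists d'; split => // y hy. apply: h1. exact: h2.
Qed.

Lemma ccont_plus (f g : C -> C) (z : C) :
  ccont f z -> ccont g z -> ccont (fun x => f x + g x)%C z.
Proof.
move=> hf hg e he.
case: (hf (e/2) ltac:(lra)) => d1 [hd1 h1]. case: (hg (e/2) ltac:(lra)) => d2 [hd2 h2].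
exists (Rmin d1 d2); split; first by apply: Rmin_glb_lt.
move=> y hy. have y1 := h1 y (Rlt_le_trans _ _ _ hy (Rmin_l _ _)).
have y2 := h2 y (Rlt_le_trans _ _ _ hy (Rmin_r _ _)).
replace (f y + g y - (f z + g z))%C with ((f y - f z) + (g y - g z))%C by ring.
apply: Rle_lt_trans (Cmod_triangle _ _) _. lra.
Qed.

Lemma ccont_mult (f g : C -> C) (z : C) :
  ccont f z -> ccont g z -> ccont (fun x => f x * g x)%C z.
Proof.
move=> hf hg e he.
set A := Cmod (f z) + Cmod (g z) + 1.
have A1 : 1 <= A by have := Cmod_ge_0 (f z); have := Cmod_ge_0 (g z); rewrite /A; lra.
set e' := Rmin 1 (e / (2 * A)).
have he' : 0 < e' by apply: Rmin_glb_lt; [lra | apply: Rdiv_lt_0_compat; lra].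
case: (hf e' he') => d1 [hd1 h1]. case: (hg e' he') => d2 [hd2 h2].
exists (Rmin d1 d2); split; first by apply: Rmin_glb_lt.
move=> y hy. have y1 := h1 y (Rlt_le_trans _ _ _ hy (Rmin_l _ _)).
have y2 := h2 y (Rlt_le_trans _ _ _ hy (Rmin_r _ _)).
replace (f y * g y - (f z * g z))%C with
  ((f y - f z) * (g y - g z) + ((f y - f z) * g z + f z * (g y - g z)))%C by ring.
apply: Rle_lt_trans (Cmod_triangle _ _) _.
have t := Cmod_triangle ((f y - f z) * g z) (f z * (g y - g z)).
rewrite !Cmod_mult in t. rewrite !Cmod_mult.
have q1 : e' <= 1 by apply: Rmin_l.
have q2 : e' <= e / (2 * A) by apply: Rmin_r.
have q3 : e' * (2 * A) <= e.
{ have : e / (2 * A) * (2 * A) = e by field; lra. nra. }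
have := Cmod_ge_0 (f z); have := Cmod_ge_0 (g z).
have := Cmod_ge_0 (f y - f z); have := Cmod_ge_0 (g y - g z).
rewrite /A in q3.
move: t y1 y2.
set a := Cmod (f y - f z). set b := Cmod (g y - g z). set p := Cmod (f z). set q := Cmod (g z).
move=> t y1 y2 b0 a0 q0 p0.
rewrite -/p -/q in q3. nra.
Qed.

Lemma ccont_opp (f : C -> C) (z : C) : ccont f z -> ccont (fun x => - f x)%C z.
Proof.
move=> hf e he. case: (hf e he) => d [hd h]. exists d; split => // y hy.
replace (- f y - - f z)%C with (- (f y - f z))%C by ring. rewrite Cmod_opp. exact: h.
Qed.

Lemma ccont_minus (f g : C -> C) (z : C) :
  ccont f z -> ccont g z -> ccont (fun x => f x - g x)%C z.
Proof. move=> hf hg. apply: ccont_plus => //. exact: ccont_opp. Qed.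

Lemma ccont_inv (z : C) : z <> RtoC 0 -> ccont (fun x => / x)%C z.
Proof.
move=> hz e he. have p := proj1 (Cmod_gt_0 z) hz.
set m := Cmod z in p *.
exists (Rmin (m / 2) (e * (m * m) / 2)); split.
{ apply: Rmin_glb_lt; first lra. have : 0 < e * (m * m); last lra. apply: Rmult_lt_0_compat => //; nra. }
move=> y hy. have y1 := Rlt_le_trans _ _ _ hy (Rmin_l _ _).
have y2 := Rlt_le_trans _ _ _ hy (Rmin_r _ _).
have ym : m / 2 < Cmod y. { have := Cmod_triangle_inv z y. rewrite (Cmod_minus_sym z y) -/m. lra. }
have yn : y <> RtoC 0. { apply/Cmod_gt_0. lra. }
replace (/ y - / z)%C with ((z - y) / (y * z))%C by (field; split; auto).
rewrite Cmod_div; last by apply: Cmult_neq_0.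
rewrite Cmod_mult -/m (Cmod_minus_sym z y).
apply/Rlt_div_l. { nra. }
have : e * (m / 2 * m) < e * (Cmod y * m). { apply: Rmult_lt_compat_l => //. nra. }
lra.
Qed.

Lemma ccont_ext (f g : C -> C) (z : C) :
  (exists r, 0 < r /\ forall y, Cmod (y - z) < r -> f y = g y) -> ccont f z -> ccont g z.
Proof.
move=> [r [hr E]] hf e he. case: (hf e he) => d [hd h].
exists (Rmin r d); split; first by apply: Rmin_glb_lt.
move=> y hy. rewrite -E; last by apply: Rlt_le_trans hy (Rmin_l _ _).
rewrite -E; last by rewrite Cmod_self. apply: h. by apply: Rlt_le_trans hy (Rmin_r _ _).
Qed.

Lemma cderiv_ccont (f : C -> C) (z l : C) : cderiv f z l -> ccont f z.
Proof.
move=> [phi [_ [hc E]]].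
have h : ccont (fun y => f z + phi y * (y - z))%C z.
{ apply: ccont_plus; first exact: ccont_const. apply: ccont_mult => //.
  apply: ccont_minus; [exact: ccont_id | exact: ccont_const]. }
apply: ccont_ext h. exists 1; split; first lra. move=> y _. by rewrite -E.
Qed.

Lemma cderiv_const (a z : C) : cderiv (fun _ => a) z (RtoC 0).
Proof. exists (fun _ => RtoC 0); split => //; split; first exact: ccont_const. move=> y; ring. Qed.

Lemma cderiv_id (z : C) : cderiv (fun x => x) z (RtoC 1).
Proof. exists (fun _ => RtoC 1); split => //; split; first exact: ccont_const. move=> y; ring. Qed.

Lemma cderiv_plus (f g : C -> C) (z l m : C) :
  cderiv f z l -> cderiv g z m -> cderiv (fun x => f x + g x)%C z (l + m)%C.
Proof.
move=> [p [p1 [p2 p3]]] [q [q1 [q2 q3]]]. exists (fun x => p x + q x)%C. split; first by rewrite p1 q1.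
split; first exact: ccont_plus. move=> y. rewrite (p3 y) (q3 y). ring.
Qed.

Lemma cderiv_opp (f : C -> C) (z l : C) :
  cderiv f z l -> cderiv (fun x => - f x)%C z (- l)%C.
Proof.
move=> [p [p1 [p2 p3]]]. exists (fun x => - p x)%C. split; first by rewrite p1.
split; first exact: ccont_opp. move=> y. rewrite (p3 y). ring.
Qed.

Lemma cderiv_minus (f g : C -> C) (z l m : C) :
  cderiv f z l -> cderiv g z m -> cderiv (fun x => f x - g x)%C z (l - m)%C.
Proof. move=> hf hg. apply: cderiv_plus => //. exact: cderiv_opp. Qed.

Lemma cderiv_mult (f g : C -> C) (z l m : C) :
  cderiv f z l -> cderiv g z m -> cderiv (fun x => f x * g x)%C z (l * g z + f z * m)%C.
Proof.
move=> hf hg. have cg := cderiv_ccont hg.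
move: hf hg => [p [p1 [p2 p3]]] [q [q1 [q2 q3]]]. exists (fun x => p x * g x + f z * q x)%C.
split; first by rewrite p1 q1.
split. { apply: ccont_plus; apply: ccont_mult => //. exact: ccont_const. }
move=> y. rewrite (p3 y) (q3 y). ring.
Qed.

Lemma cderiv_eq (f : C -> C) (z l m : C) : cderiv f z l -> l = m -> cderiv f z m.
Proof. by move=> h <-. Qed.

Lemma cderiv_scal (a : C) (f : C -> C) (z l : C) :
  cderiv f z l -> cderiv (fun x => a * f x)%C z (a * l)%C.
Proof. move=> h. apply: cderiv_eq (cderiv_mult (cderiv_const a z) h) _. ring. Qed.

Lemma cderiv_comp (f g : C -> C) (z l m : C) :
  cderiv g z m -> cderiv f (g z) l -> cderiv (fun x => f (g x)) z (l * m)%C.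
Proof.
move=> hg hf. have cg := cderiv_ccont hg.
move: hf hg => [p [p1 [p2 p3]]] [q [q1 [q2 q3]]]. exists (fun x => p (g x) * q x)%C.
split; first by rewrite p1 q1.
split. { apply: ccont_mult => //. exact: (@ccont_comp p g). }
move=> y. rewrite (p3 (g y)). have := q3 y => e. replace (g y - g z)%C with (q y * (y - z))%C; first ring.
rewrite e. ring.
Qed.

Lemma cderiv_inv (z : C) : z <> RtoC 0 -> cderiv (fun x => / x)%C z (- / (z * z))%C.
Proof.
move=> hz.
(* The slope identity is required at every [y], also at 0 where [/ y] takes its default value; there
   the bare difference quotient is used. Near [z] only the other branch matters. *)
exists (fun y => match Ceq_dec y (RtoC 0) with left _ => (/ y - / z) / (y - z) | right _ => - / (y * z) end)%C.
split. { case: (Ceq_dec z (RtoC 0)) => //. }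
split.
{ apply: (@ccont_ext (fun y => - / (y * z))%C).
  - exists (Cmod z). have p := proj1 (Cmod_gt_0 z) hz. split => // y hy. case: (Ceq_dec y (RtoC 0)) => // e.
    exfalso. rewrite e in hy. replace (0 - z)%C with (- z)%C in hy by ring. rewrite Cmod_opp in hy. lra.
  - apply: ccont_opp. apply: (@ccont_comp (fun x => / x)%C (fun y => y * z)%C).
    + apply: ccont_mult; [exact: ccont_id | exact: ccont_const].
    + apply: ccont_inv. exact: Cmult_neq_0. }
move=> y. case: (Ceq_dec y (RtoC 0)) => e.
- have n : (y - z)%C <> RtoC 0. { apply: Cminus_neq0. by rewrite e; auto. }
  replace ((/ y - / z) / (y - z) * (y - z))%C with (/ y - / z)%C; first ring.
  rewrite /Cdiv -Cmult_assoc Cinv_l //. ring.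
- field. split; auto.
Qed.

Lemma cderiv_ext_loc (f g : C -> C) (z l : C) (r : R) :
  0 < r -> (forall y, Cmod (y - z) < r -> f y = g y) -> cderiv f z l -> cderiv g z l.
Proof.
move=> hr E [p [p1 [p2 p3]]].
(* Outside the disc [g] is arbitrary, and its own difference quotient keeps the slope identity
   valid. *)
exists (fun y => match Rlt_dec (Cmod (y - z)) r with left _ => p y | right _ => (g y - g z) / (y - z) end)%C.
split. { case: (Rlt_dec (Cmod (z - z)) r) => // n. exfalso. rewrite Cmod_self in n. lra. }
split.
{ apply: ccont_ext p2. exists r; split => // y hy. by case: (Rlt_dec (Cmod (y - z)) r). }
move=> y. case: (Rlt_dec (Cmod (y - z)) r) => h.
- rewrite -(E y h) -(E z); last by rewrite Cmod_self. exact: p3.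
- field. apply: Cminus_neq0 => e. rewrite e Cmod_self in h. lra.
Qed.

Lemma cderiv_unique (f : C -> C) (z l m : C) : cderiv f z l -> cderiv f z m -> l = m.
Proof.
move=> [p [p1 [p2 p3]]] [q [q1 [q2 q3]]]. apply: Ceq_of_eps => e he.
case: (p2 (e/2) ltac:(lra)) => d1 [hd1 h1]. case: (q2 (e/2) ltac:(lra)) => d2 [hd2 h2].
set d := Rmin d1 d2. have hd : 0 < d by apply: Rmin_glb_lt.
set y := (z + RtoC (d/2))%C.
have yz : (y - z = RtoC (d/2))%C by rewrite /y; ring.
have my : Cmod (y - z) = d / 2. { rewrite yz Cmod_R Rabs_pos_eq; lra. }
have ne : (y - z)%C <> RtoC 0. { apply/Cmod_gt_0. lra. }
have pq : p y = q y.
{ have e1 := p3 y. rewrite (q3 y) in e1.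
  have e2 : (p y * (y - z) = q y * (y - z))%C. { replace (p y * (y - z))%C with (f z + p y * (y - z) - f z)%C by ring. rewrite -e1. ring. }
  replace (p y) with (p y * (y - z) * / (y - z))%C by (field; auto). rewrite e2. field; auto. }
have a1 := h1 y. have a2 := h2 y. rewrite my in a1 a2.
have b1 := a1 ltac:(have := Rmin_l d1 d2; rewrite -/d; lra).
have b2 := a2 ltac:(have := Rmin_r d1 d2; rewrite -/d; lra).
rewrite p1 in b1. rewrite q1 -pq in b2.
have t := Cmod_triangle_mid l (p y) m. rewrite (Cmod_minus_sym l (p y)) in t. lra.
Qed.

Lemma cderiv_eps (f : C -> C) (z l : C) : cderiv f z l <->
  (forall eps, 0 < eps -> exists d, 0 < d /\
    forall y, Cmod (y - z) < d -> Cmod (f y - f z - l * (y - z)) <= eps * Cmod (y - z)).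
Proof.
split.
- move=> [p [p1 [p2 p3]]] e he. case: (p2 e he) => d [hd h]. exists d; split => // y hy.
  rewrite (p3 y). replace (f z + p y * (y - z) - f z - l * (y - z))%C with ((p y - l) * (y - z))%C by ring.
  rewrite Cmod_mult -p1. apply: Rmult_le_compat_r; first exact: Cmod_ge_0. left. exact: h.
- move=> h. exists (fun y => match Ceq_dec y z with left _ => l | right _ => (f y - f z) / (y - z) end)%C.
  split. { by case: (Ceq_dec z z). }
  split.
  { move=> e he. case: (h (e/2) ltac:(lra)) => d [hd H]. exists d; split => // y hy.
    case: (Ceq_dec z z) => // _. case: (Ceq_dec y z) => n.
    - rewrite Cmod_self; lra.
    - have n' := Cminus_neq0 n. have g0 := Cmod_minus_gt0 n.
      replace ((f y - f z) / (y - z) - l)%C with ((f y - f z - l * (y - z)) / (y - z))%C by (field; auto).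
      rewrite Cmod_div //. have := H y hy => H1.
      apply: Rle_lt_trans (_ : e / 2 < e); last lra. by apply/Rle_div_l. }
  move=> y. case: (Ceq_dec y z) => n.
  + rewrite n. ring.
  + field. exact: Cminus_neq0.
Qed.

Lemma cderiv_is_derive (f : C -> C) (z l : C) :
  cderiv f z l <-> is_derive (K := C_AbsRing) (V := C_NormedModule) f z l.
Proof.
rewrite cderiv_eps. split.
- move=> h. split; first exact: is_linear_scal_l.
  move=> x hx. have -> : x = z. { symmetry. exact: is_filter_lim_locally_unique hx. }
  move=> eps. case: (h eps (cond_pos eps)) => d [hd H].
  exists (mkposreal d hd) => y hy. have := H y hy.
  have -> : minus (minus (f y) (f z)) (scal (minus y z) l) = (f y - f z - l * (y - z))%C.
  { rewrite /minus /plus /opp /scal /= /mult /=. ring. }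
  by [].
- move=> [_ h] e he. case: (h z (fun P hP => hP) (mkposreal e he)) => d H.
  exists d; split; first exact: cond_pos. move=> y hy. have := H y hy.
  have -> : minus (minus (f y) (f z)) (scal (minus y z) l) = (f y - f z - l * (y - z))%C.
  { rewrite /minus /plus /opp /scal /= /mult /=. ring. }
  by [].
Qed.

Lemma Cmod_RtoC_pos (x : R) : 0 <= x -> Cmod (RtoC x) = x.
Proof. move=> h. by rewrite Cmod_R Rabs_pos_eq. Qed.

(** * Complex functions of a real variable *)

Lemma rcont_continuous (f : R -> C) (t : R) :
  rcont f t <-> continuous (U := C_R_NormedModule) f t.
Proof.
split.
- move=> h. apply/(filterlim_locally_ball_norm (U := C_R_NormedModule)) => eps.
  case: (h eps (cond_pos eps)) => d [hd H]. exists (mkposreal d hd) => u hu.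
  rewrite /ball_norm -Cmod_norm. exact: (H u hu).
- move=> /(filterlim_locally_ball_norm (U := C_R_NormedModule)) h e he.
  case: (h (mkposreal e he)) => d H. exists d; split; first exact: cond_pos.
  move=> u hu. have := H u hu. by rewrite /ball_norm -Cmod_norm.
Qed.

Lemma rcont_comp (f : C -> C) (g : R -> C) (t : R) :
  rcont g t -> ccont f (g t) -> rcont (fun x => f (g x)) t.
Proof.
move=> hg hf e he. case: (hf e he) => d [hd h1]. case: (hg d hd) => d' [hd' h2].
exists d'; split => // y hy. apply: h1. exact: h2.
Qed.

Lemma rcont_const (a : C) (t : R) : rcont (fun _ => a) t.
Proof. move=> e he. exists 1; split; first lra. move=> y _. by rewrite Cmod_self. Qed.

Lemma rcont_RtoC (g : R -> R) (t : R) : continuous g t -> rcont (fun x => RtoC (g x)) t.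
Proof.
move=> h e he. case: (proj1 (filterlim_locally g (g t)) h (mkposreal e he)) => d H.
exists d; split; first exact: cond_pos. move=> u hu. rewrite -RtoC_minus Cmod_R. exact: (H u hu).
Qed.

Lemma rcont_ccont (f : R -> C) (t : R) : rcont f t <-> ccont (fun z => f (Re z)) (RtoC t).
Proof.
split=> h e he; case: (h e he) => d [hd H]; exists d; split => // y hy.
- apply: H. apply: Rle_lt_trans hy. have := re_le_Cmod (y - RtoC t). by rewrite re_plus re_opp.
- have := H (RtoC y). by rewrite -RtoC_minus Cmod_R; exact.
Qed.

Lemma rcont_plus (f g : R -> C) (t : R) :
  rcont f t -> rcont g t -> rcont (fun x => f x + g x)%C t.
Proof. move=> /rcont_ccont hf /rcont_ccont hg. apply/rcont_ccont. exact: ccont_plus hf hg. Qed.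

Lemma rcont_mult (f g : R -> C) (t : R) :
  rcont f t -> rcont g t -> rcont (fun x => f x * g x)%C t.
Proof. move=> /rcont_ccont hf /rcont_ccont hg. apply/rcont_ccont. exact: ccont_mult hf hg. Qed.

Lemma rcont_opp (f : R -> C) (t : R) : rcont f t -> rcont (fun x => - f x)%C t.
Proof. move=> /rcont_ccont hf. apply/rcont_ccont. exact: ccont_opp hf. Qed.

Lemma rcont_minus (f g : R -> C) (z : R) :
  rcont f z -> rcont g z -> rcont (fun x => f x - g x)%C z.
Proof. move=> hf hg. apply: rcont_plus => //. exact: rcont_opp. Qed.

Lemma rcont_scal (a : C) (f : R -> C) (t : R) : rcont f t -> rcont (fun x => a * f x)%C t.
Proof. exact: rcont_mult (rcont_const a t). Qed.

Lemma rderiv_is_derive (f : R -> C) (t : R) (l : C) :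
  rderiv f t l <-> is_derive (K := R_AbsRing) (V := C_R_NormedModule) f t l.
Proof.
have E : forall u : R, @norm R_AbsRing C_R_NormedModule (@minus C_R_NormedModule (@minus C_R_NormedModule (f u) (f t)) (@scal R_AbsRing C_R_NormedModule (@minus R_AbsRing u t) l)) = Cmod (f u - f t - l * RtoC (u - t))%C.
{ move=> u. rewrite -Cmod_norm. congr Cmod. apply: injective_projections => /=; rewrite /minus /plus /opp /scal /= /mult /=; ring. }
split.
- move=> [p [p1 [p2 p3]]]. split; first exact: is_linear_scal_l.
  move=> x hx. have -> : x = t. { symmetry. exact: is_filter_lim_locally_unique hx. }
  move=> eps. case: (p2 eps (cond_pos eps)) => d [hd H].
  exists (mkposreal d hd) => u hu. rewrite E (p3 u).
  replace (f t + p u * RtoC (u - t) - f t - l * RtoC (u - t))%C with ((p u - l) * RtoC (u - t))%C by ring.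
  rewrite Cmod_mult Cmod_R. apply: Rmult_le_compat_r; first exact: Rabs_pos.
  left. rewrite -p1. exact: (H u hu).
- move=> [_ h]. exists (fun u => match Req_EM_T u t with left _ => l | right _ => (f u - f t) / RtoC (u - t) end)%C.
  have nz : forall u, u <> t -> RtoC (u - t) <> RtoC 0.
  { move=> u n e. have : u - t = 0 by apply: RtoC_inj. lra. }
  split. { by case: (Req_EM_T t t). }
  split.
  { move=> e he. have he2 : 0 < e / 2 by lra. case: (h t (fun P hP => hP) (mkposreal _ he2)) => d H. exists d; split; first exact: cond_pos.
    move=> u hu. case: (Req_EM_T t t) => // _. case: (Req_EM_T u t) => n.
    - rewrite Cmod_self; lra.
    - have n' := nz u n. have g0 : 0 < Rabs (u - t) by apply: Rabs_pos_lt; lra.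
      replace ((f u - f t) / RtoC (u - t) - l)%C with ((f u - f t - l * RtoC (u - t)) / RtoC (u - t))%C by (field; auto).
      rewrite Cmod_div // Cmod_R. have := H u hu. rewrite E => H1.
      apply: Rle_lt_trans (_ : e / 2 < e); last lra. by apply/Rle_div_l. }
  move=> u. case: (Req_EM_T u t) => n.
  + rewrite n. rewrite (_ : t - t = 0); last lra. ring.
  + field. exact: nz.
Qed.

Lemma rderiv_comp (f : C -> C) (g : R -> C) (t : R) (l m : C) :
  rderiv g t m -> cderiv f (g t) l -> rderiv (fun x => f (g x)) t (l * m)%C.
Proof.
move=> hg [p [p1 [p2 p3]]].
have cg : rcont g t.
{ apply/rcont_continuous. move/rderiv_is_derive: hg => hg. apply: ex_derive_continuous. by exists m. }
move: hg => [q [q1 [q2 q3]]]. exists (fun x => p (g x) * q x)%C.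
split; first by rewrite p1 q1.
split. { apply: rcont_mult => //. exact: (@rcont_comp p g). }
move=> u. rewrite (p3 (g u)). have e := q3 u. replace (g u - g t)%C with (q u * RtoC (u - t))%C; first ring.
rewrite e. ring.
Qed.

Lemma rderiv_const (a : C) (t : R) : rderiv (fun _ => a) t (RtoC 0).
Proof. exists (fun _ => RtoC 0); split => //; split; first exact: rcont_const. move=> y; ring. Qed.

Lemma rderiv_plus (f g : R -> C) (t : R) (l m : C) :
  rderiv f t l -> rderiv g t m -> rderiv (fun x => f x + g x)%C t (l + m)%C.
Proof.
move=> [p [p1 [p2 p3]]] [q [q1 [q2 q3]]]. exists (fun x => p x + q x)%C. split; first by rewrite p1 q1.
split; first exact: rcont_plus. move=> y. rewrite (p3 y) (q3 y). ring.
Qed.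

Lemma rderiv_rcont (f : R -> C) (t : R) (l : C) : rderiv f t l -> rcont f t.
Proof.
move/rderiv_is_derive => h. apply/rcont_continuous. apply: ex_derive_continuous. by exists l.
Qed.

Lemma rderiv_mult (f g : R -> C) (t : R) (l m : C) :
  rderiv f t l -> rderiv g t m -> rderiv (fun x => f x * g x)%C t (l * g t + f t * m)%C.
Proof.
move=> hf hg. have cg := rderiv_rcont hg.
move: hf hg => [p [p1 [p2 p3]]] [q [q1 [q2 q3]]]. exists (fun x => p x * g x + f t * q x)%C.
split; first by rewrite p1 q1.
split. { apply: rcont_plus; apply: rcont_mult => //. exact: rcont_const. }
move=> y. rewrite (p3 y) (q3 y). ring.
Qed.

Lemma rderiv_eq (f : R -> C) (t : R) (l m : C) : rderiv f t l -> l = m -> rderiv f t m.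
Proof. by move=> h <-. Qed.

Lemma rderiv_RtoC (g : R -> R) (t l : R) : is_derive g t l -> rderiv (fun x => RtoC (g x)) t (RtoC l).
Proof.
move=> [_ h]. apply/rderiv_is_derive. split; first exact: is_linear_scal_l.
move=> x hx.
move=> eps. case: (h x hx eps) => d H. exists d => u hu. have := H u hu.
have -> : @norm R_AbsRing C_R_NormedModule (@minus C_R_NormedModule (@minus C_R_NormedModule (RtoC (g u)) (RtoC (g x))) (@scal R_AbsRing C_R_NormedModule (@minus R_AbsRing u x) (RtoC l))) = norm (minus (minus (g u) (g x)) (scal (minus u x) l)).
{ rewrite -Cmod_norm. rewrite -[RHS]Cmod_R. congr Cmod. apply: injective_projections => /=; rewrite /minus /plus /opp /scal /= /mult /=; ring. }
by [].
Qed.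

(** * Integrals over intervals and along segments *)

Definition CInt (f : R -> C) (a b : R) : C := RInt (V := C_R_CompleteNormedModule) f a b.
Definition is_CInt (f : R -> C) (a b : R) (l : C) : Prop :=
  is_RInt (V := C_R_NormedModule) f a b l.

Lemma is_CInt_unique (f : R -> C) (a b : R) (l : C) : is_CInt f a b l -> CInt f a b = l.
Proof. exact: (is_RInt_unique (V := C_R_CompleteNormedModule)). Qed.

Lemma CInt_correct (f : R -> C) (a b : R) :
  a <= b -> (forall t, a <= t <= b -> rcont f t) -> is_CInt f a b (CInt f a b).
Proof.
move=> ab h. apply: (RInt_correct (V := C_R_CompleteNormedModule)).
apply: (ex_RInt_continuous (V := C_R_CompleteNormedModule)) => t.
rewrite Rmin_left // Rmax_right // => ht. apply/rcont_continuous. exact: h.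
Qed.

Lemma is_CInt_ext (f g : R -> C) (a b : R) (l : C) : a <= b ->
  (forall t, a <= t <= b -> f t = g t) -> is_CInt f a b l -> is_CInt g a b l.
Proof.
move=> ab h. apply: (is_RInt_ext (V := C_R_NormedModule)) => t. rewrite Rmin_left // Rmax_right // => ht.
apply: h. lra.
Qed.

Lemma CInt_ext (f g : R -> C) (a b : R) : a <= b ->
  (forall t, a <= t <= b -> f t = g t) -> CInt f a b = CInt g a b.
Proof.
move=> ab h. apply: (RInt_ext (V := C_R_CompleteNormedModule)) => t. rewrite Rmin_left // Rmax_right // => ht.
apply: h. lra.
Qed.

Lemma is_CInt_plus (f g : R -> C) (a b : R) (l m : C) :
  is_CInt f a b l -> is_CInt g a b m -> is_CInt (fun t => f t + g t)%C a b (l + m)%C.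
Proof. exact: (is_RInt_plus (V := C_R_NormedModule)). Qed.

Lemma is_CInt_minus (f g : R -> C) (a b : R) (l m : C) :
  is_CInt f a b l -> is_CInt g a b m -> is_CInt (fun t => f t - g t)%C a b (l - m)%C.
Proof. exact: (is_RInt_minus (V := C_R_NormedModule)). Qed.

Lemma is_CInt_pair (f : R -> C) (a b : R) (l : C) :
  is_CInt f a b l <-> is_RInt (fun t => Re (f t)) a b (Re l) /\ is_RInt (fun t => Im (f t)) a b (Im l).
Proof.
split.
- move=> h. split.
  + exact: (is_RInt_fct_extend_fst (U := R_NormedModule) (V := R_NormedModule) f a b l).
  + exact: (is_RInt_fct_extend_snd (U := R_NormedModule) (V := R_NormedModule) f a b l).
- move=> [h1 h2]. have := is_RInt_fct_extend_pair (U := R_NormedModule) (V := R_NormedModule) f a b (Re l) (Im l) h1 h2.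
  rewrite /is_CInt. by rewrite /Re /Im -surjective_pairing.
Qed.

(** The integral is taken in C as a real vector space, so a complex factor is treated on real and
    imaginary parts. *)
Lemma is_CInt_scal (c : C) (f : R -> C) (a b : R) (l : C) :
  is_CInt f a b l -> is_CInt (fun t => c * f t)%C a b (c * l)%C.
Proof.
move/is_CInt_pair => [h1 h2]. apply/is_CInt_pair; split.
- rewrite re_mult. apply: (is_RInt_ext (fun t => minus (scal (Re c) (Re (f t))) (scal (Im c) (Im (f t))))).
  + move=> t _. by rewrite re_mult.
  + apply: (is_RInt_minus (V := R_NormedModule)); exact: is_RInt_scal.
- rewrite im_mult. apply: (is_RInt_ext (fun t => plus (scal (Re c) (Im (f t))) (scal (Im c) (Re (f t))))).
  + move=> t _. by rewrite im_mult.
  + apply: (is_RInt_plus (V := R_NormedModule)); exact: is_RInt_scal.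
Qed.

Lemma is_CInt_norm (f : R -> C) (g : R -> R) (a b : R) (l : C) (m : R) : a <= b ->
  (forall t, a <= t <= b -> Cmod (f t) <= g t) -> is_CInt f a b l -> is_RInt g a b m -> Cmod l <= m.
Proof.
move=> ab h hf hg. rewrite Cmod_norm. apply: (norm_RInt_le (V := C_R_NormedModule) f g a b) => // t ht.
have := h t ht. by rewrite Cmod_norm.
Qed.

Lemma is_CInt_bound (f : R -> C) (a b M : R) (l : C) : a <= b ->
  (forall t, a <= t <= b -> Cmod (f t) <= M) -> is_CInt f a b l -> Cmod l <= M * (b - a).
Proof.
move=> ab h hf. apply: (is_CInt_norm ab h hf).
have := is_RInt_const (V := R_NormedModule) a b M. by rewrite /scal /= /mult /= Rmult_comm.
Qed.

Lemma is_CInt_FTC (F f : R -> C) (a b : R) : a <= b ->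
  (forall t, a <= t <= b -> rderiv F t (f t)) -> (forall t, a <= t <= b -> rcont f t) ->
  is_CInt f a b (F b - F a)%C.
Proof.
move=> ab h1 h2. apply: (is_RInt_derive (V := C_R_CompleteNormedModule)) => t; rewrite Rmin_left // Rmax_right // => ht.
- apply/rderiv_is_derive. exact: h1.
- apply/rcont_continuous. exact: h2.
Qed.

Lemma is_CInt_Chasles (f : R -> C) (a b c : R) (l m : C) :
  is_CInt f a b l -> is_CInt f b c m -> is_CInt f a c (l + m)%C.
Proof. exact: (is_RInt_Chasles (V := C_R_NormedModule)). Qed.

Lemma is_CInt_comp_lin (f : R -> C) (u v a b : R) (l : C) :
  is_CInt f (u * a + v) (u * b + v) l -> is_CInt (fun t => (RtoC u * f (u * t + v)%R)%C) a b l.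
Proof.
move=> h. have := is_RInt_comp_lin (V := C_R_NormedModule) f u v a b l h.
apply: (is_RInt_ext (V := C_R_NormedModule)) => t _. exact: scal_R_Cmult.
Qed.

Definition path (a b : C) (t : R) : C := (a + RtoC t * (b - a))%C.
Definition seg (f : C -> C) (a b : C) : C := ((b - a) * CInt (fun t => f (path a b t)) 0 1)%C.

Lemma path_rderiv (a b : C) (t : R) : rderiv (path a b) t (b - a)%C.
Proof.
exists (fun _ => b - a)%C; split => //; split; first exact: rcont_const.
move=> u. rewrite /path RtoC_minus. ring.
Qed.

Lemma path_rcont (a b : C) (t : R) : rcont (path a b) t.
Proof. exact: rderiv_rcont (path_rderiv a b t). Qed.

Definition convexC (U : C -> Prop) := forall a b t, U a -> U b -> 0 <= t <= 1 -> U (path a b t).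

Lemma path0 (a b : C) : path a b 0 = a. Proof. rewrite /path. ring. Qed.
Lemma path1 (a b : C) : path a b 1 = b. Proof. rewrite /path. ring. Qed.

Lemma is_seg (f : C -> C) (a b : C) :
  (forall t, 0 <= t <= 1 -> ccont f (path a b t)) ->
  is_CInt (fun t => (b - a) * f (path a b t))%C 0 1 (seg f a b).
Proof.
move=> h. apply: is_CInt_scal. apply: CInt_correct; first lra. move=> t ht.
apply: rcont_comp; [exact: path_rcont | exact: h].
Qed.

Lemma seg_unique (f : C -> C) (a b l : C) :
  (forall t, 0 <= t <= 1 -> ccont f (path a b t)) ->
  is_CInt (fun t => (b - a) * f (path a b t))%C 0 1 l -> seg f a b = l.
Proof. move=> h1 h2. rewrite -(is_CInt_unique h2). symmetry. apply: is_CInt_unique. exact: is_seg. Qed.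

Lemma seg_FTC (F f : C -> C) (a b : C) :
  (forall t, 0 <= t <= 1 -> cderiv F (path a b t) (f (path a b t))) ->
  (forall t, 0 <= t <= 1 -> ccont f (path a b t)) -> seg f a b = (F b - F a)%C.
Proof.
move=> h1 h2. apply: seg_unique => //.
have := @is_CInt_FTC (fun t => F (path a b t)) (fun t => (b - a) * f (path a b t))%C 0 1 ltac:(lra).
rewrite path0 path1. apply.
- move=> t ht. apply: rderiv_eq (rderiv_comp (path_rderiv a b t) (h1 t ht)) _. ring.
- move=> t ht. apply: rcont_scal. apply: rcont_comp; [exact: path_rcont | exact: h2].
Qed.

Lemma seg_bound (f : C -> C) (a b : C) (M : R) :
  (forall t, 0 <= t <= 1 -> ccont f (path a b t)) ->
  (forall t, 0 <= t <= 1 -> Cmod (f (path a b t)) <= M) -> Cmod (seg f a b) <= M * Cmod (b - a).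
Proof.
move=> h1 h2. have := @is_CInt_bound _ 0 1 (Cmod (b - a) * M) _ ltac:(lra) _ (is_seg h1).
rewrite Rminus_0_r Rmult_1_r Rmult_comm. apply. move=> t ht. rewrite Cmod_mult.
rewrite Rmult_comm. apply: Rmult_le_compat_r; [exact: Cmod_ge_0 | exact: h2].
Qed.

Lemma seg_minus (f g : C -> C) (a b : C) :
  (forall t, 0 <= t <= 1 -> ccont f (path a b t)) ->
  (forall t, 0 <= t <= 1 -> ccont g (path a b t)) ->
  seg (fun z => f z - g z)%C a b = (seg f a b - seg g a b)%C.
Proof.
move=> h1 h2. apply: seg_unique.
- move=> t ht. apply: ccont_minus; auto.
- apply: (is_CInt_ext _ _ (is_CInt_minus (is_seg h1) (is_seg h2))); first lra. move=> t ht. ring.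
Qed.

Lemma seg_sub (f : C -> C) (a b : C) (s : R) : 0 <= s <= 1 ->
  (forall t, 0 <= t <= 1 -> ccont f (path a b t)) ->
  seg f a b = (seg f a (path a b s) + seg f (path a b s) b)%C.
Proof.
move=> hs h.
have E1 : forall t, path a (path a b s) t = path a b (s * t).
{ move=> t. rewrite /path RtoC_mult. ring. }
have E2 : forall t, path (path a b s) b t = path a b ((1 - s) * t + s).
{ move=> t. rewrite /path RtoC_plus RtoC_mult RtoC_minus. ring. }
apply: seg_unique => //.
have C1 : is_CInt (fun t => (b - a) * f (path a b t))%C 0 s (seg f a (path a b s)).
{ have c : is_CInt (fun t => (b - a) * f (path a b t))%C 0 s (CInt (fun t => (b - a) * f (path a b t))%C 0 s).
  { apply: CInt_correct; first lra. move=> t ht. apply: rcont_scal. apply: rcont_comp; first exact: path_rcont. apply: h; lra. }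
  have -> : seg f a (path a b s) = CInt (fun t => (b - a) * f (path a b t))%C 0 s; last by [].
  apply: seg_unique.
  - move=> t ht. rewrite E1. apply: h. nra.
  - have := @is_CInt_comp_lin (fun t => (b - a) * f (path a b t))%C s 0 0 1 (CInt (fun t => (b - a) * f (path a b t))%C 0 s).
    rewrite Rmult_0_r Rmult_1_r !Rplus_0_r => H. apply: (is_CInt_ext _ _ (H c)); first lra.
    move=> t ht. rewrite E1 Rplus_0_r /path. ring. }
have C2 : is_CInt (fun t => (b - a) * f (path a b t))%C s 1 (seg f (path a b s) b).
{ have c : is_CInt (fun t => (b - a) * f (path a b t))%C s 1 (CInt (fun t => (b - a) * f (path a b t))%C s 1).
  { apply: CInt_correct; first lra. move=> t ht. apply: rcont_scal. apply: rcont_comp; first exact: path_rcont. apply: h; lra. }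
  have -> : seg f (path a b s) b = CInt (fun t => (b - a) * f (path a b t))%C s 1; last by [].
  apply: seg_unique.
  - move=> t ht. rewrite E2. apply: h. nra.
  - have := @is_CInt_comp_lin (fun t => (b - a) * f (path a b t))%C (1 - s) s 0 1 (CInt (fun t => (b - a) * f (path a b t))%C s 1).
    rewrite Rmult_0_r Rmult_1_r Rplus_0_l (_ : 1 - s + s = 1); last lra. move=> H. apply: (is_CInt_ext _ _ (H c)); first lra.
    move=> t ht. rewrite E2 RtoC_minus /path. ring. }
exact: is_CInt_Chasles C1 C2.
Qed.

Lemma seg_rev (f : C -> C) (a b : C) :
  (forall t, 0 <= t <= 1 -> ccont f (path a b t)) -> seg f b a = (- seg f a b)%C.
Proof.
move=> h.
have E : forall t, path b a t = path a b (-1 * t + 1).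
{ move=> t. rewrite /path RtoC_plus RtoC_mult. ring. }
apply: seg_unique.
{ move=> t ht. rewrite E. apply: h. lra. }
have c := is_seg h.
have := @is_CInt_comp_lin (fun t => (b - a) * f (path a b t))%C (-1) 1 0 1 (- seg f a b)%C.
rewrite Rmult_0_r Rplus_0_l (_ : -1 * 1 + 1 = 0); last lra. move=> H.
apply: (is_CInt_ext _ _ (H _)); first lra.
- move=> t ht. rewrite E. ring.
- exact: (is_RInt_swap (V := C_R_NormedModule)).
Qed.

(** * Goursat's theorem for triangles *)

Definition tri (f : C -> C) (a b c : C) : C := (seg f a b + seg f b c + seg f c a)%C.

Definition closedC (U : C -> Prop) :=
  forall z, (forall eps, 0 < eps -> exists x, U x /\ Cmod (x - z) < eps) -> U z.

(** The intervals of centre x_n and radius 2K(1/2)^n are nested, so the supremum of their left ends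
    lies in all of them. *)
Lemma R_cauchy (x : nat -> R) (K : R) : (forall n, Rabs (x (S n) - x n) <= K * (1/2)^n) ->
  exists l, forall n, Rabs (x n - l) <= 2 * K * (1/2)^n.
Proof.
move=> h. pose p n := 2 * K * (1/2)^n.
have st : forall n, x n - p n <= x (S n) - p (S n) /\ x (S n) + p (S n) <= x n + p n.
{ move=> n. have := proj1 (Rabs_le_between _ _) (h n). rewrite /p /=. lra. }
have p0 : forall n, 0 <= p n. { move=> n. have := Rabs_pos (x (S n) - x n). have := h n. rewrite /p. lra. }
have up : forall n m, x n - p n <= x (n + m)%nat - p (n + m)%nat /\ x (n + m)%nat + p (n + m)%nat <= x n + p n.
{ move=> n. elim=> [|m IH]; first by rewrite Nat.add_0_r; lra. rewrite Nat.add_succ_r. have := st (n + m)%nat. lra. }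
have ub : forall n m, x n - p n <= x m + p m.
{ move=> n m. have := up n m. have := up m n. rewrite (Nat.add_comm m n). have := p0 (n + m)%nat. lra. }
have bd : bound (fun y => exists n, y = x n - p n) by exists (x 0%nat + p 0%nat) => y [n ->]; exact: ub.
have [l [l1 l2]] := completeness _ bd (ex_intro _ _ (ex_intro _ 0%nat eq_refl)).
exists l => n. have a1 := l1 _ (ex_intro _ n eq_refl). have a2 : l <= x n + p n by apply: l2 => y [m ->]. apply: Rabs_le. rewrite -/(p n). lra.
Qed.

Lemma C_cauchy (a : nat -> C) (K : R) : (forall n, Cmod (a (S n) - a n) <= K * (1/2)^n) ->
  exists z, forall n, Cmod (a n - z) <= 4 * K * (1/2)^n.
Proof.
move=> h. have [x hx] := @R_cauchy (fun n => Re (a n)) K (fun n => Rle_trans _ _ _ (re_le_Cmod (a (S n) - a n)) (h n)).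
have [y hy] : exists l, forall n, Rabs (Im (a n) - l) <= 2 * K * (1/2)^n.
{ apply: R_cauchy => n. apply: Rle_trans (h n). apply: Rle_trans (Rmax_Cmod _). exact: Rmax_r. }
exists (x, y) => n. have -> : (a n - (x, y))%C = (RtoC (Re (a n) - x) + Ci * RtoC (Im (a n) - y))%C.
{ apply: injective_projections; rewrite /= /Re /Im; ring. }
apply: Rle_trans (Cmod_triangle _ _) _. rewrite Cmod_mult Cmod_Ci !Cmod_R. have := hx n. have := hy n. lra.
Qed.

(** An affine function has a quadratic primitive. In Goursat's argument this disposes of the linear
    approximation of [f]. *)
Lemma tri_affine (u v a b c : C) : tri (fun z => u + v * z)%C a b c = RtoC 0.
Proof.
have E : forall p q, seg (fun z => u + v * z)%C p q =
  ((u * q + v * (q * q) * RtoC (1/2)) - (u * p + v * (p * p) * RtoC (1/2)))%C.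
{ move=> p q. apply: (@seg_FTC (fun z => u * z + v * (z * z) * RtoC (1/2))%C).
  - move=> t _. set z := path p q t.
    apply: (@cderiv_eq _ _ ((u * 1) + ((0 * (z * z) + v * (1 * z + z * 1)) * RtoC (1/2) + v * (z * z) * 0)))%C.
    + apply: cderiv_plus; first by apply: cderiv_scal; exact: cderiv_id.
      apply: (@cderiv_mult (fun z => v * (z * z))%C); last exact: cderiv_const.
      apply: (@cderiv_mult (fun _ => v)); first exact: cderiv_const.
      apply: (@cderiv_mult (fun z => z) (fun z => z)); exact: cderiv_id.
    + have H : RtoC (1/2) = (/ (RtoC 2))%C. { rewrite -RtoC_inv; last lra. congr RtoC. lra. }
      rewrite H. field.
  - move=> t _. apply: ccont_plus; first exact: ccont_const. apply: ccont_mult; [exact: ccont_const | exact: ccont_id]. }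
rewrite /tri !E. ring.
Qed.

Lemma path_dist (a b z : C) (t r : R) : 0 <= t <= 1 -> Cmod (a - z) <= r -> Cmod (b - z) <= r ->
  Cmod (path a b t - z) <= r.
Proof.
move=> ht ha hb. replace (path a b t - z)%C with (RtoC (1 - t) * (a - z) + RtoC t * (b - z))%C.
2: { rewrite /path RtoC_minus. ring. }
apply: Rle_trans (Cmod_triangle _ _) _. rewrite !Cmod_mult !Cmod_RtoC_pos; try lra. nra.
Qed.

(** Repeated bisection: one of the four medial triangles carries at least a quarter of the integral.
    The triangles shrink to a point of the closed set [U], where [f] is affine up to a small
    multiple of the distance, and the affine part integrates to 0. *)
Lemma goursat (U : C -> Prop) (f : C -> C) : convexC U -> closedC U ->
  (forall z, U z -> exists l, cderiv f z l) -> forall a b c, U a -> U b -> U c -> tri f a b c = RtoC 0.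
Proof.
move=> cv cl df a b c Ua Ub Uc.
have cf : forall z, U z -> ccont f z. { move=> z /df [l]. exact: cderiv_ccont. }
have cfp : forall x y, U x -> U y -> forall t, 0 <= t <= 1 -> ccont f (path x y t).
{ move=> x y Ux Uy t ht. apply: cf. exact: cv. }
pose mid x y := path x y (1/2).
have Umid : forall x y, U x -> U y -> U (mid x y). { move=> x y ux uy. apply: cv => //; lra. }
have sub : forall x y z, U x -> U y -> U z -> tri f x y z =
  (tri f x (mid x y) (mid z x) + tri f (mid x y) y (mid y z) + tri f (mid y z) z (mid z x) + tri f (mid x y) (mid y z) (mid z x))%C.
{ move=> x y z ux uy uz. rewrite {1}/tri.
  rewrite (@seg_sub f x y (1/2) ltac:(lra) (cfp _ _ ux uy)).
  rewrite (@seg_sub f y z (1/2) ltac:(lra) (cfp _ _ uy uz)).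
  rewrite (@seg_sub f z x (1/2) ltac:(lra) (cfp _ _ uz ux)).
  rewrite -!/(mid _ _) /tri.
  rewrite (@seg_rev f (mid z x) (mid x y)); last by apply: cfp; apply: Umid.
  rewrite (@seg_rev f (mid x y) (mid y z)); last by apply: cfp; apply: Umid.
  rewrite (@seg_rev f (mid y z) (mid z x)); last by apply: cfp; apply: Umid.
  ring. }
have dm : forall x y z : C, (mid x y - mid z x = RtoC (1/2) * (y - z))%C.
{ move=> x y z. rewrite /mid /path. apply: injective_projections; simpl; field. }
have dm2 : forall x y : C, (mid x y - x = RtoC (1/2) * (y - x))%C.
{ move=> x y. rewrite /mid /path. apply: injective_projections; simpl; field. }
have dm3 : forall x y : C, (y - mid x y = RtoC (1/2) * (y - x))%C.
{ move=> x y. rewrite /mid /path. apply: injective_projections; simpl; field. }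
have dm4 : forall x y z : C, (mid x y - mid y z = RtoC (1/2) * (x - z))%C.
{ move=> x y z. rewrite /mid /path. apply: injective_projections; simpl; field. }
pose sz (T : C * C * C) d := Cmod (snd (fst T) - fst (fst T)) <= d /\ Cmod (snd T - snd (fst T)) <= d /\ Cmod (fst (fst T) - snd T) <= d.
pose inU (T : C * C * C) := U (fst (fst T)) /\ U (snd (fst T)) /\ U (snd T).
pose I (T : C * C * C) := Cmod (tri f (fst (fst T)) (snd (fst T)) (snd T)).
have half : forall w : C, Cmod (RtoC (1/2) * w) = Cmod w / 2.
{ move=> w. rewrite Cmod_mult Cmod_RtoC_pos; lra. }
(* If none of the three corner triangles carries a quarter of the integral, the central one does.
   Membership in [U] is an antecedent inside the existential, so that a total successor map can be
   chosen. *)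
have step : forall T, exists T', inU T -> inU T' /\ I T <= 4 * I T' /\
  (forall d, sz T d -> sz T' (d/2) /\ Cmod (fst (fst T') - fst (fst T)) <= d).
{ move=> [[x y] z]. case: (classic (inU (x, y, z))); last by move=> n; exists (x, y, z).
  move=> [/= ux [uy uz]].
  have E := sub x y z ux uy uz.
  set i1 := tri f x (mid x y) (mid z x) in E. set i2 := tri f (mid x y) y (mid y z) in E.
  set i3 := tri f (mid y z) z (mid z x) in E. set i4 := tri f (mid x y) (mid y z) (mid z x) in E.
  have B : Cmod (tri f x y z) <= Cmod i1 + Cmod i2 + Cmod i3 + Cmod i4.
  { rewrite E. have := Cmod_triangle (i1 + i2 + i3) i4. have := Cmod_triangle (i1 + i2) i3. have := Cmod_triangle i1 i2. lra. }
  have um1 := Umid x y ux uy. have um2 := Umid y z uy uz. have um3 := Umid z x uz ux.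
  case: (Rle_dec (Cmod (tri f x y z)) (4 * Cmod i1)) => [h1|h1].
  { exists (x, mid x y, mid z x) => _. split; [by repeat split|split; [exact: h1|]].
    move=> d [/= s1 [s2 s3]]. rewrite /sz /= dm2 (Cmod_minus_sym (mid z x)) dm dm3 Cmod_self !half. rewrite (Cmod_minus_sym y z). have := Cmod_ge_0 (x - z). repeat split; lra. }
  case: (Rle_dec (Cmod (tri f x y z)) (4 * Cmod i2)) => [h2|h2].
  { exists (mid x y, y, mid y z) => _. split; [by repeat split|split; [exact: h2|]].
    move=> d [/= s1 [s2 s3]]. rewrite /sz /= dm3 dm2 dm4 dm2 !half. have := Cmod_ge_0 (y - x). repeat split; lra. }
  case: (Rle_dec (Cmod (tri f x y z)) (4 * Cmod i3)) => [h3|h3].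
  { exists (mid y z, z, mid z x) => _. split; [by repeat split|split; [exact: h3|]].
    move=> d [/= s1 [s2 s3]]. have k : Cmod (mid y z - x) <= d. { apply: path_dist; first lra. - exact: s1. - by rewrite Cmod_minus_sym. }
    rewrite /sz /= dm3 dm2 dm4 !half. rewrite (Cmod_minus_sym y x) in s1 *. repeat split; lra. }
  exists (mid x y, mid y z, mid z x) => _. split; [by repeat split|split; [rewrite /I /= -/i4; lra|]].
  move=> d [/= s1 [s2 s3]]. rewrite /sz /= !dm dm2 !half.
  rewrite (Cmod_minus_sym y z) (Cmod_minus_sym z x) (Cmod_minus_sym x y). have := Cmod_ge_0 (y - x). repeat split; lra. }
pose nxt T := proj1_sig (constructive_indefinite_description _ (step T)).
have nxtP : forall T, inU T -> inU (nxt T) /\ I T <= 4 * I (nxt T) /\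
  (forall d, sz T d -> sz (nxt T) (d/2) /\ Cmod (fst (fst (nxt T)) - fst (fst T)) <= d).
{ move=> T. exact: (proj2_sig (constructive_indefinite_description _ (step T))). }
pose T := fix T n := match n with O => (a, b, c) | S m => nxt (T m) end.
set d := Cmod (b - a) + Cmod (c - b) + Cmod (a - c).
have d0 : 0 <= d. { have := Cmod_ge_0 (b - a). have := Cmod_ge_0 (c - b). have := Cmod_ge_0 (a - c). rewrite /d. lra. }
have TP : forall n, inU (T n) /\ sz (T n) (d * (1/2)^n) /\ I (a, b, c) <= 4^n * I (T n).
{ elim=> [|n [IH1 [IH2 IH3]]].
  - split; first by repeat split. split. { rewrite /sz /= /d. have := Cmod_ge_0 (b - a). have := Cmod_ge_0 (c - b). have := Cmod_ge_0 (a - c). repeat split; lra. }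
    rewrite /=. lra.
  - have [h1 [h2 h3]] := nxtP _ IH1. split => //. split.
    + have [h4 _] := h3 _ IH2. rewrite /=. by replace (d * (1/2 * (1/2)^n)) with (d * (1/2)^n / 2) by field.
    + rewrite /=. have : 0 < 4^n by apply: pow_lt; lra. rewrite /= in h2. nra. }
pose A n := fst (fst (T n)).
have [z hz] := @C_cauchy A d ltac:(move=> n; have [h1 [h2 h3]] := TP n; have [_ [_ h4]] := nxtP _ h1; exact: (proj2 (h4 _ h2))).
have Uz : U z.
{ apply: cl => eps he.
  have : is_lim_seq (fun n => 4 * d * (1/2)^n) (4 * d * 0).
  { apply: (is_lim_seq_scal_l _ (4 * d) 0). apply: is_lim_seq_geom. rewrite Rabs_pos_eq; lra. }
  rewrite Rmult_0_r => /is_lim_seq_spec lim. case: (lim (mkposreal _ he)) => N HN.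
  exists (A N). split; first exact: (proj1 (proj1 (TP N))).
  apply: Rle_lt_trans (hz N) _. have := HN N ltac:(lia). rewrite /= Rminus_0_r. move=> hh. apply: Rle_lt_trans (Rle_abs _) hh. }
have [l hl] := df z Uz. move/cderiv_eps: hl => hl.
(* At depth N the sides are at most d q with q = (1/2)^N, and the vertices lie within 5 d q of the
   limit point: 4 d q for the first vertex plus one side. Three sides with error eps (5 d q)(d q)
   each, times 4^N = 1 / q^2, give 15 d^2 eps. *)
have key : forall eps, 0 < eps -> I (a, b, c) <= 15 * d * d * eps.
{ move=> eps he. case: (hl eps he) => dl [hdl H].
  have : is_lim_seq (fun n => 5 * d * (1/2)^n) (5 * d * 0).
  { apply: (is_lim_seq_scal_l _ (5 * d) 0). apply: is_lim_seq_geom. rewrite Rabs_pos_eq; lra. }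
  rewrite Rmult_0_r => /is_lim_seq_spec lim. case: (lim (mkposreal _ hdl)) => N HN.
  have HN' := HN N ltac:(lia). rewrite /= Rminus_0_r in HN'. have HN2 := Rle_lt_trans _ _ _ (Rle_abs _) HN'.
  move: (TP N) (hz N). rewrite /A. case: (T N) => [[x y] w] [/= [ux [uy uw]] [[/= s1 [s2 s3]] Ib]] zb.
  rewrite /= in ux uy uw.
  set q := (1/2)^N in s1 s2 s3 HN2 zb.
  have q0 : 0 < q by apply: pow_lt; lra.
  have dq : 0 <= d * q by nra.
  have bx : Cmod (x - z) <= 5 * d * q by lra.
  have by_ : Cmod (y - z) <= 5 * d * q. { have := Cmod_triangle_mid y x z. lra. }
  have bw : Cmod (w - z) <= 5 * d * q. { have := Cmod_triangle_mid w x z. rewrite (Cmod_minus_sym w x). lra. }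
  pose g u := ((f z - l * z) + l * u)%C.
  have cg : forall u, ccont g u. { move=> u. apply: ccont_plus; first exact: ccont_const. apply: ccont_mult; [exact: ccont_const|exact: ccont_id]. }
  have sb : forall p r, U p -> U r -> Cmod (p - z) <= 5 * d * q -> Cmod (r - z) <= 5 * d * q -> Cmod (r - p) <= d * q ->
    Cmod (seg f p r - seg g p r) <= eps * (5 * d * q) * (d * q).
  { move=> p r up ur bp br bpr. rewrite -seg_minus //; last by apply: cfp.
    apply: Rle_trans (_ : eps * (5 * d * q) * Cmod (r - p) <= _).
    - apply: seg_bound. { move=> t ht. apply: ccont_minus => //. exact: cfp. }
      move=> t ht. have bt := path_dist ht bp br.
      have -> : (f (path p r t) - g (path p r t) = f (path p r t) - f z - l * (path p r t - z))%C. { rewrite /g. ring. }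
      apply: Rle_trans (H _ _) _; first lra. apply: Rmult_le_compat_l; lra.
    - apply: Rmult_le_compat_l => //. apply: Rmult_le_pos; lra. }
  have z0 : tri g x y w = RtoC 0 by apply: tri_affine.
  have b1 := sb x y ux uy bx by_ s1. have b2 := sb y w uy uw by_ bw s2. have b3 := sb w x uw ux bw bx s3.
  have Ib2 : Cmod (tri f x y w) <= 15 * d * q * (d * q) * eps.
  { have -> : tri f x y w = ((seg f x y - seg g x y) + (seg f y w - seg g y w) + (seg f w x - seg g w x) + tri g x y w)%C. { rewrite /tri. ring. }
    rewrite z0 Cplus_0_r.
    have := Cmod_triangle ((seg f x y - seg g x y) + (seg f y w - seg g y w)) (seg f w x - seg g w x).
    have := Cmod_triangle (seg f x y - seg g x y) (seg f y w - seg g y w). lra. }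
  apply: Rle_trans Ib _. rewrite /I /=.
  have e4 : 4^N * (q * q) = 1. { rewrite /q -!Rpow_mult_distr. rewrite (_ : 4 * (1/2 * (1/2)) = 1); [exact: pow1|lra]. }
  have p4 : 0 < 4^N by nra.
  apply: Rle_trans (Rmult_le_compat_l _ _ _ (Rlt_le _ _ p4) Ib2) _.
  right. transitivity (15 * d * d * eps * (4^N * (q * q))); first ring. rewrite e4. ring. }
apply: Ceq_of_eps => eps he. replace (tri f a b c - 0)%C with (tri f a b c) by ring.
have k := key (eps / (15 * d * d + 1)) ltac:(apply: Rdiv_lt_0_compat => //; nra).
apply: Rle_trans k _. have : 0 <= 15 * d * d by nra. move=> h.
rewrite /Rdiv -Rmult_assoc. apply/Rle_div_l; first lra. nra.
Qed.

(** * Cauchy's theorem and Taylor expansion *)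

Definition disc (z0 : C) (r : R) (z : C) : Prop := Cmod (z - z0) <= r.

Lemma disc_convex (z0 : C) (r : R) : convexC (disc z0 r).
Proof. move=> a b t ha hb ht. exact: path_dist. Qed.

Lemma disc_closed (z0 : C) (r : R) : closedC (disc z0 r).
Proof.
move=> z h. rewrite /disc. apply: le_epsilon => eps he. case: (h eps he) => x [hx xz].
rewrite /disc in hx. have := Cmod_triangle_mid z x z0. rewrite (Cmod_minus_sym z x). lra.
Qed.

Lemma re_minus (x y : C) : Re (x - y) = Re x - Re y.
Proof. by rewrite re_plus re_opp. Qed.
Lemma im_minus (x y : C) : Im (x - y) = Im x - Im y.
Proof. by rewrite im_plus im_opp. Qed.

Definition halfplane (p n : C) (m : R) (z : C) : Prop := m <= Re ((z - p) * Cconj n).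

Lemma halfplane_convex (p n : C) (m : R) : convexC (halfplane p n m).
Proof.
move=> a b t ha hb ht. rewrite /halfplane /path.
replace ((a + RtoC t * (b - a) - p) * Cconj n)%C with (RtoC (1 - t) * ((a - p) * Cconj n) + RtoC t * ((b - p) * Cconj n))%C.
2: { rewrite RtoC_minus. ring. }
rewrite re_plus !re_scal_l. rewrite /halfplane in ha hb. nra.
Qed.

Lemma halfplane_closed (p n : C) (m : R) : closedC (halfplane p n m).
Proof.
move=> z h. rewrite /halfplane. apply: le_epsilon => eps he.
have n0 := Cmod_ge_0 n.
case: (h (eps / (Cmod n + 1)) ltac:(apply: Rdiv_lt_0_compat; lra)) => x [hx xz]. rewrite /halfplane in hx.
have E : ((x - p) * Cconj n = (z - p) * Cconj n + (x - z) * Cconj n)%C by ring.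
rewrite E re_plus in hx.
have b := Rle_trans _ _ _ (Rle_abs _) (re_le_Cmod ((x - z) * Cconj n)). rewrite Cmod_mult Cmod_conj in b.
have : Cmod (x - z) * Cmod n <= eps / (Cmod n + 1) * (Cmod n + 1). { apply: Rmult_le_compat; try lra. exact: Cmod_ge_0. }
have -> : eps / (Cmod n + 1) * (Cmod n + 1) = eps by field; lra. lra.
Qed.

Lemma inter_convex (U V : C -> Prop) : convexC U -> convexC V -> convexC (fun z => U z /\ V z).
Proof. move=> hU hV a b t [a1 a2] [b1 b2] ht. split; [exact: hU | exact: hV]. Qed.

Lemma inter_closed (U V : C -> Prop) : closedC U -> closedC V -> closedC (fun z => U z /\ V z).
Proof.
move=> hU hV z h. split; [apply: hU | apply: hV] => eps he; case: (h eps he) => x [[u v] k]; by exists x.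
Qed.

Lemma seg_pp (f : C -> C) (a : C) : seg f a a = RtoC 0.
Proof. rewrite /seg. ring. Qed.

Lemma tri_cut (U : C -> Prop) (f : C -> C) (p b c : C) (t : R) : convexC U ->
  (forall z, U z -> ccont f z) -> U p -> U b -> U c -> 0 <= t <= 1 ->
  tri f p b c = (tri f p (path p b t) (path p c t) + tri f (path p b t) b c + tri f (path p b t) c (path p c t))%C.
Proof.
move=> cv cf up ub uc ht. set b' := path p b t. set c' := path p c t.
have ub' : U b' by apply: cv. have uc' : U c' by apply: cv.
have cfp : forall x y, U x -> U y -> forall t, 0 <= t <= 1 -> ccont f (path x y t).
{ move=> x y Ux Uy s hs. apply: cf. exact: cv. }
rewrite /tri (@seg_sub f p b t) -/b' //; last by apply: cfp.
rewrite (@seg_rev f p c); last by apply: cfp. rewrite (@seg_sub f p c t) -/c' //; last by apply: cfp.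
rewrite (@seg_rev f p c'); last by apply: cfp.
rewrite (@seg_rev f b' c'); last by apply: cfp.
rewrite (@seg_rev f b' c); last by apply: cfp.
rewrite (@seg_rev f c' c); last by apply: cfp. ring.
Qed.

(** Differentiability may fail at the vertex [p]. The last hypothesis makes the angle at [p] acute,
    so a half-plane separates [p] from the quadrilateral left after a small similar triangle at [p]
    is cut off. Goursat kills the quadrilateral; continuity makes the small triangle negligible. *)
Lemma goursat_vertex (U : C -> Prop) (f : C -> C) (p b c : C) : convexC U -> closedC U ->
  (forall z, U z -> ccont f z) -> (forall z, U z -> z <> p -> exists l, cderiv f z l) ->
  U p -> U b -> U c -> 0 < Re ((c - p) * Cconj (b - p)) -> tri f p b c = RtoC 0.
Proof.
move=> cv cl cf df up ub uc pos. set n := (b - p)%C in pos.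
set m := Rmin (Cmod n ^ 2) (Re ((c - p) * Cconj n)).
have nb : n <> RtoC 0. { move=> e. rewrite e in pos. move: pos. rewrite re_mult /=. lra. }
have n0 := proj1 (Cmod_gt_0 n) nb.
have m0 : 0 < m. { apply: Rmin_glb_lt => //. nra. }
have hn : Re ((b - p) * Cconj n) = Cmod n ^ 2. { rewrite Cmod2_alt -/n re_mult re_conj im_conj. ring. }
have Et : forall t, 0 < t <= 1 -> tri f p b c = tri f p (path p b t) (path p c t).
{ move=> t ht. rewrite (@tri_cut U f p b c t) //; last lra.
  set V := fun z => U z /\ halfplane p n (t * m) z.
  have hp : forall x, m <= Re ((x - p) * Cconj n) -> halfplane p n (t * m) x /\ halfplane p n (t * m) (path p x t).
  { move=> x hx. split.
    - rewrite /halfplane. nra.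
    - rewrite /halfplane /path. replace ((p + RtoC t * (x - p) - p) * Cconj n)%C with (RtoC t * ((x - p) * Cconj n))%C by ring.
      rewrite re_scal_l. apply: Rmult_le_compat_l; lra. }
  have [hb1 hb2] := hp b ltac:(rewrite hn; exact: Rmin_l).
  have [hc1 hc2] := hp c ltac:(exact: Rmin_r).
  have g := @goursat V f (inter_convex cv (@halfplane_convex _ _ _)) (inter_closed cl (@halfplane_closed _ _ _)).
  have dV : forall z, V z -> exists l, cderiv f z l.
  { move=> z [uz hz]. apply: df => // e. rewrite e /halfplane in hz. replace ((p - p) * Cconj n)%C with (RtoC 0) in hz by ring.
    rewrite /= in hz. have : 0 < t * m by nra. lra. }
  have vb' : V (path p b t). { split => //. apply: cv => //. lra. }
  have vc' : V (path p c t). { split => //. apply: cv => //. lra. }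
  rewrite (g dV (path p b t) b c) // (g dV (path p b t) c (path p c t)) //. ring. }
apply: Ceq_of_eps => eps he. replace (tri f p b c - 0)%C with (tri f p b c) by ring.
case: (cf p up 1 ltac:(lra)) => d [hd H].
set K := Cmod (b - p) + Cmod (c - p) + Cmod (c - b) + 1.
have K1 : 1 <= K. { have := Cmod_ge_0 (b - p). have := Cmod_ge_0 (c - p). have := Cmod_ge_0 (c - b). rewrite /K. lra. }
set M := Cmod (f p) + 1. have M1 : 1 <= M. { have := Cmod_ge_0 (f p). rewrite /M. lra. }
(* The cut-off triangle has sides at most t K and lies where |f| <= M, so each of its three sides
   contributes at most eps / 3. *)
set t := Rmin 1 (Rmin (d / (2 * K)) (eps / (3 * M * K))).
have t0 : 0 < t. { apply: Rmin_glb_lt; first lra. apply: Rmin_glb_lt; apply: Rdiv_lt_0_compat => //; nra. }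
have t1 : t <= 1 by apply: Rmin_l.
have td : t * K < d. { have : t <= d / (2 * K). { apply: Rle_trans (Rmin_r _ _) _. exact: Rmin_l. } move=> h. have : d / (2 * K) * (2 * K) = d by field; lra. nra. }
have te : t * (3 * M * K) <= eps. { have : t <= eps / (3 * M * K). { apply: Rle_trans (Rmin_r _ _) _. exact: Rmin_r. } move=> h. have : eps / (3 * M * K) * (3 * M * K) = eps by field; lra. nra. }
rewrite (Et t) //.
have Pn : forall x, Cmod (path p x t - p) = t * Cmod (x - p).
{ move=> x. rewrite /path. replace (p + RtoC t * (x - p) - p)%C with (RtoC t * (x - p))%C by ring. rewrite Cmod_mult Cmod_RtoC_pos; lra. }
have bnd : forall x y, U x -> U y -> Cmod (x - p) <= t * K -> Cmod (y - p) <= t * K -> Cmod (y - x) <= t * K -> Cmod (seg f x y) <= M * (t * K).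
{ move=> x y ux uy hx hy hxy. apply: Rle_trans (_ : M * Cmod (y - x) <= _); last by apply: Rmult_le_compat_l; lra.
  apply: seg_bound. { move=> s hs. apply: cf. exact: cv. }
  move=> s hs. have := H (path x y s) (Rle_lt_trans _ _ _ (path_dist hs hx hy) td).
  have := Cmod_triangle_inv (f (path x y s)) (f p). rewrite /M. lra. }
have hb : Cmod (b - p) <= K. { have := Cmod_ge_0 (c - p). have := Cmod_ge_0 (c - b). rewrite /K. lra. }
have hc : Cmod (c - p) <= K. { have := Cmod_ge_0 (b - p). have := Cmod_ge_0 (c - b). rewrite /K. lra. }
have hbc : Cmod (c - b) <= K. { have := Cmod_ge_0 (b - p). have := Cmod_ge_0 (c - p). rewrite /K. lra. }
have ub' : U (path p b t) by apply: cv => //; lra. have uc' : U (path p c t) by apply: cv => //; lra.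
have p0 : Cmod (p - p) <= t * K. { rewrite Cmod_self. nra. }
have pb : Cmod (path p b t - p) <= t * K by rewrite Pn; nra.
have pc : Cmod (path p c t - p) <= t * K by rewrite Pn; nra.
have pbc : Cmod (path p c t - path p b t) <= t * K.
{ rewrite /path. replace (p + RtoC t * (c - p) - (p + RtoC t * (b - p)))%C with (RtoC t * (c - b))%C by ring. rewrite Cmod_mult Cmod_RtoC_pos; nra. }
rewrite /tri.
have b1 := bnd _ _ up ub' p0 pb pb. have b2 := bnd _ _ ub' uc' pb pc pbc.
have b3 := bnd _ _ uc' up pc p0 ltac:(by rewrite Cmod_minus_sym).
have := Cmod_triangle (seg f p (path p b t) + seg f (path p b t) (path p c t)) (seg f (path p c t) p).
have := Cmod_triangle (seg f p (path p b t)) (seg f (path p b t) (path p c t)). lra.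
Qed.

(** Only triangles with a vertex at the base point have to integrate to 0. This form therefore
    applies to an integrand that is merely continuous at the base point. *)
Lemma prim_deriv (q : C -> C) (p z : C) (r : R) : 0 < r ->
  (forall y t, Cmod (y - z) < r -> 0 <= t <= 1 -> ccont q (path p y t)) ->
  (forall y, Cmod (y - z) < r -> tri q p z y = RtoC 0) -> cderiv (fun y => seg q p y) z (q z).
Proof.
move=> hr cq tr. apply/cderiv_eps => eps he.
have cz : forall y, Cmod (y - z) < r -> ccont q y. { move=> y hy. have := cq y 1 hy ltac:(lra). by rewrite path1. }
case: (cz z ltac:(by rewrite Cmod_self) eps he) => d [hd H].
exists (Rmin r d); split; first exact: Rmin_glb_lt.
move=> y hy. have yr : Cmod (y - z) < r by apply: Rlt_le_trans hy (Rmin_l _ _).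
have yd : Cmod (y - z) < d by apply: Rlt_le_trans hy (Rmin_r _ _).
have pd : forall t, 0 <= t <= 1 -> Cmod (path z y t - z) <= Cmod (y - z).
{ move=> t ht. apply: path_dist => //; last lra. rewrite Cmod_self. exact: Cmod_ge_0. }
have cp : forall t, 0 <= t <= 1 -> ccont q (path z y t).
{ move=> t ht. apply: cz. have := pd t ht. lra. }
have E : (seg q p y - seg q p z = seg q z y)%C.
{ have := tr y yr. rewrite /tri (@seg_rev q p y); last by move=> t; exact: cq. move=> e.
  replace (seg q z y) with ((seg q p z + seg q z y + - seg q p y) + (seg q p y - seg q p z))%C by ring. rewrite e. ring. }
rewrite E.
have -> : (q z * (y - z))%C = seg (fun _ => q z) z y.
{ symmetry. apply: (eq_trans (@seg_FTC (fun u => q z * u)%C (fun _ => q z) z y _ _)).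
  - move=> t _. apply: cderiv_eq (cderiv_scal _ (cderiv_id _)) _. ring.
  - move=> t _. exact: ccont_const.
  - ring. }
rewrite -seg_minus //; last by move=> t _; exact: ccont_const.
apply: seg_bound. { move=> t ht. apply: ccont_minus; [exact: cp | exact: ccont_const]. }
move=> t ht. left. apply: H. have := pd t ht. lra.
Qed.

Lemma primitive_convex (U : C -> Prop) (g : C -> C) (p z : C) (r : R) : convexC U -> closedC U ->
  (forall y, U y -> exists l, cderiv g y l) -> U p -> 0 < r -> (forall y, Cmod (y - z) < r -> U y) ->
  cderiv (fun y => seg g p y) z (g z).
Proof.
move=> cv cl dg up hr hU. apply: (@prim_deriv g p z r) => //.
- move=> y t hy ht. have [l] := dg (path p y t) ltac:(apply: cv => //; exact: hU). exact: cderiv_ccont.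
- move=> y hy. apply: (goursat cv cl dg) => //; apply: hU => //. by rewrite Cmod_self.
Qed.

(** * Cauchy's formula on a circle *)

Definition cis (t : R) : C := (cos t, sin t).

Lemma cis_0 : cis 0 = RtoC 1. Proof. by rewrite /cis cos_0 sin_0. Qed.
Lemma cis_2PI : cis (2 * PI) = RtoC 1. Proof. by rewrite /cis cos_2PI sin_2PI. Qed.
Lemma Cmod_cis (t : R) : Cmod (cis t) = 1.
Proof.
rewrite /Cmod /cis /=. rewrite (_ : _ + _ = 1) ?sqrt_1 //.
have := sin2_cos2 t. rewrite /Rsqr. lra.
Qed.
Lemma cis_neq0 (t : R) : cis t <> RtoC 0.
Proof. apply/Cmod_gt_0. rewrite Cmod_cis. lra. Qed.

Lemma rderiv_pair (x y : R -> R) (t a b : R) : is_derive x t a -> is_derive y t b ->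
  rderiv (fun u => (x u, y u)) t (a, b).
Proof.
move=> hx hy.
have := rderiv_plus (rderiv_RtoC hx) (rderiv_mult (rderiv_const Ci t) (rderiv_RtoC hy)).
move=> h. apply: rderiv_eq (_ : rderiv _ t (RtoC a + (0 * RtoC (y t) + Ci * RtoC b))%C) _.
- move: h. set f := (fun _ => _ + _)%C. have -> : (fun u => (x u, y u)) = f; last by [].
  apply: FunctionalExtensionality.functional_extensionality => u. rewrite /f.
  apply: injective_projections; rewrite /=; ring.
- apply: injective_projections; rewrite /=; ring.
Qed.

Lemma cis_rderiv (t : R) : rderiv cis t (Ci * cis t)%C.
Proof.
apply: rderiv_eq (rderiv_pair (is_derive_cos t) (is_derive_sin t)) _.
apply: injective_projections; rewrite /=; ring.
Qed.

Lemma cis_rcont (t : R) : rcont cis t. Proof. exact: rderiv_rcont (cis_rderiv t). Qed.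

Lemma cderiv_pow (n : nat) (z : C) : cderiv (fun x => x ^ (S n))%C z (RtoC (INR (S n)) * z ^ n)%C.
Proof.
elim: n => [|n IH].
- apply: (@cderiv_ext_loc (fun x => x)%C _ _ _ 1); first lra.
  + move=> y _. rewrite /=. ring.
  + apply: cderiv_eq (cderiv_id z) _. rewrite /=. ring.
- apply: (@cderiv_ext_loc (fun x => x * x ^ (S n))%C _ _ _ 1) => //; first lra.
  apply: cderiv_eq (cderiv_mult (cderiv_id z) IH) _.
  rewrite (S_INR (S n)) RtoC_plus /=. ring.
Qed.

Lemma ccont_pow (n : nat) (z : C) : ccont (fun x => x ^ n)%C z.
Proof.
case: n => [|n]; first exact: ccont_const. exact: cderiv_ccont (cderiv_pow n z).
Qed.

Lemma cisinv_rderiv (t : R) : rderiv (fun u => / cis u)%C t (- Ci * / cis t)%C.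
Proof.
apply: rderiv_eq (rderiv_comp (cis_rderiv t) (cderiv_inv (@cis_neq0 t))) _.
field. exact: cis_neq0.
Qed.

Lemma cisinv_int (n : nat) : is_CInt (fun t => (/ cis t) ^ (S n))%C 0 (2 * PI) (RtoC 0).
Proof.
have hPI := PI_RGT_0.
set k := (- (RtoC (INR (S n)) * Ci))%C.
have nz : k <> RtoC 0.
{ have h : INR (S n) <> 0 by apply: not_0_INR. move=> e. apply: h. have := f_equal (fun z => Im z) e. rewrite /k /Im /=. lra. }
have H : is_CInt (fun t => k * (/ cis t) ^ (S n))%C 0 (2 * PI) ((/ cis (2 * PI)) ^ (S n) - (/ cis 0) ^ (S n))%C.
{ apply: (@is_CInt_FTC (fun t => (/ cis t) ^ (S n))%C); first lra.
  - move=> t _. apply: rderiv_eq (rderiv_comp (cisinv_rderiv t) (cderiv_pow n _)) _. rewrite /k /=. ring.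
  - move=> t _. apply: rcont_scal. apply: (@rcont_comp (fun z => z ^ (S n))%C); last exact: ccont_pow.
    exact: rderiv_rcont (cisinv_rderiv t). }
rewrite cis_0 cis_2PI in H. have H2 := is_CInt_scal (c := (/ k)%C) H.
replace (/ k * ((/ 1) ^ S n - (/ 1) ^ S n))%C with (RtoC 0) in H2 by ring.
apply: is_CInt_ext H2; first lra. move=> t _. rewrite Cmult_assoc Cinv_l //. ring.
Qed.

Fixpoint Csum (a : nat -> C) (n : nat) : C :=
  match n with O => RtoC 0 | S m => (Csum a m + a m)%C end.

Lemma geom_partial (x : C) (n : nat) : ((1 - x) * Csum (fun k => x ^ k) n = 1 - x ^ n)%C.
Proof. elim: n => [|n IH]; rewrite /=; first ring. rewrite Cmult_plus_distr_l IH. ring. Qed.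

Lemma is_CInt_Csum (f : nat -> R -> C) (l : nat -> C) (a b : R) (n : nat) :
  (forall k, is_CInt (f k) a b (l k)) -> is_CInt (fun t => Csum (fun k => f k t) n) a b (Csum l n).
Proof.
move=> h. elim: n => [|n IH] /=; last exact: is_CInt_plus.
have := is_RInt_const (V := C_R_NormedModule) a b (RtoC 0).
by rewrite scal_R_Cmult Cmult_0_r.
Qed.

Lemma Csum_ext (a b : nat -> C) (n : nat) : (forall k, (k < n)%nat -> a k = b k) -> Csum a n = Csum b n.
Proof. elim: n => [|n IH] h //=. rewrite IH; last by move=> k hk; apply: h; lia. by rewrite h. Qed.

Lemma Csum_scal (c : C) (a : nat -> C) (n : nat) : Csum (fun k => c * a k)%C n = (c * Csum a n)%C.
Proof. elim: n => [|n IH] /=; first ring. rewrite IH. ring. Qed.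

Lemma Cmod_ratio_lt1 (x r : R) : 0 <= x < r -> 0 <= x / r < 1.
Proof.
move=> h. split. { apply: Rdiv_le_0_compat; lra. } apply/Rlt_div_l; lra.
Qed.

Lemma Cmod_one_minus (x : C) (q : R) : Cmod x <= q -> 1 - q <= Cmod (1 - x).
Proof. move=> h. have := Cmod_triangle_inv 1 x. rewrite Cmod_1. lra. Qed.

Lemma le_of_geom (a K q : R) : 0 <= q < 1 -> (forall n, a <= K * q ^ n) -> a <= 0.
Proof.
move=> hq h. have l : is_lim_seq (fun n => K * q^n) (K * 0).
{ apply: (is_lim_seq_scal_l _ K 0). apply: is_lim_seq_geom. rewrite Rabs_pos_eq; lra. }
rewrite Rmult_0_r in l. exact: (is_lim_seq_le _ _ _ _ h (is_lim_seq_const a) l).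
Qed.

Section CauchyFormula.
Variables (g : C -> C) (z0 w : C) (rho r : R).
Hypothesis dg : forall z, disc z0 rho z -> exists l, cderiv g z l.
Hypothesis hr : 0 < r < rho.
Hypothesis hw : Cmod (w - z0) < r.

Let Z t := (z0 + RtoC r * cis t)%C.

Lemma circle_mod t : Cmod (Z t - z0) = r.
Proof.
rewrite /Z. replace (z0 + RtoC r * cis t - z0)%C with (RtoC r * cis t)%C by ring.
rewrite Cmod_mult Cmod_cis Cmod_RtoC_pos; lra.
Qed.

Lemma circle_neq t : Z t <> w.
Proof. move=> e. have := circle_mod t. rewrite e. lra. Qed.

Lemma circle_rderiv t : rderiv Z t (RtoC r * (Ci * cis t))%C.
Proof.
apply: rderiv_eq (rderiv_plus (rderiv_const z0 t) (rderiv_mult (rderiv_const (RtoC r) t) (cis_rderiv t))) _. ring.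
Qed.

Lemma circle_disc t : disc z0 rho (Z t).
Proof. rewrite /disc circle_mod. lra. Qed.

Lemma circle_gcont t : rcont (fun t => g (Z t)) t.
Proof.
apply: rcont_comp. { exact: rderiv_rcont (circle_rderiv t). }
have [l] := dg (circle_disc t). exact: cderiv_ccont.
Qed.

(** The slope function [phi] of [g] at [w] is continuous at [w] and holomorphic elsewhere, so
    [seg phi w] is a primitive of it around every point of the circle, and the integral over the
    closed curve vanishes. *)
Lemma cauchy_quotient_int :
  is_CInt (fun t => (g (Z t) - g w) / (Z t - w) * (RtoC r * (Ci * cis t)))%C 0 (2 * PI) (RtoC 0).
Proof.
have [l hl] := dg (z := w) ltac:(rewrite /disc; lra).
move: (hl) => [phi [p1 [p2 p3]]].
pose U := disc z0 rho.
have E : forall y, y <> w -> phi y = ((g y - g w) / (y - w))%C.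
{ move=> y n. rewrite (p3 y). field. exact: Cminus_neq0. }
have dphi : forall z, U z -> z <> w -> exists m, cderiv phi z m.
{ move=> z uz n. have [m hm] := dg uz.
  have n0 := Cmod_minus_gt0 n.
  have H : exists m', cderiv (fun y => (g y - g w) * / (y - w))%C z m'.
  { eexists. apply: (@cderiv_mult (fun y => g y - g w)%C (fun y => / (y - w))%C).
    - apply: cderiv_minus hm (cderiv_const _ _).
    - apply: (@cderiv_comp (fun x => / x)%C (fun y => y - w)%C).
      + apply: cderiv_minus (cderiv_id _) (cderiv_const _ _).
      + apply: cderiv_inv. exact: Cminus_neq0. }
  case: H => m' hm'. exists m'. apply: (@cderiv_ext_loc _ phi z m' (Cmod (z - w)) n0 _ hm').
  move=> y hy. rewrite E //. move=> e. rewrite e Cmod_minus_sym in hy. lra. }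
have cphi : forall z, U z -> ccont phi z.
{ move=> z uz. case: (Ceq_dec z w) => [->|n] //. have [m] := dphi z uz n. exact: cderiv_ccont. }
have uw : U w by rewrite /U /disc; lra.
have dQ : forall t, cderiv (fun y => seg phi w y) (Z t) (phi (Z t)).
{ move=> t. set z := Z t. have n := circle_neq (t := t). have n0 := Cmod_minus_gt0 n. rewrite -/z in n n0.
  have zr := circle_mod t. rewrite -/z in zr.
  apply: (@prim_deriv phi w z (Rmin (rho - r) (Cmod (z - w) / 2))).
  - apply: Rmin_glb_lt; lra.
  - move=> y s hy hs. apply: cphi. apply: (@disc_convex z0 rho) => //.
    rewrite /disc. have := Cmod_triangle_mid y z z0. have := Rmin_l (rho - r) (Cmod (z - w) / 2). lra.
  - move=> y hy. apply: (@goursat_vertex U) => //.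
    + exact: disc_convex. + exact: disc_closed.
    + rewrite /U /disc. lra.
    + rewrite /U /disc. have := Cmod_triangle_mid y z z0. have := Rmin_l (rho - r) (Cmod (z - w) / 2). lra.
    (* Since |y - z| < |z - w| / 2, the angle at [w] is acute, as [goursat_vertex] requires. *)
    + have e : ((y - w) * Cconj (z - w) = (z - w) * Cconj (z - w) + (y - z) * Cconj (z - w))%C by ring.
      rewrite e re_plus -Cmod2_conj re_RtoC.
      have b := re_le_Cmod ((y - z) * Cconj (z - w)). rewrite Cmod_mult Cmod_conj in b.
      have b' := Rle_abs (- Re ((y - z) * Cconj (z - w))). rewrite Rabs_Ropp in b'.
      have h2 : Cmod (y - z) < Cmod (z - w) / 2. { have := Rmin_r (rho - r) (Cmod (z - w) / 2). lra. } nra. }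
have hPI := PI_RGT_0.
have F : is_CInt (fun t => phi (Z t) * (RtoC r * (Ci * cis t)))%C 0 (2 * PI) (seg phi w (Z (2 * PI)) - seg phi w (Z 0))%C.
{ apply: (@is_CInt_FTC (fun t => seg phi w (Z t))); first lra.
  - move=> t _. apply: (@rderiv_comp (fun y => seg phi w y)); [exact: circle_rderiv | exact: dQ].
  - move=> t _. apply: rcont_mult.
    + apply: rcont_comp; [exact: rderiv_rcont (circle_rderiv t) | apply: cphi; exact: circle_disc].
    + apply: rcont_scal. apply: rcont_scal. exact: cis_rcont. }
have e0 : Z (2 * PI) = Z 0 by rewrite /Z cis_0 cis_2PI.
rewrite e0 in F. replace (seg phi w (Z 0) - seg phi w (Z 0))%C with (RtoC 0) in F by ring.
apply: is_CInt_ext F; first lra. move=> t _. rewrite E //. exact: circle_neq.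
Qed.

(** Geometric series: every positive power of 1 / [cis] integrates to 0 over a period, and only the
    constant term remains. *)
Lemma cauchy_kernel_int :
  is_CInt (fun t => / (1 - (w - z0) / RtoC r * / cis t))%C 0 (2 * PI) (RtoC (2 * PI)).
Proof.
have hPI := PI_RGT_0.
set x := ((w - z0) / RtoC r)%C.
have rn : RtoC r <> RtoC 0. { move=> e. have := RtoC_inj _ _ e. lra. }
set q := Cmod (w - z0) / r.
have hq : 0 <= q < 1. { apply: Cmod_ratio_lt1. split => //. exact: Cmod_ge_0. }
have mx : forall t, Cmod (x * / cis t) = q.
{ move=> t. rewrite Cmod_mult Cmod_inv; last exact: cis_neq0. rewrite Cmod_cis Rinv_1 Rmult_1_r /x Cmod_div // Cmod_RtoC_pos //; lra. }
have nz : forall t, (1 - x * / cis t)%C <> RtoC 0.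
{ move=> t. apply/Cmod_gt_0. have := @Cmod_one_minus (x * / cis t) q ltac:(rewrite mx; lra). lra. }
have nz2 : forall t, (cis t - x)%C <> RtoC 0.
{ move=> t e. apply: (nz t). replace (1 - x * / cis t)%C with ((cis t - x) / cis t)%C by (field; exact: cis_neq0). rewrite e. field. exact: cis_neq0. }
set K := (fun t => / (1 - x * / cis t))%C.
have Kc : forall t, rcont K t.
{ move=> t. apply: (@rcont_comp (fun z => / z)%C).
  - apply: rcont_minus; first exact: rcont_const. apply: rcont_scal. exact: rderiv_rcont (cisinv_rderiv t).
  - exact: ccont_inv. }
have c : is_CInt K 0 (2 * PI) (CInt K 0 (2 * PI)) by apply: CInt_correct => //; lra.
suff -> : RtoC (2 * PI) = CInt K 0 (2 * PI) by [].
have S1 : forall n, is_CInt (fun t => Csum (fun k => (x * / cis t) ^ k)%C (S n)) 0 (2 * PI) (RtoC (2 * PI)).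
{ move=> n.
  have H := @is_CInt_Csum (fun k t => (x * / cis t) ^ k)%C (fun k => match k with O => RtoC (2 * PI) | S _ => RtoC 0 end) 0 (2 * PI) (S n).
  have e : forall m, Csum (fun k => match k with O => RtoC (2 * PI) | S _ => RtoC 0 end) (S m) = RtoC (2 * PI).
  { elim=> [|m IH]; first by rewrite /= Cplus_0_l. by rewrite [LHS]/= -/(Csum _ (S m)) IH Cplus_0_r. }
  rewrite e in H. apply: H => -[|k].
  - have := is_RInt_const (V := C_R_NormedModule) 0 (2 * PI) (RtoC 1). rewrite scal_R_Cmult Rminus_0_r Cmult_1_r. by [].
  - have := is_CInt_scal (c := (x ^ (S k))%C) (cisinv_int k). rewrite Cmult_0_r => h.
    apply: is_CInt_ext h; first lra. move=> t _. by rewrite -Cpow_mult_l. }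
apply: Ceq_of_eps => eps he. apply: Rle_trans (_ : 0 <= eps); last lra.
apply: (@le_of_geom _ (q / (1 - q) * (2 * PI)) q hq) => n.
have := is_CInt_minus (S1 n) c => H.
have := @is_CInt_bound _ 0 (2 * PI) (q ^ (S n) / (1 - q)) _ ltac:(lra) _ H.
rewrite Rminus_0_r => B. apply: Rle_trans (B _) _.
- move=> t _.
  have -> : (Csum (fun k => (x * / cis t) ^ k) (S n) - K t)%C = (- ((x * / cis t) ^ (S n) / (1 - x * / cis t)))%C.
  { have g1 := geom_partial (x * / cis t) (S n). rewrite /K.
    have -> : Csum (fun k => ((x * / cis t) ^ k)%C) (S n) = ((1 - (x * / cis t) ^ (S n)) / (1 - x * / cis t))%C.
    { rewrite -g1. field. by split; [exact: cis_neq0| exact: nz2]. }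
    field. by split; [exact: cis_neq0| exact: nz2]. }
  rewrite Cmod_opp Cmod_div // Cmod_pow mx. apply: Rmult_le_compat_l. { apply: pow_le; lra. }
  apply: Rinv_le_contravar; first lra. apply: Cmod_one_minus. rewrite mx; lra.
- right. rewrite /=. field. lra.
Qed.

Lemma cauchy_formula :
  is_CInt (fun t => g (Z t) * / (1 - (w - z0) / RtoC r * / cis t))%C 0 (2 * PI) (RtoC (2 * PI) * g w)%C.
Proof.
have hPI := PI_RGT_0.
have rn : RtoC r <> RtoC 0. { move=> e. have := RtoC_inj _ _ e. lra. }
have H := is_CInt_plus (is_CInt_scal (c := (/ Ci)%C) cauchy_quotient_int) (is_CInt_scal (c := g w) cauchy_kernel_int).
replace (/ Ci * 0 + g w * RtoC (2 * PI))%C with (RtoC (2 * PI) * g w)%C in H by ring.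
apply: is_CInt_ext H; first lra. move=> t _.
have n1 := cis_neq0 (t := t). have n2 := Cminus_neq0 (circle_neq (t := t)).
have e : (Z t - w = RtoC r * cis t * (1 - (w - z0) / RtoC r * / cis t))%C.
{ rewrite /Z. field. by split. }
have n3 : (1 - (w - z0) / RtoC r * / cis t)%C <> RtoC 0.
{ move=> e2. apply: n2. rewrite e e2. ring. }
rewrite e. set y := (1 - (w - z0) / RtoC r * / cis t)%C in n3 *.
field. repeat split => //. exact: Ci_nz.
Qed.
End CauchyFormula.

(** Cauchy's kernel is expanded to finitely many terms, which keeps an explicit remainder. The case
    n = 0 is a weak maximum principle; n = 1, 2, 3 give the local estimates that follow. *)
Lemma taylor (g : C -> C) (z0 : C) (rho r M : R) :
  (forall z, disc z0 rho z -> exists l, cderiv g z l) -> 0 < r < rho ->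
  (forall z, Cmod (z - z0) = r -> Cmod (g z) <= M) ->
  exists a : nat -> C, (forall n, Cmod (a n) <= M / r ^ n) /\
    forall w n, Cmod (w - z0) < r ->
      Cmod (g w - Csum (fun k => a k * (w - z0) ^ k)%C n) <= M * ((Cmod (w - z0) / r) ^ n / (1 - Cmod (w - z0) / r)).
Proof.
move=> dg hr hM. have hPI := PI_RGT_0.
have rn : RtoC r <> RtoC 0. { move=> e. have := RtoC_inj _ _ e. lra. }
have pn : RtoC (2 * PI) <> RtoC 0. { move=> e. have := RtoC_inj _ _ e. lra. }
pose Z t := (z0 + RtoC r * cis t)%C.
have Zm : forall t, Cmod (Z t - z0) = r by move=> t; exact: (@circle_mod z0 rho r hr t).
pose h n t := (g (Z t) * (/ (RtoC r * cis t)) ^ n)%C.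
pose a n := (/ RtoC (2 * PI) * CInt (h n) 0 (2 * PI))%C.
have hc : forall n, is_CInt (h n) 0 (2 * PI) (CInt (h n) 0 (2 * PI)).
{ move=> n. apply: CInt_correct; first lra. move=> t _. apply: rcont_mult.
  - exact: (@circle_gcont g z0 rho r).
  - apply: (@rcont_comp (fun z => z ^ n)%C); last exact: ccont_pow.
    apply: (@rcont_comp (fun z => / z)%C). { apply: rcont_scal. exact: cis_rcont. }
    apply: ccont_inv. apply: Cmult_neq_0 => //. exact: cis_neq0. }
exists a. split.
- move=> n. rewrite /a Cmod_mult Cmod_inv // Cmod_RtoC_pos; last lra.
  have B := @is_CInt_bound _ 0 (2 * PI) (M / r ^ n) _ ltac:(lra) _ (hc n).
  have B' : Cmod (CInt (h n) 0 (2 * PI)) <= M / r ^ n * (2 * PI - 0).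
  { apply: B => t _. rewrite /h Cmod_mult Cmod_pow Cmod_inv; last by apply: Cmult_neq_0 => //; exact: cis_neq0.
    rewrite Cmod_mult Cmod_cis Cmod_RtoC_pos; last lra. rewrite Rmult_1_r pow_inv.
    apply: Rmult_le_compat_r; last by apply: hM.
    left. apply: Rinv_0_lt_compat. apply: pow_lt; lra. }
  apply: Rle_trans (Rmult_le_compat_l _ _ _ _ B') _. { left. apply: Rinv_0_lt_compat. lra. }
  right. field. split; last lra. apply: pow_nonzero. lra.
- move=> w n hw. set u := (w - z0)%C. set q := Cmod u / r.
  have hq : 0 <= q < 1. { apply: Cmod_ratio_lt1. split => //. exact: Cmod_ge_0. }
  have mx : forall t, Cmod (u / RtoC r * / cis t) = q.
  { move=> t. rewrite Cmod_mult Cmod_inv; last exact: cis_neq0. rewrite Cmod_cis Rinv_1 Rmult_1_r Cmod_div // Cmod_RtoC_pos //; lra. }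
  have nz : forall t, (1 - u / RtoC r * / cis t)%C <> RtoC 0.
  { move=> t. apply/Cmod_gt_0. have := @Cmod_one_minus (u / RtoC r * / cis t) q ltac:(rewrite mx; lra). lra. }
  have C1 := @cauchy_formula g z0 w rho r dg hr hw.
  have C2 := @is_CInt_Csum (fun k t => u ^ k * h k t)%C (fun k => u ^ k * CInt (h k) 0 (2 * PI))%C 0 (2 * PI) n ltac:(move=> k; exact: is_CInt_scal).
  have C3 := is_CInt_minus C1 C2.
  have e : (g w - Csum (fun k => a k * u ^ k) n)%C = (/ RtoC (2 * PI) * (RtoC (2 * PI) * g w - Csum (fun k => u ^ k * CInt (h k) 0 (2 * PI)) n))%C.
  { have -> : Csum (fun k => a k * u ^ k)%C n = (/ RtoC (2 * PI) * Csum (fun k => u ^ k * CInt (h k) 0 (2 * PI)) n)%C.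
    { rewrite -Csum_scal. apply: Csum_ext => k _. rewrite /a. ring. }
    field. exact: pn. }
  rewrite e Cmod_mult Cmod_inv // Cmod_RtoC_pos; last lra.
  have B : Cmod (RtoC (2 * PI) * g w - Csum (fun k => u ^ k * CInt (h k) 0 (2 * PI))%C n) <= M * (q ^ n / (1 - q)) * (2 * PI - 0).
  { apply: (@is_CInt_bound _ 0 (2 * PI) _ _ ltac:(lra) _ C3) => t _.
    set x := (u / RtoC r * / cis t)%C.
    have xe : forall k, ((u ^ k) * h k t = g (Z t) * x ^ k)%C.
    { move=> k. rewrite /h. have -> : x = (u * / (RtoC r * cis t))%C. { rewrite /x. field. split => //. exact: cis_neq0. }
      rewrite Cpow_mult_l. ring. }
    have -> : Csum (fun k => u ^ k * h k t)%C n = (g (Z t) * Csum (fun k => x ^ k)%C n)%C.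
    { rewrite -Csum_scal. apply: Csum_ext => k _. exact: xe. }
    have g1 := geom_partial x n. have nzt := nz t. rewrite -/x in nzt.
    have -> : Csum (fun k => x ^ k)%C n = ((1 - x ^ n) / (1 - x))%C. { rewrite -g1. field. exact: nzt. }
    rewrite -/(Z t) -/x.
    have -> : (g (Z t) * / (1 - x) - g (Z t) * ((1 - x ^ n) / (1 - x)))%C = (g (Z t) * (x ^ n / (1 - x)))%C by field; exact: nzt.
    rewrite Cmod_mult Cmod_div // Cmod_pow /x mx -/x.
    have d := @Cmod_one_minus x q ltac:(rewrite /x mx; lra).
    apply: Rmult_le_compat.
    - exact: Cmod_ge_0.
    - apply: Rdiv_le_0_compat; [apply: pow_le; lra | lra].
    - exact: hM.
    - apply: Rmult_le_compat_l; first by apply: pow_le; lra. apply: Rinv_le_contravar; lra. }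
  apply: Rle_trans (Rmult_le_compat_l _ _ _ _ B) _. { left. apply: Rinv_0_lt_compat. lra. }
  right. rewrite /u. field. rewrite -/u -/q. lra.
Qed.

Lemma continuous_circle_bound (g : C -> C) (z0 : C) (r : R) : 0 < r ->
  (forall z, Cmod (z - z0) = r -> ccont g z) -> exists M, 0 <= M /\ forall z, Cmod (z - z0) = r -> Cmod (g z) <= M.
Proof.
move=> hr cg. pose f t := Cmod (g (z0 + RtoC r * cis t)%C).
have hPI := PI_RGT_0.
have cf : forall t, continuity_pt f t.
{ move=> t. apply/continuity_pt_filterlim. apply/filterlim_locally => eps.
  have c : rcont (fun t => g (z0 + RtoC r * cis t)%C) t.
  { apply: rcont_comp. { apply: rcont_plus; first exact: rcont_const. apply: rcont_scal. exact: cis_rcont. }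
    apply: cg. exact: (@circle_mod z0 (r * 2) r ltac:(lra)). }
  case: (c eps (cond_pos eps)) => d [hd H]. exists (mkposreal d hd) => u hu. have h := H u hu.
  apply: Rle_lt_trans h. rewrite /f. apply: Rabs_le.
  set x := g _. set y := g _. have := Cmod_triangle_inv x y. have := Cmod_triangle_inv y x. rewrite (Cmod_minus_sym y x).
  rewrite /minus /plus /opp /=. lra. }
have [m [hm _]] := continuity_ab_maj f 0 (2 * PI) ltac:(lra) (fun t _ => cf t).
exists (f m). split; first exact: Cmod_ge_0.
move=> z hz.
(* [acos] of the normalized real part gives an angle in [0, pi]; on the lower half circle 2 pi minus
   that angle is taken. *)
have [t [ht e]] : exists t, 0 <= t <= 2 * PI /\ z = (z0 + RtoC r * cis t)%C.
{ set x := Re (z - z0) / r. set y := Im (z - z0) / r.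
  have xy : x * x + y * y = 1.
  { have := Cmod2_alt (z - z0). rewrite hz => h. rewrite /x /y. have -> : Re (z - z0) / r * (Re (z - z0) / r) + Im (z - z0) / r * (Im (z - z0) / r) = (Re (z - z0) ^ 2 + Im (z - z0) ^ 2) / r ^ 2 by field; lra. rewrite -h. field. lra. }
  have x1 : -1 <= x <= 1 by nra.
  have ze : z = (z0 + RtoC r * (x, y))%C.
  { apply: injective_projections; rewrite /= /x /y /Re /Im /=; field; lra. }
  have c := cos_acos x x1. have [a1 a2] := acos_bound x.
  have s : sin (acos x) = sqrt (1 - Rsqr x) by apply: sin_acos.
  case: (Rle_dec 0 y) => hy.
  - exists (acos x). split; first lra. rewrite ze /cis c s. congr (_ + _ * (_, _))%C.
    rewrite -(sqrt_Rsqr y) //. congr sqrt. rewrite /Rsqr. lra.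
  - exists (2 * PI - acos x). split; first lra. rewrite ze /cis.
    have -> : cos (2 * PI - acos x) = x. { rewrite (_ : 2 * PI - acos x = - acos x + 2 * PI); last ring. rewrite cos_plus cos_2PI sin_2PI cos_neg c. ring. }
    have -> : sin (2 * PI - acos x) = - sqrt (1 - Rsqr x). { rewrite (_ : 2 * PI - acos x = - acos x + 2 * PI); last ring. rewrite sin_plus cos_2PI sin_2PI sin_neg s. ring. }
    congr (_ + _ * (_, _))%C. have -> : 1 - Rsqr x = Rsqr (- y) by rewrite /Rsqr; lra. rewrite sqrt_Rsqr; lra. }
rewrite e. exact: hm.
Qed.

Definition holo_on (U : C -> Prop) (g : C -> C) : Prop := forall z, U z -> exists l, cderiv g z l.

Lemma holo_bound (g : C -> C) (z0 : C) (rho r : R) : holo_on (disc z0 rho) g -> 0 < r <= rho ->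
  exists M, 0 <= M /\ forall z, Cmod (z - z0) = r -> Cmod (g z) <= M.
Proof.
move=> dg hr. apply: continuous_circle_bound; first lra.
move=> z hz. have [l] := dg z ltac:(rewrite /disc; lra). exact: cderiv_ccont.
Qed.

Lemma disc_refl (z0 : C) (r : R) : 0 <= r -> disc z0 r z0.
Proof. by rewrite /disc Cmod_self. Qed.

Lemma disc_shift (z0 z : C) (rho r : R) : Cmod (z - z0) + r <= rho -> forall y, disc z r y -> disc z0 rho y.
Proof. move=> h y. rewrite /disc => hy. have := Cmod_triangle_mid y z z0. lra. Qed.

Lemma taylor_coef01 (g : C -> C) (z0 l : C) (r M : R) (a : nat -> C) : 0 < r -> 0 <= M ->
  (forall w n, Cmod (w - z0) < r ->
      Cmod (g w - Csum (fun k => a k * (w - z0) ^ k)%C n) <= M * ((Cmod (w - z0) / r) ^ n / (1 - Cmod (w - z0) / r))) ->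
  cderiv g z0 l -> a 0%nat = g z0 /\ a 1%nat = l.
Proof.
move=> hr hM h hl.
have a0 : a 0%nat = g z0.
{ have := h z0 1%nat. rewrite Cmod_self /= => H. have {H} H := H hr.
  apply: Ceq_of_eps => eps he. apply: Rle_trans (_ : 0 <= eps); last lra.
  rewrite Cmod_minus_sym. replace (g z0 - a 0%nat)%C with (g z0 - (0 + a 0%nat * 1))%C by ring.
  apply: Rle_trans H _. right. field. lra. }
split => //. apply: (@cderiv_unique g z0) => //. apply/cderiv_eps => eps he.
set K := 2 * M / (r * r) + 1.
have K0 : 0 < K. { have : 0 <= 2 * M / (r * r). { apply: Rdiv_le_0_compat; nra. } rewrite /K. lra. }
exists (Rmin (r / 2) (eps / K)). split. { apply: Rmin_glb_lt; first lra. exact: Rdiv_lt_0_compat. }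
move=> y hy. have y1 : Cmod (y - z0) < r / 2 by apply: Rlt_le_trans hy (Rmin_l _ _).
have y2 : Cmod (y - z0) < eps / K by apply: Rlt_le_trans hy (Rmin_r _ _).
have H := h y 2%nat ltac:(lra). rewrite /= a0 in H. 
replace (g y - g z0 - a 1%nat * (y - z0))%C with (g y - (0 + g z0 * 1 + a 1%nat * ((y - z0) * 1)))%C by ring.
apply: Rle_trans H _. set x := Cmod (y - z0) in y1 y2 *.
have x0 : 0 <= x by exact: Cmod_ge_0.
have b : (x / r * (x / r * 1)) / (1 - x / r) <= 2 * (x * x) / (r * r).
{ have q : x / r <= 1 / 2. { apply/Rle_div_l => //. lra. }
  apply/Rle_div_l; first lra. have -> : 2 * (x * x) / (r * r) * (1 - x / r) = (x / r) * (x / r) * (2 * (1 - x / r)) by field; lra. nra. }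
apply: Rle_trans (Rmult_le_compat_l _ _ _ hM b) _.
have -> : M * (2 * (x * x) / (r * r)) = (2 * M / (r * r)) * x * x by field; lra.
apply: Rmult_le_compat_r => //.
have : x * K <= eps. { have : eps / K * K = eps by field; lra. nra. }
rewrite /K. nra.
Qed.

(** Both bounds are read off Taylor's formula. The second one is quadratic in w - z0 and linear in
    M; summed over a series it yields term by term differentiation in [weierstrass]. *)
Lemma cauchy_est (g : C -> C) (z0 l : C) (rho r M : R) : holo_on (disc z0 rho) g -> 0 < r < rho ->
  (forall z, Cmod (z - z0) = r -> Cmod (g z) <= M) -> cderiv g z0 l ->
  Cmod l <= M / r /\ forall w, Cmod (w - z0) <= r / 2 -> Cmod (g w - g z0 - l * (w - z0)) <= 2 * M * (Cmod (w - z0) / r) ^ 2.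
Proof.
move=> dg hr hM hl.
have M0 : 0 <= M. { apply: Rle_trans (hM (z0 + RtoC r)%C _); first exact: Cmod_ge_0. replace (z0 + RtoC r - z0)%C with (RtoC r) by ring. rewrite Cmod_RtoC_pos; lra. }
have [a [ha h]] := taylor dg hr hM.
have [a0 a1] := @taylor_coef01 g z0 l r M a ltac:(lra) M0 h hl.
split. { rewrite -a1. have := ha 1%nat. by rewrite /= Rmult_1_r. }
move=> w hw. have H := h w 2%nat ltac:(lra). rewrite /= a0 a1 in H.
replace (g w - g z0 - l * (w - z0))%C with (g w - (0 + g z0 * 1 + l * ((w - z0) * 1)))%C by ring.
apply: Rle_trans H _. set x := Cmod (w - z0) / r.
have x1 : x <= 1/2. { apply/Rle_div_l; lra. }
rewrite (_ : 2 * M * x ^ 2 = M * (2 * x ^ 2)); last ring. apply: Rmult_le_compat_l => //.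
rewrite /=. apply/Rle_div_l; first lra. nra.
Qed.

Lemma third_order (g : C -> C) (z0 l : C) (rho : R) : holo_on (disc z0 rho) g -> 0 < rho -> cderiv g z0 l ->
  exists b K r, 0 <= K /\ 0 < r /\ r <= rho /\ forall w, Cmod (w - z0) <= r ->
    Cmod (g w - g z0 - l * (w - z0) - b * (w - z0) ^ 2) <= K * Cmod (w - z0) ^ 3.
Proof.
move=> dg hrho hl.
have hr : 0 < rho / 2 < rho by lra.
have [M [M0 hM]] := holo_bound dg (r := rho / 2) ltac:(lra).
have [a [ha h]] := taylor dg hr hM.
have [a0 a1] := @taylor_coef01 g z0 l (rho / 2) M a ltac:(lra) M0 h hl.
set r := rho / 2 in hr hM h.
exists (a 2%nat), (2 * M / r ^ 3), (r / 2).
have r3 : 0 < r ^ 3 by apply: pow_lt; lra.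
split. { apply: Rdiv_le_0_compat => //. lra. }
split; first lra. split; first lra.
move=> w hw. have H := h w 3%nat ltac:(lra). rewrite /= a0 a1 in H.
replace (g w - g z0 - l * (w - z0) - a 2%nat * (w - z0) ^ 2)%C with (g w - (0 + g z0 * 1 + l * ((w - z0) * 1) + a 2%nat * ((w - z0) * ((w - z0) * 1))))%C by (rewrite /=; ring).
apply: Rle_trans H _. set y := Cmod (w - z0) in hw *. have y0 : 0 <= y by exact: Cmod_ge_0.
set x := y / r. have x0 : 0 <= x by apply: Rdiv_le_0_compat; lra.
have x1 : x <= 1/2. { apply/Rle_div_l; lra. }
have -> : 2 * M / r ^ 3 * y ^ 3 = M * (2 * (x * (x * (x * 1)))). { rewrite /x. field. lra. }
apply: Rmult_le_compat_l => //. apply/Rle_div_l; first lra. have : 0 <= x ^ 3 by nra. rewrite /= => ?. nra.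
Qed.

(** The second-order Taylor remainder of [g] at z0 is cubic, and its derivative is dg w - dg z0 - 2b
    (w - z0). Cauchy's estimate on a disc around w makes that derivative quadratic in w - z0, so 2b
    is the derivative of [dg]. *)
Lemma holo_deriv (g dg : C -> C) (z0 : C) (rho : R) : 0 < rho ->
  (forall z, disc z0 rho z -> cderiv g z (dg z)) -> exists m, cderiv dg z0 m.
Proof.
move=> hrho hd. have hg : holo_on (disc z0 rho) g. { move=> z hz. exists (dg z). exact: hd. }
have [b [K [r [K0 [r0 [rr H]]]]]] := third_order hg hrho (hd z0 (disc_refl _ (Rlt_le _ _ hrho))).
exists (2 * b)%C.
pose phi w := (g w - g z0 - dg z0 * (w - z0) - b * (w - z0) ^ 2)%C.
have dphi : forall w, disc z0 rho w -> cderiv phi w (dg w - dg z0 - 2 * b * (w - z0))%C.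
{ move=> w hw. rewrite /phi.
  have d1 : cderiv (fun y => y - z0)%C w (RtoC 1). { apply: cderiv_eq (cderiv_minus (cderiv_id _) (cderiv_const _ _)) _. ring. }
  have d2 : cderiv (fun y => (y - z0) ^ 2)%C w (2 * (w - z0))%C.
  { apply: cderiv_eq (@cderiv_comp (fun y => y ^ 2)%C (fun y => y - z0)%C w _ _ d1 (cderiv_pow 1 (w - z0))) _. rewrite /= RtoC_plus. ring. }
  apply: cderiv_eq (cderiv_minus (cderiv_minus (cderiv_minus (hd w hw) (cderiv_const _ _)) (cderiv_scal _ d1)) (cderiv_scal _ d2)) _. ring. }
(* Cauchy's estimate on radius y / 2 around w, inside the disc of radius 2y around z0: K (2y)^3 / (y
   / 2) = 16 K y^2. *)
have bnd : forall w, 0 < Cmod (w - z0) <= r / 2 -> Cmod (dg w - dg z0 - 2 * b * (w - z0)) <= 16 * K * Cmod (w - z0) ^ 2.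
{ move=> w hw. set y := Cmod (w - z0) in hw *.
  have [] := @cauchy_est phi w (dg w - dg z0 - 2 * b * (w - z0))%C y (y / 2) (K * (2 * y) ^ 3).
  - move=> z hz. exists (dg z - dg z0 - 2 * b * (z - z0))%C. apply: dphi.
    apply: (disc_shift (z := w) (r := y)) => //. rewrite -/y. lra.
  - lra.
  - move=> z hz. have t := Cmod_triangle_mid z w z0. rewrite hz -/y in t.
    apply: Rle_trans (H z _) _; first lra. apply: Rmult_le_compat_l => //. apply: pow_incr. split; [exact: Cmod_ge_0 | lra].
  - apply: dphi. rewrite /disc -/y. lra.
  - move=> h _. apply: Rle_trans h _. right. field. lra. }
apply/cderiv_eps => eps he. exists (Rmin (r / 2) (eps / (16 * K + 1))).
split. { apply: Rmin_glb_lt; first lra. apply: Rdiv_lt_0_compat; lra. }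
move=> y hy. have y1 := Rlt_le_trans _ _ _ hy (Rmin_l _ _). have y2 := Rlt_le_trans _ _ _ hy (Rmin_r _ _).
case: (Ceq_dec y z0) => [->|n].
{ replace (dg z0 - dg z0 - 2 * b * (z0 - z0))%C with (RtoC 0) by ring. rewrite Cmod_0 Cmod_self. lra. }
have p := Cmod_minus_gt0 n. apply: Rle_trans (bnd y ltac:(lra)) _.
rewrite (_ : 16 * K * Cmod (y - z0) ^ 2 = (16 * K * Cmod (y - z0)) * Cmod (y - z0)); last ring.
apply: Rmult_le_compat_r; first lra.
have : eps / (16 * K + 1) * (16 * K + 1) = eps by field; lra. nra.
Qed.

(** The quotient is extended to z0 by the derivative of [g]. The quadratic Taylor coefficient [b] is
    then the derivative of the quotient there, which removes the singularity. *)
Lemma division (g : C -> C) (z0 : C) (rho : R) : 0 < rho -> holo_on (disc z0 rho) g -> g z0 = RtoC 0 ->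
  exists q, (forall z, g z = (z - z0) * q z)%C /\ cderiv g z0 (q z0) /\
   (exists m, cderiv q z0 m) /\ forall z, z <> z0 -> (exists l, cderiv g z l) -> exists m, cderiv q z m.
Proof.
move=> hrho hg g0. have [l hl] := hg z0 (disc_refl _ (Rlt_le _ _ hrho)).
have [b [K [r [K0 [r0 [rr H]]]]]] := third_order hg hrho hl.
exists (fun z => match Ceq_dec z z0 with left _ => l | right _ => g z / (z - z0) end)%C.
split. { move=> z. case: (Ceq_dec z z0) => [->|n]; first by rewrite g0; ring. field. exact: Cminus_neq0. }
split. { by case: (Ceq_dec z0 z0). }
split.
- exists b. apply/cderiv_eps => eps he. exists (Rmin r (eps / (K + 1))).
  split. { apply: Rmin_glb_lt; first lra. apply: Rdiv_lt_0_compat; lra. }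
  move=> y hy. have y1 := Rlt_le_trans _ _ _ hy (Rmin_l _ _). have y2 := Rlt_le_trans _ _ _ hy (Rmin_r _ _).
  case: (Ceq_dec z0 z0) => // _. case: (Ceq_dec y z0) => [->|n].
  { replace (l - l - b * (z0 - z0))%C with (RtoC 0) by ring. rewrite Cmod_0 Cmod_self. lra. }
  have p := Cmod_minus_gt0 n. have n' := Cminus_neq0 n.
  have -> : (g y / (y - z0) - l - b * (y - z0) = (g y - g z0 - l * (y - z0) - b * (y - z0) ^ 2) / (y - z0))%C.
  { rewrite g0 /=. field. exact: n'. }
  rewrite Cmod_div //. apply/Rle_div_l => //. apply: Rle_trans (H y ltac:(lra)) _.
  set x := Cmod (y - z0) in p y2 *. have : eps / (K + 1) * (K + 1) = eps by field; lra. move=> e.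
  have : K * x <= eps by nra. move=> h. rewrite (_ : K * x ^ 3 = K * x * (x * x)); last ring. nra.
- move=> z n [m hm]. have p := Cmod_minus_gt0 n.
  eexists. apply: (@cderiv_ext_loc (fun y => g y * / (y - z0))%C _ z _ (Cmod (z - z0)) p).
  + move=> y hy. case: (Ceq_dec y z0) => // e. rewrite e Cmod_minus_sym in hy. lra.
  + apply: cderiv_mult hm _. apply: (@cderiv_comp (fun x => / x)%C (fun y => y - z0)%C).
    * apply: cderiv_minus (cderiv_id _) (cderiv_const _ _).
    * apply: cderiv_inv. exact: Cminus_neq0.
Qed.

(** * The identity theorem *)

Definition accz (g : C -> C) (z : C) : Prop :=
  forall d, 0 < d -> exists w, 0 < Cmod (w - z) < d /\ g w = RtoC 0.

(** The Taylor coefficients vanish one after another: if the first n are 0, then at a zero u near z0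
    the remainder forces |a_n| <= Kc |u - z0|, and such zeros come arbitrarily close to z0. *)
Lemma ident_disc (g : C -> C) (z0 : C) (rho : R) : holo_on (disc z0 rho) g -> accz g z0 ->
  forall w, Cmod (w - z0) < rho -> g w = RtoC 0.
Proof.
move=> dg ac w hw. set y := Cmod (w - z0) in hw. have y0 : 0 <= y by exact: Cmod_ge_0.
set r := (y + rho) / 2. have hr : 0 < r < rho by rewrite /r; lra. have yr : y < r by rewrite /r; lra. clearbody r.
have [M [M0 hM]] := holo_bound dg (r := r) ltac:(lra).
have [a [ha h]] := taylor dg hr hM.
have az : forall n, (forall k, (k < n)%nat -> a k = RtoC 0) -> forall z, Csum (fun k => a k * z ^ k)%C n = RtoC 0.
{ elim=> [|n IH] hn z //=. rewrite IH; last by move=> k hk; apply: hn; lia. rewrite (hn n); last lia. ring. }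
have a0 : forall n k, (k < n)%nat -> a k = RtoC 0.
{ elim=> [|n IH] k hk; first lia. case: (Nat.eq_dec k n) => [->|ne]; last by apply: IH; lia.
  apply: Ceq_of_eps => eps he. replace (a n - 0)%C with (a n) by ring.
  set Kc := 2 * M / r ^ (S n).
  have rp : 0 < r ^ (S n) by apply: pow_lt; lra.
  have K0 : 0 <= Kc by apply: Rdiv_le_0_compat => //; lra.
  case: (ac (Rmin (r / 2) (eps / (Kc + 1)))). { apply: Rmin_glb_lt; first lra. apply: Rdiv_lt_0_compat; lra. }
  move=> u [[u0 ud] gu]. have u1 := Rlt_le_trans _ _ _ ud (Rmin_l _ _). have u2 := Rlt_le_trans _ _ _ ud (Rmin_r _ _).
  have H := h u (S n) ltac:(lra). rewrite gu [Csum _ _]/= az // in H.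
  replace (0 - (0 + a n * (u - z0) ^ n))%C with (- (a n * (u - z0) ^ n))%C in H by ring.
  rewrite Cmod_opp Cmod_mult Cmod_pow in H. set x := Cmod (u - z0) in u0 u1 u2 H.
  have xp : 0 < x ^ n by apply: pow_lt.
  have H2 : Cmod (a n) * x ^ n <= Kc * x * x ^ n.
  { apply: Rle_trans H _. have -> : Kc * x * x ^ n = M * (2 * (x / r) ^ (S n)). { rewrite /Rdiv Rpow_mult_distr pow_inv /Kc (_ : x ^ (S n) = x * x ^ n) //. field. lra. }
    apply: Rmult_le_compat_l => //. have q : x / r <= 1 / 2. { apply/Rle_div_l; lra. }
    apply/Rle_div_l; first lra. have : 0 <= (x / r) ^ (S n). { apply: pow_le. apply: Rdiv_le_0_compat; lra. } nra. }
  have H3 := Rmult_le_reg_r _ _ _ xp H2. apply: Rle_trans H3 _.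
  have : eps / (Kc + 1) * (Kc + 1) = eps by field; lra. nra. }
apply: Ceq_of_eps => eps he. apply: Rle_trans (_ : 0 <= eps); last lra.
have hq : 0 <= y / r < 1 by apply: Cmod_ratio_lt1.
apply: (@le_of_geom _ (M / (1 - y / r)) (y / r) hq) => n.
have H := h w n yr. rewrite az in H; last by exact: a0. apply: Rle_trans H _. right. rewrite -/y. field. split; [lra|]. move=> e. lra.
Qed.

Lemma accz_of_vanish (g : C -> C) (z : C) (r : R) : 0 < r ->
  (forall w, Cmod (w - z) < r -> g w = RtoC 0) -> accz g z.
Proof.
move=> hr h d hd. exists (z + RtoC (Rmin r d / 2))%C.
have m0 : 0 < Rmin r d by apply: Rmin_glb_lt.
have e : Cmod (z + RtoC (Rmin r d / 2) - z) = Rmin r d / 2.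
{ replace (z + RtoC (Rmin r d / 2) - z)%C with (RtoC (Rmin r d / 2)) by ring. rewrite Cmod_RtoC_pos; lra. }
have := Rmin_l r d. have := Rmin_r r d. rewrite e => h1 h2. split; first lra. apply: h. lra.
Qed.

(** Chain of discs: the segment is cut into steps shorter than d, so each new centre lies inside the
    previous disc, where [g] already vanishes. *)
Lemma ident_seg (g : C -> C) (a b : C) (d : R) : 0 < d ->
  (forall t, 0 <= t <= 1 -> holo_on (disc (path a b t) d) g) -> accz g a ->
  forall w, Cmod (w - b) < d -> g w = RtoC 0.
Proof.
move=> hd hg ac.
have [N hN] : exists N : nat, Cmod (b - a) / d < INR (S N).
{ have p : 0 <= Cmod (b - a) / d. { apply: Rdiv_le_0_compat => //. exact: Cmod_ge_0. }
  have [N] := nfloor_ex _ p => -[_ h]. exists N. rewrite S_INR. lra. }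
have SN : 0 < INR (S N) by apply: lt_0_INR; lia.
have step : forall k, (k <= S N)%nat -> forall w, Cmod (w - path a b (INR k / INR (S N))) < d -> g w = RtoC 0.
{ elim=> [|k IH] hk w.
  - rewrite /= (_ : 0 / _ = 0); last by field; rewrite /= in SN; lra. rewrite path0 => hw. apply: ident_disc ac _ hw. have := hg 0 ltac:(lra). by rewrite path0.
  - have kb : 0 <= INR k / INR (S N) /\ INR (S k) / INR (S N) <= 1 /\ 0 <= INR (S k) / INR (S N).
    { split. { apply: Rdiv_le_0_compat => //. exact: pos_INR. } split. { apply/Rle_div_l => //. rewrite Rmult_1_l. exact: le_INR. } apply: Rdiv_le_0_compat => //. exact: pos_INR. }
    apply: ident_disc. { apply: hg. lra. }
    apply: (@accz_of_vanish g _ (d - Cmod (path a b (INR (S k) / INR (S N)) - path a b (INR k / INR (S N))))).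
    + have -> : (path a b (INR (S k) / INR (S N)) - path a b (INR k / INR (S N)))%C = (RtoC (/ INR (S N)) * (b - a))%C.
      { rewrite /path. replace (INR (S k) / INR (S N)) with (INR k / INR (S N) + / INR (S N)). 2: { rewrite (S_INR k). field. lra. } rewrite RtoC_plus. ring. }
      rewrite Cmod_mult Cmod_RtoC_pos; last by left; apply: Rinv_0_lt_compat.
      have : / INR (S N) * Cmod (b - a) < d; last lra. rewrite Rmult_comm. apply/Rlt_div_l => //. have : Cmod (b - a) < INR (S N) * d by apply/Rlt_div_l. lra.
    + move=> u hu. apply: IH; first lia. have := Cmod_triangle_mid u (path a b (INR (S k) / INR (S N))) (path a b (INR k / INR (S N))). lra. }
move=> w hw. apply: (step (S N)) => //. by rewrite (_ : INR (S N) / INR (S N) = 1) ?path1 //; field; lra.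
Qed.

(** * Complex series *)

Definition Cser (a : nat -> C) (l : C) : Prop :=
  forall eps, 0 < eps -> exists N, forall n, (N <= n)%nat -> Cmod (Csum a n - l) < eps.

Lemma Csum_sum_n (a : nat -> C) (n : nat) : sum_n (G := C_AbelianMonoid) a n = Csum a (S n).
Proof.
elim: n => [|n IH]. { rewrite sum_O /=. ring. } by rewrite sum_Sn IH.
Qed.

Lemma Cser_is_series (a : nat -> C) (l : C) : Cser a l <-> is_series (K := C_AbsRing) (V := C_NormedModule) a l.
Proof.
split.
- move=> h. apply/(filterlim_locally_ball_norm (K := C_AbsRing) (U := C_NormedModule)) => eps.
  case: (h eps (cond_pos eps)) => N H. exists N => n hn. rewrite /ball_norm. have := H (S n) ltac:(lia). by rewrite -Csum_sum_n.
- move=> /(filterlim_locally_ball_norm (K := C_AbsRing) (U := C_NormedModule)) h e he.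
  case: (h (mkposreal e he)) => N H. exists (S N) => -[|n] hn; first lia. have := H n ltac:(lia).
  by rewrite /ball_norm -Csum_sum_n.
Qed.

Lemma Cser_unique (a : nat -> C) (l m : C) : Cser a l -> Cser a m -> l = m.
Proof.
move=> h1 h2. apply: Ceq_of_eps => eps he.
case: (h1 (eps/2) ltac:(lra)) => N1 H1. case: (h2 (eps/2) ltac:(lra)) => N2 H2.
have := H1 (N1 + N2)%nat ltac:(lia). have := H2 (N1 + N2)%nat ltac:(lia).
have := Cmod_triangle_mid l (Csum a (N1 + N2)) m. rewrite (Cmod_minus_sym l (Csum a (N1 + N2))). lra.
Qed.

Lemma Cser_ext (a b : nat -> C) (l : C) : (forall n, a n = b n) -> Cser a l -> Cser b l.
Proof. move=> h H e he. case: (H e he) => N HN. exists N => n hn. rewrite -(@Csum_ext a b) //. exact: HN. Qed.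

Lemma Csum_plus (a b : nat -> C) (n : nat) : Csum (fun k => a k + b k)%C n = (Csum a n + Csum b n)%C.
Proof. elim: n => [|n IH] /=; first ring. rewrite IH. ring. Qed.

Lemma Cser_plus (a b : nat -> C) (l m : C) : Cser a l -> Cser b m -> Cser (fun n => a n + b n)%C (l + m)%C.
Proof.
move=> h1 h2 eps he. case: (h1 (eps/2) ltac:(lra)) => N1 H1. case: (h2 (eps/2) ltac:(lra)) => N2 H2.
exists (N1 + N2)%nat => n hn. rewrite Csum_plus.
replace (Csum a n + Csum b n - (l + m))%C with ((Csum a n - l) + (Csum b n - m))%C by ring.
have := Cmod_triangle (Csum a n - l) (Csum b n - m). have := H1 n ltac:(lia). have := H2 n ltac:(lia). lra.
Qed.

Lemma Cser_scal (c : C) (a : nat -> C) (l : C) : Cser a l -> Cser (fun n => c * a n)%C (c * l)%C.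
Proof.
move=> h eps he. have c0 := Cmod_ge_0 c.
case: (h (eps / (Cmod c + 1)) ltac:(apply: Rdiv_lt_0_compat; lra)) => N H. exists N => n hn.
rewrite Csum_scal. replace (c * Csum a n - c * l)%C with (c * (Csum a n - l))%C by ring. rewrite Cmod_mult.
have := H n hn. have : eps / (Cmod c + 1) * (Cmod c + 1) = eps by field; lra. nra.
Qed.

Lemma Csum_le (a : nat -> C) (m : nat -> R) (N n : nat) :
  (forall k, Cmod (a k) <= m k) -> Cmod (Csum a (N + n) - Csum a N) <= sum_f_R0 (fun k => m (N + k)%nat) n.
Proof.
move=> h. have m0 : forall k, 0 <= m k. { move=> k. apply: Rle_trans (h k). exact: Cmod_ge_0. }
elim: n => [|n IH].
- rewrite Nat.add_0_r Cmod_self /=. exact: m0.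
- rewrite Nat.add_succ_r /=. have := Cmod_triangle (Csum a (N + n) - Csum a N) (a (N + n)%nat).
  replace (Csum a (N + n) - Csum a N + a (N + n)%nat)%C with (Csum a (N + n) + a (N + n)%nat - Csum a N)%C by ring.
  move=> t. apply: Rle_trans t _.
  case: n IH => [|n] IH /=.
  + rewrite Nat.add_0_r Cmod_self. have := h N. have := m0 (N + 1)%nat. lra.
  + have : Cmod (Csum a (N + S n) - Csum a N) <= sum_f_R0 (fun k => m (N + k)%nat) n.
    { clear IH. elim: n => [|n IH]. { rewrite Nat.add_1_r /=. replace (Csum a N + a N - Csum a N)%C with (a N) by ring. rewrite Nat.add_0_r. exact: h. }
      rewrite Nat.add_succ_r /=. have t := Cmod_triangle (Csum a (N + S n) - Csum a N) (a (N + S n)%nat).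
      replace (Csum a (N + S n) - Csum a N + a (N + S n)%nat)%C with (Csum a (N + S n) + a (N + S n)%nat - Csum a N)%C in t by ring.
      have := h (N + S n)%nat. lra. }
    have := h (N + S n)%nat. have := m0 (N + S (S n))%nat. lra.
Qed.

Lemma Cser_ex (a : nat -> C) (m : nat -> R) : (forall n, Cmod (a n) <= m n) -> ex_series m -> exists l, Cser a l.
Proof.
move=> h hm. have [l hl] := @ex_series_le C_AbsRing C_CompleteNormedModule a m h hm.
exists l. exact/Cser_is_series.
Qed.

Lemma Cser_bound (a : nat -> C) (m : nat -> R) (l : C) : (forall n, Cmod (a n) <= m n) -> ex_series m -> Cser a l -> Cmod l <= Series m.
Proof.
move=> h hm hl. apply: le_epsilon => eps he. case: (hl eps he) => N H.
have H1 := H (N + 1)%nat ltac:(lia). have b := @Csum_le a m 0 (N + 1) h. have e0 : (0 + (N + 1) = N + 1)%nat by lia. rewrite e0 [Csum a 0]/= in b.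
replace (Csum a (N + 1) - 0)%C with (Csum a (N + 1)) in b by ring.
have m0 : forall k, 0 <= m k. { move=> k. apply: Rle_trans (h k). exact: Cmod_ge_0. }
have b2 : sum_f_R0 m (N + 1) <= Series m.
{ rewrite -sum_n_Reals. have := is_lim_seq_incr_compare (sum_n m) (Series m). apply. { exact: Series_correct. } move=> n. rewrite sum_Sn /plus /=. have := m0 (S n). lra. }
have := Cmod_triangle_mid l (Csum a (N + 1)) 0. rewrite (Cmod_minus_sym l (Csum a (N + 1))). replace (l - 0)%C with l by ring. replace (Csum a (N + 1) - 0)%C with (Csum a (N + 1)) by ring. 
change (fun k : nat => m (0 + k)%nat) with m in b. lra.
Qed.

(** Summing the quadratic remainders of [cauchy_est] bounds the remainder of [S] by a constant times
    [Series m] times |y - z0|^2, so the sum of the derivatives is the derivative of the sum. *)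
Lemma weierstrass (u : nat -> C -> C) (du : nat -> C) (S : C -> C) (m : nat -> R) (z0 : C) (r : R) : 0 < r ->
  (forall n, holo_on (disc z0 r) (u n)) -> (forall n, cderiv (u n) z0 (du n)) ->
  (forall n z, disc z0 r z -> Cmod (u n z) <= m n) -> ex_series m ->
  (forall z, disc z0 r z -> Cser (fun n => u n z) (S z)) ->
  exists l, Cser du l /\ cderiv S z0 l.
Proof.
move=> hr hu hdu hb hm hS.
have est : forall n, Cmod (du n) <= m n / (r/2) /\ forall w, Cmod (w - z0) <= r / 2 / 2 -> Cmod (u n w - u n z0 - du n * (w - z0)) <= 2 * m n * (Cmod (w - z0) / (r/2)) ^ 2.
{ move=> n. apply: (@cauchy_est (u n) z0 (du n) r (r/2)) => //; first lra. move=> z hz. apply: hb. rewrite /disc. lra. }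
have hm2 : forall c, ex_series (fun n => c * m n). { move=> c. exact: (ex_series_scal_l c m hm). }
have [l hl] : exists l, Cser du l.
{ apply: (@Cser_ex _ (fun n => / (r / 2) * m n)) => // n. have [h _] := est n. rewrite Rmult_comm. exact: h. }
exists l. split => //. apply/cderiv_eps => eps he.
set K := 8 / (r * r) * Series m.
have S0 : 0 <= Series m. { apply: Rle_trans (@Cser_bound (fun n => u n z0) m (S z0) _ hm _). - exact: Cmod_ge_0. - move=> n. apply: hb. exact: disc_refl (Rlt_le _ _ hr). - apply: hS. exact: disc_refl (Rlt_le _ _ hr). }
have K0 : 0 <= K. { apply: Rmult_le_pos => //. apply: Rdiv_le_0_compat; nra. }
exists (Rmin (r / 4) (eps / (K + 1))). split. { apply: Rmin_glb_lt; first lra. apply: Rdiv_lt_0_compat; lra. }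
move=> y hy. have y1 := Rlt_le_trans _ _ _ hy (Rmin_l _ _). have y2 := Rlt_le_trans _ _ _ hy (Rmin_r _ _).
set x := Cmod (y - z0) in y1 y2 *. have x0 : 0 <= x by exact: Cmod_ge_0.
have c1 := Cser_plus (hS y ltac:(rewrite /disc -/x; lra)) (Cser_plus (Cser_scal (- (1))%C (hS z0 (disc_refl _ (Rlt_le _ _ hr)))) (Cser_scal (- (y - z0))%C hl)).
have B := @Cser_bound _ (fun n => (8 / (r * r) * x ^ 2) * m n) _ _ (hm2 _) c1.
have B' : Cmod (S y - S z0 - l * (y - z0)) <= Series (fun n => (8 / (r * r) * x ^ 2) * m n).
{ replace (S y - S z0 - l * (y - z0))%C with (S y + (- (1) * S z0 + - (y - z0) * l))%C by ring. apply: B => n.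
  have [_ h] := est n. replace (u n y + (- (1) * u n z0 + - (y - z0) * du n))%C with (u n y - u n z0 - du n * (y - z0))%C by ring.
  apply: Rle_trans (h y _) _; first by rewrite -/x; lra. rewrite -/x. right. field. lra. }
apply: Rle_trans B' _. rewrite Series_scal_l.
rewrite (_ : 8 / (r * r) * x ^ 2 * Series m = K * x * x); last by rewrite /K; ring.
apply: Rmult_le_compat_r => //. have : eps / (K + 1) * (K + 1) = eps by field; lra. nra.
Qed.

(** * The complex exponential and logarithms *)

Definition Cexp (z : C) : C := (RtoC (exp (Re z)) * cis (Im z))%C.

Lemma cis_plus (s t : R) : cis (s + t) = (cis s * cis t)%C.
Proof. rewrite /cis cos_plus sin_plus. apply: injective_projections; rewrite /=; ring. Qed.

Lemma Cexp_plus (z w : C) : Cexp (z + w) = (Cexp z * Cexp w)%C.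
Proof. rewrite /Cexp re_plus im_plus exp_plus cis_plus RtoC_mult. ring. Qed.

Lemma Cexp_0 : Cexp 0 = RtoC 1.
Proof. rewrite /Cexp /= exp_0 cis_0. ring. Qed.

Lemma Cmod_Cexp (z : C) : Cmod (Cexp z) = exp (Re z).
Proof. rewrite /Cexp Cmod_mult Cmod_cis Cmod_RtoC_pos; [ring | left; exact: exp_pos]. Qed.

Lemma Cexp_neq0 (z : C) : Cexp z <> RtoC 0.
Proof. apply/Cmod_gt_0. rewrite Cmod_Cexp. exact: exp_pos. Qed.

Lemma Cexp_RtoC (x : R) : Cexp (RtoC x) = RtoC (exp x).
Proof. rewrite /Cexp /= cis_0. ring. Qed.

Lemma rderiv_eps (f : R -> C) (t : R) (l : C) : rderiv f t l ->
  (forall eps, 0 < eps -> exists d, 0 < d /\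
    forall u, Rabs (u - t) < d -> Cmod (f u - f t - l * RtoC (u - t)) <= eps * Rabs (u - t)).
Proof.
move=> [p [p1 [p2 p3]]] e he. case: (p2 e he) => d [hd h]. exists d; split => // u hu.
rewrite (p3 u). replace (f t + p u * RtoC (u - t) - f t - l * RtoC (u - t))%C with ((p u - l) * RtoC (u - t))%C by ring.
rewrite Cmod_mult -p1 Cmod_R. apply: Rmult_le_compat_r; first exact: Rabs_pos. left. exact: h.
Qed.

Lemma im_le_Cmod (z : C) : Rabs (Im z) <= Cmod z.
Proof. apply: Rle_trans (Rmax_Cmod z). exact: Rmax_r. Qed.

Lemma Cexp_cderiv (z : C) : cderiv Cexp z (Cexp z).
Proof.
have H0 : cderiv Cexp 0 1.
{ apply/cderiv_eps => eps he.
  have e3 : 0 < eps / 3 by lra.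
  have [d1 [hd1 h1]] := rderiv_eps (rderiv_RtoC (is_derive_exp 0)) e3.
  have [d2 [hd2 h2]] := rderiv_eps (cis_rderiv 0) e3.
  have [d3 [hd3 h3]] := @cis_rcont 0 _ e3.
  exists (Rmin d1 (Rmin d2 d3)). split. { repeat apply: Rmin_glb_lt => //. }
  move=> y. replace (y - 0)%C with y by ring. move=> hy.
  have m1 : Cmod y < d1 by apply: Rlt_le_trans hy (Rmin_l _ _).
  have m2 : Cmod y < d2. { apply: Rlt_le_trans hy _. apply: Rle_trans (Rmin_r _ _) _. exact: Rmin_l. }
  have m3 : Cmod y < d3. { apply: Rlt_le_trans hy _. apply: Rle_trans (Rmin_r _ _) _. exact: Rmin_r. }
  have rx := re_le_Cmod y. have ry := im_le_Cmod y.
  have b1 := h1 (Re y) ltac:(rewrite Rminus_0_r; lra). have b2 := h2 (Im y) ltac:(rewrite Rminus_0_r; lra).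
  have b3 := h3 (Im y) ltac:(rewrite Rminus_0_r; lra).
  rewrite exp_0 Rminus_0_r in b1. rewrite cis_0 Rminus_0_r in b2. rewrite cis_0 in b3.
  rewrite Cexp_0.
  (* The error of [exp], the error of [cis] and the mixed term Re y (cis (Im y) - 1); each receives
     a third of eps. *)
  have -> : (Cexp y - 1 - 1 * y)%C = ((RtoC (exp (Re y)) - 1 - 1 * RtoC (Re y)) * cis (Im y) + (cis (Im y) - 1 - Ci * 1 * RtoC (Im y)) + RtoC (Re y) * (cis (Im y) - 1))%C.
  { have ey : y = (RtoC (Re y) + Ci * RtoC (Im y))%C by apply: injective_projections; rewrite /= /Re /Im; ring.
    rewrite {2}ey /Cexp. ring. }
  have t1 := Cmod_triangle ((RtoC (exp (Re y)) - 1 - 1 * RtoC (Re y)) * cis (Im y) + (cis (Im y) - 1 - Ci * 1 * RtoC (Im y))) (RtoC (Re y) * (cis (Im y) - 1)).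
  have t2 := Cmod_triangle ((RtoC (exp (Re y)) - 1 - 1 * RtoC (Re y)) * cis (Im y)) (cis (Im y) - 1 - Ci * 1 * RtoC (Im y)).
  rewrite !Cmod_mult Cmod_cis Cmod_R in t1 t2.
  have p1 := Rabs_pos (Re y).
  nra. }
have e1 : cderiv (fun y => y - z)%C z (RtoC 1). { apply: cderiv_eq (cderiv_minus (cderiv_id _) (cderiv_const _ _)) _. ring. }
have H1 := @cderiv_comp Cexp (fun y => y - z)%C z 1 1 e1. 
have zz : (z - z)%C = RtoC 0 by ring. rewrite zz in H1. have {H1} H1 := H1 H0.
have H2 := cderiv_scal (Cexp z) H1.
apply: (@cderiv_ext_loc _ _ _ _ 1 ltac:(lra) _ (cderiv_eq H2 _)); last ring.
move=> y _. rewrite -Cexp_plus. congr Cexp. ring.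
Qed.

Lemma constant_convex (U : C -> Prop) (F : C -> C) (a b : C) : convexC U ->
  (forall z, U z -> cderiv F z (RtoC 0)) -> U a -> U b -> F a = F b.
Proof.
move=> cv h ua ub.
have := @seg_FTC F (fun _ => RtoC 0) a b (fun t ht => h _ (cv _ _ _ ua ub ht)) (fun t _ => @ccont_const _ _).
have -> : seg (fun _ => RtoC 0) a b = RtoC 0.
{ have := @seg_FTC (fun _ => RtoC 0) (fun _ => RtoC 0) a b (fun t _ => @cderiv_const _ _) (fun t _ => @ccont_const _ _). move=> ->. ring. }
move=> e. replace (F b) with (F b - F a + F a)%C by ring. rewrite -e. ring.
Qed.


(** L is the primitive of f' / f that vanishes at z0, and f e^(-L) has derivative 0. Keeping the
    factor f(z0) avoids the choice of a branch. *)
Lemma log_disc (f df : C -> C) (z0 : C) (rho : R) : 0 < rho ->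
  (forall z, disc z0 rho z -> cderiv f z (df z)) -> (forall z, disc z0 rho z -> f z <> RtoC 0) ->
  exists L, L z0 = RtoC 0 /\ (forall z, Cmod (z - z0) < rho -> cderiv L z (df z / f z)%C) /\
    forall z, Cmod (z - z0) < rho -> f z = (f z0 * Cexp (L z))%C.
Proof.
move=> hrho hf nz.
pose q z := (df z / f z)%C.
have dq : forall r, r < rho -> holo_on (disc z0 r) q.
{ move=> r hr z hz. rewrite /disc in hz.
  have [m hm] : exists m, cderiv df z m.
  { apply: (@holo_deriv f df z (rho - r)); first lra. move=> y hy. apply: hf. apply: (disc_shift (z := z) (r := rho - r)) => //. lra. }
  have hz' : disc z0 rho z by rewrite /disc; lra.
  eexists. apply: cderiv_mult hm _. apply: (@cderiv_comp (fun x => / x)%C f); [exact: hf hz' | apply: cderiv_inv; exact: nz]. }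
pose L z := seg q z0 z.
have dL : forall z, Cmod (z - z0) < rho -> cderiv L z (q z).
{ move=> z hz. set r := (Cmod (z - z0) + rho) / 2.
  apply: (@primitive_convex (disc z0 r) q z0 z ((rho - Cmod (z - z0)) / 2)).
  - exact: disc_convex. - exact: disc_closed.
  - apply: dq. rewrite /r. lra.
  - apply: disc_refl. have := Cmod_ge_0 (z - z0). rewrite /r. lra.
  - lra.
  - move=> y hy. rewrite /disc /r. have := Cmod_triangle_mid y z z0. lra. }
exists L. split; first exact: seg_pp. split => // z hz.
have e : forall w, disc z0 (Cmod (z - z0)) w -> cderiv (fun y => f y * Cexp (- L y))%C w 0.
{ move=> w hw. rewrite /disc in hw. have hw' : disc z0 rho w by rewrite /disc; lra.
  apply: cderiv_eq (cderiv_mult (hf w hw') (@cderiv_comp Cexp (fun y => - L y)%C w _ _ (cderiv_opp (dL w ltac:(lra))) (Cexp_cderiv _))) _.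
  rewrite /q. field. exact: nz. }
have := @constant_convex (disc z0 (Cmod (z - z0))) _ z0 z (@disc_convex _ _) e (disc_refl _ (Cmod_ge_0 _)) (Rle_refl _).
rewrite {1}/L seg_pp (_ : (- 0)%C = RtoC 0); last ring. rewrite Cexp_0 => E.
have E2 : (f z0 = f z * Cexp (- L z))%C by rewrite -E; ring.
rewrite E2 -Cmult_assoc -Cexp_plus (_ : (- L z + L z)%C = RtoC 0); last ring. rewrite Cexp_0. ring.
Qed.

(** Writing f = f(z0) e^L, the growth of f bounds Re L by B. Then L / (2B - L) maps into the unit
    disc and vanishes at the centre, so L itself is bounded, and Cauchy's estimate bounds L' = f' /
    f. *)
Lemma borel_caratheodory (f df : C -> C) (z0 z : C) (rho r M B : R) : 0 < r < rho ->
  (forall z, disc z0 rho z -> cderiv f z (df z)) -> (forall z, disc z0 rho z -> f z <> RtoC 0) ->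
  (forall z, disc z0 rho z -> Cmod (f z) <= M) -> 0 < B -> M <= Cmod (f z0) * exp B ->
  Cmod (z - z0) <= r / 8 -> Cmod (df z / f z) <= 8 * B / r.
Proof.
move=> hr hf nz hM hB hMB hz.
have [L [L0 [dL EL]]] := log_disc (Rlt_trans _ _ _ (proj1 hr) (proj2 hr)) hf nz.
have f0 : 0 < Cmod (f z0). { apply/Cmod_gt_0. apply: nz. apply: disc_refl. lra. }
have reL : forall w, Cmod (w - z0) < rho -> Re (L w) <= B.
{ move=> w hw. have h := hM w ltac:(rewrite /disc; lra). rewrite (EL w hw) Cmod_mult Cmod_Cexp in h.
  case: (Rle_dec (Re (L w)) B) => // n. have : exp B < exp (Re (L w)) by apply: exp_increasing; lra. nra. }
pose phi w := (L w / (2 * RtoC B - L w))%C.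
have n1 : forall w, Cmod (w - z0) < rho -> (2 * RtoC B - L w)%C <> RtoC 0.
{ move=> w hw e. have := f_equal Re e. rewrite re_minus re_mult /=. have := reL w hw. lra. }
have mphi : forall w, Cmod (w - z0) < rho -> Cmod (phi w) <= 1.
{ move=> w hw. rewrite /phi Cmod_div; last exact: n1. apply/Rle_div_l. { apply/Cmod_gt_0. exact: n1. }
  rewrite Rmult_1_l. apply: Rsqr_incr_0; try exact: Cmod_ge_0.
  rewrite !Rsqr_pow2 !Cmod2_alt re_minus im_minus re_mult im_mult /=. have := reL w hw. nra. }
have dphi : holo_on (disc z0 ((r + rho) / 2)) phi.
{ move=> w hw. rewrite /disc in hw. have hw' : Cmod (w - z0) < rho by lra.
  eexists. apply: cderiv_mult (dL w hw') _. apply: (@cderiv_comp (fun x => / x)%C (fun y => 2 * RtoC B - L y)%C).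
  - apply: cderiv_minus (cderiv_const _ _) (dL w hw').
  - apply: cderiv_inv. exact: n1. }
have [a [_ ha]] := @taylor phi z0 ((r + rho) / 2) r 1 dphi ltac:(lra) ltac:(move=> w hw; apply: mphi; lra).
have [l0 hl0] := dphi z0 ltac:(apply: disc_refl; lra).
have [a0 _] := @taylor_coef01 phi z0 l0 r 1 a ltac:(lra) ltac:(lra) ha hl0.
have phi0 : phi z0 = RtoC 0. { rewrite /phi L0. rewrite /Cdiv. ring. }
(* On |w - z0| <= r/4 the Taylor bound gives |phi| <= (1/4) / (1 - 1/4) = 1/3, whence |L| <= (2B +
   |L|) / 3 and so |L| <= B. Cauchy's estimate on radius r/8 then produces the constant 8. *)
have bL : forall w, Cmod (w - z0) <= r / 4 -> Cmod (L w) <= B.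
{ move=> w hw. have hw' : Cmod (w - z0) < rho by lra.
  have h := ha w 1%nat ltac:(lra). rewrite /= a0 phi0 in h.
  replace (phi w - (0 + 0 * 1))%C with (phi w) in h by ring.
  set x := Cmod (w - z0) / r in h. have x1 : x <= 1/4 by apply/Rle_div_l; lra.
  have h2 : Cmod (phi w) <= 1/3. { apply: Rle_trans h _. rewrite Rmult_1_r Rmult_1_l. apply/Rle_div_l; lra. }
  have e : L w = (phi w * (2 * RtoC B - L w))%C. { rewrite /phi. field. exact: n1. }
  have e2 : Cmod (L w) <= 1/3 * (2 * B + Cmod (L w)).
  { rewrite {1}e Cmod_mult. apply: Rmult_le_compat; try exact: Cmod_ge_0; first exact: h2.
    apply: Rle_trans (Cmod_triangle_minus _ _) _. rewrite Cmod_mult !Cmod_RtoC_pos; lra. }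
  lra. }
have [] := @cauchy_est L z (df z / f z)%C (r / 4) (r / 8) B.
- move=> y hy. eexists. apply: dL. rewrite /disc in hy. have := Cmod_triangle_mid y z z0. lra.
- lra.
- move=> y hy. apply: bL. have := Cmod_triangle_mid y z z0. lra.
- apply: dL. lra.
- move=> h _. apply: Rle_trans h _. right. field. lra.
Qed.

(** * Integrals over the real line *)

Definition isI (f : R -> C) (l : C) : Prop :=
  forall eps, 0 < eps -> exists M, 0 <= M /\ forall a b, a <= - M -> M <= b -> Cmod (CInt f a b - l) < eps.

(** Domination by a multiple of 1 / (1 + t^2): its tails are explicit arctangents, and its mass pi
    enters the bounds below. *)
Definition dom (f : R -> C) (K : R) : Prop :=
  (forall t, rcont f t) /\ forall t, Cmod (f t) <= K / (1 + t ^ 2).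

(** A total integral operator chosen by [epsilon]; it is meaningful once some value satisfies [isI],
    for instance under [dom]. *)
Definition II (f : R -> C) : C := epsilon (inhabits (RtoC 0)) (isI f).

Lemma CIntc (f : R -> C) (a b : R) : (forall t, rcont f t) -> a <= b -> is_CInt f a b (CInt f a b).
Proof. move=> h ab. by apply: CInt_correct. Qed.

Lemma isI_unique (f : R -> C) (l m : C) : isI f l -> isI f m -> l = m.
Proof.
move=> h1 h2. apply: Ceq_of_eps => e he.
case: (h1 (e/2) ltac:(lra)) => M1 [p1 H1]. case: (h2 (e/2) ltac:(lra)) => M2 [p2 H2].
set M := M1 + M2. have q1 := H1 (- M) M ltac:(rewrite /M; lra) ltac:(rewrite /M; lra).
have q2 := H2 (- M) M ltac:(rewrite /M; lra) ltac:(rewrite /M; lra).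
have := Cmod_triangle_mid l (CInt f (- M) M) m. rewrite (Cmod_minus_sym l (CInt f (- M) M)). lra.
Qed.

Lemma II_correct (f : R -> C) (l : C) : isI f l -> isI f (II f).
Proof. move=> h. apply: (epsilon_spec (inhabits (RtoC 0)) (isI f)). by exists l. Qed.

Lemma II_eq (f : R -> C) (l : C) : isI f l -> II f = l.
Proof. move=> h. exact: isI_unique (II_correct h) h. Qed.

Lemma isI_ext (f g : R -> C) (l : C) : (forall t, f t = g t) -> isI f l -> isI g l.
Proof.
move=> e h eps he. case: (h eps he) => M [M0 H]. exists M; split => // a b ha hb.
rewrite -(@CInt_ext f g) //; [exact: H | lra].
Qed.

Lemma isI_plus (f g : R -> C) (l m : C) : (forall t, rcont f t) -> (forall t, rcont g t) ->
  isI f l -> isI g m -> isI (fun t => f t + g t)%C (l + m)%C.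
Proof.
move=> cf cg h1 h2 e he. case: (h1 (e/2) ltac:(lra)) => M1 [p1 H1]. case: (h2 (e/2) ltac:(lra)) => M2 [p2 H2].
exists (M1 + M2); split; first lra. move=> a b ha hb. have ab : a <= b by lra.
rewrite (is_CInt_unique (is_CInt_plus (CIntc cf ab) (CIntc cg ab))).
replace (CInt f a b + CInt g a b - (l + m))%C with ((CInt f a b - l) + (CInt g a b - m))%C by ring.
have := Cmod_triangle (CInt f a b - l) (CInt g a b - m).
have := H1 a b ltac:(lra) ltac:(lra). have := H2 a b ltac:(lra) ltac:(lra). lra.
Qed.

Lemma isI_scal (c : C) (f : R -> C) (l : C) : (forall t, rcont f t) -> isI f l -> isI (fun t => c * f t)%C (c * l)%C.
Proof.
move=> cf h e he. have c0 := Cmod_ge_0 c.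
case: (h (e / (Cmod c + 1)) ltac:(apply: Rdiv_lt_0_compat; lra)) => M [p H].
exists M; split => // a b ha hb. have ab : a <= b by lra.
rewrite (is_CInt_unique (is_CInt_scal (c := c) (CIntc cf ab))).
replace (c * CInt f a b - c * l)%C with (c * (CInt f a b - l))%C by ring. rewrite Cmod_mult.
have := H a b ha hb. have : e / (Cmod c + 1) * (Cmod c + 1) = e by field; lra. nra.
Qed.

Lemma isI_minus (f g : R -> C) (l m : C) : (forall t, rcont f t) -> (forall t, rcont g t) ->
  isI f l -> isI g m -> isI (fun t => f t - g t)%C (l - m)%C.
Proof.
move=> cf cg h1 h2. have h3 := isI_scal (- (1))%C cg h2.
have h4 := isI_plus cf (fun t => rcont_scal _ (cg t)) h1 h3.
replace (l - m)%C with (l + - (1) * m)%C by ring. apply: isI_ext h4 => t. ring.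
Qed.

Lemma is_RInt_atan (K a b : R) : is_RInt (fun t => K / (1 + t ^ 2)) a b (K * (atan b - atan a)).
Proof.
have H : is_RInt (fun t => / (1 + t ^ 2)) a b (minus (atan b) (atan a)).
{ apply: (is_RInt_derive (V := R_CompleteNormedModule)).
  - move=> t _. apply/is_derive_Reals. have := derivable_pt_lim_atan t. by rewrite /Rsqr /= Rmult_1_r.
  - move=> t _. apply/continuity_pt_filterlim. apply: continuity_pt_inv.
    + apply: derivable_continuous_pt. apply: derivable_pt_plus; first exact: derivable_pt_const. exact: derivable_pt_pow.
    + nra. }
have := is_RInt_scal _ a b K _ H. rewrite /scal /= /mult /minus /plus /opp /=.
by apply: is_RInt_ext => t _.
Qed.

Arguments is_RInt_atan K a b : clear implicits.

Lemma atan_lim (e : R) : 0 < e -> exists M, 0 <= M /\ forall b, M <= b -> PI / 2 - e < atan b.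
Proof.
move=> he. have hp := PI_RGT_0. set x := PI / 2 - Rmin e (PI / 2) / 2.
have m0 : 0 < Rmin e (PI / 2) by apply: Rmin_glb_lt; lra.
have m1 := Rmin_l e (PI / 2). have m2 := Rmin_r e (PI / 2).
have hx : 0 < x < PI / 2 by rewrite /x; lra.
exists (tan x). split. { left. apply: tan_gt_0; lra. }
move=> b hb. have h : atan (tan x) = x by apply: atan_tan; lra.
case: hb => [hb|<-]. { have := atan_increasing _ _ hb. rewrite h /x. lra. } rewrite h /x. lra.
Qed.

Lemma CInt_tail (f : R -> C) (K a a' b' b : R) : dom f K -> a <= a' -> a' <= b' -> b' <= b ->
  Cmod (CInt f a b - CInt f a' b') <= K * ((atan a' - atan a) + (atan b - atan b')).
Proof.
move=> [cf hf] h1 h2 h3.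
have e : (CInt f a b - CInt f a' b' = CInt f a a' + CInt f b' b)%C.
{ rewrite (is_CInt_unique (is_CInt_Chasles (is_CInt_Chasles (CIntc cf h1) (CIntc cf h2)) (CIntc cf h3))). ring. }
rewrite e. apply: Rle_trans (Cmod_triangle _ _) _.
have := is_CInt_norm h1 (fun t _ => hf t) (CIntc cf h1) (is_RInt_atan K a a').
have := is_CInt_norm h3 (fun t _ => hf t) (CIntc cf h3) (is_RInt_atan K b' b). lra.
Qed.

Lemma dom_K (f : R -> C) (K : R) : dom f K -> 0 <= K.
Proof. move=> [_ h]. have := h 0. have := Cmod_ge_0 (f 0). rewrite /= (_ : 1 + 0 * (0 * 1) = 1); lra. Qed.

Lemma CInt_bound_PI (f : R -> C) (K a b : R) : dom f K -> a <= b -> Cmod (CInt f a b) <= K * PI.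
Proof.
move=> hd ab. have K0 := dom_K hd. move: hd => [cf hf].
apply: Rle_trans (is_CInt_norm ab (fun t _ => hf t) (CIntc cf ab) (is_RInt_atan K a b)) _.
apply: Rmult_le_compat_l => //. have := atan_bound a. have := atan_bound b. lra.
Qed.

(** The integrals over [-n, n] form a Cauchy sequence; the arctangent tails then allow both end
    points to vary independently. *)
Lemma isI_ex (f : R -> C) (K : R) : dom f K -> exists l, isI f l /\ Cmod l <= K * PI.
Proof.
move=> hd. have K0 := dom_K hd.
have tl : forall eps, 0 < eps -> exists M, 0 <= M /\ forall a a' b' b, a <= a' -> a' <= - M -> M <= b' -> b' <= b -> Cmod (CInt f a b - CInt f a' b') < eps.
{ move=> eps he. have [M [M0 HM]] := @atan_lim (eps / (2 * (K + 1))) ltac:(apply: Rdiv_lt_0_compat; lra).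
  exists M; split => // a a' b' b h1 h2 h3 h4. have h5 : a' <= b' by lra. apply: Rle_lt_trans (CInt_tail hd h1 h5 h4) _.
  have q1 := HM b' h3. have q2 := HM (- a') ltac:(lra). rewrite atan_opp in q2.
  have := atan_bound a. have := atan_bound b.
  have e : eps / (2 * (K + 1)) * (2 * (K + 1)) = eps by field; lra.
  set d := eps / _ in q1 q2 e. move=> z1 z2. nra. }
have : exists y : C, filterlim (fun n : nat => CInt f (- INR n) (INR n)) eventually (locally (T := C_UniformSpace) y).
{ apply/(filterlim_locally_cauchy (U := C_R_CompleteNormedModule)) => eps.
  case: (tl eps (cond_pos eps)) => M [M0 HM].
  have [N [_ hN]] := nfloor_ex M M0.
  exists (fun n => (S N <= n)%nat); split; first by exists (S N).
  have : forall u v, (S N <= u)%nat -> (u <= v)%nat -> Cmod (CInt f (- INR v) (INR v) - CInt f (- INR u) (INR u)) < eps.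
  { move=> u v hu huv. have i1 := le_INR _ _ hu. have i2 := le_INR _ _ huv. rewrite S_INR in i1. apply: HM; lra. }
  move=> H u v hu hv. apply: (norm_compat1 (V := C_R_NormedModule)). rewrite -Cmod_norm.
  case: (Nat.le_ge_cases u v) => h; first exact: H. change (Cmod (CInt f (- INR v) (INR v) - CInt f (- INR u) (INR u)) < eps). rewrite Cmod_minus_sym. exact: H. }
move=> [l hl]. have hl' : forall eps, 0 < eps -> exists N, forall n, (N <= n)%nat -> Cmod (CInt f (- INR n) (INR n) - l) < eps.
{ move=> e he. move/(filterlim_locally_ball_norm (U := C_R_NormedModule)): hl => hl.
  case: (hl (mkposreal e he)) => N HN. exists N => n hn. have := HN n hn. by rewrite /ball_norm -Cmod_norm. }
exists l. split.
- move=> e he. case: (tl (e/2) ltac:(lra)) => M [M0 HM]. case: (hl' (e/2) ltac:(lra)) => N HN.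
  have [N' [_ hN']] := nfloor_ex M M0. set n := (N + S N')%nat.
  have i1 : M <= INR n. { rewrite /n plus_INR S_INR. have := pos_INR N. lra. }
  exists (INR n); split; first exact: pos_INR. move=> a b ha hb.
  have q1 := HM a (- INR n) (INR n) b ha ltac:(lra) i1 hb. have q2 := HN n ltac:(rewrite /n; lia).
  have := Cmod_triangle_mid (CInt f a b) (CInt f (- INR n) (INR n)) l. lra.
- apply: le_epsilon => e he. case: (hl' e he) => N HN. have q := HN N ltac:(lia).
  have := CInt_bound_PI (a := - INR N) (b := INR N) hd ltac:(have := pos_INR N; lra).
  have := Cmod_triangle_mid l (CInt f (- INR N) (INR N)) 0. rewrite (Cmod_minus_sym l (CInt f (- INR N) (INR N))).
  replace (l - 0)%C with l by ring. replace (CInt f (- INR N) (INR N) - 0)%C with (CInt f (- INR N) (INR N)) by ring. lra.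
Qed.

Lemma isI_II (f : R -> C) (K : R) : dom f K -> isI f (II f).
Proof. move=> /isI_ex [l [h _]]. exact: II_correct h. Qed.

Lemma isI_bound (f : R -> C) (K : R) (l : C) : dom f K -> isI f l -> Cmod l <= K * PI.
Proof. move=> /isI_ex [m [h hm]] hl. by rewrite (isI_unique hl h). Qed.

Lemma isI_re_le (f g : R -> C) (l m : C) : (forall t, rcont f t) -> (forall t, rcont g t) ->
  (forall t, Re (f t) <= Re (g t)) -> isI f l -> isI g m -> Re l <= Re m.
Proof.
move=> cf cg h h1 h2. apply: le_epsilon => e he.
case: (h1 (e/2) ltac:(lra)) => M1 [p1 H1]. case: (h2 (e/2) ltac:(lra)) => M2 [p2 H2].
set M := M1 + M2. have q1 := H1 (- M) M ltac:(rewrite /M; lra) ltac:(rewrite /M; lra).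
have q2 := H2 (- M) M ltac:(rewrite /M; lra) ltac:(rewrite /M; lra).
have MM : - M <= M by rewrite /M; lra.
have [r1 _] := proj1 (is_CInt_pair _ _ _ _) (CIntc cf MM). have [r2 _] := proj1 (is_CInt_pair _ _ _ _) (CIntc cg MM).
have r3 := is_RInt_le _ _ _ _ _ _ MM r1 r2 (fun t _ => h t).
have b1 := Rle_lt_trans _ _ _ (re_le_Cmod _) q1. have b2 := Rle_lt_trans _ _ _ (re_le_Cmod _) q2.
rewrite re_minus in b1. rewrite re_minus in b2.
move/Rabs_def2: b1. move/Rabs_def2: b2. lra.
Qed.

Lemma isI_FTC (F f : R -> C) : (forall t, rderiv F t (f t)) -> (forall t, rcont f t) ->
  (forall e, 0 < e -> exists M, 0 <= M /\ forall t, M <= Rabs t -> Cmod (F t) < e) -> isI f (RtoC 0).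
Proof.
move=> h1 h2 h3 e he. case: (h3 (e/2) ltac:(lra)) => M [M0 H]. exists M; split => // a b ha hb.
rewrite (@is_CInt_unique f a b (F b - F a)%C); last by apply: is_CInt_FTC => //; lra.
replace (F b - F a - 0)%C with (F b - F a)%C by ring.
have := Cmod_triangle_minus (F b) (F a).
have := H a ltac:(rewrite Rabs_left1; lra). have := H b ltac:(rewrite Rabs_pos_eq; lra). lra.
Qed.

Lemma isI_comp_aff (f : R -> C) (u v : R) (l : C) : u = 1 \/ u = -1 -> (forall t, rcont f t) ->
  isI f l -> isI (fun t => f (u * t + v)) l.
Proof.
move=> hu cf h e he. case: (h e he) => M [M0 H].
exists (M + Rabs v). split. { have := Rabs_pos v. lra. }
move=> a b ha hb. have v1 := Rle_abs v. have v2 := Rle_abs (- v). rewrite Rabs_Ropp in v2.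
case: hu => ->.
- have hab : 1 * a + v <= 1 * b + v by lra.
  have c := @is_CInt_comp_lin f 1 v a b (CInt f (1 * a + v) (1 * b + v)) (CIntc cf hab).
  rewrite (_ : CInt (fun t => f (1 * t + v)) a b = CInt f (1 * a + v) (1 * b + v)).
  + apply: H; lra.
  + apply: is_CInt_unique. apply: is_CInt_ext c; first by lra. move=> t _. ring.
- have c := @is_CInt_comp_lin f (-1) v a b (- CInt f (-1 * b + v) (-1 * a + v))%C.
  have s : is_CInt f (-1 * a + v) (-1 * b + v) (- CInt f (-1 * b + v) (-1 * a + v))%C.
  { apply: (is_RInt_swap (V := C_R_NormedModule)). apply: (CIntc cf). lra. }
  have c2 := is_CInt_scal (c := (- (1))%C) (c s).
  rewrite (_ : CInt (fun t => f (-1 * t + v)) a b = CInt f (-1 * b + v) (-1 * a + v)).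
  + apply: H; lra.
  + replace (CInt f (-1 * b + v) (-1 * a + v)) with (- (1) * - CInt f (-1 * b + v) (-1 * a + v))%C by ring.
    apply: is_CInt_unique. apply: is_CInt_ext c2; first by lra. move=> t _. ring.
Qed.

Lemma Cser_shift (a : nat -> C) (l : C) (N : nat) : Cser a l -> Cser (fun k => a (N + k)%nat) (l - Csum a N)%C.
Proof.
move=> h d hd. case: (h d hd) => N2 H2. exists N2 => k hk. have := H2 (N + k)%nat ltac:(lia).
have -> : Csum a (N + k) = (Csum a N + Csum (fun k => a (N + k)%nat) k)%C.
{ clear. elim: k => [|k IH]. { rewrite Nat.add_0_r [Csum _ 0]/=. ring. } rewrite Nat.add_succ_r. change (Csum a (S (N + k))) with (Csum a (N + k) + a (N + k)%nat)%C. rewrite IH. change (Csum (fun k => a (N + k)%nat) (S k)) with (Csum (fun k => a (N + k)%nat) k + a (N + k)%nat)%C. ring. }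
move=> H. by replace (Csum (fun k => a (N + k)%nat) k - (l - Csum a N))%C with (Csum a N + Csum (fun k => a (N + k)%nat) k - l)%C by ring.
Qed.

Lemma ex_series_shift (m : nat -> R) (N : nat) : ex_series m -> ex_series (fun k => m (N + k)%nat).
Proof. move=> h. by apply/(ex_series_incr_n m N). Qed.

Lemma Series_tail_small (m : nat -> R) (e : R) : ex_series m -> 0 < e ->
  exists N, forall n, (N <= n)%nat -> Rabs (Series (fun k => m (n + k)%nat)) < e.
Proof.
move=> hm he. have hs : is_lim_seq (sum_n m) (Series m) by apply: Series_correct.
move/is_lim_seq_spec: hs => hs. case: (hs (mkposreal e he)) => N HN. exists (S N) => -[|n] hn; first lia.
have := HN n ltac:(lia). rewrite (Series_incr_n m (S n)) //; last lia.
rewrite -sum_n_Reals /= -Rabs_Ropp. set a := sum_n m n. set b := Series _. replace (- (a - (a + b))) with b by ring. by [].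
Qed.

Lemma ex_series_scal_r (m : nat -> R) (c : R) : ex_series m -> ex_series (fun n => m n * c).
Proof.
move=> h. apply: ex_series_ext (ex_series_scal_l c m h) => n. by rewrite /scal /= /mult /= Rmult_comm.
Qed.

Lemma series_rcont (f : nat -> R -> C) (g : R -> C) (m : nat -> R) (t0 : R) :
  (forall n t, rcont (f n) t) -> (forall n t, Cmod (f n t) <= m n) -> ex_series m ->
  (forall t, Cser (fun n => f n t) (g t)) -> rcont g t0.
Proof.
move=> cf hf hm hg e he.
have he4 : 0 < e / 4 by lra.
have [N HN] := Series_tail_small hm he4. have {HN} HN := HN N ltac:(lia).
have tail : forall t, Cmod (g t - Csum (fun n => f n t) N) <= e / 4.
{ move=> t. have := Cser_bound (fun k => hf (N + k)%nat t) (ex_series_shift N hm) (Cser_shift N (hg t)).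
  have := Rle_abs (Series (fun k => m (N + k)%nat)). lra. }
have c : rcont (fun t => Csum (fun n => f n t) N) t0.
{ clear HN tail. elim: N => [|N IH]; first exact: rcont_const. exact: rcont_plus. }
case: (c (e/4) ltac:(lra)) => d [hd H]. exists d; split => // u hu.
have := H u hu. have := tail u. have := tail t0.
have := Cmod_triangle_mid (g u) (Csum (fun n => f n u) N) (g t0).
have := Cmod_triangle_mid (Csum (fun n => f n u) N) (Csum (fun n => f n t0) N) (g t0).
rewrite (Cmod_minus_sym (Csum (fun n => f n t0) N) (g t0)). lra.
Qed.

(** All terms share the profile 1 / (1 + t^2) with summable constants, so the remainder after n
    terms is dominated by a tail of [m] times the same profile and its integral tends to 0. *)
Lemma isI_series (f : nat -> R -> C) (g : R -> C) (l : nat -> C) (m : nat -> R) :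
  (forall n, dom (f n) (m n)) -> ex_series m -> (forall t, Cser (fun n => f n t) (g t)) ->
  (forall n, isI (f n) (l n)) -> exists L, Cser l L /\ isI g L /\ dom g (Series m).
Proof.
move=> hf hm hg hl.
have m0 : forall n, 0 <= m n by move=> n; exact: dom_K (hf n).
have q : forall t, 0 < 1 + t ^ 2 by move=> t; nra.
have dg : dom g (Series m).
{ split.
  - move=> t. apply: (@series_rcont f g m) => //; first by move=> n; exact: (proj1 (hf n)).
    move=> n s. apply: Rle_trans (proj2 (hf n) s) _. apply/Rle_div_l => //. have := m0 n. nra.
  - move=> t. have ex : ex_series (fun n => m n / (1 + t ^ 2)).
    { apply: ex_series_ext (ex_series_scal_l (/ (1 + t ^ 2)) m hm) => n. by rewrite /scal /= /mult /= Rmult_comm. }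
    have := Cser_bound (fun n => proj2 (hf n) t) ex (hg t). rewrite /Rdiv Series_scal_r. by []. }
have [L hL] : exists L, Cser l L.
{ apply: (@Cser_ex l (fun n => PI * m n)). - move=> n. rewrite Rmult_comm. exact: isI_bound (hf n) (hl n).
  - exact: (ex_series_scal_l PI m hm). }
exists L. split => //. split => //.
have gI := isI_II dg. suff -> : L = II g by [].
apply: Cser_unique hL _ => e he.
have hp := PI_RGT_0.
have he2 : 0 < e / (2 * PI) by apply: Rdiv_lt_0_compat; lra.
have [N HN] := Series_tail_small hm he2. exists N => n hn. have {HN} HN := HN n hn.
have cS : forall k t, rcont (fun t => Csum (fun j => f j t) k) t.
{ elim=> [|k IH] t; first exact: rcont_const. apply: rcont_plus => //. exact: (proj1 (hf k)). }
have iS : forall k, isI (fun t => Csum (fun j => f j t) k) (Csum l k).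
{ elim=> [|k IH].
  - move=> e' he'. exists 0; split; first lra. move=> a b ha hb. rewrite (@is_CInt_unique _ a b 0) ?Cmod_self //.
    have := is_RInt_const (V := C_R_NormedModule) a b (RtoC 0). by rewrite scal_R_Cmult Cmult_0_r.
  - apply: isI_plus => //. exact: (proj1 (hf k)). }
have dd : isI (fun t => Csum (fun j => f j t) n - g t)%C (Csum l n - II g)%C.
{ apply: isI_minus => //. exact: (proj1 dg). }
have bd : dom (fun t => Csum (fun j => f j t) n - g t)%C (Series (fun k => m (n + k)%nat)).
{ split. { move=> t. apply: rcont_minus => //. exact: (proj1 dg). }
  move=> t. rewrite Cmod_minus_sym.
  have ex2 : ex_series (fun k => m (n + k)%nat / (1 + t ^ 2)) by apply: ex_series_scal_r; exact: ex_series_shift.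
  have b := Cser_bound (fun k => proj2 (hf (n + k)%nat) t) ex2 (Cser_shift n (hg t)). by rewrite /Rdiv Series_scal_r in b. }
apply: Rle_lt_trans (isI_bound bd dd) _.
have : e / (2 * PI) * PI = e / 2 by field; lra.
have := Rle_abs (Series (fun k => m (n + k)%nat)) => q1.
have : Series (fun k => m (n + k)%nat) * PI < e / (2 * PI) * PI by nra.
lra.
Qed.

(** * Moving vertical lines of integration *)

Lemma vline_rderiv (c t : R) : rderiv (fun t => (c, t) : C) t Ci.
Proof.
apply: rderiv_eq (rderiv_pair (is_derive_const (K := R_AbsRing) (V := R_NormedModule) c t) (is_derive_id (K := R_AbsRing) t)) _. by [].
Qed.

Lemma vline_rcont (c t : R) : rcont (fun t => (c, t) : C) t.
Proof. exact: rderiv_rcont (vline_rderiv c t). Qed.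

Definition strip (c1 c2 : R) (z : C) : Prop := c1 <= Re z <= c2.

Lemma halfplane_re_convex (P : R -> Prop) : (forall a b t, P a -> P b -> 0 <= t <= 1 -> P (a + t * (b - a))) ->
  convexC (fun z => P (Re z)).
Proof.
move=> h a b t ha hb ht. rewrite /path re_plus re_scal_l re_minus. exact: h.
Qed.

Lemma re_closed (P : R -> Prop) : (forall x, (forall e, 0 < e -> exists y, P y /\ Rabs (y - x) < e) -> P x) ->
  closedC (fun z => P (Re z)).
Proof.
move=> h z hz. apply: h => e he. case: (hz e he) => x [px hx]. exists (Re x). split => //.
apply: Rle_lt_trans hx. rewrite -re_minus. exact: re_le_Cmod.
Qed.

Lemma strip_convex (c1 c2 : R) : convexC (strip c1 c2).
Proof. apply: (@halfplane_re_convex (fun x => c1 <= x <= c2)) => a b t ha hb ht. nra. Qed.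

Lemma strip_closed (c1 c2 : R) : closedC (strip c1 c2).
Proof.
apply: (@re_closed (fun x => c1 <= x <= c2)) => x h.
split; apply: le_epsilon => e he; case: (h e he) => y [py hy]; move/Rabs_def2: hy; lra.
Qed.

Lemma seg_vertical (f : C -> C) (c a b : R) : (forall t, ccont f (c, t)) -> a <= b ->
  seg f (c, a) (c, b) = (Ci * CInt (fun t => f (c, t)) a b)%C.
Proof.
move=> cf ab. apply: seg_unique.
{ move=> t _. have -> : path (c, a) (c, b) t = (c, a + t * (b - a)) :> C; last exact: cf.
  apply: injective_projections; rewrite /=; ring. }
have H := @is_CInt_comp_lin (fun t => f (c, t)) (b - a) a 0 1 (CInt (fun t => f (c, t)) a b).
have e0 : (b - a) * 0 + a = a by ring. have e1 : (b - a) * 1 + a = b by ring. rewrite e0 e1 in H.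
have {H} H := H (CIntc (fun t => rcont_comp (vline_rcont c t) (cf t)) ab).
apply: is_CInt_ext (is_CInt_scal (c := Ci) H); first lra.
move=> t _. have -> : path (c, a) (c, b) t = (c, (b - a) * t + a) :> C.
{ apply: injective_projections; rewrite /=; ring. }
have -> : (((c, b) : C) - (c, a))%C = (Ci * RtoC (b - a))%C. { apply: injective_projections; rewrite /=; ring. }
ring.
Qed.

(** Cauchy's theorem on a rectangle, cut into two triangles; the horizontal side at height b
    contributes at most K (c2 - c1) / (1 + b^2). *)
Lemma line_shift (f : C -> C) (c1 c2 K : R) (l : C) : c1 <= c2 -> holo_on (strip c1 c2) f ->
  (forall c t, c1 <= c <= c2 -> Cmod (f (c, t)) <= K / (1 + t ^ 2)) ->
  isI (fun t => f (c1, t)) l <-> isI (fun t => f (c2, t)) l.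
Proof.
move=> h12 hf hb.
have cf : forall z, strip c1 c2 z -> ccont f z. { move=> z /hf [m]. exact: cderiv_ccont. }
have s1 : forall t, strip c1 c2 (c1, t) by move=> t; rewrite /strip /=; lra.
have s2 : forall t, strip c1 c2 (c2, t) by move=> t; rewrite /strip /=; lra.
have rect : forall a b, a <= b ->
  (Ci * CInt (fun t => f (c1, t)) a b - Ci * CInt (fun t => f (c2, t)) a b = seg f (c1, a) (c2, a) - seg f (c1, b) (c2, b))%C.
{ move=> a b ab.
  rewrite -!seg_vertical //; try (move=> t; exact: cf).
  have g := goursat (@strip_convex c1 c2) (@strip_closed c1 c2) hf.
  have t1 := g (c1, a) (c2, a) (c2, b) (s1 a) (s2 a) (s2 b).
  have t2 := g (c1, a) (c2, b) (c1, b) (s1 a) (s2 b) (s1 b).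
  have cp : forall x y, strip c1 c2 x -> strip c1 c2 y -> forall t, 0 <= t <= 1 -> ccont f (path x y t).
  { move=> x y hx hy t ht. apply: cf. exact: strip_convex. }
  rewrite /tri (@seg_rev f (c1, a) (c2, b)) in t1; last exact: cp.
  rewrite /tri (@seg_rev f (c1, b) (c2, b)) in t2; last exact: cp.
  rewrite (@seg_rev f (c1, a) (c1, b)) in t2; last exact: cp.
  have e := Cplus_0_r 0. rewrite -{1}t1 -{1}t2 in e. 
  set x1 := seg f (c1, a) (c2, a) in t1 t2 e *. set x2 := seg f (c2, a) (c2, b) in t1 t2 e *.
  set x3 := seg f (c1, a) (c2, b) in t1 t2 e. set x4 := seg f (c1, b) (c2, b) in t1 t2 e *. set x5 := seg f (c1, a) (c1, b) in t1 t2 e *.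
  replace (x5 - x2)%C with (x1 - x4 - (x1 + x2 + - x3 + (x3 + - x4 + - x5)))%C by ring. rewrite e. ring. }
have K0 : 0 <= K. { have := hb c1 0 ltac:(lra). have := Cmod_ge_0 (f (c1, 0)). rewrite /= (_ : 1 + 0 * (0 * 1) = 1); lra. }
have hseg : forall b, Cmod (seg f (c1, b) (c2, b)) <= K / (1 + b ^ 2) * (c2 - c1).
{ move=> b. have -> : c2 - c1 = Cmod (((c2, b) : C) - (c1, b)).
  { have -> : (((c2, b) : C) - (c1, b))%C = RtoC (c2 - c1) by apply: injective_projections; rewrite /=; ring. rewrite Cmod_RtoC_pos; lra. }
  have pt : forall t, path (c1, b) (c2, b) t = (c1 + t * (c2 - c1), b) :> C.
  { move=> t. apply: injective_projections; rewrite /=; ring. }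
  apply: seg_bound => t ht.
  - apply: cf. apply: strip_convex => //.
  - rewrite pt. apply: hb. nra. }
have key : forall e, 0 < e -> exists M, 0 <= M /\ forall a b, a <= - M -> M <= b ->
   Cmod (CInt (fun t => f (c1, t)) a b - CInt (fun t => f (c2, t)) a b) < e.
{ move=> e he. set Q := 2 * K * (c2 - c1) / e + 1.
  have Q0 : 0 <= 2 * K * (c2 - c1) / e. { apply: Rdiv_le_0_compat => //. nra. }
  exists Q. split; first by rewrite /Q; lra.
  move=> a b ha hb2. have ab : a <= b by rewrite /Q in ha hb2; lra.
  have sm : forall x, Q <= Rabs x -> K / (1 + x ^ 2) * (c2 - c1) < e / 2.
  { move=> x hx. have q1 : Q <= x ^ 2. { rewrite -(Rabs_pos_eq (x ^ 2)); last by nra. rewrite -RPow_abs. have : 1 <= Q by rewrite /Q; lra. simpl. nra. }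
    have -> : K / (1 + x ^ 2) * (c2 - c1) = K * (c2 - c1) / (1 + x ^ 2) by field; nra.
    apply/Rlt_div_l; first nra. have : e / 2 * (2 * K * (c2 - c1) / e) = K * (c2 - c1) by field; lra.
    rewrite /Q in q1. nra. }
  have r := rect a b ab.
  have -> : (CInt (fun t => f (c1, t)) a b - CInt (fun t => f (c2, t)) a b)%C = (/ Ci * (seg f (c1, a) (c2, a) - seg f (c1, b) (c2, b)))%C.
  { rewrite -r. field. exact: Ci_nz. }
  rewrite Cmod_mult Cmod_inv; last exact: Ci_nz. rewrite Cmod_Ci Rinv_1 Rmult_1_l.
  have := Cmod_triangle_minus (seg f (c1, a) (c2, a)) (seg f (c1, b) (c2, b)).
  have := hseg a. have := hseg b. have := sm a ltac:(rewrite Rabs_left1; rewrite /Q in ha *; lra). have := sm b ltac:(rewrite Rabs_pos_eq; rewrite /Q in hb2 *; lra). lra. }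
split => h e he; case: (h (e/2) ltac:(lra)) => M1 [M10 H1]; case: (key (e/2) ltac:(lra)) => M2 [M20 H2];
  exists (M1 + M2); (split; first lra); move=> a b ha hb2; have q1 := H1 a b ltac:(lra) ltac:(lra); have q2 := H2 a b ltac:(lra) ltac:(lra).
- have := Cmod_triangle_mid (CInt (fun t => f (c2, t)) a b) (CInt (fun t => f (c1, t)) a b) l.
  rewrite (Cmod_minus_sym (CInt (fun t => f (c2, t)) a b) (CInt (fun t => f (c1, t)) a b)). lra.
- have := Cmod_triangle_mid (CInt (fun t => f (c1, t)) a b) (CInt (fun t => f (c2, t)) a b) l. lra.
Qed.

(** * Gaussian integrals *)

Lemma pow_exp_bound (N : nat) (a : R) : 0 < a -> exists K, 0 < K /\ forall y, 0 <= y -> y ^ N * exp (- a * y) <= K.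
Proof.
move=> ha. case: N => [|N].
- exists 1. split; first lra. move=> y hy. rewrite /= Rmult_1_l -exp_0. case: (Req_dec y 0) => [->|n]; first by right; congr exp; ring. left. apply: exp_increasing. nra.
- have hN : 0 < INR (S N) by apply: lt_0_INR; lia.
  exists ((INR (S N) / a) ^ (S N)). split. { apply: pow_lt. exact: Rdiv_lt_0_compat. }
  move=> y hy.
  have b : y * exp (- a * y / INR (S N)) <= INR (S N) / a.
  { have h := exp_ineq1_le (a * y / INR (S N)).
    have e : exp (a * y / INR (S N)) * exp (- a * y / INR (S N)) = 1. { rewrite -exp_plus -exp_0. congr exp. field. lra. }
    have p := exp_pos (- a * y / INR (S N)).
    have x1 : a * y / INR (S N) * exp (- a * y / INR (S N)) <= 1 by nra.
    have -> : y * exp (- a * y / INR (S N)) = INR (S N) / a * (a * y / INR (S N) * exp (- a * y / INR (S N))) by field; lra.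
    have : 0 < INR (S N) / a by apply: Rdiv_lt_0_compat. nra. }
  have e : exp (- a * y) = exp (- a * y / INR (S N)) ^ (S N).
  { rewrite -Rpower_pow; last exact: exp_pos. rewrite /Rpower ln_exp. congr exp. field. lra. }
  rewrite e -Rpow_mult_distr. apply: pow_incr. split => //. apply: Rmult_le_pos => //. left. exact: exp_pos.
Qed.

Lemma gauss_dom (N : nat) (a : R) : 0 < a -> exists K, 0 < K /\ forall t, (1 + t ^ 2) ^ N * exp (- a * t ^ 2) <= K.
Proof.
move=> ha. have [K [K0 h]] := pow_exp_bound N ha. exists (K * exp a). split. { apply: Rmult_lt_0_compat => //. exact: exp_pos. }
move=> t. have q := h (1 + t ^ 2) ltac:(nra).
have -> : exp (- a * t ^ 2) = exp (- a * (1 + t ^ 2)) * exp a by rewrite -exp_plus; congr exp; ring.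
have := exp_pos a. nra.
Qed.

Lemma Cmod_strip_sq (c t C0 : R) : c ^ 2 <= C0 -> 1 <= C0 -> Cmod (c, t) ^ 2 <= C0 * (1 + t ^ 2).
Proof. move=> h1 h2. rewrite Cmod2_alt /=. nra. Qed.

Definition Csqexp (a : R) (w : C) : C := Cexp (RtoC a * (w * w)).

Lemma Csqexp_mod (a c t : R) : Cmod (Csqexp a (c, t)) = exp (a * c ^ 2) * exp (- a * t ^ 2).
Proof. rewrite Cmod_Cexp -exp_plus. congr exp. rewrite re_mult /=. ring. Qed.

Lemma Csqexp_deriv (a : R) (w : C) : cderiv (Csqexp a) w (2 * RtoC a * w * Csqexp a w)%C.
Proof.
have h : cderiv (fun y => RtoC a * (y * y))%C w (RtoC a * (1 * w + w * 1))%C.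
{ apply: cderiv_scal. apply: (@cderiv_mult (fun y => y) (fun y => y)); exact: cderiv_id. }
apply: cderiv_eq (cderiv_comp h (Cexp_cderiv _)) _. rewrite /Csqexp. ring.
Qed.

Lemma rcont_RtoC_diff (g : R -> R) (t : R) : ex_derive g t -> rcont (fun x => RtoC (g x)) t.
Proof. move=> h. apply: rcont_RtoC. exact: ex_derive_continuous. Qed.

Lemma isI_re (f : R -> C) (l : C) : (forall t, rcont f t) -> isI f l -> isI (fun t => RtoC (Re (f t))) (RtoC (Re l)).
Proof.
move=> cf h e he. case: (h e he) => M [M0 H]. exists M; split => // a b ha hb.
have ab : a <= b by lra.
have [r1 _] := proj1 (is_CInt_pair _ _ _ _) (CIntc cf ab).
have -> : CInt (fun t => RtoC (Re (f t))) a b = RtoC (Re (CInt f a b)).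
{ apply: is_CInt_unique. apply/is_CInt_pair. split => //=. have := is_RInt_const (V := R_NormedModule) a b 0. by rewrite scal_zero_r. }
rewrite -RtoC_minus Cmod_R -re_minus. apply: Rle_lt_trans (H a b ha hb). exact: re_le_Cmod.
Qed.

(** The Gaussian integral stays an unknown constant until Poisson summation determines it in
    [gam_PI] and [gam_val]. *)
Definition gam (a : R) : R := Re (II (fun t => RtoC (exp (- a * t ^ 2)))).

Lemma rcont_gauss (a t : R) : rcont (fun t => RtoC (exp (- a * t ^ 2))) t.
Proof. apply: rcont_RtoC_diff. auto_derive. by []. Qed.

Lemma dom_gauss (a : R) : 0 < a -> exists K, dom (fun t => RtoC (exp (- a * t ^ 2))) K.
Proof.
move=> ha. have [K [K0 h]] := gauss_dom 1 ha. exists K. split; first exact: rcont_gauss.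
move=> t. rewrite Cmod_RtoC_pos; last by left; exact: exp_pos. apply/Rle_div_r; first nra. rewrite Rmult_comm. have := h t. by rewrite pow_1.
Qed.

Lemma isI_gauss (a : R) : 0 < a -> isI (fun t => RtoC (exp (- a * t ^ 2))) (RtoC (gam a)).
Proof.
move=> ha. have [K hK] := dom_gauss ha. have h := isI_II hK.
have h2 := isI_re (@rcont_gauss a) h. rewrite -/(gam a) in h2.
exact: isI_ext h2.
Qed.

Lemma Csqexp_line (a c t : R) : Csqexp a (c, t) = (RtoC (exp (a * c ^ 2) * exp (- a * t ^ 2)) * cis (2 * a * c * t))%C.
Proof.
rewrite /Csqexp /Cexp. congr (RtoC _ * _)%C.
- rewrite -exp_plus. congr exp. rewrite re_mult /=. ring.
- congr cis. rewrite im_mult /=. ring.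
Qed.

Lemma isI_gauss_line (a c : R) : 0 < a -> isI (fun t => Csqexp a (c, t)) (RtoC (gam a)).
Proof.
move=> ha. have [K [K0 h]] := gauss_dom 1 ha.
have hol : forall c1 c2, holo_on (strip c1 c2) (Csqexp a). { move=> c1 c2 z _. eexists. exact: Csqexp_deriv. }
have bd : forall c0 C0, c0 ^ 2 <= C0 -> forall t, Cmod (Csqexp a (c0, t)) <= (exp (a * C0) * K) / (1 + t ^ 2).
{ move=> c0 C0 hc t. rewrite Csqexp_mod. have t2 := pow2_ge_0 t. have t3 : 0 < 1 + t ^ 2 by lra. apply: (proj1 (Rle_div_r _ _ _ t3)). rewrite Rmult_assoc.
  apply: Rmult_le_compat.
  - left; exact: exp_pos.
  - apply: Rmult_le_pos; [left; exact: exp_pos | lra].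
  - case: (Req_dec (a * c0 ^ 2) (a * C0)) => [->|n]; first lra. left. apply: exp_increasing. have : a * c0 ^ 2 <= a * C0 by nra. lra.
  - rewrite Rmult_comm. have := h t. by rewrite pow_1. }
have base : isI (fun t => Csqexp a (0, t)) (RtoC (gam a)).
{ apply: isI_ext (isI_gauss ha) => t. rewrite Csqexp_line. rewrite (_ : a * 0 ^ 2 = 0); last by rewrite /=; ring. rewrite (_ : 2 * a * 0 * t = 0); last ring. rewrite exp_0 cis_0 Rmult_1_l. ring. }
case: (Rle_dec 0 c) => hc.
- apply/(@line_shift (Csqexp a) 0 c (exp (a * c ^ 2) * K)) => // c0 t hc0. apply: bd. nra.
- apply/(@line_shift (Csqexp a) c 0 (exp (a * c ^ 2) * K)) => //; first lra. move=> c0 t hc0. apply: bd. nra.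
Qed.

(** Real part of the integral of e^(a w^2) along Re w = u / (2a), where the integrand oscillates
    with frequency u. Shifting the line leaves the integral unchanged but puts the factor e^(a c^2)
    in front of the Gaussian. *)
Lemma isI_gauss_cos (a u : R) : 0 < a ->
  isI (fun t => RtoC (exp (- a * t ^ 2) * cos (u * t))) (RtoC (gam a * exp (- u ^ 2 / (4 * a)))).
Proof.
move=> ha. set c := u / (2 * a).
have cc : forall t, rcont (fun t => Csqexp a (c, t)) t.
{ move=> t. apply: rcont_comp; [exact: vline_rcont | exact: cderiv_ccont (Csqexp_deriv _ _)]. }
have h := isI_re cc (isI_gauss_line c ha).
have h2 := isI_scal (RtoC (exp (- (a * c ^ 2)))) (_ : forall t, rcont (fun t => RtoC (Re (Csqexp a (c, t)))) t) h. 
have -> : RtoC (gam a * exp (- u ^ 2 / (4 * a))) = (RtoC (exp (- (a * c ^ 2))) * RtoC (Re (RtoC (gam a))))%C.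
{ rewrite -RtoC_mult. congr RtoC. rewrite Rmult_comm /=. congr (exp _ * _). rewrite /c /=. field. lra. }
apply: isI_ext (h2 _).
- move=> t. rewrite Csqexp_line re_scal_l -RtoC_mult. congr RtoC. rewrite /=.
  have e : exp (- (a * (c * (c * 1)))) * exp (a * (c * (c * 1))) = 1 by rewrite -exp_plus -exp_0; congr exp; ring.
  rewrite (_ : 2 * a * c * t = u * t); last by rewrite /c; field; lra.
  transitivity (exp (- (a * (c * (c * 1)))) * exp (a * (c * (c * 1))) * (exp (- a * (t * (t * 1))) * cos (u * t))); first ring. rewrite e. ring.
- move=> t. apply: (@rcont_comp (fun z => RtoC (Re z)) (fun t => Csqexp a (c, t)) t) => //.
  move=> e he. exists e. split => // y hy. rewrite -RtoC_minus Cmod_R -re_minus. apply: Rle_lt_trans hy. exact: re_le_Cmod.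
Qed.

(** * The theta function *)

Lemma exp_le (x y : R) : x <= y -> exp x <= exp y.
Proof. case=> [h|->]; last lra. left. exact: exp_increasing. Qed.

Lemma INR_S_pos (n : nat) : 0 < INR (S n).
Proof. apply: lt_0_INR. lia. Qed.

Lemma ex_series_bounded (a : nat -> R) (K : R) : (forall n, 0 <= a n) -> (forall n, sum_n a n <= K) -> ex_series a.
Proof.
move=> h0 hK. have : ex_finite_lim_seq (sum_n a).
{ apply: (ex_finite_lim_seq_incr _ K) => // n. rewrite sum_Sn /plus /=. have := h0 (S n). lra. }
by [].
Qed.

Lemma ex_series_pos_le (a b : nat -> R) : (forall n, 0 <= a n <= b n) -> ex_series b -> ex_series a.
Proof.
move=> h hb. apply: (ex_series_le a b) => // n. rewrite /norm /= /abs /= Rabs_pos_eq; have := h n; lra.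
Qed.

(** Telescoping: for x = n + 1, (x + 1)^(-1-d) <= (x^(-d) - (x + 1)^(-d)) / d, because ln(x + 1) -
    ln x >= 1 / (x + 1). *)
Lemma pseries (d : R) : 0 < d -> ex_series (fun n => exp (- (1 + d) * ln (INR (S n)))).
Proof.
move=> hd. set u := fun n => exp (- d * ln (INR (S n))).
have step : forall n, exp (- (1 + d) * ln (INR (S (S n)))) <= / d * (u n - u (S n)).
{ move=> n. set x := INR (S n). have hx : 0 < x by exact: INR_S_pos. have e : INR (S (S n)) = x + 1 by rewrite S_INR.
  rewrite /u e -/x.
  have l1 : / (x + 1) <= ln (x + 1) - ln x.
  { have h := exp_ineq1_le (ln x - ln (x + 1)). have e2 : exp (ln x - ln (x + 1)) = x / (x + 1).
    { rewrite /Rminus exp_plus exp_Ropp !exp_ln //; lra. }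
    rewrite e2 in h. have : x / (x + 1) = 1 - / (x + 1) by field; lra. lra. }
  have e3 : exp (- d * ln x) = exp (- d * ln (x + 1)) * exp (d * (ln (x + 1) - ln x)) by rewrite -exp_plus; congr exp; ring.
  have h4 := exp_ineq1_le (d * (ln (x + 1) - ln x)).
  have p := exp_pos (- d * ln (x + 1)).
  have e5 : exp (- (1 + d) * ln (x + 1)) = exp (- d * ln (x + 1)) * / (x + 1).
  { have -> : - (1 + d) * ln (x + 1) = - d * ln (x + 1) + - ln (x + 1) by ring. rewrite exp_plus exp_Ropp exp_ln //. lra. }
  rewrite e5 e3. have id : 0 < / d by apply: Rinv_0_lt_compat.
  have : / (x + 1) <= / d * (exp (d * (ln (x + 1) - ln x)) - 1).
  { apply: Rle_trans l1 _. have e6 : / d * (d * (ln (x + 1) - ln x)) = ln (x + 1) - ln x by field; lra.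
    rewrite -{1}e6. apply: Rmult_le_compat_l; lra. }
  nra. }
apply/(ex_series_incr_1). 
apply: (@ex_series_bounded _ (/ d * u 0%nat)). { move=> n. left. exact: exp_pos. }
move=> n. have : sum_n (fun k => exp (- (1 + d) * ln (INR (S (S k))))) n <= / d * (u 0%nat - u (S n)).
{ elim: n => [|n IH]. { rewrite sum_O. exact: step. } rewrite sum_Sn /plus /=. have := step (S n). rewrite /= in IH *. lra. }
have : 0 < u (S n) by exact: exp_pos. have id : 0 < / d by apply: Rinv_0_lt_compat. nra.
Qed.

Lemma ex_series_inv_sq : ex_series (fun n => / (INR (S n)) ^ 2).
Proof.
apply: ex_series_ext (@pseries 1 ltac:(lra)) => n. have h := INR_S_pos n.
have -> : - (1 + 1) * ln (INR (S n)) = - (ln (INR (S n)) + ln (INR (S n))) by ring.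
by rewrite exp_Ropp exp_plus exp_ln //= Rmult_1_r.
Qed.

Fixpoint Rsum (a : nat -> R) (n : nat) : R := match n with O => 0 | S m => Rsum a m + a m end.

Lemma Rsum_sum_n (a : nat -> R) (n : nat) : sum_n a n = Rsum a (S n).
Proof. elim: n => [|n IH]. { rewrite sum_O /=. ring. } by rewrite sum_Sn IH. Qed.

Lemma Rsum_le_Series (a : nat -> R) (n : nat) : (forall k, 0 <= a k) -> ex_series a -> Rsum a n <= Series a.
Proof.
move=> h ex. have inc : forall k, Rsum a (S k) <= Series a.
{ move=> k. rewrite -Rsum_sum_n. apply: (is_lim_seq_incr_compare (sum_n a) (Series a)). { exact: Series_correct. }
  move=> j. rewrite sum_Sn /plus /=. have := h (S j). lra. }
case: n => [|n] //. have := inc 0%nat. rewrite /=. have := h 0%nat. lra.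
Qed.

Lemma Series_pos (a : nat -> R) : (forall k, 0 <= a k) -> ex_series a -> 0 <= Series a.
Proof. move=> h ex. exact: (@Rsum_le_Series a 0 h ex). Qed.

(** [Dk] is the Dirichlet kernel and [FK] is N times the Fejer kernel; [th] and [sth] are the
    partial sums of theta and their sums. Integrating a Gaussian against a kernel turns it into the
    corresponding theta sum at the inverse argument. *)
Fixpoint Dk (j : nat) (v : R) : R :=
  match j with O => 1 | S i => Dk i v + 2 * cos (2 * PI * INR (S i) * v) end.
Fixpoint th (j : nat) (x : R) : R :=
  match j with O => 1 | S i => th i x + 2 * exp (- (PI * x) * INR (S i) ^ 2) end.
Fixpoint FK (N : nat) (v : R) : R := match N with O => 0 | S i => FK i v + Dk i v end.
Fixpoint sth (N : nat) (x : R) : R := match N with O => 0 | S i => sth i x + th i x end.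

Lemma ex_derive_Dk (j : nat) (v : R) : ex_derive (Dk j) v.
Proof.
elim: j => [|j IH]; first exact: ex_derive_const.
apply: ex_derive_plus => //. auto_derive. by [].
Qed.

Lemma ex_derive_FK (j : nat) (v : R) : ex_derive (FK j) v.
Proof. elim: j => [|j IH]; first exact: ex_derive_const. apply: ex_derive_plus => //. exact: ex_derive_Dk. Qed.

Lemma ex_derive_gauss (a v : R) : ex_derive (fun v => exp (- a * v ^ 2)) v.
Proof. auto_derive. by []. Qed.

Lemma isI_gauss_Dk (x : R) (j : nat) : 0 < x ->
  isI (fun v => RtoC (exp (- (PI * x) * v ^ 2) * Dk j v)) (RtoC (gam (PI * x) * th j (/ x))).
Proof.
move=> hx. have hp := PI_RGT_0. have ha : 0 < PI * x by nra.
have cD : forall j t, rcont (fun v => RtoC (exp (- (PI * x) * v ^ 2) * Dk j v)) t.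
{ move=> i t. apply: rcont_RtoC_diff. apply: ex_derive_mult; [exact: ex_derive_gauss | exact: ex_derive_Dk]. }
elim: j => [|j IH].
- rewrite /= Rmult_1_r. apply: isI_ext (isI_gauss ha) => t /=. congr RtoC. ring.
- have h := isI_gauss_cos (2 * PI * INR (S j)) ha.
  have cc : forall t, rcont (fun t => RtoC (exp (- (PI * x) * t ^ 2) * cos (2 * PI * INR (S j) * t))) t.
  { move=> t. apply: rcont_RtoC_diff. auto_derive. by []. }
  have h2 := isI_plus (cD j) (fun t => rcont_scal (RtoC 2) (cc t)) IH (isI_scal (RtoC 2) cc h).
  have -> : RtoC (gam (PI * x) * th (S j) (/ x)) = (RtoC (gam (PI * x) * th j (/ x)) + RtoC 2 * RtoC (gam (PI * x) * exp (- (2 * PI * INR (S j)) ^ 2 / (4 * (PI * x)))))%C.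
  { rewrite -RtoC_mult -RtoC_plus. congr RtoC. 
    have -> : - (2 * PI * INR (S j)) ^ 2 / (4 * (PI * x)) = - (PI * / x) * INR (S j) ^ 2 by field; lra.
    change (th (S j) (/ x)) with (th j (/ x) + 2 * exp (- (PI * / x) * INR (S j) ^ 2)). ring. }
  apply: isI_ext h2 => t. rewrite -RtoC_mult -RtoC_plus. congr RtoC.
  change (Dk (S j) t) with (Dk j t + 2 * cos (2 * PI * INR (S j) * t)). ring.
Qed.

Lemma isI_gauss_FK (x : R) (N : nat) : 0 < x ->
  isI (fun v => RtoC (exp (- (PI * x) * v ^ 2) * FK N v)) (RtoC (gam (PI * x) * sth N (/ x))).
Proof.
move=> hx.
have cD : forall i t, rcont (fun v => RtoC (exp (- (PI * x) * v ^ 2) * Dk i v)) t.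
{ move=> i t. apply: rcont_RtoC_diff. apply: ex_derive_mult; [exact: ex_derive_gauss | exact: ex_derive_Dk]. }
have cF : forall i t, rcont (fun v => RtoC (exp (- (PI * x) * v ^ 2) * FK i v)) t.
{ move=> i t. apply: rcont_RtoC_diff. apply: ex_derive_mult; [exact: ex_derive_gauss | exact: ex_derive_FK]. }
elim: N => [|N IH].
- have h := isI_scal (RtoC 0) (cD 0%nat) (isI_gauss_Dk 0 hx). rewrite Cmult_0_l in h. rewrite /= Rmult_0_r.
  apply: isI_ext h => t. rewrite Rmult_0_r. ring.
- have h := isI_plus (cF N) (cD N) IH (isI_gauss_Dk N hx). rewrite -RtoC_plus in h.
  rewrite /= Rmult_plus_distr_l. apply: isI_ext h => t. rewrite -RtoC_plus. congr RtoC. rewrite /=. ring.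
Qed.

Lemma sin_Dk (j : nat) (v : R) : sin (PI * v) * Dk j v = sin ((2 * INR j + 1) * (PI * v)).
Proof.
elim: j => [|j IH]. { rewrite /= Rmult_1_r. congr sin. ring. }
change (Dk (S j) v) with (Dk j v + 2 * cos (2 * PI * INR (S j) * v)).
rewrite Rmult_plus_distr_l IH S_INR. set y := PI * v. set n := INR j.
have -> : (2 * n + 1) * y = 2 * (n + 1) * y - y by ring.
have -> : (2 * (n + 1) + 1) * y = 2 * (n + 1) * y + y by ring.
have -> : 2 * PI * (n + 1) * v = 2 * (n + 1) * y by rewrite /y; ring.
rewrite sin_minus sin_plus. ring.
Qed.

(** Telescoping with sin y sin((2n+1) y) = sin((n+1) y)^2 - sin(n y)^2. *)
Lemma sin_FK (N : nat) (v : R) : sin (PI * v) ^ 2 * FK N v = sin (INR N * (PI * v)) ^ 2.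
Proof.
elim: N => [|N IH]. { rewrite /= Rmult_0_l sin_0. ring. }
change (FK (S N) v) with (FK N v + Dk N v). rewrite Rmult_plus_distr_l IH.
have -> : sin (PI * v) ^ 2 * Dk N v = sin (PI * v) * (sin (PI * v) * Dk N v) by ring.
rewrite sin_Dk S_INR. set y := PI * v. set n := INR N.
have -> : (2 * n + 1) * y = (n + 1) * y + n * y by ring.
have e : sin y = sin ((n + 1) * y - n * y) by congr sin; ring.
rewrite e sin_minus sin_plus.
have p1 := sin2_cos2 ((n + 1) * y). have p2 := sin2_cos2 (n * y). rewrite /Rsqr in p1 p2.
set s1 := sin ((n + 1) * y) in p1 *. set c1 := cos ((n + 1) * y) in p1 *. set s2 := sin (n * y) in p2 *. set c2 := cos (n * y) in p2 *.
have q1 : c1 * c1 = 1 - s1 * s1 by lra. have q2 : c2 * c2 = 1 - s2 * s2 by lra.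
have -> : (s1 * c2 - c1 * s2) * (s1 * c2 + c1 * s2) = s1 * s1 * (c2 * c2) - c1 * c1 * (s2 * s2) by ring.
rewrite q1 q2. ring.
Qed.

Lemma Dk_periodic (j : nat) (v : R) : Dk j (v + 1) = Dk j v.
Proof.
elim: j => [|j IH] //. change (Dk (S j) (v + 1)) with (Dk j (v + 1) + 2 * cos (2 * PI * INR (S j) * (v + 1))). rewrite IH.
change (Dk (S j) v) with (Dk j v + 2 * cos (2 * PI * INR (S j) * v)). congr (_ + 2 * _).
have -> : 2 * PI * INR (S j) * (v + 1) = 2 * PI * INR (S j) * v + 2 * INR (S j) * PI by ring. exact: cos_period.
Qed.

Lemma FK_periodic (N : nat) (v : R) : FK N (v + 1) = FK N v.
Proof. elim: N => [|N IH] //=. by rewrite IH Dk_periodic. Qed.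

Lemma FK_shift (N M : nat) (v : R) : FK N (v + INR M) = FK N v /\ FK N (v - INR M) = FK N v.
Proof.
elim: M v => [|M IH] v. { split; congr FK; rewrite /=; ring. }
rewrite S_INR. have [h1 h2] := IH v. split.
- rewrite -h1 -(FK_periodic N (v + INR M)). congr FK. ring.
- rewrite -h2. rewrite -(FK_periodic N (v - (INR M + 1))). congr FK. ring.
Qed.

Lemma FK_int (N : nat) : is_RInt (FK N) (-1/2) (1/2) (INR N).
Proof.
have D : forall j, is_RInt (Dk j) (-1/2) (1/2) 1.
{ elim=> [|j IH].
  - have := is_RInt_const (V := R_NormedModule) (-1/2) (1/2) 1. rewrite /scal /= /mult /= (_ : (1/2 - -1/2) * 1 = 1) //. lra.
  - have h : is_RInt (fun v => 2 * cos (2 * PI * INR (S j) * v)) (-1/2) (1/2) 0.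
    { have hp := PI_RGT_0. have hj := INR_S_pos j.
      have s0 : sin (0 + INR (S j) * PI) = 0. { rewrite Rplus_0_l. apply: sin_eq_0_1. exists (Z.of_nat (S j)). by rewrite -INR_IZR_INZ. }
      set c := 2 * PI * INR (S j). have c0 : c <> 0 by rewrite /c; nra.
      pose F v := 2 * (sin (c * v) / c).
      have e : minus (F (1/2)) (F (-1/2)) = 0.
      { rewrite /F /minus /plus /opp. have -> : c * (1/2) = 0 + INR (S j) * PI by rewrite /c; field. have -> : c * (-1/2) = - (0 + INR (S j) * PI) by rewrite /c; field. rewrite sin_neg s0 /=. field. exact: c0. }
      rewrite -e. clearbody c. apply: (is_RInt_derive (V := R_CompleteNormedModule)).
      - move=> v _. rewrite /F. auto_derive => //. field. exact: c0.
      - move=> v _. apply: ex_derive_continuous. auto_derive. by []. }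
    have := is_RInt_plus _ _ _ _ _ _ IH h. rewrite /plus /= Rplus_0_r. by []. }
elim: N => [|N IH].
- have := is_RInt_const (V := R_NormedModule) (-1/2) (1/2) 0. rewrite /scal /= /mult /= Rmult_0_r. by [].
- rewrite S_INR. exact: (is_RInt_plus _ _ _ _ _ _ IH (D N)).
Qed.

Fixpoint EM (a : R) (M : nat) (v : R) : R :=
  match M with O => exp (- a * v ^ 2)
  | S i => EM a i v + (exp (- a * (v + INR (S i)) ^ 2) + exp (- a * (v - INR (S i)) ^ 2)) end.

Lemma ex_derive_EM (a : R) (M : nat) (v : R) : ex_derive (EM a M) v.
Proof.
elim: M => [|M IH]; first exact: ex_derive_gauss. apply: ex_derive_plus => //. auto_derive. by [].
Qed.

(** Unfolding: [FK] has period 1, so the periodized Gaussian over one period gives the Gaussian over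
    2M + 1 periods. *)
Lemma EM_int (a : R) (M N : nat) (l : R) : is_RInt (fun v => EM a M v * FK N v) (-1/2) (1/2) l ->
  is_RInt (fun v => exp (- a * v ^ 2) * FK N v) (-1/2 - INR M) (1/2 + INR M) l.
Proof.
have ex : forall f : R -> R, (forall v, ex_derive f v) -> forall p q, is_RInt f p q (RInt f p q).
{ move=> f hf p q. apply: (RInt_correct (V := R_CompleteNormedModule)). apply: (ex_RInt_continuous (V := R_CompleteNormedModule)) => z _. exact: ex_derive_continuous. }
elim: M l => [|M IH] l h. { rewrite /= Rminus_0_r Rplus_0_r. exact: h. }
set f := fun v => exp (- a * v ^ 2) * FK N v.
have df : forall v, ex_derive f v. { move=> v. apply: ex_derive_mult; [exact: ex_derive_gauss | exact: ex_derive_FK]. }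
have d0 : forall v, ex_derive (fun v => EM a M v * FK N v) v. { move=> v. apply: ex_derive_mult; [exact: ex_derive_EM | exact: ex_derive_FK]. }
have h0 := IH _ (ex _ d0 (-1/2) (1/2)).
have h1 : is_RInt f (1/2 + INR M) (1/2 + INR (S M)) (RInt (fun v => f (v + INR (S M))) (-1/2) (1/2)).
{ have c := ex f df (1/2 + INR M) (1/2 + INR (S M)).
  have := is_RInt_comp_lin f 1 (INR (S M)) (-1/2) (1/2) (RInt f (1/2 + INR M) (1/2 + INR (S M))).
  have -> : 1 * (-1/2) + INR (S M) = 1/2 + INR M by rewrite S_INR; lra. have -> : 1 * (1/2) + INR (S M) = 1/2 + INR (S M) by ring.
  move=> H. have {H} H := H c. suff -> : RInt (fun v => f (v + INR (S M))) (-1/2) (1/2) = RInt f (1/2 + INR M) (1/2 + INR (S M)) by [].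
  apply: is_RInt_unique. apply: is_RInt_ext H => v _. rewrite /scal /= /mult /= !Rmult_1_l. by []. }
have h2 : is_RInt f (-1/2 - INR (S M)) (-1/2 - INR M) (RInt (fun v => f (v - INR (S M))) (-1/2) (1/2)).
{ have c := ex f df (-1/2 - INR (S M)) (-1/2 - INR M).
  have := is_RInt_comp_lin f 1 (- INR (S M)) (-1/2) (1/2) (RInt f (-1/2 - INR (S M)) (-1/2 - INR M)).
  have -> : 1 * (-1/2) + - INR (S M) = -1/2 - INR (S M) by ring. have -> : 1 * (1/2) + - INR (S M) = -1/2 - INR M by rewrite S_INR; lra.
  move=> H. have {H} H := H c. suff -> : RInt (fun v => f (v - INR (S M))) (-1/2) (1/2) = RInt f (-1/2 - INR (S M)) (-1/2 - INR M) by [].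
  apply: is_RInt_unique. apply: is_RInt_ext H => v _. rewrite /scal /= /mult /= !Rmult_1_l. by []. }
have h3 := is_RInt_Chasles _ _ _ _ _ _ h2 (is_RInt_Chasles _ _ _ _ _ _ h0 h1).
suff -> : l = plus (RInt (fun v => f (v - INR (S M))) (-1/2) (1/2)) (plus (RInt (fun v => EM a M v * FK N v) (-1/2) (1/2)) (RInt (fun v => f (v + INR (S M))) (-1/2) (1/2))) by exact: h3.
rewrite -(is_RInt_unique _ _ _ _ h). apply: is_RInt_unique.
have df1 : forall v, ex_derive (fun v => f (v - INR (S M))) v. { move=> v. apply: (ex_derive_comp f (fun v => v - INR (S M))) => //. auto_derive. by []. }
have df2 : forall v, ex_derive (fun v => f (v + INR (S M))) v. { move=> v. apply: (ex_derive_comp f (fun v => v + INR (S M))) => //. auto_derive. by []. }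
apply: is_RInt_ext (is_RInt_plus _ _ _ _ _ _ (ex _ df1 (-1/2) (1/2)) (is_RInt_plus _ _ _ _ _ _ (ex _ d0 (-1/2) (1/2)) (ex _ df2 (-1/2) (1/2)))) => v _.
have [s1 s2] := FK_shift N (S M) v. rewrite /plus /f s1 s2. 
change (EM a (S M) v) with (EM a M v + (exp (- a * (v + INR (S M)) ^ 2) + exp (- a * (v - INR (S M)) ^ 2))). cbv [AbelianMonoid.plus]. simpl. ring.
Qed.

Lemma sin_lower (y : R) : 0 <= y <= PI / 2 -> y / 4 <= sin y.
Proof.
move=> hy. have h3 := PI_4.
case: (Rle_dec y (PI / 3)) => h.
- have [c [hc e]] := MVT_gen sin 0 y cos (fun x _ => is_derive_sin x) (fun x _ => continuity_sin x).
  rewrite sin_0 !Rminus_0_r in e. rewrite Rmin_left ?Rmax_right in hc; try lra.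
  have : cos (PI / 3) <= cos c. { apply: cos_decr_1; lra. } rewrite cos_PI3 e. nra.
- have : sin (PI / 6) <= sin y. { apply: sin_incr_1; lra. } rewrite sin_PI6. lra.
Qed.

(** From [sin_FK] and |sin(pi v)| >= |v| / 2. The bound does not depend on N, so a function that is
    O(v^2) has a bounded integral against [FK]. *)
Lemma FK_bound (N : nat) (v : R) : -1/2 <= v <= 1/2 -> 0 <= v ^ 2 * FK N v <= 4.
Proof.
move=> hv. have hp2 : 2 < PI by have := PI2_3_2; lra.
case: (Req_dec v 0) => [->|n]. { lra. }
have s2 : v ^ 2 / 4 <= sin (PI * v) ^ 2.
{ case: (Rle_dec 0 v) => h.
  - have := sin_lower (y := PI * v) ltac:(split; nra). move=> l. have : v / 2 <= sin (PI * v) by nra. nra.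
  - have := sin_lower (y := PI * - v) ltac:(split; nra). rewrite (_ : PI * - v = - (PI * v)) ?sin_neg; last ring. move=> l. have : - v / 2 <= - sin (PI * v) by nra. nra. }
have v2 : 0 < v ^ 2 by nra.
have e := sin_FK N v. have b : 0 <= sin (INR N * (PI * v)) ^ 2 <= 1.
{ have := SIN_bound (INR N * (PI * v)). nra. }
have F0 : 0 <= FK N v by nra.
split; first by apply: Rmult_le_pos; lra.
have : v ^ 2 / 4 * FK N v <= 1 by nra.
lra.
Qed.

Lemma cosh_bound (y : R) : Rabs ((exp y + exp (- y)) / 2 - 1) <= y ^ 2 * exp (Rabs y).
Proof.
have H : forall y, 0 <= y -> 0 <= (exp y + exp (- y)) / 2 - 1 <= y ^ 2 * exp y.
{ clear y => y hy. set p := exp (y / 2). set q := exp (- (y / 2)).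
  have pq : p * q = 1 by rewrite /p /q -exp_plus -exp_0; congr exp; field.
  have e1 : exp y = p * p by rewrite /p -exp_plus; congr exp; field.
  have e2 : exp (- y) = q * q by rewrite /q -exp_plus; congr exp; field.
  have p0 : 0 < p by exact: exp_pos.
  have h : 1 - y <= q * q. { rewrite -e2. have := exp_ineq1_le (- y). lra. }
  have q1 : q <= p. { rewrite /p /q. case: hy => [hy|<-]; last by right; congr exp; field. left. apply: exp_increasing. lra. }
  have b : p - q <= y * p. { nra. }
  split. { nra. } rewrite e1. nra. }
case: (Rle_dec 0 y) => hy.
- have [h1 h2] := H y hy. rewrite !Rabs_pos_eq //.
- have [h1 h2] := H (- y) ltac:(lra). rewrite Ropp_involutive in h1 h2. rewrite (Rabs_left1 y); last lra.
  rewrite Rabs_pos_eq; last by lra. rewrite Rplus_comm. apply: Rle_trans h2 _. right. ring.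
Qed.

(** Pairing n with -n cancels the part linear in v: the pair equals 2 exp(-a n^2 - a v^2) cosh(2 a n
    v), and cosh - 1 is quadratic. As |v| <= 1/2, the loss is at most exp(a n). *)
Lemma EM_term (a v n : R) : 0 < a -> 0 <= n -> -1/2 <= v <= 1/2 ->
  Rabs (exp (- a * (v + n) ^ 2) + exp (- a * (v - n) ^ 2) - 2 * exp (- a * n ^ 2)) <=
  v ^ 2 * ((8 * a ^ 2 * n ^ 2 + 2 * a) * exp (- a * (n ^ 2 - n))).
Proof.
move=> ha hn hv. set y := 2 * a * n * v.
have e1 : exp (- a * (v + n) ^ 2) = exp (- a * n ^ 2) * (exp (- a * v ^ 2) * exp (- y)). { rewrite -!exp_plus. congr exp. rewrite /y. ring. }
have e2 : exp (- a * (v - n) ^ 2) = exp (- a * n ^ 2) * (exp (- a * v ^ 2) * exp y). { rewrite -!exp_plus. congr exp. rewrite /y. ring. }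
have cb := cosh_bound y. set ch := (exp y + exp (- y)) / 2 in cb.
have -> : exp (- a * (v + n) ^ 2) + exp (- a * (v - n) ^ 2) - 2 * exp (- a * n ^ 2) = 2 * exp (- a * n ^ 2) * (exp (- a * v ^ 2) * (ch - 1) + (exp (- a * v ^ 2) - 1)).
{ rewrite e1 e2 /ch. field. }
have ya : Rabs y <= a * n. { rewrite /y Rabs_mult Rabs_pos_eq; last by nra. have : Rabs v <= 1/2 by apply: Rabs_le; lra. have : 0 <= a * n by nra. nra. }
have ey : exp (Rabs y) <= exp (a * n). { case: ya => [h|->]; last lra. left. exact: exp_increasing. }
have g1 : exp (- a * v ^ 2) <= 1. { rewrite -exp_0. have : - a * v ^ 2 <= 0 by nra. case=> [h|->]; last lra. left. exact: exp_increasing. }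
have g2 : 1 - a * v ^ 2 <= exp (- a * v ^ 2). { have := exp_ineq1_le (- a * v ^ 2). lra. }
have g0 := exp_pos (- a * v ^ 2). have q0 := exp_pos (- a * n ^ 2).
have en : 1 <= exp (a * n). { have := exp_ineq1_le (a * n). have : 0 <= a * n by nra. lra. }
have e3 : exp (- a * (n ^ 2 - n)) = exp (- a * n ^ 2) * exp (a * n) by rewrite -exp_plus; congr exp; ring.
rewrite Rabs_mult Rabs_pos_eq; last lra.
have b : Rabs (exp (- a * v ^ 2) * (ch - 1) + (exp (- a * v ^ 2) - 1)) <= v ^ 2 * ((4 * a ^ 2 * n ^ 2 + a) * exp (a * n)).
{ apply: Rle_trans (Rabs_triang _ _) _. rewrite Rabs_mult (Rabs_pos_eq (exp _)); last lra.
  have b1 : exp (- a * v ^ 2) * Rabs (ch - 1) <= y ^ 2 * exp (a * n).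
  { apply: Rle_trans (_ : 1 * Rabs (ch - 1) <= _). { apply: Rmult_le_compat_r => //. exact: Rabs_pos. }
    rewrite Rmult_1_l. apply: Rle_trans cb _. apply: Rmult_le_compat_l => //. exact: pow2_ge_0. }
  have b2 : Rabs (exp (- a * v ^ 2) - 1) <= a * v ^ 2. { apply: Rabs_le. lra. }
  have -> : v ^ 2 * ((4 * a ^ 2 * n ^ 2 + a) * exp (a * n)) = y ^ 2 * exp (a * n) + a * v ^ 2 * exp (a * n) by rewrite /y; ring. nra. }
apply: Rle_trans (Rmult_le_compat_l _ _ _ _ b) _; first lra. rewrite e3. right. ring.
Qed.

(** The constant is uniform in M because exp(-a (n^2 - n)) beats the polynomial factor in n. *)
Lemma EM_sum_bound (a : R) : 0 < a -> exists C, 0 <= C /\ forall M v, -1/2 <= v <= 1/2 -> Rabs (EM a M v - EM a M 0) <= C * v ^ 2.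
Proof.
move=> ha. pose c n := (8 * a ^ 2 * INR (S n) ^ 2 + 2 * a) * exp (- a * (INR (S n) ^ 2 - INR (S n))).
have c0 : forall n, 0 <= c n. { move=> n. apply: Rmult_le_pos; last by left; exact: exp_pos. nra. }
have ex : ex_series c.
{ have [K [K0 h]] := pow_exp_bound 4 ha.
  apply: (@ex_series_pos_le _ (fun n => ((8 * a ^ 2 + 2 * a) * K * exp a) * / INR (S n) ^ 2)).
  - move=> n. split => //. have x1 : 1 <= INR (S n). { rewrite S_INR. have := pos_INR n. lra. }
    rewrite /c. set x := INR (S n) in x1 *. have hx := h x ltac:(lra).
    have e1 : exp (- a * (x ^ 2 - x)) <= exp a * exp (- a * x).
    { rewrite -exp_plus. have : 0 <= a * (x - 1) ^ 2 by apply: Rmult_le_pos; [lra | exact: pow2_ge_0]. move=> ?. have : - a * (x ^ 2 - x) <= a + - a * x by lra. case=> [q|->]; last lra. left. exact: exp_increasing. }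
    have p1 : 0 < exp a * exp (- a * x) by apply: Rmult_lt_0_compat; exact: exp_pos.
    apply: Rle_trans (_ : (8 * a ^ 2 * x ^ 2 + 2 * a) * (exp a * exp (- a * x)) <= _).
    { apply: Rmult_le_compat_l => //. nra. }
    have b2 : 8 * a ^ 2 * x ^ 2 + 2 * a <= (8 * a ^ 2 + 2 * a) * x ^ 2. { have : 1 <= x ^ 2 by nra. nra. }
    apply: Rle_trans (Rmult_le_compat_r _ _ _ (Rlt_le _ _ p1) b2) _.
    have x2 : 0 < x ^ 2 by nra.
    have e2 : x ^ 2 * exp (- a * x) <= K * / x ^ 2.
    { apply: (proj1 (Rle_div_r _ _ _ x2)). apply: Rle_trans hx. right. ring. }
    have -> : (8 * a ^ 2 + 2 * a) * x ^ 2 * (exp a * exp (- a * x)) = (8 * a ^ 2 + 2 * a) * exp a * (x ^ 2 * exp (- a * x)) by ring.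
    have -> : (8 * a ^ 2 + 2 * a) * K * exp a * / x ^ 2 = (8 * a ^ 2 + 2 * a) * exp a * (K * / x ^ 2) by ring.
    apply: Rmult_le_compat_l => //. apply: Rmult_le_pos; last by left; exact: exp_pos. have := pow2_ge_0 a. lra.
  - exact: (ex_series_scal_l _ _ ex_series_inv_sq). }
exists (a + Series c). have S0 : 0 <= Series c by apply: Series_pos.
split; first lra. move=> M v hv.
have H : Rabs (EM a M v - EM a M 0) <= (a + Rsum c M) * v ^ 2.
{ elim: M => [|M IH].
  - rewrite /= (_ : - a * (0 * (0 * 1)) = 0); last ring. rewrite exp_0 Rplus_0_r. apply: Rabs_le.
    have g1 : exp (- a * (v * (v * 1))) <= 1. { rewrite -[X in _ <= X]exp_0. apply: exp_le. nra. }
    have := exp_ineq1_le (- a * (v * (v * 1))). lra.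
  - have t := @EM_term a v (INR (S M)) ha (pos_INR _) hv.
    change (EM a (S M) v) with (EM a M v + (exp (- a * (v + INR (S M)) ^ 2) + exp (- a * (v - INR (S M)) ^ 2))).
    change (EM a (S M) 0) with (EM a M 0 + (exp (- a * (0 + INR (S M)) ^ 2) + exp (- a * (0 - INR (S M)) ^ 2))).
    change (Rsum c (S M)) with (Rsum c M + c M). rewrite -/(c M) in t.
    have -> : (0 + INR (S M)) ^ 2 = INR (S M) ^ 2 by ring. have -> : (0 - INR (S M)) ^ 2 = INR (S M) ^ 2 by ring.
    set A := EM a M v in IH *. set B := EM a M 0 in IH *. set p := exp (- a * (v + INR (S M)) ^ 2) in t *. set q := exp (- a * (v - INR (S M)) ^ 2) in t *. set r := exp (- a * INR (S M) ^ 2) in t *.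
    have -> : A + (p + q) - (B + (r + r)) = (A - B) + (p + q - 2 * r) by ring.
    apply: Rle_trans (Rabs_triang _ _) _. lra. }
apply: Rle_trans H _. apply: Rmult_le_compat_r; first exact: pow2_ge_0. have := @Rsum_le_Series c M c0 ex. lra.
Qed.

Definition om (x : R) : R := Series (fun n => exp (- (PI * x) * INR (S n) ^ 2)).
Definition theta (x : R) : R := 1 + 2 * om x.

Lemma om_ex (x : R) : 0 < x -> ex_series (fun n => exp (- (PI * x) * INR (S n) ^ 2)).
Proof.
move=> hx. have hp := PI_RGT_0. have ha : 0 < PI * x by nra.
have [K [K0 h]] := pow_exp_bound 1 ha.
apply: (@ex_series_pos_le _ (fun n => K * / INR (S n) ^ 2)).
- move=> n. split; first by left; exact: exp_pos. have x2 : 0 < INR (S n) ^ 2 by have := INR_S_pos n; nra.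
  have := h (INR (S n) ^ 2) (Rlt_le _ _ x2). rewrite pow_1 => q. apply: (proj1 (Rle_div_r _ _ _ x2)). by rewrite Rmult_comm.
- exact: (ex_series_scal_l _ _ ex_series_inv_sq).
Qed.

Lemma th_lim (x : R) : 0 < x -> is_lim_seq (fun M => th M x) (theta x).
Proof.
move=> hx. have h : is_lim_seq (sum_n (fun n => exp (- (PI * x) * INR (S n) ^ 2))) (om x) by exact: Series_correct (om_ex hx).
apply/is_lim_seq_incr_1. apply: (is_lim_seq_ext (fun n => 1 + 2 * sum_n (fun n => exp (- (PI * x) * INR (S n) ^ 2)) n)).
- elim=> [|n IH]. { by rewrite sum_O. } change (th (S (S n)) x) with (th (S n) x + 2 * exp (- (PI * x) * INR (S (S n)) ^ 2)). rewrite -IH sum_Sn /plus /=. ring.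
- apply: is_lim_seq_plus'; first exact: is_lim_seq_const. exact: (is_lim_seq_scal_l _ 2 (om x)).
Qed.

Lemma EM_th (x : R) (M : nat) : EM (PI * x) M 0 = th M x.
Proof.
elim: M => [|M IH]. { rewrite /= (_ : _ * (0 * (0 * 1)) = 0); last ring. exact: exp_0. }
change (EM (PI * x) (S M) 0) with (EM (PI * x) M 0 + (exp (- (PI * x) * (0 + INR (S M)) ^ 2) + exp (- (PI * x) * (0 - INR (S M)) ^ 2))).
change (th (S M) x) with (th M x + 2 * exp (- (PI * x) * INR (S M) ^ 2)).
rewrite IH. have -> : (0 + INR (S M)) ^ 2 = INR (S M) ^ 2 by ring. have -> : (0 - INR (S M)) ^ 2 = INR (S M) ^ 2 by ring. ring.
Qed.

(** Replacing the periodized Gaussian by its value at 0 costs O(v^2), which [FK_bound] integrates to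
    a bounded error; the constant value is multiplied by the mass N of [FK]. *)
Lemma fejer_bound (x : R) : 0 < x -> exists C, 0 <= C /\ forall N, Rabs (gam (PI * x) * sth N (/ x) - INR N * theta x) <= C.
Proof.
move=> hx. have hp := PI_RGT_0. have ha : 0 < PI * x by nra.
have [C [C0 hC]] := EM_sum_bound ha. exists (4 * C). split; first lra. move=> N.
have lim : is_lim_seq (fun M => Rabs (gam (PI * x) * sth N (/ x) - INR N * th M x)) (Rabs (gam (PI * x) * sth N (/ x) - INR N * theta x)).
{ apply: (is_lim_seq_abs _ (gam (PI * x) * sth N (/ x) - INR N * theta x)). apply: is_lim_seq_minus'; first exact: is_lim_seq_const. exact: (is_lim_seq_scal_l _ (INR N) (theta x) (th_lim hx)). }
apply: le_epsilon => e he. case: (isI_gauss_FK N hx he) => A [A0 H].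
have [m [_ hm]] := nfloor_ex A A0.
(* For M beyond the cut-off [A] the integral over [-1/2 - M, 1/2 + M] is within e of the full one; M
   then tends to infinity inside [th M x]. *)
apply: (is_lim_seq_le_loc _ (fun _ => 4 * C + e) _ _ _ lim (is_lim_seq_const _)).
exists (S m) => M hM.
have ex : forall f : R -> R, (forall v, ex_derive f v) -> forall p q, is_RInt f p q (RInt f p q).
{ move=> f hf p q. apply: (RInt_correct (V := R_CompleteNormedModule)). apply: (ex_RInt_continuous (V := R_CompleteNormedModule)) => z _. exact: ex_derive_continuous. }
have d0 : forall v, ex_derive (fun v => EM (PI * x) M v * FK N v) v. { move=> v. apply: ex_derive_mult; [exact: ex_derive_EM | exact: ex_derive_FK]. }
have r0 := ex _ d0 (-1/2) (1/2). set l := RInt _ _ _ in r0.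
have r1 := EM_int r0.
have iM : INR (S m) <= INR M by apply: le_INR. rewrite S_INR in iM.
have q := H (-1/2 - INR M) (1/2 + INR M) ltac:(lra) ltac:(lra).
have eI : CInt (fun v => RtoC (exp (- (PI * x) * v ^ 2) * FK N v)) (-1/2 - INR M) (1/2 + INR M) = RtoC l.
{ apply: is_CInt_unique. apply/is_CInt_pair. split => //=. have := is_RInt_const (V := R_NormedModule) (-1/2 - INR M) (1/2 + INR M) 0. by rewrite scal_zero_r. }
rewrite eI -RtoC_minus Cmod_R in q.
have rs := is_RInt_scal (FK N) (-1/2) (1/2) (EM (PI * x) M 0) (INR N) (@FK_int N).
have r2 := is_RInt_minus _ _ _ _ _ _ r0 rs.
have b : Rabs (l - EM (PI * x) M 0 * INR N) <= 4 * C * (1/2 - -1/2).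
{ have -> : 4 * C * (1/2 - -1/2) = (1/2 - -1/2) * (4 * C) by ring.
  change (norm (minus l (scal (EM (PI * x) M 0) (INR N)) : R) <= (1/2 - -1/2) * (4 * C)).
  apply: (norm_RInt_le_const (V := R_NormedModule) _ _ _ _ _ _ _ r2); first lra.
  move=> v hv. rewrite /norm /= /abs /minus /plus /opp /scal /= /mult /=.
  have -> : EM (PI * x) M v * FK N v + - (EM (PI * x) M 0 * FK N v) = (EM (PI * x) M v - EM (PI * x) M 0) * FK N v by ring.
  rewrite Rabs_mult. have [f0 f4] := @FK_bound N v ltac:(lra).
  case: (Req_dec v 0) => [->|n]. { rewrite Rminus_diag_eq // Rabs_R0. lra. }
  have v2 : 0 < v ^ 2 by nra.
  have F0 : 0 <= FK N v by nra.
  rewrite (Rabs_pos_eq (FK N v)) //. have := hC M v ltac:(lra) => h. apply: Rle_trans (Rmult_le_compat_r _ _ _ F0 h) _. nra. }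
rewrite EM_th in b. have -> : gam (PI * x) * sth N (/ x) - INR N * th M x = (l - th M x * INR N) - (l - gam (PI * x) * sth N (/ x)) by ring.
apply: Rle_trans (Rabs_triang _ _) _. rewrite Rabs_Ropp. lra.
Qed.

Lemma isI_scale (f : R -> C) (s : R) (l : C) : 0 < s -> (forall t, rcont f t) -> isI f l -> isI (fun t => RtoC s * f (s * t)%R)%C l.
Proof.
move=> hs cf h e he. case: (h e he) => M [M0 H]. exists (M / s). split. { by apply: Rdiv_le_0_compat. }
move=> a b ha hb.
have e1 : s * a <= - M. { have : s * (- (M / s)) = - M by field; lra. nra. }
have e2 : M <= s * b. { have : s * (M / s) = M by field; lra. nra. }
have hab : s * a + 0 <= s * b + 0 by lra.
have c := @is_CInt_comp_lin f s 0 a b (CInt f (s * a + 0) (s * b + 0)) (CIntc cf hab).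
have ab : a <= b by nra.
have -> : CInt (fun t => (RtoC s * f (s * t)%R)%C) a b = CInt f (s * a + 0) (s * b + 0).
{ apply: is_CInt_unique. apply: is_CInt_ext c => // t _. by rewrite Rplus_0_r. }
apply: H; lra.
Qed.

(* Poisson summation for the Gaussian: integrating it against Dirichlet and Fejer kernels and taking Cesaro means. *)
Lemma theta_gam (x : R) : 0 < x -> gam (PI * x) * theta (/ x) = theta x.
Proof.
move=> hx. have hx' : 0 < / x by apply: Rinv_0_lt_compat.
have [C [C0 hC]] := fejer_bound hx.
have ces : is_lim_seq (fun n => sth (S n) (/ x) / INR (S n)) (theta (/ x)).
{ have h : Un_cv (fun M => th M (/ x)) (theta (/ x)) by apply/is_lim_seq_Reals; exact: th_lim.
  have c := Cesaro_1 _ _ h. have c' := proj1 (is_lim_seq_incr_1 _ _) (proj2 (is_lim_seq_Reals _ _) c).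
  apply: is_lim_seq_ext c' => n /=. congr (_ / _). elim: n => [|n IH]; first by rewrite /=; ring. rewrite [LHS]/= IH. by []. }
have l1 : is_lim_seq (fun n => gam (PI * x) * (sth (S n) (/ x) / INR (S n)) - theta x) (gam (PI * x) * theta (/ x) - theta x).
{ apply: is_lim_seq_minus'; last exact: is_lim_seq_const. exact: (is_lim_seq_scal_l _ (gam (PI * x)) (theta (/ x)) ces). }
have l2 : is_lim_seq (fun n => gam (PI * x) * (sth (S n) (/ x) / INR (S n)) - theta x) 0.
{ have z : is_lim_seq (fun n => C * / INR (S n)) (C * 0).
  { apply: (is_lim_seq_scal_l _ C 0). apply/(is_lim_seq_incr_1 (fun n => / INR n)). apply: (is_lim_seq_inv _ p_infty) => //. exact: is_lim_seq_INR. }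
  rewrite Rmult_0_r in z. apply: (proj2 (is_lim_seq_abs_0 _)).
  apply: (is_lim_seq_le_le (fun _ => 0) _ (fun n => C * / INR (S n))) => //; last exact: is_lim_seq_const.
  move=> n. split; first exact: Rabs_pos. have p := INR_S_pos n. apply: (proj1 (Rle_div_r _ _ _ p)).
  rewrite -{2}(Rabs_pos_eq (INR (S n))); last lra. rewrite -Rabs_mult. 
  have -> : (gam (PI * x) * (sth (S n) (/ x) / INR (S n)) - theta x) * INR (S n) = gam (PI * x) * sth (S n) (/ x) - INR (S n) * theta x by field; lra. by []. }
have := is_lim_seq_unique _ _ l1. rewrite (is_lim_seq_unique _ _ l2) => -[e]. lra.
Qed.

Lemma om_pos (x : R) : 0 < x -> 0 <= om x.
Proof. move=> hx. apply: Series_pos (om_ex hx) => n. left. exact: exp_pos. Qed.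

(** At x = 1 both sides of [theta_gam] contain the same theta value, which is at least 1 and
    cancels. *)
Lemma gam_PI : gam PI = 1.
Proof.
have := theta_gam Rlt_0_1. rewrite Rinv_1 Rmult_1_r. have := om_pos Rlt_0_1. rewrite /theta. move=> h e. nra.
Qed.

Lemma gam_val (a : R) : 0 < a -> gam a = sqrt (PI / a).
Proof.
move=> ha. have hp := PI_RGT_0. set s := sqrt (a / PI).
have s0 : 0 < s. { apply: sqrt_lt_R0. exact: Rdiv_lt_0_compat. }
have ss : s * s = a / PI. { apply: sqrt_sqrt. left. exact: Rdiv_lt_0_compat. }
have h := isI_scale s0 (@rcont_gauss PI) (isI_gauss hp).
have h2 : isI (fun t => RtoC s * RtoC (exp (- a * t ^ 2)))%C (RtoC (gam PI)).
{ apply: isI_ext h => t. congr (_ * RtoC (exp _))%C. have -> : a = s * s * PI by rewrite ss; field; lra. ring. }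
have h3 := isI_scal (RtoC s) (@rcont_gauss a) (isI_gauss ha).
have e := isI_unique h2 h3. rewrite gam_PI -RtoC_mult in e. have e' := RtoC_inj _ _ e.
have -> : PI / a = / (s * s) by rewrite ss; field; lra.
rewrite sqrt_inv sqrt_square; last lra. apply: (Rmult_eq_reg_l s); last lra. rewrite -e'. field. lra.
Qed.

Lemma theta_fe (x : R) : 0 < x -> theta (/ x) = sqrt x * theta x.
Proof.
move=> hx. have hp := PI_RGT_0. have e := theta_gam hx. rewrite gam_val in e; last by apply: Rmult_lt_0_compat.
have e2 : PI / (PI * x) = / x by field; lra. rewrite e2 sqrt_inv in e. rewrite -e.
have := sqrt_lt_R0 x hx. move=> s. field. lra.
Qed.

(** * The archimedean factor *)

Lemma expabs_dom (N : nat) (s : R) : 0 < s -> exists K, 0 < K /\ forall u, (1 + u ^ 2) ^ N * exp (- s * Rabs u) <= K.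
Proof.
move=> hs. have [K [K0 h]] := pow_exp_bound (2 * N) hs. exists (K * exp s). split. { apply: Rmult_lt_0_compat => //. exact: exp_pos. }
move=> u. have r0 := Rabs_pos u. have q := h (1 + Rabs u) ltac:(lra).
have -> : exp (- s * Rabs u) = exp (- s * (1 + Rabs u)) * exp s by rewrite -exp_plus; congr exp; ring.
rewrite pow_mult in q.
have b : (1 + u ^ 2) ^ N <= ((1 + Rabs u) ^ 2) ^ N. { apply: pow_incr. rewrite -(pow2_abs u). split; nra. }
have := exp_pos s. have p := exp_pos (- s * (1 + Rabs u)).
have : (1 + u ^ 2) ^ N * exp (- s * (1 + Rabs u)) <= K by nra. nra.
Qed.

Lemma dom_of_bound (f : R -> R) (K : R) : (forall t, ex_derive f t) -> (forall t, Rabs (f t) * (1 + t ^ 2) <= K) -> dom (fun t => RtoC (f t)) K.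
Proof.
move=> h1 h2. split. { move=> t. exact: rcont_RtoC_diff. }
move=> t. have t2 := pow2_ge_0 t. have p : 0 < 1 + t ^ 2 by lra. rewrite Cmod_R. apply: (proj1 (Rle_div_r _ _ _ p)). exact: h2.
Qed.

Lemma isI_FTC_real (F f : R -> R) (K : R) : (forall t, is_derive F t (f t)) -> (forall t, ex_derive f t) ->
  (forall t, Rabs (F t) * (1 + t ^ 2) <= K) -> isI (fun t => RtoC (f t)) (RtoC 0).
Proof.
move=> h1 h2 h3. apply: (@isI_FTC (fun t => RtoC (F t))).
- move=> t. exact: rderiv_RtoC.
- move=> t. exact: rcont_RtoC_diff.
- move=> e he. exists (Rabs K / e + 1). have k0 := Rabs_pos K. have k1 := Rle_abs K.
  have k2 : 0 <= Rabs K / e by apply: Rdiv_le_0_compat.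
  split; first lra. move=> t ht. rewrite Cmod_R.
  have e1 : Rabs K / e * e = Rabs K by field; lra.
  have q : Rabs t <= 1 + t ^ 2. { rewrite -(pow2_abs t). nra. }
  case: (Rlt_dec (Rabs (F t)) e) => // n. exfalso. have := h3 t.
  nra.
Qed.

(** The theta term exp(-pi x) at x = e^(2u). In this variable a Mellin transform is a two-sided
    Laplace transform: x^(s/2) becomes e^(su), and passing from x to n^2 x is a shift of u by log
    n. *)
Definition phiA (u : R) : R := exp (- PI * exp (2 * u)).

Lemma phiA_bound (s : R) : 0 < s -> exists K, 1 <= K /\ forall u, phiA u * exp (s * u) <= K * exp (- s * Rabs u).
Proof.
move=> hs. have hp := PI_RGT_0. have [N hN] := nfloor_ex s (Rlt_le _ _ hs).
have [K [K0 h]] := pow_exp_bound (S N) hp. exists (K + 1). split; first lra. move=> u.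
have p0 : 0 < phiA u by exact: exp_pos.
case: (Rle_dec 0 u) => hu.
- rewrite Rabs_pos_eq //. set y := exp (2 * u). have y0 : 0 < y by exact: exp_pos.
  have hy := h y ltac:(lra). rewrite -/(phiA u) in hy.
  have e1 : exp (s * u) * exp (s * u) <= y ^ (S N).
  { rewrite -exp_plus /y -Rpower_pow; last exact: exp_pos. rewrite /Rpower ln_exp. apply: exp_le. rewrite S_INR. nra. }
  have e2 : exp (s * u) * exp (- s * u) = 1 by rewrite -exp_plus -exp_0; congr exp; ring.
  have q1 := exp_pos (s * u). have q2 := exp_pos (- s * u).
  have b : phiA u * (exp (s * u) * exp (s * u)) <= K by nra.
  have -> : phiA u * exp (s * u) = phiA u * (exp (s * u) * exp (s * u)) * exp (- s * u) by nra.
  apply: Rmult_le_compat_r; lra.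
- rewrite Rabs_left1; last lra. have -> : - s * - u = s * u by ring. apply: Rmult_le_compat_r. { left; exact: exp_pos. }
  have : phiA u <= 1. { rewrite /phiA -exp_0. apply: exp_le. have := exp_pos (2 * u). nra. } lra.
Qed.

Lemma ex_derive_phiA (s u : R) : ex_derive (fun u => phiA u * exp (s * u)) u.
Proof. rewrite /phiA. auto_derive. by []. Qed.

(** Half of the decay is kept in reserve as exp(s/2 |u|), which leaves room for moving s by up to
    s/2 in [gA_derive]. *)
Lemma phiA_dom (N : nat) (s : R) : 0 < s -> exists K, forall u, phiA u * exp (s * u) * exp (s / 2 * Rabs u) * (1 + u ^ 2) ^ N <= K.
Proof.
move=> hs. have [K [K1 h]] := phiA_bound hs. have [L [L0 hL]] := @expabs_dom N (s / 2) ltac:(lra).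
exists (K * L). move=> u. have := h u. have := hL u.
have e : exp (- s * Rabs u) * exp (s / 2 * Rabs u) = exp (- (s / 2) * Rabs u) by rewrite -exp_plus; congr exp; field.
have q := exp_pos (s / 2 * Rabs u). have pp : 0 < (1 + u ^ 2) ^ N. { apply: pow_lt. have := pow2_ge_0 u; lra. }
move=> h1 h2. apply: Rle_trans (_ : K * exp (- s * Rabs u) * exp (s / 2 * Rabs u) * (1 + u ^ 2) ^ N <= _).
{ apply: Rmult_le_compat_r; first lra. apply: Rmult_le_compat_r; lra. }
rewrite Rmult_assoc Rmult_assoc -(Rmult_assoc (exp (- s * _))) e. apply: Rmult_le_compat_l; lra.
Qed.

Definition aInt (s : R) : R -> C := fun u => RtoC (phiA u * exp (s * u)).
Definition aInt1 (s : R) : R -> C := fun u => RtoC (u * (phiA u * exp (s * u))).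
(* [gA s] is pi^(-s/2) Gamma(s/2) / 2, so [gD] is its logarithmic derivative (psi(s/2) - log pi) / 2. *)
Definition gA (s : R) : R := Re (II (aInt s)).
Definition gA1 (s : R) : R := Re (II (aInt1 s)).

Lemma exp_abs_ge1 (s u : R) : 0 <= s -> 1 <= exp (s * Rabs u).
Proof. move=> h. rewrite -exp_0. apply: exp_le. have := Rabs_pos u. nra. Qed.

Lemma isI_real (f : R -> R) (K : R) : dom (fun t => RtoC (f t)) K -> isI (fun t => RtoC (f t)) (RtoC (Re (II (fun t => RtoC (f t))))).
Proof. move=> h. exact: isI_ext (isI_re (proj1 h) (isI_II h)). Qed.

Lemma aInt_dom (s : R) : 0 < s -> exists K, dom (aInt s) K.
Proof.
move=> hs. have [K h] := phiA_dom 1 hs. exists K. apply: dom_of_bound; first exact: ex_derive_phiA.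
move=> t. have p : 0 < phiA t * exp (s * t) by apply: Rmult_lt_0_compat; exact: exp_pos.
rewrite Rabs_pos_eq; last lra. apply: Rle_trans (h t). rewrite pow_1. apply: Rmult_le_compat_r. { have := pow2_ge_0 t; lra. }
have := @exp_abs_ge1 (s / 2) t ltac:(lra). nra.
Qed.

Lemma aInt1_dom (s : R) : 0 < s -> exists K, dom (aInt1 s) K.
Proof.
move=> hs. have [K h] := phiA_dom 2 hs. exists K. apply: dom_of_bound.
{ move=> t. rewrite /phiA. auto_derive. by []. }
move=> t. have p : 0 < phiA t * exp (s * t) by apply: Rmult_lt_0_compat; exact: exp_pos.
rewrite Rabs_mult (Rabs_pos_eq (phiA t * _)); last lra. apply: Rle_trans (h t).
have q : Rabs t <= 1 + t ^ 2. { rewrite -(pow2_abs t). nra. }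
have e := @exp_abs_ge1 (s / 2) t ltac:(lra). have t2 := pow2_ge_0 t. have := Rabs_pos t.
set x := phiA t * exp (s * t) in p *. set y := exp _ in e *. set z := 1 + t ^ 2 in q *. move=> r0.
have -> : x * y * z ^ 2 = (z * (x * y)) * z by ring. apply: Rmult_le_compat_r; first by rewrite /z; lra.
apply: Rmult_le_compat; try lra. nra.
Qed.

Lemma aInt_cont (s u : R) : rcont (aInt s) u.
Proof. apply: rcont_RtoC_diff. exact: ex_derive_phiA. Qed.
Lemma aInt1_cont (s u : R) : rcont (aInt1 s) u.
Proof. apply: rcont_RtoC_diff. rewrite /phiA. auto_derive. by []. Qed.

Lemma isI_aInt (s : R) : 0 < s -> isI (aInt s) (RtoC (gA s)).
Proof. move=> /aInt_dom [K h]. exact: isI_real h. Qed.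
Lemma isI_aInt1 (s : R) : 0 < s -> isI (aInt1 s) (RtoC (gA1 s)).
Proof. move=> /aInt1_dom [K h]. exact: isI_real h. Qed.

(** If c is the minimum of f on [0, 1], the integrals over larger intervals are at least c, and an
    approximation within c/2 keeps the limit away from 0. *)
Lemma isI_pos (f : R -> R) (l : R) : (forall t, ex_derive f t) -> (forall t, 0 < f t) -> isI (fun t => RtoC (f t)) (RtoC l) -> 0 < l.
Proof.
move=> hd hf h.
have [c [c0 hc]] : exists c, 0 < c /\ forall t, 0 <= t <= 1 -> c <= f t.
{ have [m [hm _]] := continuity_ab_min f 0 1 Rle_0_1 (fun t _ => proj2 (continuity_pt_filterlim f t) (ex_derive_continuous f t (hd t))).
  exists (f m). split => //. }
have cf : forall t, rcont (fun t => RtoC (f t)) t by move=> t; exact: rcont_RtoC_diff.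
case: (h (c / 2) ltac:(lra)) => M [M0 H]. set b := M + 1. have q := H (- b) b ltac:(rewrite /b; lra) ltac:(rewrite /b; lra).
have c1 := CIntc cf (_ : - b <= b). have {c1} c1 := c1 ltac:(rewrite /b; lra).
have [r1 _] := proj1 (is_CInt_pair _ _ _ _) c1.
have e01 : 0 <= 1 by lra.
have r0 := RInt_correct (V := R_CompleteNormedModule) f 0 1 (ex_RInt_continuous (V := R_CompleteNormedModule) f 0 1 (fun z _ => ex_derive_continuous f z (hd z))).
have ex : forall p q, ex_RInt f p q by move=> p q'; apply: (ex_RInt_continuous (V := R_CompleteNormedModule)) => z _; exact: ex_derive_continuous.
have l1 : c <= RInt f 0 1.
{ have := is_RInt_le (fun _ => c) f 0 1 _ _ e01 (is_RInt_const (V := R_NormedModule) 0 1 c) r0 (fun t ht => hc t ltac:(lra)).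
  rewrite /scal /= /mult /=. lra. }
have ge : forall p q, p <= q -> 0 <= RInt f p q. { move=> p q' hpq. apply: RInt_ge_0 => // x _. left. exact: hf. }
have ch : RInt f (- b) b = RInt f (- b) 0 + (RInt f 0 1 + RInt f 1 b).
{ rewrite (_ : RInt f 0 1 + RInt f 1 b = RInt f 0 b); last exact: (RInt_Chasles f 0 1 b). symmetry. exact: (RInt_Chasles f (- b) 0 b). }
have e : Re (CInt (fun t => RtoC (f t)) (- b) b) = RInt f (- b) b. { symmetry. apply: is_RInt_unique. exact: r1. }
have q2 := Rle_lt_trans _ _ _ (re_le_Cmod _) q. rewrite re_minus e /= in q2. move/Rabs_def2: q2.
have := ge (- b) 0 ltac:(rewrite /b; lra). have := ge 1 b ltac:(rewrite /b; lra). lra.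
Qed.

Lemma gA_pos (s : R) : 0 < s -> 0 < gA s.
Proof.
move=> hs. apply: isI_pos (isI_aInt hs); first exact: ex_derive_phiA.
move=> t. apply: Rmult_lt_0_compat; exact: exp_pos.
Qed.

(** Recursion of the Gamma function: phiA u e^(su) vanishes at both ends and has derivative s phiA u
    e^(su) - 2 pi phiA u e^((s+2)u). *)
Lemma gA_rec (s : R) : 0 < s -> gA (s + 2) = s / (2 * PI) * gA s.
Proof.
move=> hs. have hp := PI_RGT_0. have hs2 : 0 < s + 2 by lra. have [K h] := phiA_dom 1 hs.
have z : isI (fun u => RtoC (s * (phiA u * exp (s * u)) - 2 * PI * (phiA u * exp ((s + 2) * u)))) (RtoC 0).
{ apply: (@isI_FTC_real (fun u => phiA u * exp (s * u)) _ K).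
  - move=> t. rewrite /phiA. auto_derive => //. have -> : (s + 2) * t = s * t + 2 * t by ring. rewrite exp_plus. ring.
  - move=> t. rewrite /phiA. auto_derive. by [].
  - move=> t. have p : 0 < phiA t * exp (s * t) by apply: Rmult_lt_0_compat; exact: exp_pos.
    rewrite Rabs_pos_eq; last lra. apply: Rle_trans (h t). rewrite pow_1. apply: Rmult_le_compat_r. { have := pow2_ge_0 t; lra. }
    have := @exp_abs_ge1 (s / 2) t ltac:(lra). nra. }
have h2 := isI_minus (fun t => rcont_scal (RtoC s) (aInt_cont s t)) (fun t => rcont_scal (RtoC (2 * PI)) (aInt_cont (s + 2) t)) (isI_scal (RtoC s) (aInt_cont s) (isI_aInt hs)) (isI_scal (RtoC (2 * PI)) (aInt_cont (s + 2)) (isI_aInt hs2)).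
have e := isI_unique z (isI_ext _ h2). 
have {e} e := e ltac:(move=> t; rewrite /aInt -!RtoC_mult -RtoC_minus; congr RtoC; ring).
rewrite -!RtoC_mult -RtoC_minus in e. have {e} e := RtoC_inj _ _ e.
apply: (Rmult_eq_reg_l (2 * PI)); last lra. transitivity (s * gA s); first lra. field. lra.
Qed.

Lemma gA1_rec (s : R) : 0 < s -> gA1 (s + 2) = (s * gA1 s + gA s) / (2 * PI).
Proof.
move=> hs. have hp := PI_RGT_0. have hs2 : 0 < s + 2 by lra. have [K h] := phiA_dom 2 hs.
have z : isI (fun u => RtoC (phiA u * exp (s * u) + s * (u * (phiA u * exp (s * u))) - 2 * PI * (u * (phiA u * exp ((s + 2) * u))))) (RtoC 0).
{ apply: (@isI_FTC_real (fun u => u * (phiA u * exp (s * u))) _ K).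
  - move=> t. rewrite /phiA. auto_derive => //. have -> : (s + 2) * t = s * t + 2 * t by ring. rewrite exp_plus. ring.
  - move=> t. rewrite /phiA. auto_derive. by [].
  - move=> t. have p : 0 < phiA t * exp (s * t) by apply: Rmult_lt_0_compat; exact: exp_pos.
    rewrite Rabs_mult (Rabs_pos_eq (phiA t * _)); last lra. apply: Rle_trans (h t).
    have q : Rabs t <= 1 + t ^ 2. { rewrite -(pow2_abs t). nra. }
    have e := @exp_abs_ge1 (s / 2) t ltac:(lra). have t2 := pow2_ge_0 t. have := Rabs_pos t.
    set x := phiA t * exp (s * t) in p *. set y := exp _ in e *. set zz := 1 + t ^ 2 in q *. move=> r0.
    have -> : x * y * zz ^ 2 = (zz * (x * y)) * zz by ring. apply: Rmult_le_compat_r; first by rewrite /zz; lra.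
    apply: Rmult_le_compat; try lra. nra. }
have h1 := isI_plus (aInt_cont s) (fun t => rcont_scal (RtoC s) (aInt1_cont s t)) (isI_aInt hs) (isI_scal (RtoC s) (aInt1_cont s) (isI_aInt1 hs)).
have h2 := isI_minus (fun t => rcont_plus (aInt_cont s t) (rcont_scal (RtoC s) (aInt1_cont s t))) (fun t => rcont_scal (RtoC (2 * PI)) (aInt1_cont (s + 2) t)) h1 (isI_scal (RtoC (2 * PI)) (aInt1_cont (s + 2)) (isI_aInt1 hs2)).
have e := isI_unique z (isI_ext _ h2). 
have {e} e := e ltac:(move=> t; rewrite /aInt /aInt1 -!RtoC_mult -RtoC_plus -RtoC_minus; congr RtoC; ring).
rewrite -!RtoC_mult -RtoC_plus -RtoC_minus in e. have {e} e := RtoC_inj _ _ e.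
apply: (Rmult_eq_reg_l (2 * PI)); last lra. transitivity (s * gA1 s + gA s); first lra. field. lra.
Qed.

Definition gD (s : R) : R := gA1 s / gA s.

Lemma gD_rec (s : R) : 0 < s -> gD (s + 2) = gD s + / s.
Proof.
move=> hs. have p := gA_pos hs. have hp := PI_RGT_0. rewrite /gD gA_rec // gA1_rec //. field. lra.
Qed.

(** Jensen's inequality: [gD s] is the mean of u for the density behind [gA s], and e^(cu) lies
    above its tangent at that mean. *)
Lemma gA_jensen (s c : R) : 0 < s -> 0 < s + c -> exp (c * gD s) * gA s <= gA (s + c).
Proof.
move=> hs hsc. set m := gD s. have p := gA_pos hs.
have h1 := isI_plus (fun t => rcont_scal (RtoC (exp (c * m) * (1 - c * m))) (aInt_cont s t)) (fun t => rcont_scal (RtoC (exp (c * m) * c)) (aInt1_cont s t)) (isI_scal (RtoC (exp (c * m) * (1 - c * m))) (aInt_cont s) (isI_aInt hs)) (isI_scal (RtoC (exp (c * m) * c)) (aInt1_cont s) (isI_aInt1 hs)).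
have := isI_re_le _ (aInt_cont (s + c)) _ h1 (isI_aInt hsc).
rewrite -!RtoC_mult -RtoC_plus !re_RtoC => H.
have -> : exp (c * m) * gA s = exp (c * m) * (1 - c * m) * gA s + exp (c * m) * c * gA1 s.
{ have : gA1 s = m * gA s by rewrite /m /gD; field; lra. move=> ->. ring. }
apply: H.
- move=> t. apply: rcont_plus; apply: rcont_scal; [exact: aInt_cont | exact: aInt1_cont].
- move=> t. rewrite /aInt /aInt1 -!RtoC_mult -RtoC_plus !re_RtoC.
  have -> : (s + c) * t = s * t + (c * m + c * (t - m)) by ring. rewrite !exp_plus.
  have q : 0 < phiA t * exp (s * t) by apply: Rmult_lt_0_compat; exact: exp_pos.
  have e := exp_ineq1_le (c * (t - m)). have e2 := exp_pos (c * m).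
  have -> : phiA t * (exp (s * t) * (exp (c * m) * exp (c * (t - m)))) = exp (c * m) * exp (c * (t - m)) * (phiA t * exp (s * t)) by ring.
  have -> : exp (c * m) * (1 - c * m) * (phiA t * exp (s * t)) + exp (c * m) * c * (t * (phiA t * exp (s * t))) = exp (c * m) * (1 + c * (t - m)) * (phiA t * exp (s * t)) by ring.
  apply: Rmult_le_compat_r; first lra. apply: Rmult_le_compat_l; lra.
Qed.

(** Jensen with c = -2 at s + 2 and with c = 2 at s, combined with the recursions. These asymptotics
    identify [gD] with the digamma series in [Dc_real]. *)
Lemma gD_bounds (s : R) : 0 < s -> ln (s / (2 * PI)) / 2 - / s <= gD s <= ln (s / (2 * PI)) / 2.
Proof.
move=> hs. have hp := PI_RGT_0. have p := gA_pos hs. have hs2 : 0 < s + 2 by lra.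
have x0 : 0 < s / (2 * PI) by apply: Rdiv_lt_0_compat; lra.
split.
- have j := @gA_jensen (s + 2) (-2) hs2 ltac:(lra). rewrite (_ : s + 2 + -2 = s) in j; last ring.
  rewrite gA_rec // in j. 
  have j2 : exp (-2 * gD (s + 2)) <= / (s / (2 * PI)).
  { apply: (Rmult_le_reg_r (s / (2 * PI) * gA s)); first exact: Rmult_lt_0_compat. apply: Rle_trans j _. right. field. lra. }
  rewrite gD_rec // in j2. have l := ln_le _ _ (exp_pos _) j2. rewrite ln_exp ln_Rinv // in l. lra.
- have j := @gA_jensen s 2 hs hs2. rewrite gA_rec // in j.
  have j2 := Rmult_le_reg_r _ _ _ p j. have l := ln_le _ _ (exp_pos _) j2. rewrite ln_exp in l. lra.
Qed.

Lemma exp_second (x : R) : Rabs (exp x - 1 - x) <= x ^ 2 * exp (Rabs x).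
Proof.
have h1 := exp_ineq1_le x. have h2 := exp_ineq1_le (- x).
have e : exp x * exp (- x) = 1 by rewrite -exp_plus -exp_0; congr exp; ring. rewrite Rabs_pos_eq; last lra.
have q : exp x - 1 <= x * exp x by nra.
case: (Rle_dec 0 x) => hx.
- rewrite Rabs_pos_eq //. have : x * exp x - x <= x ^ 2 * exp x by nra. lra.
- rewrite Rabs_left1; last lra. nra.
Qed.

Lemma gA_derive (s : R) : 0 < s -> is_derive gA s (gA1 s).
Proof.
move=> hs. have [K h] := phiA_dom 3 hs.
have hp := PI_RGT_0.
have K0 : 0 <= K. { apply: Rle_trans (h 0). apply: Rmult_le_pos; last by apply: pow_le; rewrite /=; lra. apply: Rmult_le_pos; last by left; exact: exp_pos. apply: Rmult_le_pos; left; exact: exp_pos. }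
have bd : forall x, Rabs (x - s) <= s / 2 -> Rabs (gA x - gA s - gA1 s * (x - s)) <= (x - s) ^ 2 * K * PI.
{ move=> x hx. set d := x - s in hx *. have hx0 : 0 < x. { have := Rle_abs (- d). rewrite Rabs_Ropp /d in hx *. lra. }
  have c1 : forall t, rcont (fun t => aInt x t - aInt s t)%C t by move=> t; apply: rcont_minus; exact: aInt_cont.
  have i1 := isI_minus (aInt_cont x) (aInt_cont s) (isI_aInt hx0) (isI_aInt hs).
  have i2 := isI_minus c1 (fun t => rcont_scal (RtoC d) (aInt1_cont s t)) i1 (isI_scal (RtoC d) (aInt1_cont s) (isI_aInt1 hs)).
  rewrite -RtoC_mult -!RtoC_minus in i2. rewrite (Rmult_comm (gA1 s)). rewrite -Cmod_R. apply: isI_bound i2.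
  split. { move=> t. apply: rcont_minus => //. apply: rcont_scal. exact: aInt1_cont. }
  move=> t. have t2 := pow2_ge_0 t. have p : 0 < 1 + t ^ 2 by lra. apply: (proj1 (Rle_div_r _ _ _ p)).
  rewrite /aInt /aInt1 -RtoC_mult -!RtoC_minus Cmod_R.
  have -> : phiA t * exp (x * t) - phiA t * exp (s * t) - d * (t * (phiA t * exp (s * t))) = phiA t * exp (s * t) * (exp (d * t) - 1 - d * t).
  { have -> : x * t = s * t + d * t by rewrite /d; ring. rewrite exp_plus. ring. }
  have q : 0 < phiA t * exp (s * t) by apply: Rmult_lt_0_compat; exact: exp_pos.
  rewrite Rabs_mult Rabs_pos_eq; last lra.
  have es := exp_second (d * t). have e2 : exp (Rabs (d * t)) <= exp (s / 2 * Rabs t). { apply: exp_le. rewrite Rabs_mult. apply: Rmult_le_compat_r => //. exact: Rabs_pos. }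
  have b : Rabs (exp (d * t) - 1 - d * t) <= d ^ 2 * ((1 + t ^ 2) * exp (s / 2 * Rabs t)).
  { apply: Rle_trans es _. rewrite Rpow_mult_distr Rmult_assoc. apply: Rmult_le_compat_l; first exact: pow2_ge_0.
    apply: Rmult_le_compat => //; [left; exact: exp_pos | lra]. }
  have ht := h t. set y := phiA t * exp (s * t) in q ht *. set z := exp (s / 2 * Rabs t) in e2 b ht. have z0 : 0 < z by exact: exp_pos.
  apply: Rle_trans (_ : y * (d ^ 2 * ((1 + t ^ 2) * z)) * (1 + t ^ 2) <= _).
  { apply: Rmult_le_compat_r; first lra. apply: Rmult_le_compat_l; lra. }
  have -> : y * (d ^ 2 * ((1 + t ^ 2) * z)) * (1 + t ^ 2) = d ^ 2 * (y * z * (1 + t ^ 2) ^ 2) by ring.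
  apply: Rmult_le_compat_l; first exact: pow2_ge_0. apply: Rle_trans ht. apply: Rmult_le_compat_l; first by apply: Rmult_le_pos; lra.
  apply: Rle_pow; [lra | lia]. }
apply/is_derive_Reals => eps he.
have d0 : 0 < Rmin (s / 2) (eps / (K * PI + 1)). { apply: Rmin_glb_lt; first lra. apply: Rdiv_lt_0_compat => //. nra. }
exists (mkposreal _ d0) => x hx hd. rewrite /= in hd.
have d1 := Rlt_le_trans _ _ _ hd (Rmin_l _ _). have d2 := Rlt_le_trans _ _ _ hd (Rmin_r _ _).
have b := bd (s + x). rewrite (_ : s + x - s = x) in b; last ring. have {b} b := b ltac:(lra).
have -> : (gA (s + x) - gA s) / x - gA1 s = (gA (s + x) - gA s - gA1 s * x) / x by field.
rewrite Rabs_div //. have x0 : 0 < Rabs x by exact: Rabs_pos_lt.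
apply/Rlt_div_l => //. apply: Rle_lt_trans b _. rewrite -(pow2_abs x).
have e : eps / (K * PI + 1) * (K * PI + 1) = eps by field; nra.
have : Rabs x * (K * PI) < eps by nra. nra.
Qed.

(** * Completed zeta function *)

Lemma Csum_RtoC (a : nat -> R) (n : nat) : Csum (fun k => RtoC (a k)) n = RtoC (Rsum a n).
Proof. elim: n => [|n IH] //=. by rewrite IH RtoC_plus. Qed.

Lemma Cser_RtoC (a : nat -> R) (l : R) : is_series a l <-> Cser (fun n => RtoC (a n)) (RtoC l).
Proof.
split.
- move=> h. have h' : is_lim_seq (sum_n a) l by exact: h. move/is_lim_seq_spec: h' => h' e he. case: (h' (mkposreal e he)) => N HN.
  exists (S N) => -[|n] hn; first lia. rewrite Csum_RtoC -Rsum_sum_n -RtoC_minus Cmod_R. exact: (HN n ltac:(lia)).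
- move=> h. have : is_lim_seq (sum_n a) l; last by []. apply/is_lim_seq_spec => e. case: (h e (cond_pos e)) => N HN. exists N => n hn.
  have := HN (S n) ltac:(lia). by rewrite Csum_RtoC -Rsum_sum_n -RtoC_minus Cmod_R.
Qed.

Lemma Cser_Series (a : nat -> R) : ex_series a -> Cser (fun n => RtoC (a n)) (RtoC (Series a)).
Proof. move=> h. apply/Cser_RtoC. exact: Series_correct. Qed.

Definition lnS (n : nat) : R := ln (INR (S n)).
Definition zR (s : R) : R := Series (fun n => exp (- s * lnS n)).

Lemma lnS_pos (n : nat) : 0 <= lnS n.
Proof. rewrite /lnS -ln_1. apply: ln_le; first lra. rewrite S_INR. have := pos_INR n. lra. Qed.

Lemma zR_ex (s : R) : 1 < s -> ex_series (fun n => exp (- s * lnS n)).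
Proof. move=> h. apply: ex_series_ext (@pseries (s - 1) ltac:(lra)) => n. congr exp. rewrite /lnS. ring. Qed.

(** * The Mellin transform of theta *)

Definition W (u : R) : R := om (exp (2 * u)).

Lemma W_term (u : R) (n : nat) : exp (- (PI * exp (2 * u)) * INR (S n) ^ 2) = phiA (u + lnS n).
Proof.
rewrite /phiA /lnS. congr exp. have p := INR_S_pos n.
have -> : 2 * (u + ln (INR (S n))) = 2 * u + (ln (INR (S n)) + ln (INR (S n))) by ring.
rewrite !exp_plus exp_ln //. ring.
Qed.

Lemma log_weight (d : R) : 0 < d -> exists K, 0 < K /\ forall n, exp (- d * lnS n) * (1 + lnS n ^ 2) <= K.
Proof.
move=> hd. have [K [K0 h]] := @expabs_dom 1 d hd. exists K. split => // n. have := h (lnS n).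
rewrite pow_1 Rabs_pos_eq; last exact: lnS_pos. lra.
Qed.

(** The n-th term of [W] is [phiA] shifted by log n; undoing the shift produces n^(-s) times
    [gA s]. *)
Lemma mellin (s : R) : 1 < s -> isI (fun u => RtoC (W u * exp (s * u))) (RtoC (zR s * gA s)).
Proof.
move=> hs. have s0 : 0 < s by lra.
have [K hK] := phiA_dom 1 s0. have [L [L0 hL]] := @log_weight ((s - 1) / 2) ltac:(lra).
pose f n u := RtoC (phiA (u + lnS n) * exp (s * u)).
have fe : forall n u, f n u = (RtoC (exp (- s * lnS n)) * aInt s (1 * u + lnS n))%C.
{ move=> n u. rewrite /f /aInt -RtoC_mult. congr RtoC. rewrite Rmult_1_l (_ : s * (u + lnS n) = s * u + s * lnS n); last ring. rewrite exp_plus.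
  have e : exp (- s * lnS n) * exp (s * lnS n) = 1 by rewrite -exp_plus -exp_0; congr exp; ring.
  transitivity (exp (- s * lnS n) * exp (s * lnS n) * (phiA (u + lnS n) * exp (s * u))); [rewrite e; ring | ring]. }
have K0 : 0 <= K. { apply: Rle_trans (hK 0). apply: Rmult_le_pos; last by apply: pow_le; rewrite /=; lra. apply: Rmult_le_pos; last by left; exact: exp_pos. apply: Rmult_le_pos; left; exact: exp_pos. }
have ms : ex_series (fun n => (2 * K * L) * exp (- (1 + (s - 1) / 2) * lnS n)) by exact: (ex_series_scal_l _ _ (@pseries ((s - 1) / 2) ltac:(lra))).
have df : forall n, dom (f n) ((2 * K * L) * exp (- (1 + (s - 1) / 2) * lnS n)).
{ move=> n. apply: dom_of_bound. { move=> t. rewrite /phiA. auto_derive. by []. }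
  move=> t. set l := lnS n. have p : 0 < phiA (t + l) * exp (s * t) by apply: Rmult_lt_0_compat; exact: exp_pos.
  rewrite Rabs_pos_eq; last lra.
  have h := hK (t + l). rewrite pow_1 in h. have e := @exp_abs_ge1 (s / 2) (t + l) ltac:(lra).
  have q : 0 < phiA (t + l) * exp (s * (t + l)) by apply: Rmult_lt_0_compat; exact: exp_pos.
  have t2 := pow2_ge_0 (t + l).
  have b : phiA (t + l) * exp (s * (t + l)) * (1 + (t + l) ^ 2) <= K by nra.
  (* The shift spoils the profile 1 / (1 + t^2) only by a factor 2 (1 + l^2). Half of the excess s -
     1 pays for it, and the other half keeps the series convergent. *)
  have c : 1 + t ^ 2 <= 2 * (1 + (t + l) ^ 2) * (1 + l ^ 2) by nra.
  have -> : phiA (t + l) * exp (s * t) = phiA (t + l) * exp (s * (t + l)) * exp (- s * l).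
  { rewrite Rmult_assoc -exp_plus. congr (_ * exp _). ring. }
  have el := exp_pos (- s * l).
  have hl := hL n. rewrite -/l in hl.
  have e3 : exp (- s * l) = exp (- (1 + (s - 1) / 2) * l) * exp (- ((s - 1) / 2) * l) by rewrite -exp_plus; congr exp; field.
  set X := phiA (t + l) * exp (s * (t + l)) in q b *.
  apply: Rle_trans (_ : X * exp (- s * l) * (2 * (1 + (t + l) ^ 2) * (1 + l ^ 2)) <= _).
  { apply: Rmult_le_compat_l => //. left. exact: Rmult_lt_0_compat. }
  rewrite e3. have e4 := exp_pos (- (1 + (s - 1) / 2) * l). have e5 := exp_pos (- ((s - 1) / 2) * l).
  set E1 := exp (- (1 + (s - 1) / 2) * l) in e4 *. set E2 := exp (- ((s - 1) / 2) * l) in e5 hl *.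
  have -> : X * (E1 * E2) * (2 * (1 + (t + l) ^ 2) * (1 + l ^ 2)) = 2 * (X * (1 + (t + l) ^ 2)) * (E2 * (1 + l ^ 2)) * E1 by ring.
  apply: Rmult_le_compat_r; first lra. apply: Rmult_le_compat; try nra. }
have If : forall n, isI (f n) (RtoC (exp (- s * lnS n) * gA s)).
{ move=> n. have h := @isI_comp_aff (aInt s) 1 (lnS n) (RtoC (gA s)) (or_introl eq_refl) (aInt_cont s) (isI_aInt s0).
  have c : forall t, rcont (fun t => aInt s (1 * t + lnS n)) t.
  { move=> t. apply: rcont_RtoC_diff. rewrite /phiA. auto_derive. by []. }
  rewrite RtoC_mult. apply: isI_ext (isI_scal (RtoC (exp (- s * lnS n))) c h) => t. by rewrite fe. }
have sf : forall t, Cser (fun n => f n t) (RtoC (W t * exp (s * t))).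
{ move=> t. have ex := om_ex (exp_pos (2 * t)).
  have h := Cser_scal (RtoC (exp (s * t))) (Cser_Series ex). rewrite -RtoC_mult (Rmult_comm (exp (s * t))) in h.
  apply: Cser_ext h => n. rewrite W_term -RtoC_mult. congr RtoC. ring. }
have [G [hG [hI _]]] := isI_series df ms sf If.
have h2 : Cser (fun n => RtoC (exp (- s * lnS n) * gA s)) (RtoC (zR s * gA s)).
{ apply/Cser_RtoC. have := is_series_scal_r (gA s) _ _ (Series_correct _ (zR_ex hs)). by []. }
by rewrite -(Cser_unique hG h2).
Qed.

(* Evenness replaces W (- u), via the functional equation of theta; the difference is the polar part [rneg]. *)
Definition Phi (u : R) : R := W (Rabs u) * exp (Rabs u / 2).

Lemma W_fe (u : R) : 1 + 2 * W (- u) = exp u * (1 + 2 * W u).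
Proof.
have h := theta_fe (exp_pos (2 * u)). rewrite /theta -exp_Ropp (_ : - (2 * u) = 2 * - u) in h; last ring.
rewrite -/(W (- u)) -/(W u) in h. rewrite h. congr (_ * _).
have -> : exp (2 * u) = exp u * exp u by rewrite -exp_plus; congr exp; ring. apply: sqrt_square. left. exact: exp_pos.
Qed.

(** For x, y >= 1 one has 2xy >= x + y, so exp(-pi x y) splits into a factor decaying in y = e^(2v)
    and the terms of [om] at 1/2. *)
Lemma W_bound (v : R) : 0 <= v -> 0 <= W v <= om (1/2) * exp (- (PI / 2) * exp (2 * v)).
Proof.
move=> hv. split; first by apply: om_pos; exact: exp_pos. have hp := PI_RGT_0.
rewrite /W /om (Rmult_comm (Series _)) -Series_scal_l. apply: Series_le; last by apply: (ex_series_scal_l _ _ (om_ex (x := 1/2) _)); lra.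
move=> n. split; first by left; exact: exp_pos. rewrite -exp_plus. apply: exp_le.
set y := exp (2 * v). have y1 : 1 <= y by rewrite /y -exp_0; apply: exp_le; lra.
have x1 : 1 <= INR (S n) ^ 2. { rewrite S_INR. have := pos_INR n. nra. }
set x := INR (S n) ^ 2 in x1 *. have : 0 <= (y - 1) * (x - 1) by nra. nra.
Qed.

Lemma Phi_bound (B : R) : 0 < B -> exists K, forall u, 0 <= Phi u <= K * exp (- B * Rabs u).
Proof.
move=> hB. have hp := PI_RGT_0. have [N hN] := nfloor_ex (B + 1/2) ltac:(lra).
have [K [K0 h]] := @pow_exp_bound (S N) (PI / 2) ltac:(lra). exists (om (1/2) * K). move=> u. rewrite /Phi.
set v := Rabs u. have v0 : 0 <= v by exact: Rabs_pos. have [w0 w1] := W_bound v0.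
have e0 := exp_pos (v / 2). split; first by apply: Rmult_le_pos; lra.
apply: Rle_trans (_ : om (1 / 2) * exp (- (PI / 2) * exp (2 * v)) * exp (v / 2) <= _). { nra. }
rewrite !Rmult_assoc. apply: Rmult_le_compat_l. { apply: om_pos; lra. }
set y := exp (2 * v). have y0 : 0 < y by exact: exp_pos. have hy := h y ltac:(lra).
have e1 : exp (v / 2) <= y ^ (S N) * exp (- B * v).
{ rewrite /y -Rpower_pow; last exact: exp_pos. rewrite /Rpower ln_exp -exp_plus. apply: exp_le. rewrite S_INR. nra. }
have := exp_pos (- (PI / 2) * y). have := exp_pos (- B * v). set E := exp (- (PI / 2) * y) in hy *. set F := exp (- B * v) in e1 *. nra.
Qed.

(** With |t| the argument e^(2|t|) is at least 1, so the series is dominated by its value at x = 1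
    uniformly in t. *)
Lemma W_abs_cont (t : R) : rcont (fun t => RtoC (W (Rabs t))) t.
Proof.
apply: (@series_rcont (fun n t => RtoC (exp (- (PI * exp (2 * Rabs t)) * INR (S n) ^ 2))) _ (fun n => exp (- (PI * 1) * INR (S n) ^ 2))).
- move=> n s. apply: rcont_RtoC. apply: (continuous_comp Rabs (fun x => exp (- (PI * exp (2 * x)) * INR (S n) ^ 2))).
  + exact: continuous_Rabs.
  + apply: ex_derive_continuous. auto_derive. by [].
- move=> n s. rewrite Cmod_RtoC_pos; last by left; exact: exp_pos. apply: exp_le. have hp := PI_RGT_0.
  have : 1 <= exp (2 * Rabs s). { rewrite -exp_0. apply: exp_le. have := Rabs_pos s. lra. }
  have := pow2_ge_0 (INR (S n)). move=> a b. have : 0 <= PI * (exp (2 * Rabs s) - 1) by nra. nra.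
- exact: om_ex Rlt_0_1.
- move=> s. apply: Cser_Series. apply: om_ex. exact: exp_pos.
Qed.

Lemma Phi_cont (t : R) : rcont (fun t => RtoC (Phi t)) t.
Proof.
have h : rcont (fun t => RtoC (W (Rabs t)) * RtoC (exp (Rabs t / 2)))%C t.
{ apply: rcont_mult; first exact: W_abs_cont. apply: rcont_RtoC. apply: (continuous_comp Rabs (fun x => exp (x / 2))); first exact: continuous_Rabs.
  apply: ex_derive_continuous. auto_derive. by []. }
move=> e he. case: (h e he) => d [hd H]. exists d. split => // u hu. have := H u hu. by rewrite -!RtoC_mult.
Qed.

Definition PhiE (w : R) : R -> C := fun u => RtoC (Phi u * exp (w * u)).

Lemma PhiE_cont (w t : R) : rcont (PhiE w) t.
Proof.
have h : rcont (fun t => RtoC (Phi t) * RtoC (exp (w * t)))%C t.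
{ apply: rcont_mult; first exact: Phi_cont. apply: rcont_RtoC_diff. auto_derive. by []. }
move=> e he. case: (h e he) => d [hd H]. exists d. split => // u hu. have := H u hu. by rewrite /PhiE -!RtoC_mult.
Qed.

Lemma Phi_weight (w : R) : exists K, 0 <= K /\ forall u, Phi u * exp (2 * Rabs w * Rabs u) * (1 + u ^ 2) <= K.
Proof.
have [K h] := @Phi_bound (2 * Rabs w + 1) ltac:(have := Rabs_pos w; lra). have [L [L0 hL]] := @expabs_dom 1 1 Rlt_0_1.
have K0 : 0 <= K. { have [a b] := h 0. rewrite Rabs_R0 Rmult_0_r exp_0 in b. lra. }
exists (K * L). split; first by apply: Rmult_le_pos; lra.
move=> u. have [p0 p1] := h u. have q := hL u. rewrite pow_1 in q.
have e : exp (- (2 * Rabs w + 1) * Rabs u) * exp (2 * Rabs w * Rabs u) = exp (- (1) * Rabs u) by rewrite -exp_plus; congr exp; ring.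
have t2 := pow2_ge_0 u. have x := exp_pos (2 * Rabs w * Rabs u).
apply: Rle_trans (_ : K * exp (- (2 * Rabs w + 1) * Rabs u) * exp (2 * Rabs w * Rabs u) * (1 + u ^ 2) <= _).
{ apply: Rmult_le_compat_r; first lra. apply: Rmult_le_compat_r; lra. }
rewrite (Rmult_assoc K) e Rmult_assoc. apply: Rmult_le_compat_l; lra.
Qed.

Lemma PhiE_dom (w : R) : exists K, dom (PhiE w) K.
Proof.
have [K [K0 h]] := Phi_weight w. exists K. split; first exact: PhiE_cont.
move=> t. have t2 := pow2_ge_0 t. have p : 0 < 1 + t ^ 2 by lra. have [K' hK'] := @Phi_bound 1 Rlt_0_1. have [f0 _] := hK' t.
rewrite Cmod_RtoC_pos; last by apply: Rmult_le_pos => //; left; exact: exp_pos.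
apply: (proj1 (Rle_div_r _ _ _ p)). apply: Rle_trans (h t). apply: Rmult_le_compat_r; first lra. apply: Rmult_le_compat_l => //.
apply: exp_le. have := Rle_abs (w * t). rewrite Rabs_mult. have := Rabs_pos w. have := Rabs_pos t. nra.
Qed.

Definition rneg (u : R) : R := Rmax 0 ((exp (- (u / 2)) - exp (u / 2)) / 2).

Lemma W_Phi (w u : R) : W u * exp ((1/2 + w) * u) = Phi u * exp (w * u) + rneg u * exp (w * u).
Proof.
have -> : (1/2 + w) * u = u / 2 + w * u by field. rewrite exp_plus -Rmult_assoc -Rmult_plus_distr_r. congr (_ * _).
rewrite /Phi /rneg. case: (Rle_dec 0 u) => hu.
- rewrite Rabs_pos_eq // Rmax_left; first ring. have : exp (- (u / 2)) <= exp (u / 2) by apply: exp_le; lra. lra.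
- rewrite Rabs_left1; last lra. rewrite Rmax_right. 2: { have : exp (u / 2) <= exp (- (u / 2)) by apply: exp_le; lra. lra. }
  have h := W_fe u. have e1 : exp (- u / 2) * exp (- u / 2) * exp u = 1 by rewrite -!exp_plus -exp_0; congr exp; field.
  have e2 : exp (u / 2) * exp (u / 2) = exp u by rewrite -exp_plus; congr exp; field.
  have e3 : exp (- (u / 2)) = exp (- u / 2) by congr exp; field.
  have e4 : exp (u / 2) * exp (- u / 2) = 1 by rewrite -exp_plus -exp_0; congr exp; field.
  rewrite e3. set p := exp (u / 2) in e2 e4 *. set q := exp (- u / 2) in e1 e4 *.
  have h' : W (- u) = (exp u * (1 + 2 * W u) - 1) / 2 by lra. rewrite h' -e2.
  transitivity ((p * p * (1 + 2 * W u) * q - q + q - p) / 2). 2: field.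
  have -> : p * p * (1 + 2 * W u) * q = p * (1 + 2 * W u) * (p * q) by ring. rewrite e4. field.
Qed.

Lemma rneg_cont (w t : R) : rcont (fun u => RtoC (rneg u * exp (w * u))) t.
Proof.
apply: rcont_RtoC. apply: (continuous_mult rneg).
- apply: (continuous_comp (fun u => (exp (- (u / 2)) - exp (u / 2)) / 2) (fun x => Rmax 0 x)).
  + apply: ex_derive_continuous. auto_derive. by [].
  + apply: (continuous_ext (fun x => (x + Rabs x) / 2)).
    * move=> x. rewrite /Rmax. case: (Rle_dec 0 x) => h; [rewrite Rabs_pos_eq //; lra | rewrite Rabs_left; lra].
    * apply: (continuous_mult (fun x => x + Rabs x) (fun _ => / 2)); last exact: continuous_const.
      apply: (continuous_plus (fun x => x) Rabs); [exact: continuous_id | exact: continuous_Rabs].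
- apply: ex_derive_continuous. auto_derive. by [].
Qed.

(** An explicit antiderivative on u <= 0. The value is the polar part at s = 0 and s = 1 of the
    completed zeta function, as w^2 - 1/4 = s (s - 1). *)
Lemma rneg_int (w : R) : 1/2 < w -> isI (fun u => RtoC (rneg u * exp (w * u))) (RtoC (/ (2 * (w ^ 2 - 1/4)))).
Proof.
move=> hw. pose G u := (exp ((w - 1/2) * u) / (w - 1/2) - exp ((w + 1/2) * u) / (w + 1/2)) / 2.
have G0 : G 0 = / (2 * (w ^ 2 - 1/4)). { rewrite /G !Rmult_0_r exp_0. field. repeat split; nra. }
have key : forall a b, a <= 0 -> 0 <= b -> CInt (fun u => RtoC (rneg u * exp (w * u))) a b = RtoC (G 0 - G a).
{ move=> a b ha hb. apply: is_CInt_unique.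
  have c1 : is_CInt (fun u => RtoC (rneg u * exp (w * u))) a 0 (RtoC (G 0) - RtoC (G a))%C.
  { apply: (@is_CInt_FTC (fun u => RtoC (G u))) => //.
    - move=> t ht. apply: rderiv_RtoC. have -> : rneg t * exp (w * t) = (exp ((w - 1/2) * t) - exp ((w + 1/2) * t)) / 2.
      { rewrite /rneg Rmax_right. 2: { have : exp (t / 2) <= exp (- (t / 2)) by apply: exp_le; lra. lra. }
        have -> : (w - 1/2) * t = - (t / 2) + w * t by field. have -> : (w + 1/2) * t = t / 2 + w * t by field. rewrite !exp_plus. field. }
      rewrite /G. auto_derive => //. field. lra.
    - move=> t _. exact: rneg_cont. }
  have c2 : is_CInt (fun u => RtoC (rneg u * exp (w * u))) 0 b (RtoC 0).
  { apply: (@is_CInt_ext (fun _ => RtoC 0)) => //.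
    - move=> t ht. congr RtoC. rewrite /rneg Rmax_left; first ring. have : exp (- (t / 2)) <= exp (t / 2) by apply: exp_le; lra. lra.
    - have := is_RInt_const (V := C_R_NormedModule) 0 b (RtoC 0). by rewrite scal_R_Cmult Cmult_0_r. }
  have := is_CInt_Chasles c1 c2. by rewrite Cplus_0_r RtoC_minus. }
move=> e he. 
have gb : forall a, a <= 0 -> Rabs (G a) <= exp ((w - 1/2) * a) / (w - 1/2).
{ move=> a ha. have p1 := exp_pos ((w - 1/2) * a). have p2 := exp_pos ((w + 1/2) * a).
  have p3 : exp ((w + 1/2) * a) <= exp ((w - 1/2) * a) by apply: exp_le; nra. have i2 : 0 < / (w + 1/2) by apply: Rinv_0_lt_compat; lra.
  have i3 : / (w + 1/2) <= / (w - 1/2) by apply: Rinv_le_contravar; lra.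
  rewrite /G. set x := exp ((w - 1/2) * a) in p1 p3 *. set y := exp ((w + 1/2) * a) in p2 p3 *.
  have : 0 <= y / (w + 1/2) by nra. have : y / (w + 1/2) <= x / (w - 1/2) by nra.
  move=> h1 h2. rewrite Rabs_pos_eq; lra. }
set d := w - 1/2 in gb *. have d0 : 0 < d by rewrite /d; lra.
exists (/ (d * d * e)). have de : 0 < / (d * d * e). { apply: Rinv_0_lt_compat. repeat apply: Rmult_lt_0_compat => //. }
split; first lra. move=> a b ha hb. rewrite key; try lra. rewrite -RtoC_minus Cmod_R -G0.
have -> : G 0 - G a - G 0 = - G a by ring. rewrite Rabs_Ropp. apply: Rle_lt_trans (gb a ltac:(lra)) _.
apply/Rlt_div_l => //. have h := exp_ineq1_le (d * - a). have ee : exp (d * a) * exp (d * - a) = 1 by rewrite -exp_plus -exp_0; congr exp; ring. have q : 1 <= (d * - a) * (e * d). { have : d * d * e * / (d * d * e) = 1 by field; nra. nra. }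
have ed : 0 < e * d by nra.
have X0 := exp_pos (d * - a). apply: (Rmult_lt_reg_r _ _ _ X0). rewrite ee. apply: Rlt_le_trans (_ : e * d * (1 + d * - a) <= _); first lra. apply: Rmult_le_compat_l; lra.
Qed.

Lemma Phi_mellin (w : R) : 1/2 < w -> isI (PhiE w) (RtoC (zR (1/2 + w) * gA (1/2 + w) - / (2 * (w ^ 2 - 1/4)))).
Proof.
move=> hw. have m := @mellin (1/2 + w) ltac:(lra). have [K hK] := PhiE_dom w.
have h := isI_plus (@PhiE_cont w) (@rneg_cont w) (isI_II hK) (rneg_int hw).
have h2 : isI (fun u => RtoC (W u * exp ((1/2 + w) * u))) (II (PhiE w) + RtoC (/ (2 * (w ^ 2 - 1/4))))%C.
{ apply: isI_ext h => t. rewrite W_Phi RtoC_plus. by []. }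
have e := isI_unique m h2. have := isI_II hK. suff -> : RtoC (zR (1/2 + w) * gA (1/2 + w) - / (2 * (w ^ 2 - 1/4))) = II (PhiE w) by [].
rewrite RtoC_minus e. ring.
Qed.

(** * The transform of [Phi] as a power series in w^2 *)

Lemma pow_fact_exp (x : R) (m : nat) : 0 <= x -> x ^ m / INR (fact m) <= exp x.
Proof.
move=> hx. have h := is_exp_Reals x. rewrite /is_pseries in h.
have hs : is_series (fun n => x ^ n / INR (fact n)) (exp x).
{ apply: is_series_ext h => n. by rewrite pow_n_pow /scal /= /mult /=. }
rewrite -(is_series_unique _ _ hs).
have p : forall k, 0 <= x ^ k / INR (fact k). { move=> k. apply: Rdiv_le_0_compat; [exact: pow_le | exact: INR_fact_lt_0]. }
have := @Rsum_le_Series _ (S m) p (ex_intro _ _ hs). rewrite /=.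
have : 0 <= Rsum (fun n => x ^ n / INR (fact n)) m. { elim: m => [|m IH] /=; first lra. have := p m. lra. } lra.
Qed.

(** The terms of e^(wu) expanded under the integral; [mu m] is the m-th moment of [Phi] divided by
    m!. *)
Definition mInt (w : R) (m : nat) : R -> C := fun u => RtoC (Phi u * ((w * u) ^ m / INR (fact m))).
Definition mu (m : nat) : R := Re (II (mInt 1 m)).

Lemma Phi_pos (u : R) : 0 <= Phi u.
Proof. have [K h] := @Phi_bound 1 Rlt_0_1. exact: (proj1 (h u)). Qed.

Lemma mInt_cont (w : R) (m : nat) (t : R) : rcont (mInt w m) t.
Proof.
have h : rcont (fun t => RtoC (Phi t) * RtoC ((w * t) ^ m / INR (fact m)))%C t.
{ apply: rcont_mult; first exact: Phi_cont. apply: rcont_RtoC_diff. auto_derive. by []. }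
move=> e he. case: (h e he) => d [hd H]. exists d. split => // u hu. have := H u hu. by rewrite /mInt -!RtoC_mult.
Qed.

(** From x^m / m! = (1/2)^m (2x)^m / m! <= (1/2)^m e^(2x): doubling the exponential rate buys a
    geometric factor, which makes the expansion summable. *)
Lemma mInt_dom (w : R) : exists K, 0 <= K /\ forall m, dom (mInt w m) (K * (1/2) ^ m).
Proof.
have [K [K0 h]] := Phi_weight w. exists K. split => // m. split; first exact: mInt_cont.
move=> t. have t2 := pow2_ge_0 t. have p : 0 < 1 + t ^ 2 by lra. apply: (proj1 (Rle_div_r _ _ _ p)).
rewrite Cmod_R Rabs_mult (Rabs_pos_eq (Phi t)); last exact: Phi_pos.
have fp := INR_fact_lt_0 m. rewrite Rabs_div; last lra. rewrite (Rabs_pos_eq (INR _)); last lra. rewrite -RPow_abs Rabs_mult.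
have q := @pow_fact_exp (2 * Rabs w * Rabs t) m ltac:(have := Rabs_pos w; have := Rabs_pos t; nra).
have e : (Rabs w * Rabs t) ^ m / INR (fact m) = (1/2) ^ m * ((2 * Rabs w * Rabs t) ^ m / INR (fact m)).
{ have -> : Rabs w * Rabs t = 1/2 * (2 * Rabs w * Rabs t) by field. rewrite {1}Rpow_mult_distr. field. lra. }
rewrite e. have hp : 0 < (1/2) ^ m by apply: pow_lt; lra. have := h t. have f0 := Phi_pos t.
set E := exp _ in q *. set X := _ / _ in q *. set Y := (1/2) ^ m in hp *. set Z := 1 + t ^ 2 in p *. move=> ht.
have -> : Phi t * (Y * X) * Z = Phi t * X * Z * Y by ring. apply: Rmult_le_compat_r; first lra. apply: Rle_trans ht.
apply: Rmult_le_compat_r; first lra. by apply: Rmult_le_compat_l.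
Qed.

Lemma isI_mInt (w : R) (m : nat) : isI (mInt w m) (RtoC (w ^ m * mu m)).
Proof.
have [K [K0 h]] := mInt_dom 1. have h1 := isI_real (h m). rewrite -/(mInt 1 m) -/(mu m) in h1.
rewrite RtoC_mult. apply: isI_ext (isI_scal (RtoC (w ^ m)) (@mInt_cont 1 m) h1) => t.
rewrite /mInt -RtoC_mult. congr RtoC. rewrite !Rpow_mult_distr pow1. field. exact: INR_fact_neq_0.
Qed.

Lemma Phi_even (u : R) : Phi (- u) = Phi u.
Proof. by rewrite /Phi Rabs_Ropp. Qed.

Lemma pow_opp_odd (x : R) (n : nat) : (- x) ^ (2 * n + 1) = - x ^ (2 * n + 1).
Proof.
have e : (- x) ^ (2 * n) = x ^ (2 * n). { rewrite (pow_mult (- x) 2 n) (pow_mult x 2 n). congr (_ ^ _). ring. }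
rewrite (pow_add (- x) (2 * n) 1) (pow_add x (2 * n) 1) e !pow_1. ring.
Qed.

Lemma mu_odd (n : nat) : mu (2 * n + 1) = 0.
Proof.
have h := isI_mInt 1 (2 * n + 1). rewrite pow1 Rmult_1_l in h.
have h1 := @isI_comp_aff (mInt 1 (2 * n + 1)) (-1) 0 _ (or_intror eq_refl) (mInt_cont 1 (2 * n + 1)) h.
have h2 := isI_scal (- (1))%C (mInt_cont 1 (2 * n + 1)) h.
have e := isI_unique h1 (isI_ext _ h2).
have {e} e := e ltac:(move=> t; rewrite /mInt (_ : -1 * t + 0 = - t); [rewrite Phi_even (_ : 1 * - t = - (1 * t)); [rewrite pow_opp_odd -RtoC_opp -RtoC_mult; congr RtoC; field; exact: INR_fact_neq_0 | ring] | ring]).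
have e2 : RtoC (mu (2 * n + 1)) = RtoC (- mu (2 * n + 1)). { rewrite {1}e RtoC_opp. ring. }
have := RtoC_inj _ _ e2. lra.
Qed.

Definition kap (j : nat) : R := mu (2 * j).

Lemma isI_zero : isI (fun _ => RtoC 0) (RtoC 0).
Proof.
move=> e he. exists 0. split; first lra. move=> a b _ _. rewrite (@is_CInt_unique _ a b 0) ?Cmod_self //.
have := is_RInt_const (V := C_R_NormedModule) a b (RtoC 0). by rewrite scal_R_Cmult Cmult_0_r.
Qed.

Lemma kap_pos (j : nat) : 0 <= kap j.
Proof.
have h := isI_mInt 1 (2 * j). rewrite pow1 Rmult_1_l in h.
apply: (isI_re_le _ (mInt_cont 1 (2 * j)) _ isI_zero h); first by move=> t; exact: rcont_const.
move=> t. rewrite /mInt !re_RtoC. apply: Rmult_le_pos; first exact: Phi_pos. apply: Rdiv_le_0_compat; last exact: INR_fact_lt_0.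
rewrite (pow_mult (1 * t) 2 j). apply: pow_le. exact: pow2_ge_0.
Qed.

(** The odd moments of the even function [Phi] vanish, so only powers of w^2 remain, with the
    nonnegative coefficients [kap]. *)
Lemma kap_series (w : R) : Cser (fun j => RtoC (kap j * (w ^ 2) ^ j)) (II (PhiE w)).
Proof.
have [K [K0 hd]] := mInt_dom w.
have ms : ex_series (fun m => K * (1/2) ^ m) by apply: (ex_series_scal_l K); apply: ex_series_geom; rewrite Rabs_pos_eq; lra.
have sf : forall t, Cser (fun m => mInt w m t) (PhiE w t).
{ move=> t. have h := is_exp_Reals (w * t). 
  have hs : is_series (fun n => (w * t) ^ n / INR (fact n)) (exp (w * t)).
  { apply: is_series_ext h => n. by rewrite pow_n_pow /scal /= /mult /=. }
  have c := Cser_scal (RtoC (Phi t)) (proj1 (Cser_RtoC _ _) hs). rewrite -RtoC_mult in c.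
  apply: Cser_ext c => n. by rewrite /mInt RtoC_mult. }
have [L [hL [hI _]]] := isI_series hd ms sf (fun m => isI_mInt w m).
rewrite (II_eq hI).
have e : forall n, Csum (fun j => RtoC (kap j * (w ^ 2) ^ j)) n = Csum (fun m => RtoC (w ^ m * mu m)) (2 * n).
{ elim=> [|n IH] //. have -> : (2 * S n = S (S (2 * n)))%nat by lia. rewrite [LHS]/= IH.
  change (Csum (fun m => RtoC (w ^ m * mu m)) (S (S (2 * n)))) with (Csum (fun m => RtoC (w ^ m * mu m)) (2 * n) + RtoC (w ^ (2 * n) * mu (2 * n)) + RtoC (w ^ (S (2 * n)) * mu (S (2 * n))))%C.
  have -> : S (2 * n) = (2 * n + 1)%nat by lia. rewrite mu_odd Rmult_0_r Cplus_0_r. congr (_ + RtoC _)%C. rewrite pow_mult /kap Rmult_comm. congr (_ * _). }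
move=> ep he. case: (hL ep he) => N HN. exists N => n hn. rewrite e. apply: HN. lia.
Qed.

Lemma kap_ex (x : R) : 0 <= x -> ex_series (fun j => kap j * x ^ j).
Proof.
move=> hx. have h := kap_series (sqrt x). have e : (sqrt x) ^ 2 = x by rewrite /= Rmult_1_r sqrt_sqrt.
rewrite e in h. have hr : II (PhiE (sqrt x)) = RtoC (Re (II (PhiE (sqrt x)))).
{ have [K hK] := PhiE_dom (sqrt x). exact: isI_unique (isI_II hK) (isI_real hK). }
rewrite hr in h. exists (Re (II (PhiE (sqrt x)))). exact/Cser_RtoC.
Qed.

Definition KR (x : R) : R := Series (fun j => kap j * x ^ j).
(** Convergence at all nonnegative reals together with [kap] >= 0 gives convergence for every
    complex z, and also puts the maximum on a circle at its positive real point. *)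
Definition KC (z : C) : C := epsilon (inhabits (RtoC 0)) (Cser (fun j => RtoC (kap j) * z ^ j)%C).

Lemma kap_term_mod (z : C) (j : nat) : Cmod (RtoC (kap j) * z ^ j) = kap j * Cmod z ^ j.
Proof. rewrite Cmod_mult Cmod_pow Cmod_RtoC_pos //. exact: kap_pos. Qed.

Lemma KC_ser (z : C) : Cser (fun j => RtoC (kap j) * z ^ j)%C (KC z).
Proof.
apply: (epsilon_spec (inhabits (RtoC 0)) (Cser (fun j => RtoC (kap j) * z ^ j)%C)).
apply: (@Cser_ex _ (fun j => kap j * Cmod z ^ j)); last by apply: kap_ex; exact: Cmod_ge_0.
move=> n. rewrite kap_term_mod. lra.
Qed.

Lemma KC_bound (z : C) (x : R) : Cmod z <= x -> Cmod (KC z) <= KR x.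
Proof.
move=> h. have z0 := Cmod_ge_0 z. apply: (Cser_bound (m := fun j => kap j * x ^ j) _ _ (KC_ser z)); last by apply: kap_ex; lra.
move=> n. rewrite kap_term_mod. apply: Rmult_le_compat_l; first exact: kap_pos. apply: pow_incr. lra.
Qed.

Lemma KC_holo (z : C) : exists l, cderiv KC z l.
Proof.
have z0 := Cmod_ge_0 z.
have du : forall n y, exists l, cderiv (fun z => RtoC (kap n) * z ^ n)%C y l.
{ move=> n y. case: n => [|n].
  - exists (RtoC 0). apply: (@cderiv_ext_loc (fun _ => RtoC (kap 0) * 1)%C _ _ _ 1); [lra | by [] | exact: cderiv_const].
  - eexists. apply: cderiv_scal. exact: cderiv_pow. }
pose dd n := proj1_sig (constructive_indefinite_description _ (du n z)).
have hb : forall n y, disc z 1 y -> Cmod (RtoC (kap n) * y ^ n) <= kap n * (Cmod z + 1) ^ n.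
{ move=> n y hy. rewrite kap_term_mod. apply: Rmult_le_compat_l; first exact: kap_pos. apply: pow_incr. split; first exact: Cmod_ge_0.
  rewrite /disc in hy. have := Cmod_triangle_inv y z. lra. }
have z1 : 0 <= Cmod z + 1 by lra.
have [l [_ hl]] := @weierstrass (fun n z => RtoC (kap n) * z ^ n)%C dd KC (fun j => kap j * (Cmod z + 1) ^ j) z 1 Rlt_0_1 (fun n y _ => du n y) (fun n => proj2_sig (constructive_indefinite_description _ (du n z))) hb (kap_ex z1) (fun y _ => KC_ser y).
by exists l.
Qed.

Lemma KC_real (w : R) : 1/2 < w -> KC (RtoC (w ^ 2)) = RtoC (zR (1/2 + w) * gA (1/2 + w) - / (2 * (w ^ 2 - 1/4))).
Proof.
move=> hw. rewrite -(II_eq (Phi_mellin hw)). apply: Cser_unique (KC_ser _) _.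
apply: Cser_ext (kap_series w) => n. by rewrite RtoC_mult RtoC_pow.
Qed.

Lemma KR_real (w : R) : 1/2 < w -> KR (w ^ 2) = zR (1/2 + w) * gA (1/2 + w) - / (2 * (w ^ 2 - 1/4)).
Proof.
move=> hw. have h := kap_series w. rewrite (II_eq (Phi_mellin hw)) in h. apply: is_series_unique. exact/Cser_RtoC.
Qed.

(* The completed zeta function s (s - 1) pi^(-s/2) Gamma(s/2) zeta(s) / 2 as a function of z = (s - 1/2)^2; see [link]. *)
Definition fx (z : C) : C := (RtoC (1/2) + (z - RtoC (1/4)) * KC z)%C.

Lemma fx_holo (z : C) : exists l, cderiv fx z l.
Proof.
have [l hl] := KC_holo z. eexists. apply: cderiv_plus (cderiv_const _ _) _. apply: (@cderiv_mult (fun z => z - RtoC (1/4))%C KC); last exact: hl.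
apply: cderiv_minus (cderiv_id _) (cderiv_const _ _).
Qed.

Lemma fx_real (w : R) : 1/2 < w -> fx (RtoC (w ^ 2)) = RtoC ((w ^ 2 - 1/4) * (zR (1/2 + w) * gA (1/2 + w))).
Proof.
move=> hw. rewrite /fx KC_real // -RtoC_minus -RtoC_mult -RtoC_plus. congr RtoC. field. nra.
Qed.

Lemma gA_le (s : R) : 1 <= s <= 3 -> gA s <= gA 1 + gA 3.
Proof.
move=> hs. have h1 := isI_aInt (s := 1) ltac:(lra). have h3 := isI_aInt (s := 3) ltac:(lra). have h := isI_aInt (s := s) ltac:(lra).
have := isI_re_le (aInt_cont s) (fun t => rcont_plus (aInt_cont 1 t) (aInt_cont 3 t)) _ h (isI_plus (aInt_cont 1) (aInt_cont 3) h1 h3).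
rewrite -RtoC_plus !re_RtoC. apply. move=> t. rewrite /aInt -RtoC_plus !re_RtoC -Rmult_plus_distr_l. apply: Rmult_le_compat_l. { left. exact: exp_pos. }
have p1 := exp_pos (1 * t). have p3 := exp_pos (3 * t).
case: (Rle_dec 0 t) => ht. { have : exp (s * t) <= exp (3 * t) by apply: exp_le; nra. lra. } have : exp (s * t) <= exp (1 * t) by apply: exp_le; nra. lra.
Qed.

Lemma ln_le_sqrt (s : R) : 1 <= s -> ln s <= 2 * sqrt s.
Proof.
move=> hs. have q : 0 < sqrt s by apply: sqrt_lt_R0; lra. have e : s = sqrt s * sqrt s by rewrite sqrt_sqrt; lra.
rewrite {1}e ln_mult //. have := exp_ineq1_le (ln (sqrt s)). rewrite exp_ln //. lra.
Qed.

(** The recursion gives at most s^((s-1)/2), and log s <= 2 sqrt s turns this into exp(s sqrt s). In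
    z = w^2 that is order 3/4, still below 1. *)
Lemma gA_growth (s : R) : 1 <= s -> gA s <= (gA 1 + gA 3) * exp (s * sqrt s).
Proof.
move=> hs. have c1 := gA_pos (s := 1) ltac:(lra). have c3 := gA_pos (s := 3) ltac:(lra).
have H : forall n s, 1 <= s -> 1 + 2 * INR n <= s <= 3 + 2 * INR n -> gA s <= (gA 1 + gA 3) * s ^ n.
{ elim=> [|n IH] x hx hn. { rewrite /= Rmult_1_r. apply: gA_le. rewrite /= in hn. lra. }
  rewrite S_INR in hn. have n0 := pos_INR n. have e := gA_rec (s := x - 2) ltac:(lra). rewrite (_ : x - 2 + 2 = x) in e; last ring. rewrite e.
  have h := IH (x - 2) ltac:(lra) ltac:(lra). have p : 0 < gA (x - 2) by apply: gA_pos; lra. have hp2 := PI2_3_2.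
  have b : (x - 2) / (2 * PI) <= x. { apply/Rle_div_l; nra. }
  have b0 : 0 <= (x - 2) / (2 * PI) by apply: Rdiv_le_0_compat; lra.
  have q : (x - 2) ^ n <= x ^ n by apply: pow_incr; lra.
  change (x ^ S n) with (x * x ^ n). have -> : (gA 1 + gA 3) * (x * x ^ n) = x * ((gA 1 + gA 3) * x ^ n) by ring. apply: Rmult_le_compat; try lra. nra. }
have [n hn] := nfloor_ex ((s - 1) / 2) ltac:(lra).
apply: Rle_trans (H n s hs _) _; first lra. apply: Rmult_le_compat_l; first lra.
rewrite -Rpower_pow; last lra. rewrite /Rpower. apply: exp_le. have l := ln_le_sqrt hs. have l0 : 0 <= ln s. { rewrite -ln_1. apply: ln_le; lra. } nra.
Qed.

(* x^(3/4): growth of order below 1 suffices for a Hadamard product without exponential factors. *)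
Definition qx (x : R) : R := sqrt x * sqrt (sqrt x).

(** Nonnegative coefficients reduce the bound to the point x = w^2 of the positive axis. There s =
    1/2 + w >= 3/2, so the zeta factor is at most its value at 3/2, [gA] is at most a multiple of
    exp(3 x^(3/4)), and the polynomial factors are absorbed into the exponent. *)
Lemma fx_growth : exists C, 0 < C /\ forall z x, 1 <= x -> Cmod z <= x -> Cmod (fx z) <= exp (C * qx x).
Proof.
have c1 := gA_pos (s := 1) ltac:(lra). have c3 := gA_pos (s := 3) ltac:(lra).
have zpos : forall s, 1 < s -> 0 <= zR s. { move=> s hs. apply: Series_pos (zR_ex hs) => n. left. exact: exp_pos. }
set c := zR (3/2) * (gA 1 + gA 3) + 1. have c0 : 1 <= c. { have := zpos (3/2) ltac:(lra). rewrite /c. nra. }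
exists (ln (3 * c) + 7). have lc : 0 <= ln (3 * c). { rewrite -ln_1. apply: ln_le; lra. }
split; first lra. move=> z x hx hz.
have s1 : 1 <= sqrt x. { rewrite -sqrt_1. apply: sqrt_le_1; lra. }
have ss1 : 1 <= sqrt (sqrt x). { rewrite -[X in X <= _]sqrt_1. apply: sqrt_le_1; lra. }
have e1 : sqrt x * sqrt x = x by apply: sqrt_sqrt; lra. have e2 : sqrt (sqrt x) * sqrt (sqrt x) = sqrt x by apply: sqrt_sqrt; lra.
set w := sqrt x in s1 e1 e2 ss1. set v := sqrt w in e2 ss1.
have q1 : 1 <= qx x. { rewrite /qx -/w -/v. nra. }
set s := 1/2 + w.
have kr : KR x <= zR (3/2) * gA s.
{ have -> : x = w ^ 2 by lra. rewrite KR_real; last lra. rewrite -/s.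
  have i : 0 < / (2 * (w ^ 2 - 1 / 4)) by apply: Rinv_0_lt_compat; nra.
  have : zR s <= zR (3/2). { apply: Series_le; last by apply: zR_ex; lra. move=> n. split; first by left; exact: exp_pos. apply: exp_le. have := lnS_pos n. rewrite /s. nra. }
  have := gA_pos (s := s) ltac:(rewrite /s; lra). nra. }
have ga : gA s <= (gA 1 + gA 3) * exp (3 * qx x).
{ apply: Rle_trans (gA_growth (s := s) ltac:(rewrite /s; lra)) _. apply: Rmult_le_compat_l; first lra. apply: exp_le.
  have b1 : s <= 3/2 * w by rewrite /s; lra. have b2 : sqrt s <= 2 * v.
  { rewrite /v. have -> : 2 = sqrt (2 * 2) by rewrite sqrt_square; lra. rewrite -sqrt_mult; try lra. apply: sqrt_le_1; rewrite /s; lra. }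
  rewrite /qx -/w -/v. have s0 := sqrt_pos s. have : s * sqrt s <= 3/2 * w * (2 * v) by nra. lra. }
have kb := KC_bound hz.
have fz : Cmod (fx z) <= 1/2 + (x + 1/4) * KR x.
{ rewrite /fx. apply: Rle_trans (Cmod_triangle _ _) _. rewrite Cmod_RtoC_pos; last lra. apply: Rplus_le_compat_l. rewrite Cmod_mult.
  apply: Rmult_le_compat; try exact: Cmod_ge_0; last exact: kb. apply: Rle_trans (Cmod_triangle_minus _ _) _. rewrite Cmod_RtoC_pos; lra. }
apply: Rle_trans fz _.
have E0 : 1 <= exp (3 * qx x) by rewrite -exp_0; apply: exp_le; lra.
have kr2 : KR x <= c * exp (3 * qx x). { apply: Rle_trans kr _. have := zpos (3/2) ltac:(lra). rewrite /c. nra. }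
have xe : x <= exp (4 * qx x).
{ have h : v <= exp (qx x). { have := exp_ineq1_le (qx x). rewrite /qx -/w -/v. nra. }
  have -> : exp (4 * qx x) = exp (qx x) ^ 4. { rewrite -Rpower_pow; last exact: exp_pos. rewrite /Rpower ln_exp. congr exp. rewrite /=. ring. }
  have ev : x = v ^ 4 by nra. rewrite {1}ev. apply: pow_incr. lra. }
have fin : 1 / 2 + (x + 1 / 4) * KR x <= 3 * c * (x * exp (3 * qx x)).
{ have : (x + 1/4) * KR x <= (2 * x) * (c * exp (3 * qx x)). { apply: Rle_trans (_ : (x + 1/4) * (c * exp (3 * qx x)) <= _). { nra. } apply: Rmult_le_compat_r; nra. }
  have i1 : 1 * 1 <= x * exp (3 * qx x) by nra.
  have : 1 * 1 <= c * (x * exp (3 * qx x)) by nra. lra. }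
apply: Rle_trans fin _.
have -> : exp ((ln (3 * c) + 7) * qx x) = exp (ln (3 * c) * qx x) * (exp (4 * qx x) * exp (3 * qx x)) by rewrite -!exp_plus; congr exp; ring.
have e3 : 3 * c <= exp (ln (3 * c) * qx x). { rewrite -{1}(exp_ln (3 * c)); last lra. apply: exp_le. nra. }
have := exp_pos (4 * qx x). move=> p4. apply: Rmult_le_compat; nra.
Qed.

(** * Digamma function in the half plane *)

(** The convergence term is chosen so that its partial sums telescope to log(N + 1) / 2; against 1 /
    (s + 2j) it leaves terms of size 1 / j^2. *)
Definition Dl (j : nat) : R := ln (INR (S (S j)) / INR (S j)) / 2.
Definition Dterm (j : nat) (s : C) : C := (RtoC (Dl j) - / (s + RtoC (2 * INR j)))%C.
(* (psi(s/2) - log pi) / 2 on the complex right half plane; [epsilon] picks the sum of the convergent series. *)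
Definition Dc (s : C) : C := (RtoC (- ln PI / 2) + epsilon (inhabits (RtoC 0)) (Cser (fun j => Dterm j s)))%C.

Lemma Dl_bound (j : nat) : Rabs (Dl j - / (2 * INR (S j))) <= / INR (S j) ^ 2.
Proof.
have p := INR_S_pos j. have e : INR (S (S j)) = INR (S j) + 1 by rewrite (S_INR (S j)). rewrite /Dl e. set x := INR (S j) in p *.
have l1 : ln ((x + 1) / x) <= / x.
{ have h := exp_ineq1_le (/ x). have q : 0 < (x + 1) / x by apply: Rdiv_lt_0_compat; lra.
  have -> : / x = ln (exp (/ x)) by rewrite ln_exp. apply: ln_le => //. have -> : (x + 1) / x = 1 + / x by field; lra. exact: h. }
have l2 : / (x + 1) <= ln ((x + 1) / x).
{ have h := exp_ineq1_le (- / (x + 1)). have q : 0 < x / (x + 1) by apply: Rdiv_lt_0_compat; lra.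
  have -> : (x + 1) / x = / (x / (x + 1)) by field; lra. rewrite ln_Rinv //.
  have : ln (x / (x + 1)) <= - / (x + 1). { rewrite -(ln_exp (- / (x + 1))). apply: ln_le => //. have -> : x / (x + 1) = 1 + - / (x + 1) by field; lra. exact: h. } lra. }
have e1 : / (2 * x) = / x / 2 by field; lra. have i : / x - / (x + 1) <= / x ^ 2.
{ have -> : / x - / (x + 1) = / (x * (x + 1)) by field; lra. apply: Rinv_le_contravar; nra. } rewrite e1. apply: Rabs_le. lra.
Qed.

Lemma Dterm_bound (j : nat) (s : C) : 0 < Re s -> Cmod (Dterm j s) <= (3 + 4 * Cmod s + 2 / Re s) * / INR (S j) ^ 2.
Proof.
move=> hs. have p := INR_S_pos j. have b := Dl_bound j. have x2 : 0 < INR (S j) ^ 2 by nra. have i2 := Rinv_0_lt_compat _ x2.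
have m0 := Cmod_ge_0 s. have r0 : 0 < 2 / Re s by apply: Rdiv_lt_0_compat; lra.
have re : Re (s + RtoC (2 * INR j)) = Re s + 2 * INR j by rewrite re_plus re_RtoC.
have j0 := pos_INR j.
have lo : Re s + 2 * INR j <= Cmod (s + RtoC (2 * INR j)). { rewrite -re. apply: Rle_trans (re_le_Cmod _). exact: Rle_abs. }
have nz : (s + RtoC (2 * INR j))%C <> RtoC 0. { apply/Cmod_gt_0. lra. }
case: j p b x2 i2 re j0 lo nz => [|j] p b x2 i2 re j0 lo nz.
- rewrite /Dterm. apply: Rle_trans (Cmod_triangle_minus _ _) _. rewrite Cmod_R Cmod_inv //.
  have q : / Cmod (s + RtoC (2 * INR 0)) <= / Re s. { apply: Rinv_le_contravar => //. rewrite /= in lo *. lra. }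
  have e1 : INR 1 = 1 by []. rewrite e1 in b *. have : Rabs (Dl 0) <= 3/2. { have := Rabs_triang_inv (Dl 0) (/ (2 * 1)). rewrite (Rabs_pos_eq (/ (2 * 1))); last lra. rewrite /= in b. lra. } lra.
- set x := INR (S j) in j0 lo nz re *. have x1 : 1 <= x. { rewrite /x S_INR. have := pos_INR j. lra. }
  have ex : INR (S (S j)) = x + 1 by rewrite /x (S_INR (S j)). rewrite ex in b p x2 i2 *.
  have xn : RtoC (2 * (x + 1)) <> RtoC 0. { move=> e. have := RtoC_inj _ _ e. lra. }
  have -> : Dterm (S j) s = (RtoC (Dl (S j) - / (2 * (x + 1))) + (s - 2) * / (RtoC (2 * (x + 1)) * (s + RtoC (2 * x))))%C.
  { rewrite /Dterm -/x. rewrite !RtoC_minus RtoC_inv; last lra. have x1n : (RtoC x + 1)%C <> 0. { move=> e. apply: xn. rewrite RtoC_mult RtoC_plus e. ring. }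
    rewrite !RtoC_mult RtoC_plus. rewrite RtoC_mult in nz. field. by repeat split. }
  apply: Rle_trans (Cmod_triangle _ _) _. rewrite Cmod_R Cmod_mult Cmod_inv; last by apply: Cmult_neq_0.
  rewrite Cmod_mult Cmod_RtoC_pos; last lra.
  have s2 : Cmod (s - 2) <= Cmod s + 2. { apply: Rle_trans (Cmod_triangle_minus _ _) _. rewrite Cmod_RtoC_pos; lra. }
  have iq : / (2 * (x + 1) * Cmod (s + RtoC (2 * x))) <= / (x + 1) ^ 2 . { apply: Rinv_le_contravar => //. nra. }
  have : Cmod (s - 2) * / (2 * (x + 1) * Cmod (s + RtoC (2 * x))) <= (Cmod s + 2) * / (x + 1) ^ 2.
  { apply: Rmult_le_compat => //; first exact: Cmod_ge_0. left. apply: Rinv_0_lt_compat. nra. }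
  nra.
Qed.

Lemma Dc_ser (s : C) : 0 < Re s -> Cser (fun j => Dterm j s) (Dc s - RtoC (- ln PI / 2))%C.
Proof.
move=> hs. have -> : (Dc s - RtoC (- ln PI / 2))%C = epsilon (inhabits (RtoC 0)) (Cser (fun j => Dterm j s)) by rewrite /Dc; ring.
apply: (epsilon_spec (inhabits (RtoC 0)) (Cser (fun j => Dterm j s))).
apply: (Cser_ex (fun j => Dterm_bound j hs)). exact: (ex_series_scal_l _ _ ex_series_inv_sq).
Qed.

Lemma Dc_bound (s : C) : 0 < Re s -> Cmod (Dc s) <= Rabs (ln PI / 2) + (3 + 4 * Cmod s + 2 / Re s) * Series (fun n => / INR (S n) ^ 2).
Proof.
move=> hs. have b := Cser_bound (fun j => Dterm_bound j hs) (ex_series_scal_l _ _ ex_series_inv_sq) (Dc_ser hs).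
rewrite Series_scal_l in b. have := Cmod_triangle (RtoC (- ln PI / 2)) (Dc s - RtoC (- ln PI / 2)).
replace (RtoC (- ln PI / 2) + (Dc s - RtoC (- ln PI / 2)))%C with (Dc s) by ring. have e : Rabs (- ln PI / 2) = Rabs (ln PI / 2). { rewrite -(Rabs_Ropp (ln PI / 2)). congr Rabs. field. } rewrite Cmod_R e. lra.
Qed.

Lemma Dterm_deriv (j : nat) (s : C) : 0 < Re s -> exists l, cderiv (Dterm j) s l.
Proof.
move=> hs. eexists. apply: cderiv_minus (cderiv_const _ _) _. apply: (@cderiv_comp (fun x => / x)%C (fun y => y + RtoC (2 * INR j))%C).
- apply: cderiv_plus (cderiv_id _) (cderiv_const _ _).
- apply: cderiv_inv. move=> e. have := f_equal Re e. rewrite re_plus re_RtoC /=. have := pos_INR j. lra.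
Qed.

Lemma Dc_holo (s : C) : 0 < Re s -> exists l, cderiv Dc s l.
Proof.
move=> hs. set r := Re s / 2. have r0 : 0 < r by rewrite /r; lra.
have hd : forall y, disc s r y -> r <= Re y /\ Cmod y <= Cmod s + r.
{ move=> y hy. rewrite /disc in hy. split.
  - have := re_le_Cmod (y - s). rewrite re_minus => h. have := Rle_abs (- (Re y - Re s)). rewrite Rabs_Ropp /r in hy *. lra.
  - have := Cmod_triangle_inv y s. lra. }
have du : forall n y, disc s r y -> exists l, cderiv (Dterm n) y l. { move=> n y hy. apply: Dterm_deriv. have := hd y hy. lra. }
have s0 : disc s r s by apply: disc_refl; lra.
pose dd n := proj1_sig (constructive_indefinite_description _ (du n s s0)).
pose S0 y := (Dc y - RtoC (- ln PI / 2))%C.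
have hb : forall n y, disc s r y -> Cmod (Dterm n y) <= (3 + 4 * (Cmod s + r) + 2 / r) * / INR (S n) ^ 2.
{ move=> n y hy. have [h1 h2] := hd y hy. apply: Rle_trans (@Dterm_bound n y ltac:(lra)) _.
  apply: Rmult_le_compat_r. { left. apply: Rinv_0_lt_compat. have := INR_S_pos n. nra. }
  have : 2 / Re y <= 2 / r. { apply: Rmult_le_compat_l; first lra. exact: Rinv_le_contravar. } lra. }
have [l [_ hl]] := @weierstrass Dterm dd S0 (fun n => (3 + 4 * (Cmod s + r) + 2 / r) * / INR (S n) ^ 2) s r r0 du (fun n => proj2_sig (constructive_indefinite_description _ (du n s s0))) hb (ex_series_scal_l _ _ ex_series_inv_sq) (fun y hy => Dc_ser (Rlt_le_trans _ _ _ r0 (proj1 (hd y hy)))).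
exists (l + 0)%C. apply: (@cderiv_ext_loc (fun y => S0 y + RtoC (- ln PI / 2))%C _ _ _ 1); first lra.
- move=> y _. rewrite /S0. ring.
- apply: cderiv_plus hl (cderiv_const _ _).
Qed.

(** By [gD_rec] the partial sums telescope to log(N + 1) / 2 - gD(s + 2N) + gD(s), and [gD_bounds]
    evaluates the limit as log(pi) / 2 + gD(s). *)
Lemma Dc_real (s : R) : 0 < s -> Dc (RtoC s) = RtoC (gD s).
Proof.
move=> hs. have hp := PI_RGT_0.
have h := Dc_ser (s := RtoC s) hs.
suff H : Cser (fun j => Dterm j (RtoC s)) (RtoC (gD s) - RtoC (- ln PI / 2))%C.
{ have e := Cser_unique h H. replace (Dc (RtoC s)) with (Dc (RtoC s) - RtoC (- ln PI / 2) + RtoC (- ln PI / 2))%C by ring. rewrite e. ring. }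
rewrite -RtoC_minus. 
have part : forall N, Csum (fun j => Dterm j (RtoC s)) N = RtoC (ln (INR (S N)) / 2 - (gD (s + 2 * INR N) - gD s)).
{ elim=> [|N IH]. { rewrite /= ln_1. congr RtoC. rewrite Rmult_0_r Rplus_0_r. field. }
  rewrite [LHS]/= IH. have n0 := pos_INR N. rewrite /Dterm -RtoC_plus -RtoC_inv; last lra. rewrite -RtoC_minus -RtoC_plus. congr RtoC.
  have e : s + 2 * INR (S N) = s + 2 * INR N + 2 by rewrite S_INR; ring. rewrite e gD_rec; last lra.
  rewrite /Dl ln_div; try exact: INR_S_pos. field. lra. }
have lim : is_lim_seq (fun N => ln (INR (S N)) / 2 - gD (s + 2 * INR N)) (ln PI / 2).
{ have b : forall N, ln PI / 2 - ln ((s + 2 * INR N) / (2 * INR (S N))) / 2 <= ln (INR (S N)) / 2 - gD (s + 2 * INR N) <= ln PI / 2 - ln ((s + 2 * INR N) / (2 * INR (S N))) / 2 + / (s + 2 * INR N).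
  { move=> N. have n0 := pos_INR N. have n1 := INR_S_pos N. have x0 : 0 < s + 2 * INR N by lra. have [b1 b2] := gD_bounds x0.
    have e : ln ((s + 2 * INR N) / (2 * PI)) = ln ((s + 2 * INR N) / (2 * INR (S N))) + ln (INR (S N)) - ln PI.
    { rewrite !ln_div; try lra. rewrite (ln_mult 2 PI) ?(ln_mult 2 (INR (S N))); lra. }
    lra. }
  have linv : is_lim_seq (fun N => / (s + 2 * INR N)) 0.
  { apply: (is_lim_seq_inv _ p_infty) => //. apply: (is_lim_seq_plus _ _ s p_infty) => //; first exact: is_lim_seq_const.
    apply: (is_lim_seq_mult _ _ 2 p_infty) => //; [exact: is_lim_seq_const | exact: is_lim_seq_INR | rewrite /is_Rbar_mult /=; case: (Rle_dec 0 2) => [h2|]; last lra; case: (Rle_lt_or_eq_dec 0 2 h2) => //; lra]. }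
  have linv2 : is_lim_seq (fun N => / INR (S N)) 0.
  { apply: (is_lim_seq_inv _ p_infty) => //. by apply/(is_lim_seq_incr_1 INR); exact: is_lim_seq_INR. }
  have lq : is_lim_seq (fun N => (s + 2 * INR N) / (2 * INR (S N))) 1.
  { apply: (is_lim_seq_ext (fun N => 1 + (s / 2 - 1) * / INR (S N))).
    - move=> N. have := INR_S_pos N. rewrite S_INR => n1. field. lra.
    - have -> : Finite 1 = Finite (1 + (s/2 - 1) * 0) by congr Finite; ring. apply: is_lim_seq_plus'; first exact: is_lim_seq_const. exact: (is_lim_seq_scal_l _ (s/2 - 1) 0). }
  have ll : is_lim_seq (fun N => ln ((s + 2 * INR N) / (2 * INR (S N)))) 0.
  { rewrite -ln_1. apply: (is_lim_seq_continuous ln _ 1) => //. apply/continuity_pt_filterlim. apply: ex_derive_continuous. exists (/ 1). apply: is_derive_ln. lra. }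
  have ll2 : is_lim_seq (fun N => ln PI / 2 - ln ((s + 2 * INR N) / (2 * INR (S N))) / 2) (ln PI / 2).
  { have -> : Finite (ln PI / 2) = Finite (ln PI / 2 - 0 * / 2) by congr Finite; ring. apply: is_lim_seq_minus'; first exact: is_lim_seq_const. exact: (is_lim_seq_scal_r _ (/ 2) 0). }
  apply: (is_lim_seq_le_le _ _ _ _ b) => //.
  have -> : Finite (ln PI / 2) = Finite (ln PI / 2 + 0) by congr Finite; ring. exact: is_lim_seq_plus'. }
have lim2 : is_lim_seq (fun N => ln (INR (S N)) / 2 - (gD (s + 2 * INR N) - gD s)) (gD s - - ln PI / 2).
{ apply: (is_lim_seq_ext (fun N => (ln (INR (S N)) / 2 - gD (s + 2 * INR N)) + gD s)). { move=> N. ring. }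
  rewrite (_ : gD s - - ln PI / 2 = ln PI / 2 + gD s); last field. apply: is_lim_seq_plus' => //. exact: is_lim_seq_const. }
move/is_lim_seq_spec: lim2 => lim2 e he. case: (lim2 (mkposreal e he)) => N HN. exists N => n hn. rewrite part -RtoC_minus Cmod_R. exact: HN.
Qed.

(** A primitive of the digamma series, normalized at s = 1: its exponential is the complex Gamma
    factor divided by [gA 1]. *)
Definition ell (s : C) : C := seg Dc 1 s.

Lemma rehalf_convex (m : R) : convexC (fun z => m <= Re z).
Proof. apply: (@halfplane_re_convex (fun x => m <= x)) => a b t ha hb ht. nra. Qed.

Lemma rehalf_closed (m : R) : closedC (fun z => m <= Re z).
Proof.
apply: (@re_closed (fun x => m <= x)) => x h. apply: le_epsilon => e he. case: (h e he) => y [py hy]. move/Rabs_def2: hy. lra.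
Qed.

Lemma ell_deriv (s : C) : 0 < Re s -> cderiv ell s (Dc s).
Proof.
move=> hs. set m := Rmin (Re s / 2) 1. have m0 : 0 < m by apply: Rmin_glb_lt; lra.
have m1 : m <= 1 by exact: Rmin_r. have m2 : m <= Re s / 2 by exact: Rmin_l.
apply: (@primitive_convex (fun z => m <= Re z) Dc 1 s (Re s / 2)).
- exact: rehalf_convex. - exact: rehalf_closed.
- move=> y hy. apply: Dc_holo. lra.
- exact: m1.
- lra.
- move=> y hy. have := re_le_Cmod (y - s). rewrite re_minus => h. have := Rle_abs (- (Re y - Re s)). rewrite Rabs_Ropp. lra.
Qed.

(** * Zeros of zeta *)

Lemma natCpow_Cexp (n : nat) (s : C) : natCpow (S n) s = Cexp (s * RtoC (lnS n)).
Proof.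
rewrite /natCpow /Cexp /cis -/(lnS n).
have -> : Re (s * RtoC (lnS n)) = Re s * lnS n by case: s => a b; rewrite /=; ring.
have -> : Im (s * RtoC (lnS n)) = Im s * lnS n by case: s => a b; rewrite /=; ring. by [].
Qed.

Definition zterm (n : nat) (s : C) : C := Cexp (- (s * RtoC (lnS n)))%C.

Lemma zterm_inv (n : nat) (s : C) : (/ natCpow (S n) s)%C = zterm n s.
Proof.
rewrite natCpow_Cexp /zterm. set x := (s * RtoC (lnS n))%C.
have e : (Cexp x * Cexp (- x) = 1)%C. { rewrite -Cexp_plus. replace (x + - x)%C with (RtoC 0) by ring. exact: Cexp_0. }
have h := @Cexp_neq0 x. replace (Cexp (- x)) with (/ Cexp x * (Cexp x * Cexp (- x)))%C. { rewrite e. by field. } by field.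
Qed.

Definition zeta_like (zeta : C -> C) : Prop :=
  (forall s, 1 < Re s -> Cser (fun n => zterm n s) (zeta s)) /\ forall s, s <> RtoC 1 -> exists l, cderiv zeta s l.

Lemma zeta_like_of (zeta : C -> C) : is_Riemann_zeta zeta -> zeta_like zeta.
Proof.
case=> h1 h2. split.
- move=> s hs. have h := proj2 (Cser_is_series _ _) (h1 s hs). apply: Cser_ext h => n. exact: zterm_inv.
- move=> s hs. case: (h2 s hs) => l hl. exists l. exact/cderiv_is_derive.
Qed.

Lemma zterm_mod (n : nat) (s : C) : Cmod (zterm n s) = exp (- Re s * lnS n).
Proof. rewrite /zterm Cmod_Cexp. congr exp. case: s => a b /=. ring. Qed.

Lemma zterm_real (n : nat) (s : R) : zterm n (RtoC s) = RtoC (exp (- s * lnS n)).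
Proof. rewrite /zterm -RtoC_mult -RtoC_opp Cexp_RtoC. congr (RtoC (exp _)). ring. Qed.

Lemma zeta_real (zeta : C -> C) (s : R) : zeta_like zeta -> 1 < s -> zeta (RtoC s) = RtoC (zR s).
Proof.
case=> h _ hs. apply: Cser_unique (h (RtoC s) hs) _.
have q := Cser_Series (zR_ex hs). apply: Cser_ext q => n. by rewrite zterm_real.
Qed.

Lemma rderiv0_const (F : R -> C) (a b : R) : a <= b -> (forall t, a <= t <= b -> rderiv F t (RtoC 0)) -> F a = F b.
Proof.
move=> ab h. have i := @is_CInt_FTC F (fun _ => RtoC 0) a b ab h (fun t _ => rcont_const _ t).
have z : is_CInt (fun _ => RtoC 0) a b (RtoC 0). { have := is_RInt_const (V := C_R_NormedModule) a b (RtoC 0). by rewrite scal_R_Cmult Cmult_0_r. }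
have e := is_CInt_unique i. rewrite (is_CInt_unique z) in e.
replace (F b) with ((F b - F a) + F a)%C by ring. rewrite -e. ring.
Qed.

Lemma RtoC_neq (x y : R) : x <> y -> RtoC x <> RtoC y.
Proof. move=> h e. exact: h (RtoC_inj _ _ e). Qed.

(** gA t e^(-ell t) has derivative 0, since [gA1] / [gA] = [gD] agrees with [Dc] on the positive
    axis. *)
Lemma gA_ell (s : R) : 0 < s -> RtoC (gA s) = (RtoC (gA 1) * Cexp (ell (RtoC s)))%C.
Proof.
move=> hs. pose P t := (RtoC (gA t) * Cexp (- ell (RtoC t)))%C.
have d : forall t, 0 < t -> rderiv P t (RtoC 0).
{ move=> t ht. have g0 := gA_pos ht.
  have d1 := rderiv_RtoC (gA_derive ht).
  have d2 : rderiv (fun t => Cexp (- ell (RtoC t))) t (Cexp (- ell (RtoC t)) * (- Dc (RtoC t)))%C.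
  { apply: (@rderiv_comp Cexp (fun t => - ell (RtoC t))%C); last exact: Cexp_cderiv.
    have e : (- Dc (RtoC t))%C = (- Dc (RtoC t) * RtoC 1)%C by ring. rewrite e.
    apply: (@rderiv_comp (fun z => - ell z)%C RtoC). { apply: (rderiv_RtoC (g := fun x => x)). exact: is_derive_id. }
    apply: cderiv_opp. exact: ell_deriv. }
  apply: rderiv_eq (rderiv_mult d1 d2) _. rewrite (Dc_real ht) /gD.
  have -> : RtoC (gA1 t / gA t) = (RtoC (gA1 t) / RtoC (gA t))%C by rewrite /Rdiv RtoC_mult RtoC_inv //; lra.
  field. apply: RtoC_neq. lra. }
have c : P s = P 1.
{ case: (Rle_dec s 1) => h. - by apply: rderiv0_const => // t ht; apply: d; lra.
  - symmetry. apply: rderiv0_const; first lra. move=> t ht; apply: d; lra. }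
have P1 : P 1 = RtoC (gA 1). { rewrite /P /ell seg_pp. replace (- RtoC 0)%C with (RtoC 0) by ring. rewrite Cexp_0. ring. }
rewrite -P1 -c /P -Cmult_assoc -Cexp_plus. replace (- ell (RtoC s) + ell (RtoC s))%C with (RtoC 0) by ring. rewrite Cexp_0. ring.
Qed.

(** The archimedean factor s (s - 1) pi^(-s/2) Gamma(s/2) / 2 on Re s > 0. *)
Definition hfac (s : C) : C := (RtoC (gA 1) * (s * (s - 1)) * Cexp (ell s))%C.

Lemma hfac_deriv (s : C) : 0 < Re s -> s <> RtoC 1 -> cderiv hfac s (hfac s * (/ s + / (s - 1) + Dc s))%C.
Proof.
move=> hs h1. have s0 : s <> RtoC 0. { move=> e. rewrite e /= in hs. lra. }
apply: (@cderiv_eq _ _ (RtoC (gA 1) * (1 * (s - 1) + s * (1 - 0)) * Cexp (ell s) + RtoC (gA 1) * (s * (s - 1)) * (Cexp (ell s) * Dc s))%C).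
- apply: (@cderiv_mult (fun s => RtoC (gA 1) * (s * (s - 1)))%C (fun s => Cexp (ell s))).
  + apply: cderiv_scal. apply: (@cderiv_mult (fun s => s) (fun s => s - 1)%C); first exact: cderiv_id. exact: cderiv_minus (cderiv_id _) (cderiv_const _ _).
  + exact: (@cderiv_comp Cexp ell) (ell_deriv hs) (Cexp_cderiv _).
- rewrite /hfac. have s1 : (s - 1)%C <> RtoC 0 by apply: Cminus_neq0. field. by split.
Qed.

Lemma hfac_neq0 (s : C) : 0 < Re s -> s <> RtoC 1 -> hfac s <> RtoC 0.
Proof.
move=> hs h1. have s0 : s <> RtoC 0. { move=> e. rewrite e /= in hs. lra. }
have g := gA_pos Rlt_0_1. rewrite /hfac. apply: Cmult_neq_0; last exact: Cexp_neq0.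
apply: Cmult_neq_0; first by apply: RtoC_neq; lra. apply: Cmult_neq_0 => //. exact: Cminus_neq0.
Qed.

Definition ssq (s : C) : C := ((s - RtoC (1/2)) * (s - RtoC (1/2)))%C.

Lemma ssq_deriv (s : C) : cderiv ssq s (2 * (s - RtoC (1/2)))%C.
Proof.
have d : cderiv (fun s => s - RtoC (1/2))%C s 1. { apply: cderiv_eq (cderiv_minus (cderiv_id _) (cderiv_const _ _)) _. ring. }
apply: cderiv_eq (cderiv_mult d d) _. ring.
Qed.

Lemma path_re (a b : C) (t : R) : Re (path a b t) = Re a + t * (Re b - Re a).
Proof. case: a => a1 a2. case: b => b1 b2. rewrite /path /=. ring. Qed.

Lemma path_im (a b : C) (t : R) : Im (path a b t) = Im a + t * (Im b - Im a).
Proof. case: a => a1 a2. case: b => b1 b2. rewrite /path /=. ring. Qed.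

(** For real s > 1 this is [fx_real]. The identity theorem carries it over the right half-plane
    along paths that avoid the puncture s = 1. *)
Lemma link (zeta : C -> C) (s : C) : zeta_like zeta -> 0 < Re s -> s <> RtoC 1 -> fx (ssq s) = (hfac s * zeta s)%C.
Proof.
move=> hz. pose G s := (fx (ssq s) - hfac s * zeta s)%C.
suff H : forall s, 0 < Re s -> s <> RtoC 1 -> G s = RtoC 0.
{ move=> h0 h1. have := H s h0 h1. rewrite /G => e. replace (fx (ssq s)) with ((fx (ssq s) - hfac s * zeta s) + hfac s * zeta s)%C by ring. rewrite e. ring. }
have hol : forall s, 0 < Re s -> s <> RtoC 1 -> exists l, cderiv G s l.
{ move=> z h0 h1. have [l hl] := proj2 hz z h1. have [m hm] := fx_holo (ssq z). eexists.
  apply: cderiv_minus. - exact: (@cderiv_comp fx ssq) (ssq_deriv z) hm.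
  - exact: cderiv_mult (hfac_deriv h0 h1) hl. }
have real : forall x, 1 < x -> G (RtoC x) = RtoC 0.
{ move=> x hx. rewrite /G (zeta_real hz hx).
  have -> : ssq (RtoC x) = RtoC ((x - 1/2) ^ 2). { rewrite /ssq -RtoC_minus -RtoC_mult. congr RtoC. ring. }
  rewrite fx_real; last lra. have -> : 1/2 + (x - 1/2) = x by ring. rewrite /hfac !RtoC_mult (@gA_ell x); last lra.
  have -> : RtoC ((x - 1/2) ^ 2 - 1/4) = (RtoC x * (RtoC x - 1))%C. { rewrite -RtoC_minus -RtoC_mult. congr RtoC. field. } ring. }
have acc2 : accz G (RtoC 2).
{ move=> d hd. exists (RtoC (2 + d/2)). split. { rewrite -RtoC_minus Cmod_RtoC_pos; lra. } apply: real. lra. }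
(* First along Re = 2 to the height of z, then horizontally to z. The radius d keeps the discs in Re
   > 0 and, being at most |Im z| / 2, away from 1. *)
have offax : forall z, 0 < Re z -> Im z <> 0 -> G z = RtoC 0.
{ move=> z h0 hi. pose p : C := (2, Im z).
  have b : forall w, Cmod (w - p) < 1/2 -> G w = RtoC 0.
  { apply: (@ident_seg G (RtoC 2) p (1/2)); [lra | | exact: acc2]. move=> t ht y hy.
    have r : 3/2 <= Re y. { have := re_le_Cmod (y - path (RtoC 2) p t). rewrite re_minus. rewrite /disc in hy.
      have -> : Re (path (RtoC 2) p t) = 2 by rewrite /path /p /=; ring. have := Rle_abs (- (Re y - 2)). rewrite Rabs_Ropp. lra. }
    apply: hol; first lra. move=> e. rewrite e /= in r. lra. }
  have ai : 0 < Rabs (Im z) by apply: Rabs_pos_lt.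
  set d := Rmin (Rmin (Re z) 2) (Rabs (Im z)) / 2.
  have m1 := Rmin_l (Rmin (Re z) 2) (Rabs (Im z)). have m2 := Rmin_r (Rmin (Re z) 2) (Rabs (Im z)). have m3 := Rmin_l (Re z) 2. have m4 := Rmin_r (Re z) 2.
  have m0 : 0 < Rmin (Rmin (Re z) 2) (Rabs (Im z)) by repeat apply: Rmin_glb_lt; lra.
  have d0 : 0 < d by rewrite /d; lra.
  apply: (@ident_seg G p z d d0); last by rewrite Cmod_self.
  - move=> t ht y hy. rewrite /disc in hy.
    have ep : Re (path p z t) = 2 + t * (Re z - 2) by rewrite path_re.
    have ei : Im (path p z t) = Im z by rewrite path_im /p /=; ring.
    have := re_le_Cmod (y - path p z t). have := im_le_Cmod (y - path p z t). rewrite re_minus im_minus ep ei => i1 i2.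
    apply: hol.
    + have := Rle_abs (- (Re y - (2 + t * (Re z - 2)))). rewrite Rabs_Ropp. have : Rmin (Re z) 2 <= 2 + t * (Re z - 2) by nra. rewrite /d in hy. lra.
    + move=> e. rewrite e /= in i1 hy. rewrite Rminus_0_l Rabs_Ropp in i1. rewrite /d in hy. lra.
  - apply: (@accz_of_vanish G p (1/2)); [lra | exact: b]. }
(* A real z is an accumulation point of the points z + i e/2, where the identity is already
   known. *)
move=> z h0 h1. case: (Req_dec (Im z) 0) => hi; last exact: offax.
have n1 : Cmod (z - RtoC 1) > 0 by apply: Cmod_minus_gt0.
set d := Rmin (Re z) (Cmod (z - RtoC 1)) / 2.
have m1 := Rmin_l (Re z) (Cmod (z - RtoC 1)). have m2 := Rmin_r (Re z) (Cmod (z - RtoC 1)).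
have m0 : 0 < Rmin (Re z) (Cmod (z - RtoC 1)) by apply: Rmin_glb_lt; lra.
have d0 : 0 < d by rewrite /d; lra.
apply: (@ident_disc G z d); last by rewrite Cmod_self.
- move=> y hy. rewrite /disc in hy. apply: hol.
  + have := re_le_Cmod (y - z). rewrite re_minus. have := Rle_abs (- (Re y - Re z)). rewrite Rabs_Ropp. rewrite /d in hy. lra.
  + move=> e. rewrite e Cmod_minus_sym /d in hy. lra.
- move=> e he. exists (z + RtoC (e/2) * Ci)%C. split.
  + have -> : (z + RtoC (e/2) * Ci - z)%C = (RtoC (e/2) * Ci)%C by ring. rewrite Cmod_mult Cmod_Ci Cmod_RtoC_pos; lra.
  + apply: offax. { have -> : Re (z + RtoC (e/2) * Ci) = Re z by case: z {hi h0 h1 n1 d m1 m2 m0 d0} => a b /=; ring. by []. }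
    have -> : Im (z + RtoC (e/2) * Ci) = Im z + e/2 by case: z {hi h0 h1 n1 d m1 m2 m0 d0} => a b /=; ring. lra.
Qed.

(** The choice Re w >= 0 puts s = 1/2 + w into the half-plane where [link] applies. *)
Lemma Csqrt_ex (z : C) : exists w, (w * w)%C = z /\ 0 <= Re w.
Proof.
case: z => a b. set m := Cmod (a, b).
have am : Rabs a <= m by apply: (re_le_Cmod (a, b)).
have msq : m ^ 2 = a ^ 2 + b ^ 2. { rewrite /m /Cmod pow2_sqrt //=. nra. }
have a1 := Rle_abs a. have a2 := Rle_abs (- a). rewrite Rabs_Ropp in a2.
set p := sqrt ((m + a) / 2). set q := sqrt ((m - a) / 2).
have p2 : p * p = (m + a) / 2 by apply: sqrt_sqrt; lra. have q2 : q * q = (m - a) / 2 by apply: sqrt_sqrt; lra.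
have p0 : 0 <= p by exact: sqrt_pos. have q0 : 0 <= q by exact: sqrt_pos.
have pq0 : 0 <= p * q by nra.
case: (Rle_dec 0 b) => hb.
- exists (p, q). split => //. rewrite /Cmult /=. have : 2 * (p * q) = b by nra. move=> e. congr (_, _); lra.
- exists (p, - q). split => //. rewrite /Cmult /=. have : 2 * (p * q) = - b by nra. move=> e. congr (_, _); lra.
Qed.

Lemma nontriv_pos (zeta : C -> C) (s : C) : 0 < Re s -> s <> RtoC 1 -> zeta s = RtoC 0 -> nontrivial_zero zeta s.
Proof.
move=> h0 h1 hz. split => //. split => //. case=> n e. have := f_equal Re e. rewrite re_RtoC => q. have := INR_S_pos n. lra.
Qed.

Definition gm (rho : nat -> C) (n : nat) : R := Im (rho n).

Section ZeroSet.
Variables (zeta : C -> C) (rho : nat -> C).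
Hypothesis Hz : is_Riemann_zeta zeta.
Hypothesis RH : Riemann_hypothesis zeta.
Hypothesis Hs : all_nontrivial_zeros_simple zeta.
Hypothesis Hr : upper_zero_enumeration zeta rho.

Let hz := zeta_like_of Hz.

Lemma nontriv_upper (s : C) : 0 < Im s -> zeta s = RtoC 0 -> nontrivial_zero zeta s.
Proof.
move=> h0 h. split. { move=> e. rewrite e /= in h0. lra. } split => //. case=> n e. have := f_equal Im e. rewrite /=. lra.
Qed.

Lemma rho_half (n : nat) : rho n = (1/2, gm rho n).
Proof.
have [h1 h2] := proj1 Hr n. have := RH (nontriv_upper h1 h2). rewrite /gm. case: (rho n) => a b /= ->. by [].
Qed.

Lemma gm_pos (n : nat) : 0 < gm rho n.
Proof. exact: (proj1 (proj1 Hr n)). Qed.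

Lemma zeta_simple (s : C) : nontrivial_zero zeta s -> exists l, cderiv zeta s l /\ l <> RtoC 0.
Proof.
move=> h. have [l hl] := proj2 hz s (proj1 h). exists l. split => //. have := Hs h.
by rewrite (is_C_derive_unique _ _ _ (proj1 (cderiv_is_derive _ _ _) hl)).
Qed.

(** The map [ssq] has derivative 0 at 1/2, hence so does [fx (ssq s)]; by [link] a zero of zeta at
    1/2 would be multiple. This excludes the one point of the critical line that neither [rho] nor
    its reflection could reach. *)
Lemma zeta_half : zeta (RtoC (1/2)) <> RtoC 0.
Proof.
move=> h0. have n1 : RtoC (1/2) <> RtoC 1 by apply: RtoC_neq; lra.
have p : 0 < Re (RtoC (1/2)) by rewrite re_RtoC; lra.
have [l [hl l0]] := zeta_simple (nontriv_pos p n1 h0).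
have [m hm] := fx_holo (ssq (RtoC (1/2))).
have d1 := @cderiv_comp fx ssq _ _ _ (ssq_deriv (RtoC (1/2))) hm.
have d2 := cderiv_mult (hfac_deriv p n1) hl.
have loc : forall y, Cmod (y - RtoC (1/2)) < 1/4 -> fx (ssq y) = (hfac y * zeta y)%C.
{ move=> y hy. have := re_le_Cmod (y - RtoC (1/2)). rewrite re_minus re_RtoC => h. apply: (link hz).
  - have := Rle_abs (- (Re y - 1/2)). rewrite Rabs_Ropp. lra.
  - move=> e. rewrite e -RtoC_minus Cmod_RtoC_pos in hy; lra. }
have d3 := @cderiv_ext_loc _ _ _ _ (1/4) ltac:(lra) loc d1.
have := cderiv_unique d2 d3. rewrite h0. move=> e.
apply: (Cmult_neq_0 _ _ (hfac_neq0 p n1) l0).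
have -> : (hfac (RtoC (1/2)) * l)%C = (hfac (RtoC (1 / 2)) * (/ RtoC (1 / 2) + / (RtoC (1 / 2) - 1) + Dc (RtoC (1 / 2))) * RtoC 0 + hfac (RtoC (1 / 2)) * l)%C by ring.
rewrite e. ring.
Qed.

Lemma ssq_crit (g : R) : ssq (1/2, g) = RtoC (- g ^ 2).
Proof. rewrite /ssq /RtoC /Cminus /Cmult /Cplus /Copp /=. congr (_, _); ring. Qed.

(** A square root w of z gives a zero s = 1/2 + w of zeta, on the critical line by RH. If it lies in
    the lower half-plane, 1/2 - w belongs to the same z and is a zero as well; w = 0 is excluded by
    [zeta_half]. *)
Lemma fx_zero (z : C) : fx z = RtoC 0 -> exists n, z = RtoC (- gm rho n ^ 2).
Proof.
move=> h. have [w [ww w0]] := Csqrt_ex z. set s := (RtoC (1/2) + w)%C.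
have es : ssq s = z. { rewrite /ssq /s -ww. ring. }
have rs : Re s = 1/2 + Re w by rewrite /s re_plus re_RtoC.
(* s = 1 would mean z = 1/4, where [fx] takes the value 1/2. *)
have n1 : s <> RtoC 1.
{ move=> e. have hw : w = RtoC (1/2). { have -> : w = (s - RtoC (1/2))%C by rewrite /s; ring. rewrite e -RtoC_minus. congr RtoC. field. }
  have ez : z = RtoC (1/4). { rewrite -ww hw -RtoC_mult. congr RtoC. field. }
  have : fx z = RtoC (1/2). { rewrite ez /fx. ring. } rewrite h => e2. have := RtoC_inj _ _ e2. lra. }
have zs : zeta s = RtoC 0.
{ have l := link hz (s := s) ltac:(lra) n1. rewrite es h in l. have p : 0 < Re s by lra. 
  have hn := hfac_neq0 p n1. replace (zeta s) with (/ hfac s * (hfac s * zeta s))%C by field => //. rewrite -l. ring. }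
have p : 0 < Re s by lra.
have hh := RH (nontriv_pos p n1 zs).
have sE : s = (1/2, Im s). { move: hh. case: (s) => a b /= ->. by []. }
have zE : z = RtoC (- Im s ^ 2). { by rewrite -es {1}sE ssq_crit. }
case: (Rtotal_order (Im s) 0) => [lt|[e0|gt]].
- set s' : C := (1/2, - Im s).
  have n1' : s' <> RtoC 1. { move=> e. have e2 : Im s' = 0 by rewrite e. move: e2. rewrite /s'. change (- Im s = 0 -> False). lra. }
  have p' : 0 < Re s' by rewrite /=; lra.
  have zs' : zeta s' = RtoC 0.
  { have l := link hz p' n1'. have e : ssq s' = z. { rewrite /s' ssq_crit zE. congr RtoC. ring. } rewrite e h in l.
    have hn := hfac_neq0 p' n1'. replace (zeta s') with (/ hfac s' * (hfac s' * zeta s'))%C by field => //. rewrite -l. ring. }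
  have [n hn] := proj1 (proj2 Hr) s' ltac:(change (0 < - Im s); lra) zs'. exists n. rewrite zE /gm hn /=. congr RtoC. ring.
- exfalso. apply: zeta_half. have <- : s = RtoC (1/2) by rewrite sE e0. by [].
- have [n hn] := proj1 (proj2 Hr) s gt zs. exists n. by rewrite zE /gm hn.
Qed.

(** Differentiating [link] at rho_n gives fx' times 2 i gamma_n = hfac times zeta', and neither
    factor on the right vanishes there. *)
Lemma fx_at_zero (n : nat) : fx (RtoC (- gm rho n ^ 2)) = RtoC 0 /\ exists l, cderiv fx (RtoC (- gm rho n ^ 2)) l /\ l <> RtoC 0.
Proof.
have [i0 z0] := proj1 Hr n. have e := rho_half n. have g0 := gm_pos n.
have n1 : rho n <> RtoC 1. { move=> q. rewrite q /= in i0. lra. }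
have p : 0 < Re (rho n) by rewrite e /=; lra.
have es : ssq (rho n) = RtoC (- gm rho n ^ 2) by rewrite {1}e ssq_crit.
split. { rewrite -es (link hz p n1) z0. ring. }
have [l [hl l0]] := zeta_simple (nontriv_upper i0 z0).
have [m hm] := fx_holo (ssq (rho n)).
have d1 := @cderiv_comp fx ssq _ _ _ (ssq_deriv (rho n)) hm.
have d2 := cderiv_mult (hfac_deriv p n1) hl.
have loc : forall y, Cmod (y - rho n) < Rmin (1/4) (gm rho n) -> fx (ssq y) = (hfac y * zeta y)%C.
{ move=> y hy. have m1 := Rmin_l (1/4) (gm rho n). have m2 := Rmin_r (1/4) (gm rho n).
  have := re_le_Cmod (y - rho n). have := im_le_Cmod (y - rho n). rewrite re_minus im_minus {1}e {2}e /= => h1 h2. apply: (link hz).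
  - have := Rle_abs (- (Re y - 1/2)). rewrite Rabs_Ropp. lra.
  - move=> q. rewrite q /= in h1 hy. have := Rle_abs (- (0 - gm rho n)). rewrite Rabs_Ropp. lra. }
have q4 : 0 < 1/4 by lra.
have d3 := @cderiv_ext_loc _ _ _ _ _ (Rmin_glb_lt _ _ _ q4 g0) loc d1.
have q := cderiv_unique d2 d3. rewrite z0 in q. exists m. rewrite -es. split => // m0. rewrite m0 in q.
apply: (Cmult_neq_0 _ _ (hfac_neq0 p n1) l0).
have -> : (hfac (rho n) * l)%C = (hfac (rho n) * (/ rho n + / (rho n - 1) + Dc (rho n)) * RtoC 0 + hfac (rho n) * l)%C by ring.
rewrite q. ring.
Qed.

Lemma gm_inj (m n : nat) : gm rho m = gm rho n -> m = n.
Proof. move=> h. apply: (proj1 (proj2 (proj2 Hr))). by rewrite (rho_half m) (rho_half n) h. Qed.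

Lemma zeta_neq0 (s : C) : 1/2 < Re s -> s <> RtoC 1 -> zeta s <> RtoC 0.
Proof. move=> h n1 z. have p : 0 < Re s by lra. have := RH (nontriv_pos p n1 z). lra. Qed.

(** Logarithmic derivative of [link] at s = 1/2 + w, with 1 / s + 1 / (s - 1) = 2w / (w^2 - 1/4). *)
Lemma fx_logderiv (w l dz : C) : 1/2 < Re w -> cderiv fx (w * w) l -> cderiv zeta (RtoC (1/2) + w) dz ->
  fx (w * w) <> RtoC 0 /\
  (2 * w * (l / fx (w * w)))%C = (2 * w / (w * w - RtoC (1/4)) + Dc (RtoC (1/2) + w) + dz / zeta (RtoC (1/2) + w))%C.
Proof.
move=> hw hl hd. set s := (RtoC (1/2) + w)%C in hd *.
have rs : Re s = 1/2 + Re w by rewrite /s re_plus re_RtoC.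
have n1 : s <> RtoC 1. { move=> e. rewrite e /= in rs. lra. }
have p : 0 < Re s by lra. have p2 : 1/2 < Re s by lra. have zn := zeta_neq0 p2 n1. have hn := hfac_neq0 p n1.
have es : ssq s = (w * w)%C. { rewrite /ssq /s. ring. }
have lk := link hz p n1. rewrite es in lk. rewrite lk. split; first exact: Cmult_neq_0.
rewrite -es in hl.
have d1 := @cderiv_comp fx ssq _ _ _ (ssq_deriv s) hl.
have d2 := cderiv_mult (hfac_deriv p n1) hd.
have loc : forall y, Cmod (y - s) < Re w - 1/2 -> fx (ssq y) = (hfac y * zeta y)%C.
{ move=> y hy. have := re_le_Cmod (y - s). rewrite re_minus rs => h. have h2 := Rle_abs (- (Re y - (1/2 + Re w))). rewrite Rabs_Ropp in h2. apply: (link hz); first lra.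
  move=> e. rewrite e /= in h2 h hy. lra. }
have d3 := @cderiv_ext_loc _ _ _ _ (Re w - 1/2) ltac:(lra) loc d1.
have q := cderiv_unique d3 d2.
have eh : (s - RtoC (1/2))%C = w by rewrite /s; ring. rewrite eh in q.
have -> : (2 * w * (l / (hfac s * zeta s)))%C = (l * (2 * w) / (hfac s * zeta s))%C by field; split.
rewrite q.
have s0 : s <> RtoC 0. { move=> e. rewrite e /= in p. lra. }
have s1 : (s - 1)%C <> RtoC 0 by apply: Cminus_neq0.
have f1 : (w * w - RtoC (1/4))%C = (s * (s - 1))%C. { rewrite /s. have -> : RtoC (1/4) = (RtoC (1/2) * RtoC (1/2))%C by rewrite -RtoC_mult; congr RtoC; field. have e1 : RtoC 1 = (RtoC (1/2) + RtoC (1/2))%C by rewrite -RtoC_plus; congr RtoC; field. rewrite e1. ring. }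
have f2 : (2 * w)%C = (s + (s - 1))%C. { rewrite /s. have e1 : RtoC 1 = (RtoC (1/2) + RtoC (1/2))%C by rewrite -RtoC_plus; congr RtoC; field. replace (RtoC 2) with (RtoC 1 + RtoC 1)%C by (rewrite -RtoC_plus; congr RtoC; ring).
  have -> : (RtoC (1/2) + w + (RtoC (1/2) + w - 1))%C = ((RtoC 1 + RtoC 1) * w + (RtoC (1/2) + RtoC (1/2) - 1))%C by ring. rewrite -e1. ring. }
rewrite f1 f2. field. by repeat split.
Qed.

End ZeroSet.

(** * Dirichlet convolution with the von Mangoldt function *)

Module DirichletConvolution.
Import all_boot.

HB.instance Definition _ := Monoid.isComLaw.Build R 0 Rplus (fun x y z => Logic.eq_sym (Rplus_assoc x y z)) Rplus_comm Rplus_0_l.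

Notation "\Rsum_ ( m <= i < n ) F" := (\big[Rplus/0]_(m <= i < n) F) (at level 41, F at level 41, i, m, n at level 50).

Lemma von_Mangoldt_pos (n : nat) : 0 <= von_Mangoldt n.
Proof.
rewrite /von_Mangoldt. case: ifP => [/andP [h _]|_]; last lra. rewrite -ln_1. apply: ln_le; first lra. apply: (le_INR 1). by apply/leP.
Qed.

Lemma von_Mangoldt_le (n : nat) : (0 < n)%N -> von_Mangoldt n <= ln (INR n).
Proof.
move=> n0. have n1 : 1 <= INR n by apply: (le_INR 1); apply/leP. rewrite /von_Mangoldt. case: ifP => [/andP [h _]|_].
- apply: ln_le. { apply: (lt_INR 0). by apply/ltP. } apply: le_INR. apply/leP. exact: pdiv_leq.
- rewrite -ln_1. apply: ln_le; lra.
Qed.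

Lemma von_Mangoldt_pow (p k : nat) : prime p -> (0 < k)%N -> von_Mangoldt (p ^ k)%N = ln (INR p).
Proof.
move=> hp; case: k => // k _. rewrite /von_Mangoldt pdiv_pfactor // pfactorK // eqxx andbT. by rewrite -{1}(exp1n k.+1) ltn_exp2r // prime_gt1.
Qed.

Lemma von_Mangoldt_cases (d : nat) :
  (exists q j, prime q /\ (0 < j)%N /\ d = (q ^ j)%N) \/ (von_Mangoldt d = 0 /\ forall q j, prime q -> (0 < j)%N -> d <> (q ^ j)%N).
Proof.
case hc : ((1 < d)%N && (d == pdiv d ^ logn (pdiv d) d)%N).
- left. move/andP: hc => [h1 /eqP h2]. exists (pdiv d), (logn (pdiv d) d). split; first exact: pdiv_prime. split => //.
  rewrite logn_gt0. by rewrite mem_primes pdiv_prime // (ltnW h1) pdiv_dvd.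
- right. split; first by rewrite /von_Mangoldt hc. move=> q j hq hj e. move: hc. rewrite e. case: j hj {e} => // j _.
  rewrite pdiv_pfactor // pfactorK // eqxx andbT. by rewrite -{1}(exp1n j.+1) ltn_exp2r // prime_gt1.
Qed.

Definition dterm (n d : nat) : R := if (d %| n)%N then von_Mangoldt d else 0.

(** Passing from m to p m adds exactly one prime power divisor, p^(v + 1) with v the exponent of p
    in m. *)
Lemma dterm_step (p m d : nat) : prime p -> (0 < m)%N ->
  dterm (p * m) d = dterm m d + (if d == (p ^ (logn p m).+1)%N then ln (INR p) else 0).
Proof.
move=> hp m0. have pm0 : (0 < p * m)%N by rewrite muln_gt0 prime_gt0.
case: (von_Mangoldt_cases d) => [[q [j [hq [j0 ->]]]]|[z h]].
- have lg : logn q (p * m) = ((q == p) + logn q m)%N by rewrite (lognM q (prime_gt0 hp) m0) (logn_prime q hp).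
  rewrite /dterm !pfactor_dvdn // lg von_Mangoldt_pow //.
  case: (altP (q =P p)) => [->|ne].
  + rewrite eqn_exp2l ?prime_gt1 // add1n. case: (ltngtP j (logn p m).+1) => h.
    * rewrite -ltnS h. ring. * rewrite leqNgt (ltnW h) /=. ring. * by rewrite h ltnn Rplus_0_l.
  + rewrite add0n. have -> : (q ^ j == p ^ (logn p m).+1)%N = false.
    { apply/eqP => e. move/eqP: ne; apply. have := f_equal pdiv e. case: j j0 {e} => // j _. by rewrite !pdiv_pfactor. }
    ring.
- rewrite /dterm z. have -> : (d == p ^ (logn p m).+1)%N = false by apply/eqP; exact: h. by case: ifP; case: ifP; rewrite Rplus_0_l.
Qed.

(** Strong induction, removing the least prime factor. The upper limit N >= n is independent of n so
    that all n share one index range when the sums are exchanged. *)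
Lemma sum_dterm (n N : nat) : (0 < n)%N -> (n <= N)%N -> \Rsum_(1 <= d < N.+1) dterm n d = ln (INR n).
Proof.
elim/ltn_ind: n => n IH n0 nN. case: (leqP n 1) => h1.
- have -> : n = 1%N by apply/eqP; rewrite eqn_leq h1. rewrite ln_1 big1_seq // => d _. rewrite /dterm dvdn1. case: eqP => // ->. by rewrite /von_Mangoldt.
- set p := pdiv n. have hp : prime p by exact: pdiv_prime. set m := (n %/ p)%N.
  have e : n = (p * m)%N by rewrite mulnC divnK // pdiv_dvd.
  have m0 : (0 < m)%N. { rewrite lt0n. apply/eqP => q. move: n0. by rewrite e q muln0. }
  have mn : (m < n)%N. { by rewrite e -{1}(mul1n m) ltn_mul2r m0 prime_gt1. }
  have := IH m mn m0 (leq_trans (ltnW mn) nN) => hm. rewrite {1}e.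
  rewrite (eq_bigr (fun d => dterm m d + (if d == (p ^ (logn p m).+1)%N then ln (INR p) else 0))); last by move=> d _; exact: dterm_step.
  rewrite big_split /= hm -big_mkcond big_nat1_eq.
  have -> : (1 <= p ^ (logn p m).+1 < N.+1)%N.
  { rewrite expn_gt0 prime_gt0 //= ltnS. apply: leq_trans nN. apply: dvdn_leq => //. by rewrite e expnS dvdn_mul // pfactor_dvdnn. }
  rewrite e mult_INR ln_mult; first ring. { apply: (lt_INR 0). apply/ltP. exact: prime_gt0. } apply: (lt_INR 0). by apply/ltP.
Qed.

Definition ez (s : R) (n : nat) : R := exp (- s * ln (INR n)).

Lemma ez_mul (s : R) (d m : nat) : (0 < d)%N -> (0 < m)%N -> ez s (d * m) = ez s d * ez s m.
Proof.
move=> hd hm. rewrite /ez mult_INR ln_mult; try by apply: (lt_INR 0); apply/ltP. rewrite -exp_plus. congr exp. ring.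
Qed.

Lemma sum_mult (F : nat -> R) (d N : nat) : (0 < d)%N ->
  \big[Rplus/0]_(1 <= n < N.+1 | (d %| n)%N) F n = \Rsum_(1 <= m < (N %/ d).+1) F (d * m)%N.
Proof.
move=> hd. elim: N => [|N IH]; first by rewrite div0n !big_geq.
rewrite big_mkcond big_nat_recr //= -big_mkcond IH divnS //. case: ifP => h.
- rewrite add1n [in RHS]big_nat_recr //=. congr (_ + F _). by rewrite mulnC -{1}(divnK h) divnS // h add1n.
- by rewrite Rplus_0_r.
Qed.

Lemma Rsum_big (F : nat -> R) (N : nat) : \Rsum_(1 <= n < N.+1) F n = Rsum (fun n => F n.+1) N.
Proof. elim: N => [|N IH]; first by rewrite big_geq. by rewrite big_nat_recr //= IH. Qed.

Lemma big_distr (c : R) (F : nat -> R) (a b : nat) : \Rsum_(a <= n < b) (c * F n) = c * \Rsum_(a <= n < b) F n.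
Proof. apply: (big_rec2 (fun x y => x = c * y)) => [|i x y _ ->]; ring. Qed.

Lemma sD_eq (s : R) (N : nat) :
  Rsum (fun n => lnS n * ez s n.+1) N = \Rsum_(1 <= d < N.+1) (von_Mangoldt d * ez s d * Rsum (fun n => ez s n.+1) (N %/ d)).
Proof.
rewrite -(Rsum_big (fun n => ln (INR n) * ez s n)).
rewrite (eq_big_nat _ _ (F2 := fun n => \Rsum_(1 <= d < N.+1) (if (d %| n)%N then von_Mangoldt d * ez s n else 0))); last first.
{ move=> n /andP [h1 h2]. rewrite -(sum_dterm h1 h2) Rmult_comm -big_distr. apply: eq_bigr => d _. rewrite /dterm. case: ifP => _; ring. }
rewrite exchange_big_nat /=. apply: eq_big_nat => d /andP [h1 h2].
rewrite -big_mkcond sum_mult // -Rsum_big -big_distr. apply: eq_big_nat => m /andP [m1 m2]. rewrite ez_mul //. ring.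
Qed.

Lemma big_le (F G : nat -> R) (N : nat) : (forall d, (1 <= d <= N)%N -> F d <= G d) -> \Rsum_(1 <= d < N.+1) F d <= \Rsum_(1 <= d < N.+1) G d.
Proof.
elim: N => [|N IH] h; first by rewrite !big_geq //; lra. rewrite [in X in X <= _]big_nat_recr // [in X in _ <= X]big_nat_recr //.
apply: Rplus_le_compat. { apply: IH => d /andP [h1 h2]. apply: h. by rewrite h1 ltnW. } apply: h. by rewrite leqnn.
Qed.

Lemma Rsum_mono (a : nat -> R) (m n : nat) : (forall k, 0 <= a k) -> (m <= n)%N -> Rsum a m <= Rsum a n.
Proof.
move=> h. elim: n => [|n IH]; first by rewrite leqn0 => /eqP ->; lra. rewrite leq_eqVlt => /orP [/eqP ->|]; first lra. rewrite ltnS => /IH q /=. have := h n. lra.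
Qed.

Lemma ez_pos (s : R) (n : nat) : 0 <= ez s n.
Proof. left. exact: exp_pos. Qed.

Lemma sD_upper (s : R) (N : nat) :
  Rsum (fun n => lnS n * ez s n.+1) N <= Rsum (fun n => von_Mangoldt n.+1 * ez s n.+1) N * Rsum (fun n => ez s n.+1) N.
Proof.
rewrite sD_eq -(Rsum_big (fun n => von_Mangoldt n * ez s n)) Rmult_comm -big_distr. apply: big_le => d /andP [h1 h2]. rewrite Rmult_comm.
apply: Rmult_le_compat_r. { apply: Rmult_le_pos; [exact: von_Mangoldt_pos | exact: ez_pos]. }
apply: Rsum_mono; [by move=> k; exact: ez_pos | exact: leq_div].
Qed.

(** Summation up to K^2 contains the square d, m <= K, because K <= K^2 / d for d <= K. Together
    with [sD_upper] this squeezes the limits of the partial sums. *)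
Lemma sD_lower (s : R) (K : nat) :
  Rsum (fun n => von_Mangoldt n.+1 * ez s n.+1) K * Rsum (fun n => ez s n.+1) K <= Rsum (fun n => lnS n * ez s n.+1) (K * K).
Proof.
rewrite sD_eq -(Rsum_big (fun n => von_Mangoldt n * ez s n)) Rmult_comm -big_distr.
have pos : forall d m, 0 <= von_Mangoldt d * ez s d * Rsum (fun n => ez s n.+1) m.
{ move=> d m. apply: Rmult_le_pos. { apply: Rmult_le_pos; [exact: von_Mangoldt_pos | exact: ez_pos]. }
  elim: m => [|m IH] /=; first lra. have := ez_pos s m.+1. lra. }
apply: Rle_trans (_ : \Rsum_(1 <= d < K.+1) (von_Mangoldt d * ez s d * Rsum (fun n => ez s n.+1) (K * K %/ d)) <= _).
- apply: big_le => d /andP [h1 h2]. rewrite Rmult_comm. apply: Rmult_le_compat_l. { apply: Rmult_le_pos; [exact: von_Mangoldt_pos | exact: ez_pos]. }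
  apply: Rsum_mono; first by move=> k; exact: ez_pos. by rewrite leq_divRL // leq_mul2l h2 orbT.
- rewrite !(Rsum_big (fun d => von_Mangoldt d * ez s d * Rsum (fun n => ez s n.+1) (K * K %/ d))). apply: Rsum_mono; first by move=> k; exact: pos.
  case: K => // K. by rewrite leq_pmulr.
Qed.

Lemma dirichlet_product (s : R) :
  ex_series (fun n => lnS n * exp (- s * lnS n)) -> ex_series (fun n => exp (- s * lnS n)) ->
  ex_series (fun n => von_Mangoldt n.+1 * exp (- s * lnS n)) ->
  Series (fun n => lnS n * exp (- s * lnS n)) = Series (fun n => von_Mangoldt n.+1 * exp (- s * lnS n)) * Series (fun n => exp (- s * lnS n)).
Proof.
move=> e1 e2 e3.
have lim : forall a, ex_series a -> is_lim_seq (fun N => Rsum a N) (Series a).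
{ move=> a ha. apply/is_lim_seq_incr_1. apply: (is_lim_seq_ext (sum_n a)). { move=> n. exact: Rsum_sum_n. } exact: Series_correct. }
have l1 := lim _ e1. have l23 := is_lim_seq_mult' _ _ _ _ (lim _ e3) (lim _ e2).
apply: Rle_antisym.
- exact: (is_lim_seq_le _ _ _ _ (fun N => sD_upper s N) l1 l23).
- apply: (is_lim_seq_le _ (fun _ => Series (fun n => lnS n * exp (- s * lnS n))) _ _ _ l23 (is_lim_seq_const _)).
  move=> K. apply: Rle_trans (sD_lower s K) _. apply: Rsum_le_Series => // k. apply: Rmult_le_pos; [exact: lnS_pos | left; exact: exp_pos].
Qed.

Lemma von_Mangoldt_lnS (n : nat) : 0 <= von_Mangoldt n.+1 <= lnS n.
Proof. split; [exact: von_Mangoldt_pos | exact: von_Mangoldt_le]. Qed.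

End DirichletConvolution.

Definition Lam (n : nat) : R := von_Mangoldt (S n).

Lemma Lam_bound (n : nat) : 0 <= Lam n <= lnS n.
Proof. exact: DirichletConvolution.von_Mangoldt_lnS. Qed.

Lemma lnS_ex (s : R) : 1 < s -> ex_series (fun n => lnS n * exp (- s * lnS n)).
Proof.
move=> hs. set d := (s - 1) / 2. have d0 : 0 < d by rewrite /d; lra.
have [K [K0 h]] := log_weight d0.
apply: (ex_series_pos_le (b := fun n => K * exp (- (1 + d) * ln (INR (S n))))); last by apply: ex_series_scal_l; exact: pseries.
move=> n. have l0 := lnS_pos n. split. { apply: Rmult_le_pos => //. left. exact: exp_pos. }
rewrite -/(lnS n). have -> : - s * lnS n = - d * lnS n + - (1 + d) * lnS n by rewrite /d; field.
rewrite exp_plus -Rmult_assoc. apply: Rmult_le_compat_r; first by left; exact: exp_pos.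
apply: Rle_trans (h n). rewrite Rmult_comm. apply: Rmult_le_compat_l; first by left; exact: exp_pos. nra.
Qed.

Lemma Lam_ex (s : R) : 1 < s -> ex_series (fun n => Lam n * exp (- s * lnS n)).
Proof.
move=> hs. apply: (ex_series_pos_le (b := fun n => lnS n * exp (- s * lnS n))); last exact: lnS_ex.
move=> n. have [h1 h2] := Lam_bound n. have e := exp_pos (- s * lnS n). split; first by apply: Rmult_le_pos; lra. apply: Rmult_le_compat_r; lra.
Qed.

Lemma zterm_deriv (n : nat) (s : C) : cderiv (zterm n) s (- RtoC (lnS n) * zterm n s)%C.
Proof.
have d : cderiv (fun s => - (s * RtoC (lnS n)))%C s (- RtoC (lnS n))%C.
{ apply: cderiv_eq (cderiv_opp (cderiv_mult (cderiv_id s) (cderiv_const (RtoC (lnS n)) s))) _. ring. }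
apply: cderiv_eq (@cderiv_comp Cexp (fun s => - (s * RtoC (lnS n)))%C _ _ _ d (Cexp_cderiv _)) _. rewrite /zterm. ring.
Qed.

Definition Lt (n : nat) (s : C) : C := (RtoC (Lam n) * zterm n s)%C.
(* - zeta'/zeta *)
Definition LC (s : C) : C := epsilon (inhabits (RtoC 0)) (Cser (fun n => Lt n s)).

Lemma Lt_mod (n : nat) (s : C) : Cmod (Lt n s) = Lam n * exp (- Re s * lnS n).
Proof. rewrite /Lt Cmod_mult Cmod_RtoC_pos ?zterm_mod //. exact: (proj1 (Lam_bound n)). Qed.

Lemma LC_ser (s : C) : 1 < Re s -> Cser (fun n => Lt n s) (LC s).
Proof.
move=> hs. apply: (epsilon_spec (inhabits (RtoC 0)) (Cser (fun n => Lt n s))).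
apply: (@Cser_ex _ (fun n => Lam n * exp (- Re s * lnS n))); last exact: Lam_ex. move=> n. rewrite Lt_mod. lra.
Qed.

Lemma LC_bound (s : C) (x : R) : 1 < x -> x <= Re s -> Cmod (LC s) <= Series (fun n => Lam n * exp (- x * lnS n)).
Proof.
move=> hx hs. apply: (Cser_bound (m := fun n => Lam n * exp (- x * lnS n)) _ (Lam_ex hx)); last by apply: LC_ser; lra.
move=> n. rewrite Lt_mod. have [l0 _] := Lam_bound n. apply: Rmult_le_compat_l => //. apply: exp_le. have := lnS_pos n. nra.
Qed.

Lemma disc_re (s y : C) (r : R) : disc s r y -> Re s - r <= Re y <= Re s + r.
Proof.
rewrite /disc => h. have := re_le_Cmod (y - s). rewrite re_minus => h1. have := Rle_abs (Re y - Re s). have := Rle_abs (- (Re y - Re s)). rewrite Rabs_Ropp. lra.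
Qed.

Lemma LC_holo (s : C) : 1 < Re s -> exists l, cderiv LC s l.
Proof.
move=> hs. set r := (Re s - 1) / 2. have r0 : 0 < r by rewrite /r; lra. set x := (1 + Re s) / 2. have hx : 1 < x by rewrite /x; lra.
have hd : forall y, disc s r y -> x <= Re y. { move=> y /disc_re. rewrite /r /x. lra. }
have hb : forall n y, disc s r y -> Cmod (Lt n y) <= Lam n * exp (- x * lnS n).
{ move=> n y /hd hy. rewrite Lt_mod. have [l0 _] := Lam_bound n. apply: Rmult_le_compat_l => //. apply: exp_le. have := lnS_pos n. nra. }
have du : forall n y, cderiv (Lt n) y (RtoC (Lam n) * (- RtoC (lnS n) * zterm n y))%C. { move=> n y. apply: cderiv_scal. exact: zterm_deriv. }
have [l [_ hl]] := @weierstrass Lt _ LC (fun n => Lam n * exp (- x * lnS n)) s r r0 (fun n y _ => ex_intro _ _ (du n y)) (fun n => du n s) hb (Lam_ex hx) (fun y hy => LC_ser (Rlt_le_trans _ _ _ hx (hd y hy))).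
by exists l.
Qed.

Lemma zeta_deriv_ser (zeta : C -> C) (s l : C) : zeta_like zeta -> 1 < Re s -> cderiv zeta s l -> Cser (fun n => - RtoC (lnS n) * zterm n s)%C l.
Proof.
move=> hz hs hl. set r := (Re s - 1) / 2. have r0 : 0 < r by rewrite /r; lra. set x := (1 + Re s) / 2. have hx : 1 < x by rewrite /x; lra.
have hd : forall y, disc s r y -> x <= Re y. { move=> y /disc_re. rewrite /r /x. lra. }
have hb : forall n y, disc s r y -> Cmod (zterm n y) <= exp (- x * lnS n).
{ move=> n y /hd hy. rewrite zterm_mod. apply: exp_le. have := lnS_pos n. nra. }
have [m [hm hl2]] := @weierstrass zterm _ zeta (fun n => exp (- x * lnS n)) s r r0 (fun n y _ => ex_intro _ _ (zterm_deriv n y)) (fun n => zterm_deriv n s) hb (zR_ex hx) (fun y hy => proj1 hz y (Rlt_le_trans _ _ _ hx (hd y hy))).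
by rewrite (cderiv_unique hl hl2).
Qed.

(** On the real axis this is the Dirichlet product of Lambda and 1; the identity theorem extends it
    to Re s > 1. The derivative of zeta is chosen pointwise by [epsilon], and [holo_deriv] makes it
    holomorphic. *)
Lemma prime_logderiv (zeta : C -> C) (s l : C) : zeta_like zeta -> 1 < Re s -> cderiv zeta s l -> l = (- (zeta s * LC s))%C.
Proof.
move=> hz. pose dz s := epsilon (inhabits (RtoC 0)) (cderiv zeta s).
have hdz : forall s, s <> RtoC 1 -> cderiv zeta s (dz s). { move=> z hz1. exact: (epsilon_spec (inhabits (RtoC 0)) (cderiv zeta z) (proj2 hz z hz1)). }
have n1 : forall s, 1 < Re s -> s <> RtoC 1. { move=> z h e. rewrite e /= in h. lra. }
pose H s := (dz s + zeta s * LC s)%C.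
suff h : forall s, 1 < Re s -> H s = RtoC 0.
{ move=> hs hl. rewrite (cderiv_unique hl (hdz s (n1 s hs))). have := h s hs. rewrite /H => e. replace (dz s) with ((dz s + zeta s * LC s) - zeta s * LC s)%C by ring. rewrite e. ring. }
have hol : forall s, 1 < Re s -> exists l, cderiv H s l.
{ move=> z hz1. set r := (Re z - 1) / 2. have r0 : 0 < r by rewrite /r; lra.
  have [m hm] := @holo_deriv zeta dz z r r0 ltac:(move=> y /disc_re hy; apply: hdz; apply: n1; rewrite /r in hy; lra).
  have [q hq] := LC_holo hz1. eexists. apply: cderiv_plus hm _. exact: cderiv_mult (hdz z (n1 z hz1)) hq. }
have real : forall x, 1 < x -> H (RtoC x) = RtoC 0.
{ move=> x hx. have hx1 : 1 < Re (RtoC x) by [].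
  have s1 := zeta_deriv_ser hz hx1 (hdz _ (n1 _ hx1)).
  have s2 := Cser_scal (- (1))%C (Cser_Series (lnS_ex hx)).
  pose D := Series (fun n => lnS n * exp (- x * lnS n)).
  have e1 : dz (RtoC x) = (- RtoC D)%C.
  { apply: Cser_unique s1 _. replace (- RtoC D)%C with (- (1) * RtoC D)%C by ring.
    apply: Cser_ext s2 => n. rewrite zterm_real RtoC_mult. ring. }
  have e2 : LC (RtoC x) = RtoC (Series (fun n => Lam n * exp (- x * lnS n))).
  { apply: Cser_unique (LC_ser hx1) _. apply: Cser_ext (Cser_Series (Lam_ex hx)) => n. by rewrite /Lt zterm_real RtoC_mult. }
  rewrite /H e1 e2 (zeta_real hz hx) /zR /D. rewrite (DirichletConvolution.dirichlet_product (lnS_ex hx) (zR_ex hx) (Lam_ex hx)) RtoC_mult. rewrite /Lam. ring. }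
have acc2 : accz H (RtoC 2).
{ move=> d hd. exists (RtoC (2 + d/2)). split. { rewrite -RtoC_minus Cmod_RtoC_pos; lra. } apply: real. lra. }
move=> z hz1. set d := (Rmin 2 (Re z) - 1) / 2. have m1 := Rmin_l 2 (Re z). have m2 := Rmin_r 2 (Re z).
have m0 : 1 < Rmin 2 (Re z) by apply: Rmin_glb_lt; lra. have d0 : 0 < d by rewrite /d; lra.
apply: (@ident_seg H (RtoC 2) z d d0); [| exact: acc2 | by rewrite Cmod_self].
move=> t ht y /disc_re. rewrite path_re re_RtoC => hy. apply: hol. have : Rmin 2 (Re z) <= 2 + t * (Re z - 2) by nra. rewrite /d in hy. lra.
Qed.

(** * Hadamard product for order below one *)

(** Taylor's formula with no terms, whose remainder bound is M / (1 - |w| / r). The factor 2 is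
    harmless, as only the logarithm of the bound is used. *)
Lemma max_mod (g : C -> C) (r M : R) (w : C) : (forall z, exists l, cderiv g z l) -> 0 < r -> 0 <= M ->
  (forall z, Cmod z = r -> Cmod (g z) <= M) -> Cmod w <= r / 2 -> Cmod (g w) <= 2 * M.
Proof.
move=> hg hr hM hb hw. have c0 : forall z, (z - RtoC 0)%C = z by move=> z; ring.
have [a [_ h]] := @taylor g (RtoC 0) (2 * r) r M (fun z _ => hg z) ltac:(lra) ltac:(move=> z; rewrite c0; exact: hb).
have := h w 0%nat. rewrite c0 => q. have {q} := q ltac:(lra). rewrite /= c0 => q. apply: Rle_trans q _. have x1 : Cmod w / r <= 1/2 by apply/Rle_div_l; lra.
have : 1 / (1 - Cmod w / r) <= 2 by apply/Rle_div_l; lra. move=> h2. rewrite Rmult_comm. apply: Rmult_le_compat_r; lra.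
Qed.

Lemma center_mod (g : C -> C) (r M : R) : (forall z, exists l, cderiv g z l) -> 0 < r ->
  (forall z, Cmod z = r -> Cmod (g z) <= M) -> Cmod (g (RtoC 0)) <= M.
Proof.
move=> hg hr hb. have c0 : forall z, (z - RtoC 0)%C = z by move=> z; ring.
have [a [_ h]] := @taylor g (RtoC 0) (2 * r) r M (fun z _ => hg z) ltac:(lra) ltac:(move=> z; rewrite c0; exact: hb).
have := h (RtoC 0) 0%nat. rewrite c0 Cmod_0 => q. have {q} := q hr. rewrite /= c0. have -> : M * (1 / (1 - 0 / r)) = M by field; lra. by [].
Qed.

Fixpoint Pprod (b : nat -> R) (N : nat) (z : C) : C := match N with O => RtoC 1 | S n => (Pprod b n z * (1 + z / RtoC (b n)))%C end.

Section Hadamard.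
Variables (f : C -> C) (b : nat -> R) (C0 : R).
Hypothesis hf : forall z, exists l, cderiv f z l.
Hypothesis b0 : forall n, 0 < b n.
Hypothesis binj : forall m n, b m = b n -> m = n.
Hypothesis bmono : forall m n, (m <= n)%nat -> b m <= b n.
Hypothesis fz : forall z, f z = RtoC 0 -> exists n, z = RtoC (- b n).
Hypothesis fb : forall n, f (RtoC (- b n)) = RtoC 0 /\ exists l, cderiv f (RtoC (- b n)) l /\ l <> RtoC 0.
Hypothesis C0pos : 0 < C0.
Hypothesis fgrow : forall z x, 1 <= x -> Cmod z <= x -> Cmod (f z) <= exp (C0 * qx x).

Let bn (n : nat) : RtoC (b n) <> RtoC 0.
Proof. move=> e. have := RtoC_inj _ _ e. have := b0 n. lra. Qed.

Lemma Pprod_deriv (N : nat) (z : C) : exists l, cderiv (Pprod b N) z l.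
Proof.
elim: N => [|N [l hl]]; first by exists (RtoC 0); exact: cderiv_const.
eexists. apply: cderiv_mult hl _. apply: cderiv_plus (cderiv_const _ _) _.
apply: (@cderiv_mult (fun z => z) (fun _ => / RtoC (b N))%C); [exact: cderiv_id | exact: cderiv_const].
Qed.

Lemma Pprod_neq0 (N : nat) (z : C) : (forall n, (n < N)%nat -> z <> RtoC (- b n)) -> Pprod b N z <> RtoC 0.
Proof.
elim: N => [|N IH] h /=. { move=> e. have := RtoC_inj _ _ e. lra. }
apply: Cmult_neq_0; first by apply: IH => n hn; apply: h; lia.
move=> e. apply: (h N ltac:(lia)). have -> : z = (RtoC (b N) * (1 + z / RtoC (b N)) - RtoC (b N))%C by field.
rewrite e RtoC_opp. ring.
Qed.

Lemma Pprod_0 (N : nat) : Pprod b N (RtoC 0) = RtoC 1.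
Proof. elim: N => //= N ->. field. exact: bn. Qed.

(** The zeros are divided out one at a time; being simple, they do not remain zeros of the quotient.
    The factor b_N converts z + b_N into 1 + z / b_N, so that [Pprod] is 1 at 0. *)
Lemma quotient (N : nat) : exists q, (forall z, exists l, cderiv q z l) /\ (forall z, f z = q z * Pprod b N z)%C /\ forall n, (n < N)%nat -> q (RtoC (- b n)) <> RtoC 0.
Proof.
elim: N => [|N [q [hq [hm hn]]]].
- exists f. split => //. split; first by move=> z /=; ring. move=> n. lia.
- set zN := RtoC (- b N). have pn : Pprod b N zN <> RtoC 0.
  { apply: Pprod_neq0 => n hlt e. have h := RtoC_inj _ _ e. have : b N = b n by lra. move=> /binj. lia. }
  have [f0 [l [hl l0]]] := fb N. rewrite -/zN in f0 hl.
  have q0 : q zN = RtoC 0.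
  { have -> : q zN = (/ Pprod b N zN * (q zN * Pprod b N zN))%C by field. rewrite -hm f0. ring. }
  have [dq hdq] := hq zN. have [dP hdP] := Pprod_deriv N zN.
  have dq0 : dq <> RtoC 0.
  { move=> e. apply: l0. have d1 := cderiv_mult hdq hdP. have d2 : cderiv f zN (dq * Pprod b N zN + q zN * dP)%C.
    { apply: (@cderiv_ext_loc _ _ _ _ 1) d1; first lra. move=> y _. by rewrite hm. }
    rewrite (cderiv_unique hl d2) e q0. ring. }
  have [p [p1 [p2 [p3 p4]]]] := @division q zN 1 Rlt_0_1 (fun z _ => hq z) q0.
  have pz : p zN <> RtoC 0. { by rewrite (cderiv_unique p2 hdq). }
  exists (fun z => RtoC (b N) * p z)%C. split; [|split].
  + move=> z. case: (classic (z = zN)) => [->|ne].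
    * case: p3 => m h. eexists. exact: cderiv_scal h.
    * case: (p4 z ne (hq z)) => m h. eexists. exact: cderiv_scal h.
  + move=> z. rewrite hm p1 /zN RtoC_opp /=. field. exact: bn.
  + move=> n hlt. apply: Cmult_neq_0; first exact: bn.
    case: (Nat.eq_dec n N) => [->|ne] //. have h := hn n ltac:(lia). move=> e. apply: h. rewrite p1 e. ring.
Qed.

(** For b_n <= R0 and |z| = 3 R0 each factor has modulus at least 3 - 1 = 2. *)
Lemma Pprod_ge (N : nat) (R0 : R) (z : C) : (forall n, (n < N)%nat -> b n <= R0) -> Cmod z = 3 * R0 -> 2 ^ N <= Cmod (Pprod b N z).
Proof.
move=> h hz. elim: N h => [|N IH] h /=. { rewrite Cmod_1. lra. }
rewrite Cmod_mult Rmult_comm. apply: Rmult_le_compat; [apply: pow_le; lra | lra | | ].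
2: { have hb := h N ltac:(lia). have p := b0 N. 
  have := Cmod_triangle_inv (z / RtoC (b N)) (- (1))%C. rewrite Cmod_opp Cmod_1.
  have -> : (z / RtoC (b N) - - (1))%C = (1 + z / RtoC (b N))%C by ring. 
  rewrite Cmod_div // Cmod_RtoC_pos; last lra. rewrite hz => t. apply: Rle_trans t.
  have : 3 <= 3 * R0 / b N. { apply: (proj1 (Rle_div_r _ _ _ p)). nra. } lra. }
apply: IH => n hn. apply: h. lia.
Qed.

Lemma f0_neq : f (RtoC 0) <> RtoC 0.
Proof. move=> /fz [n e]. have := RtoC_inj _ _ e. have := b0 n. lra. Qed.

(** A weak form of Jensen's formula: dividing out n + 1 zeros gains 2^(n+1) on the circle of radius
    3 max(b_n, 1), while the value at 0 is unchanged. *)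
Lemma count (n : nat) : INR (S n) * ln 2 <= C0 * qx (3 * Rmax (b n) 1) - ln (Cmod (f (RtoC 0))).
Proof.
set x := Rmax (b n) 1. have x1 : 1 <= x by exact: Rmax_r. have xb : b n <= x by exact: Rmax_l.
have [q [hq [hm _]]] := quotient (S n).
have f0 : 0 < Cmod (f (RtoC 0)). { apply/Cmod_gt_0. exact: f0_neq. }
have e0 : q (RtoC 0) = f (RtoC 0). { rewrite hm Pprod_0. ring. }
have p2 : 0 < 2 ^ (S n) by apply: pow_lt; lra.
have h : Cmod (q (RtoC 0)) <= exp (C0 * qx (3 * x)) / 2 ^ (S n).
{ apply: (@center_mod q (3 * x)) => //; first lra. move=> z hz.
  have pg : 2 ^ (S n) <= Cmod (Pprod b (S n) z). { apply: (@Pprod_ge _ x) => // k hk. apply: Rle_trans xb. apply: bmono. lia. }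
  have fg := fgrow (x := 3 * x) (z := z) ltac:(lra) ltac:(lra). rewrite hm Cmod_mult in fg.
  apply: (proj1 (Rle_div_r _ _ _ p2)). have := Cmod_ge_0 (q z). nra. }
rewrite e0 in h. have h2 : 2 ^ (S n) * Cmod (f (RtoC 0)) <= exp (C0 * qx (3 * x)).
{ have := Rmult_le_compat_l (2 ^ (S n)) _ _ (Rlt_le _ _ p2) h. have -> : 2 ^ (S n) * (exp (C0 * qx (3 * x)) / 2 ^ (S n)) = exp (C0 * qx (3 * x)) by field; lra. by []. }
have h3 := ln_le _ _ (Rmult_lt_0_compat _ _ p2 f0) h2. rewrite ln_exp ln_mult // ln_pow in h3; last lra. lra.
Qed.

Lemma qx_exp (x : R) : 0 < x -> qx x = exp (3/4 * ln x).
Proof.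
move=> hx. have s : forall y, 0 < y -> sqrt y = exp (ln y / 2).
{ move=> y hy. have -> : y = exp (ln y / 2) * exp (ln y / 2). { rewrite -exp_plus. have -> : ln y / 2 + ln y / 2 = ln y by field. by rewrite exp_ln. } rewrite sqrt_square; last by left; exact: exp_pos.
  rewrite -exp_plus. congr exp. have -> : ln y / 2 + ln y / 2 = ln y by field. by rewrite ln_exp. }
rewrite /qx (s _ (sqrt_lt_R0 _ hx)) (s _ hx) ln_exp -exp_plus. congr exp. field.
Qed.

(** [count] bounds n + 1 by a multiple of max(b_n, 1)^(3/4), so 1 / b_n is at most a multiple of (n
    + 1)^(-4/3), which is summable because the order is below 1. The constant B covers the case b_n
    < 1. *)
Lemma b_lower : exists K, 0 < K /\ forall n, / b n <= K * exp (- (1 + 1/3) * ln (INR (S n))).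
Proof.
set c1 := Rabs (ln (Cmod (f (RtoC 0)))). have l2 : 0 < ln 2 by have := ln_lt_2; lra.
have hc1 : - ln (Cmod (f (RtoC 0))) <= c1. { rewrite /c1 -Rabs_Ropp. exact: Rle_abs. }
set D := (3 * C0 + c1) / ln 2. have c10 : 0 <= c1 by exact: Rabs_pos. have D0 : 0 < D by apply: Rdiv_lt_0_compat; lra.
have h1 : forall n, INR (S n) <= D * qx (Rmax (b n) 1).
{ move=> n. set x := Rmax (b n) 1. have x1 : 1 <= x by exact: Rmax_r.
  have lx : 0 <= ln x. { rewrite -ln_1. apply: ln_le; lra. }
  have q1 : 1 <= qx x. { rewrite qx_exp; last lra. rewrite -exp_0. apply: exp_le. lra. }
  have q3 : qx (3 * x) <= 3 * qx x.
  { rewrite !qx_exp; try lra. rewrite ln_mult; try lra. have -> : 3 * exp (3/4 * ln x) = exp (ln 3 + 3/4 * ln x) by rewrite exp_plus exp_ln; lra. apply: exp_le.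
    have : 0 <= ln 3. { rewrite -ln_1. apply: ln_le; lra. } lra. }
  have := count n. rewrite -/x => h. have : INR (S n) * ln 2 <= (3 * C0 + c1) * qx x. { nra. }
  move=> h2. have -> : D * qx x = ((3 * C0 + c1) * qx x) / ln 2 by rewrite /D; field; lra. by apply: (proj1 (Rle_div_r _ _ _ l2)). }
set B := Rmax 1 (/ b 0). have B1 : 1 <= B by exact: Rmax_l. have B2 : / b 0 <= B by exact: Rmax_r.
exists (B * exp (4/3 * ln D)). split. { apply: Rmult_lt_0_compat; first lra. exact: exp_pos. }
move=> n. set x := Rmax (b n) 1. have x1 : 1 <= x by exact: Rmax_r. have p := b0 n. have pS := INR_S_pos n.
have hl := ln_le _ _ pS (h1 n). rewrite -/x (@qx_exp x) in hl; last lra. rewrite ln_mult // ?ln_exp in hl; last exact: exp_pos.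
have hx : / x <= exp (4/3 * ln D) * exp (- (1 + 1/3) * ln (INR (S n))).
{ rewrite -exp_plus. rewrite -{1}(exp_ln x); last lra. rewrite -exp_Ropp. apply: exp_le. lra. }
have bx : / b n <= B * / x.
{ have xb : x <= B * b n. { rewrite /x. apply: Rmax_lub; first nra. have q := b0 0. have m := @bmono 0 n ltac:(lia).
    have : 1 <= B * b 0. { have : / b 0 * b 0 = 1 by field; lra. nra. } nra. } apply: (proj1 (Rle_div_r _ _ _ _)); first lra. have -> : / b n * x = x / b n by lra. apply/Rle_div_l => //. }
apply: Rle_trans bx _. rewrite Rmult_assoc. apply: Rmult_le_compat_l; lra.
Qed.

Lemma b_ex : ex_series (fun n => / b n).
Proof.
have [K [K0 h]] := b_lower. apply: (ex_series_pos_le (b := fun n => K * exp (- (1 + 1/3) * ln (INR (S n))))); last by apply: ex_series_scal_l; apply: pseries; lra.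
move=> n. split; last exact: h. left. apply: Rinv_0_lt_compat. exact: b0.
Qed.

Lemma b_large (X : R) : 0 < X -> exists N, forall n, (N <= n)%nat -> X < b n.
Proof.
move=> hX. have h := ex_series_lim_0 _ b_ex. move/is_lim_seq_spec: h => h.
case: (h (mkposreal (/ X) (Rinv_0_lt_compat _ hX))) => N HN. exists N => n hn. have := HN n hn. rewrite /= Rminus_0_r Rabs_pos_eq; last by left; apply: Rinv_0_lt_compat; exact: b0.
move=> q. apply: Rnot_le_lt => q2. have := Rinv_le_contravar _ _ (b0 n) q2. lra.
Qed.

Lemma Pprod_logderiv (N : nat) (z dP : C) : Pprod b N z <> RtoC 0 -> cderiv (Pprod b N) z dP -> (dP / Pprod b N z)%C = Csum (fun n => / (z + RtoC (b n)))%C N.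
Proof.
elim: N dP => [|N IH] dP h hd /=.
- rewrite (cderiv_unique hd (cderiv_const _ _)). rewrite /Cdiv. ring.
- have [l hl] := Pprod_deriv N z.
  have d1 : cderiv (fun z => 1 + z / RtoC (b N))%C z (/ RtoC (b N))%C.
  { apply: cderiv_eq (cderiv_plus (cderiv_const (RtoC 1) z) (cderiv_mult (cderiv_id z) (cderiv_const (/ RtoC (b N))%C z))) _. ring. }
  have := cderiv_unique hd (cderiv_mult hl d1) => e. rewrite /= in h.
  have h1 : Pprod b N z <> RtoC 0. { move=> q. apply: h. rewrite q. ring. }
  have h2 : (1 + z / RtoC (b N))%C <> RtoC 0. { move=> q. apply: h. rewrite q. ring. }
  have h3 : (z + RtoC (b N))%C <> RtoC 0. { move=> q. apply: h2. have -> : (1 + z / RtoC (b N))%C = ((z + RtoC (b N)) / RtoC (b N))%C by field. rewrite q /Cdiv. ring. } rewrite -(IH l h1 hl) e. field. repeat split => //. 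
Qed.

Lemma qx_small (c e : R) : 0 <= c -> 0 < e -> exists X, 1 <= X /\ forall x, X <= x -> 16 * (C0 * qx (3 * x) + c) / x < e.
Proof.
move=> hc he. have [X1 h1] : exists X, 1 <= X /\ forall x, X <= x -> qx (3 * x) <= (e / (64 * C0)) * x.
{ set d := e / (64 * C0). have d0 : 0 < d by apply: Rdiv_lt_0_compat; lra.
  exists (Rmax 1 (exp (4 * (ln 3 - ln d)))). split; first exact: Rmax_l. move=> x hx. have x1 : 1 <= x by apply: Rle_trans (Rmax_l _ _) hx.
  have x2 : exp (4 * (ln 3 - ln d)) <= x by apply: Rle_trans (Rmax_r _ _) hx. have l := ln_le _ _ (exp_pos _) x2. rewrite ln_exp in l.
  rewrite qx_exp; last lra. rewrite ln_mult; try lra. have -> : d * x = exp (ln d + ln x) by rewrite exp_plus !exp_ln; lra. apply: exp_le.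
  have : 0 <= ln 3. { rewrite -ln_1. apply: ln_le; lra. } lra. }
exists (Rmax X1 (64 * c / e + 1)). split. { apply: Rle_trans (proj1 h1) _. exact: Rmax_l. }
move=> x hx. have q1 := proj2 h1 x (Rle_trans _ _ _ (Rmax_l _ _) hx). have x1 : 1 <= x by have := Rle_trans _ _ _ (Rmax_l _ _) hx; have := proj1 h1; lra.
have q2 : 64 * c / e < x by have := Rle_trans _ _ _ (Rmax_r _ _) hx; lra. move/Rlt_div_l: q2 => q2.
apply/Rlt_div_l; first lra. have : C0 * qx (3 * x) <= e / 64 * x. { have -> : e / 64 * x = C0 * (e / (64 * C0) * x) by field; lra. apply: Rmult_le_compat_l; lra. } nra.
Qed.

(** After division by the product over the first n + 1 zeros, the quotient q is zero-free on |w| <=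
    b_n. Borel-Caratheodory on half that radius bounds q' / q at z by 16 (C0 (3 b_n)^(3/4) + c) /
    b_n, which tends to 0; the rest of f' / f is the partial sum. *)
Lemma hadamard_logderiv (z l : C) : f z <> RtoC 0 -> cderiv f z l -> Cser (fun n => / (z + RtoC (b n)))%C (l / f z)%C.
Proof.
move=> fz0 hl. have f0 : 0 < Cmod (f (RtoC 0)). { apply/Cmod_gt_0. exact: f0_neq. }
set c := 1 + Rabs (ln (Cmod (f (RtoC 0)))). have c0 : 0 <= c by rewrite /c; have := Rabs_pos (ln (Cmod (f (RtoC 0)))); lra.
move=> e he. have [X [X1 hX]] := qx_small c0 he.
(* Borel-Caratheodory on radius b_n / 2 requires |z| <= b_n / 16, hence the summand 16 |z|; [X]
   makes the final bound smaller than e. *)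
have [N HN] := b_large (X := X + 16 * Cmod z) ltac:(have := Cmod_ge_0 z; lra).
exists (S N) => n hn. case: n hn => [|n] hn; first lia.
have bb := HN n ltac:(lia). set r := b n in bb. have z0 := Cmod_ge_0 z.
have [q [hq [hm hnz]]] := quotient (S n).
have qnz : forall w, disc (RtoC 0) r w -> q w <> RtoC 0.
{ move=> w hw q0. have : f w = RtoC 0 by rewrite hm q0; ring. move=> /fz [k e1].
  case: (Nat.le_gt_cases k n) => hk.
  - apply: (hnz k ltac:(lia)). by rewrite -e1.
  - rewrite /disc e1 in hw. have m := @bmono n k ltac:(lia). have ne : b n <> b k by move/binj; lia.
    have e2 : Cmod (RtoC (- b k) - RtoC 0) = b k. { rewrite -RtoC_minus Cmod_R Rminus_0_r Rabs_Ropp Rabs_pos_eq //. left. exact: b0. }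
    rewrite e2 /r in hw. lra. }
pose dq w := epsilon (inhabits (RtoC 0)) (cderiv q w).
have hdq : forall w, cderiv q w (dq w) by move=> w; exact: (epsilon_spec (inhabits (RtoC 0)) (cderiv q w) (hq w)).
(* q is bounded through the circle of radius 3r, where the removed product has modulus at least 1.
   The 2 from [max_mod] is absorbed by the 1 in [c], as 2 <= e. *)
set M := 2 * exp (C0 * qx (3 * r)).
have hM : forall w, disc (RtoC 0) r w -> Cmod (q w) <= M.
{ move=> w hw. rewrite /disc in hw. have cw : (w - RtoC 0)%C = w by ring. rewrite cw in hw. apply: (@max_mod q (3 * r)) => //; [lra | left; exact: exp_pos | | lra].
  move=> y hy. have pg : 2 ^ (S n) <= Cmod (Pprod b (S n) y). { apply: (@Pprod_ge _ r) => // k hk. apply: bmono. lia. }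
  have p1 : 1 <= 2 ^ (S n) by apply: pow_R1_Rle; lra.
  have fg := fgrow (x := 3 * r) (z := y) ltac:(lra) ltac:(lra). rewrite hm Cmod_mult in fg. have := Cmod_ge_0 (q y). nra. }
have e0 : q (RtoC 0) = f (RtoC 0). { rewrite hm Pprod_0. ring. }
set B := C0 * qx (3 * r) + c.
have qx0 : 0 <= qx (3 * r) by rewrite /qx; apply: Rmult_le_pos; exact: sqrt_pos.
have B0 : 0 < B. { rewrite /B /c. have := Rabs_pos (ln (Cmod (f (RtoC 0)))). nra. }
have MB : M <= Cmod (q (RtoC 0)) * exp B.
{ rewrite e0 -{1}(exp_ln (Cmod (f (RtoC 0)))) // -exp_plus /M /B /c. have l2 : 2 <= exp 1 by have := exp_ineq1_le 1; lra.
  apply: Rle_trans (_ : exp 1 * exp (C0 * qx (3 * r)) <= _). { apply: Rmult_le_compat_r => //. left. exact: exp_pos. }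
  rewrite -exp_plus. apply: exp_le. have := Rle_abs (- ln (Cmod (f (RtoC 0)))). rewrite Rabs_Ropp. lra. }
have zr : Cmod (z - RtoC 0) <= r / 2 / 8. { have -> : (z - RtoC 0)%C = z by ring. lra. }
have bc := @borel_caratheodory q dq (RtoC 0) z r (r/2) M B ltac:(lra) (fun w _ => hdq w) qnz hM B0 MB zr.
have pz : Pprod b (S n) z <> RtoC 0. { move=> p. apply: fz0. rewrite hm p. ring. }
have qz : q z <> RtoC 0. { move=> p. apply: fz0. rewrite hm p. ring. }
have [dP hdP] := Pprod_deriv (S n) z.
have el : l = (dq z * Pprod b (S n) z + q z * dP)%C.
{ apply: cderiv_unique hl _. apply: (@cderiv_ext_loc _ _ _ _ 1) (cderiv_mult (hdq z) hdP); first lra. move=> y _. by rewrite hm. }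
have -> : (l / f z)%C = (dq z / q z + Csum (fun n => / (z + RtoC (b n)))%C (S n))%C.
{ rewrite -(Pprod_logderiv pz hdP) el hm. field. by split. }
set Sm := Csum _ _. have -> : (Sm - (dq z / q z + Sm))%C = (- (dq z / q z))%C by ring. rewrite Cmod_opp. apply: Rle_lt_trans bc _.
have := hX r ltac:(lra). rewrite -/B. have -> : 8 * B / (r/2) = 16 * B / r by field; lra. by [].
Qed.

End Hadamard.

Section Explicit.
Variables (zeta : C -> C) (rho : nat -> C).
Hypothesis Hz : is_Riemann_zeta zeta.
Hypothesis RH : Riemann_hypothesis zeta.
Hypothesis Hs : all_nontrivial_zeros_simple zeta.
Hypothesis Hr : upper_zero_enumeration zeta rho.

Let b (n : nat) := gm rho n ^ 2.

Lemma gm2_pos (n : nat) : 0 < gm rho n ^ 2.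
Proof. apply: pow_lt. exact: (gm_pos Hr). Qed.

Lemma gm_mono (m n : nat) : (m <= n)%nat -> gm rho m <= gm rho n.
Proof. move=> h. apply: (proj2 (proj2 (proj2 Hr))). exact: (ssrbool.introT ssrnat.leP h). Qed.

Lemma gm2_mono (m n : nat) : (m <= n)%nat -> gm rho m ^ 2 <= gm rho n ^ 2.
Proof. move=> h. apply: pow_incr. split; [left; exact: (gm_pos Hr) | exact: gm_mono]. Qed.

Lemma gm2_inj (m n : nat) : gm rho m ^ 2 = gm rho n ^ 2 -> m = n.
Proof.
move=> h. apply: (gm_inj RH Hr). have p := gm_pos Hr m. have q := gm_pos Hr n.
apply: Rsqr_inj; try lra. rewrite !Rsqr_pow2. exact: h.
Qed.

Lemma gm2_ex : ex_series (fun n => / gm rho n ^ 2).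
Proof.
have [C0 [C0p gr]] := fx_growth.
exact: (b_ex fx_holo gm2_pos gm2_inj gm2_mono (fx_zero Hz RH Hs Hr) (fx_at_zero Hz RH Hs Hr) C0p gr).
Qed.

(** The partial fractions of [fx] at w^2, multiplied by 2w, against the logarithmic derivative of
    [hfac] times zeta. Re w > 1/2 is the region where zeta' / zeta is the series -[LC]. *)
Lemma explicit_logderiv (w : C) : 1/2 < Re w ->
  Cser (fun n => 2 * w / (w * w + RtoC (gm rho n ^ 2)))%C (2 * w / (w * w - RtoC (1/4)) + Dc (RtoC (1/2) + w) - LC (RtoC (1/2) + w))%C.
Proof.
move=> hw. have hz := zeta_like_of Hz. set s := (RtoC (1/2) + w)%C.
have rs : Re s = 1/2 + Re w by rewrite /s re_plus re_RtoC.
have n1 : s <> RtoC 1. { move=> e. rewrite e /= in rs. lra. }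
have [dz hdz] := proj2 hz s n1. have [l hl] := fx_holo (w * w)%C.
have [f0 e] := fx_logderiv Hz RH hw hl hdz.
have [C0 [C0p gr]] := fx_growth.
have h := hadamard_logderiv fx_holo gm2_pos gm2_inj gm2_mono (fx_zero Hz RH Hs Hr) (fx_at_zero Hz RH Hs Hr) C0p gr f0 hl.
have h2 := Cser_scal (2 * w)%C h. rewrite e -/s in h2.
have p := prime_logderiv hz (s := s) ltac:(lra) hdz.
have zn : zeta s <> RtoC 0 by apply: (zeta_neq0 RH) => //; lra.
have e2 : (dz / zeta s)%C = (- LC s)%C. { rewrite p. field. exact: zn. }
rewrite e2 in h2. exact: h2.
Qed.

End Explicit.

(** * Gaussian contour integrals *)

Lemma line_cont (f : C -> C) (c : R) : (forall z, Re z = c -> ccont f z) -> forall t, rcont (fun t => f (c, t)) t.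
Proof. move=> h t. apply: (@rcont_comp f (fun t => (c, t))); [exact: vline_rcont | exact: h]. Qed.

Lemma pow_gauss_bound (a : R) (m : nat) : 0 < a -> exists K, 0 <= K /\ forall c t, 0 <= c <= 1 -> Cmod ((c, t) ^ m * Csqexp a (c, t)) <= K / (1 + t ^ 2).
Proof.
move=> ha. have [K [K0 h]] := gauss_dom (S m) ha. exists (exp a * K). split. { apply: Rmult_le_pos; [left; exact: exp_pos | lra]. }
move=> c t hc. have t2 := pow2_ge_0 t. apply: (proj1 (Rle_div_r _ _ _ _)); first lra.
rewrite Cmod_mult Cmod_pow Csqexp_mod.
have m0 := Cmod_ge_0 (c, t). have sq := @Cmod_strip_sq c t 1 ltac:(nra) ltac:(lra).
have m1 : Cmod (c, t) <= 1 + t ^ 2 by nra.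
have mp : Cmod (c, t) ^ m <= (1 + t ^ 2) ^ m by apply: pow_incr.
have c2 : c ^ 2 <= 1 by nra. have e1 : exp (a * c ^ 2) <= exp a by apply: exp_le; nra.
have := h t. rewrite /= -/(t ^ 2) => q.
apply: Rle_trans (_ : (1 + t ^ 2) ^ m * (exp a * exp (- a * t ^ 2)) * (1 + t ^ 2) <= _).
- apply: Rmult_le_compat_r; first lra. apply: Rmult_le_compat => //; first by apply: pow_le. { apply: Rmult_le_pos; left; exact: exp_pos. } apply: Rmult_le_compat_r; [left; exact: exp_pos | exact: e1].
- have -> : (1 + t ^ 2) ^ m * (exp a * exp (- a * t ^ 2)) * (1 + t ^ 2) = exp a * ((1 + t ^ 2) * (1 + t ^ 2) ^ m * exp (- a * t ^ 2)) by ring.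
  apply: Rmult_le_compat_l; first by left; exact: exp_pos. simpl in q |- *. exact: q.
Qed.

Lemma pow_gauss_ccont (a : R) (m : nat) (z : C) : ccont (fun w => w ^ m * Csqexp a w)%C z.
Proof. apply: ccont_mult; [exact: ccont_pow | exact: cderiv_ccont (Csqexp_deriv a z)]. Qed.

(** * The Cauchy transform of a Gaussian *)

Lemma gauss1_bound (a : R) : 0 < a -> exists K, 0 <= K /\ forall t, Cmod (Csqexp a (1, t)) <= K / (1 + t ^ 2).
Proof.
move=> ha. have [K [K0 h]] := pow_gauss_bound 0 ha. exists K. split => // t. have := h 1 t ltac:(lra). by rewrite /= Cmult_1_l.
Qed.

Lemma wq_neq (q : C) (t : R) : Re q < 1 -> ((1, t) - q)%C <> RtoC 0.
Proof. move=> h e. have := f_equal Re e. rewrite re_minus /=. lra. Qed.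

Lemma wq_mod (q : C) (t m : R) : m <= 1 - Re q -> m <= Cmod ((1, t) - q).
Proof. move=> h. have := re_le_Cmod ((1, t) - q). rewrite re_minus /=. have := Rle_abs (1 - Re q). change (fst q) with (Re q). lra. Qed.

Definition Kf (a : R) (q : C) (t : R) : C := (Csqexp a (1, t) / ((1, t) - q))%C.
(** Studied as a function of the pole q, to the left of the line Re w = 1; it satisfies a
    first-order linear differential equation in q. *)
Definition Kq (a : R) (q : C) : C := II (Kf a q).

Lemma wq_cont (q : C) (z : C) : z <> q -> ccont (fun w => / (w - q))%C z.
Proof.
move=> h. apply: (@ccont_comp (fun w => / w)%C (fun w => w - q)%C).
- exact: ccont_minus (ccont_id _) (ccont_const _ _). - apply: ccont_inv. exact: Cminus_neq0.
Qed.

Lemma re1_neq (q z : C) : Re q < 1 -> Re z = 1 -> z <> q.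
Proof. move=> h1 h2 e. rewrite e in h2. lra. Qed.

Lemma Kf_cont (a : R) (q : C) (t : R) : Re q < 1 -> rcont (Kf a q) t.
Proof.
move=> hq. apply: (@line_cont (fun w => Csqexp a w / (w - q))%C 1) => z hz. apply: ccont_mult; first exact: cderiv_ccont (Csqexp_deriv a z).
apply: wq_cont. exact: re1_neq hq hz.
Qed.

Lemma Kf_dom (a K m : R) (q : C) : (forall t, Cmod (Csqexp a (1, t)) <= K / (1 + t ^ 2)) -> 0 <= K -> 0 < m -> m <= 1 - Re q -> dom (Kf a q) (K / m).
Proof.
move=> h K0 m0 hm. have hq : Re q < 1 by lra. split; first by move=> t; exact: Kf_cont. move=> t. have t2 := pow2_ge_0 t.
rewrite /Kf Cmod_div; last exact: wq_neq. have b := wq_mod t hm. have -> : K / m / (1 + t ^ 2) = K / (1 + t ^ 2) * / m by field; lra.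
apply: Rmult_le_compat => //; first exact: Cmod_ge_0. { left. apply: Rinv_0_lt_compat. lra. } exact: Rinv_le_contravar.
Qed.

Lemma isI_Kq (a : R) (q : C) : 0 < a -> Re q < 1 -> isI (Kf a q) (Kq a q).
Proof. move=> ha hq. have [K [K0 h]] := gauss1_bound ha. apply: isI_II (Kf_dom h K0 (m := 1 - Re q) _ _); lra. Qed.

Definition Kf2 (a : R) (q : C) (t : R) : C := (Kf a q t * / ((1, t) - q))%C.

Lemma inv_dom (f : R -> C) (q : C) (K m : R) : dom f K -> 0 < m -> m <= 1 - Re q -> dom (fun t => f t * / ((1, t) - q))%C (K / m).
Proof.
move=> [cf hf] m0 hm. have hq : Re q < 1 by lra. split.
- move=> t. apply: rcont_mult; first exact: cf. apply: (@line_cont (fun w => / (w - q))%C 1) => z hz. apply: wq_cont. exact: re1_neq hq hz.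
- move=> t. have t2 := pow2_ge_0 t. rewrite Cmod_mult Cmod_inv; last exact: wq_neq. have b := wq_mod t hm. have -> : K / m / (1 + t ^ 2) = K / (1 + t ^ 2) * / m by field; lra.
  apply: Rmult_le_compat => //; first exact: Cmod_ge_0. { left. apply: Rinv_0_lt_compat. lra. } exact: Rinv_le_contravar.
Qed.

Lemma Kq_deriv0 (a : R) (q : C) : 0 < a -> Re q < 1 -> cderiv (Kq a) q (II (Kf2 a q)).
Proof.
move=> ha hq. have [K [K0 h]] := gauss1_bound ha. set m := (1 - Re q) / 2. have m0 : 0 < m by rewrite /m; lra.
have hm : m <= 1 - Re q by rewrite /m; lra.
have d1 := Kf_dom (q := q) h K0 m0 hm. have d2 := inv_dom (q := q) d1 m0 hm.
set B := K / m / m / m * PI. have B0 : 0 <= B. { have p := PI_RGT_0. have i := Rinv_0_lt_compat _ m0. rewrite /B /Rdiv. do 3 (apply: Rmult_le_pos; last lra). apply: Rmult_le_pos; lra. }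
apply/cderiv_eps => e he. exists (Rmin m (e / (B + 1))). have e1 : 0 < e / (B + 1) by apply: Rdiv_lt_0_compat; lra.
split; first by apply: Rmin_glb_lt. move=> y hy. have y1 := Rlt_le_trans _ _ _ hy (Rmin_l _ _). have y2 := Rlt_le_trans _ _ _ hy (Rmin_r _ _).
have ym : m <= 1 - Re y. { have := re_le_Cmod (y - q). rewrite re_minus. have := Rle_abs (Re y - Re q). rewrite /m in y1 *. lra. }
have yq : Re y < 1 by lra.
have d3 := inv_dom (q := y) d2 m0 ym. have i3 := isI_II d3.
have c3 := isI_scal ((y - q) * (y - q))%C (proj1 d3) i3.
have i1 := isI_minus (fun t => Kf_cont a t yq) (fun t => Kf_cont a t hq) (isI_Kq ha yq) (isI_Kq ha hq).
have cm : forall t, rcont (fun t => Kf a y t - Kf a q t)%C t. { move=> t. apply: rcont_minus; exact: Kf_cont. }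
have cs : forall t, rcont (fun t => (y - q) * Kf2 a q t)%C t. { move=> t. apply: rcont_scal. exact: (proj1 d2). }
have i2 := isI_minus cm cs i1 (isI_scal (y - q)%C (proj1 d2) (isI_II d2)).
(* 1/(w - y) - 1/(w - q) - (y - q)/(w - q)^2 = (y - q)^2 / ((w - q)^2 (w - y)), so the remainder is
   quadratic in y - q. The choice of [m] keeps y at distance at least m from the line. *)
have eq : (Kq a y - Kq a q - II (Kf2 a q) * (y - q))%C = ((y - q) * (y - q) * II (fun t => Kf2 a q t * / ((1, t) - y))%C)%C.
{ rewrite (Cmult_comm (II (Kf2 a q))). apply: isI_unique i2 _. apply: isI_ext c3 => t. rewrite /Kf2 /Kf. field. split; exact: wq_neq. }
rewrite eq !Cmod_mult. have b := isI_bound d3 i3. rewrite -/B in b. have w0 := Cmod_ge_0 (y - q).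
have : Cmod (y - q) * (B + 1) <= e. { have : Cmod (y - q) < e / (B + 1) by []. move=> q2. apply: Rlt_le. have := Rmult_lt_compat_r (B + 1) _ _ ltac:(lra) q2. have -> : e / (B + 1) * (B + 1) = e by field; lra. by []. } move=> q3. rewrite (Rmult_comm e) Rmult_assoc. apply: Rmult_le_compat_l => //.
have b' : Cmod (II (fun t => Kf2 a q t * / ((1, t) - y))%C) <= B := b.
have := Rmult_le_compat_l _ _ _ w0 b'. lra.
Qed.

Lemma dom_small (f : R -> C) (K : R) : dom f K -> forall e, 0 < e -> exists M, 0 <= M /\ forall t, M <= Rabs t -> Cmod (f t) < e.
Proof.
move=> [_ h] e he. have K0 : 0 <= K. { have := h 0. have := Cmod_ge_0 (f 0). lra. }
exists (K / e + 1). have p : 0 <= K / e by apply: Rdiv_le_0_compat. split; first lra. move=> t ht. apply: Rle_lt_trans (h t) _.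
have a2 : Rabs t ^ 2 = t ^ 2 by rewrite pow2_abs. apply/Rlt_div_l; first by have := pow2_ge_0 t; lra.
have : K = e * (K / e) by field; lra. move=> kE. have : K / e < 1 + t ^ 2 by nra. nra.
Qed.

(** The derivative of e^(a w^2) / (w - q) integrates to 0 along the line, and 2a w / (w - q) = 2a +
    2a q / (w - q). *)
Lemma Kq_parts (a : R) (q : C) : 0 < a -> Re q < 1 -> II (Kf2 a q) = (2 * RtoC a * (RtoC (gam a) + q * Kq a q))%C.
Proof.
move=> ha hq. have [K [K0 h]] := gauss1_bound ha. set m := 1 - Re q. have m0 : 0 < m by rewrite /m; lra.
have d1 := Kf_dom (q := q) h K0 m0 (Rle_refl _). have d2 := inv_dom (q := q) d1 m0 (Rle_refl _).
have gc : forall t, rcont (fun t => Csqexp a (1, t)) t. { apply: (@line_cont (Csqexp a) 1) => z _. exact: cderiv_ccont (Csqexp_deriv a z). }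
have ig := isI_scal (2 * RtoC a)%C gc (isI_gauss_line 1 ha).
have ik := isI_scal (2 * RtoC a * q)%C (fun t => Kf_cont a t hq) (isI_Kq ha hq).
have c1 : forall t, rcont (fun t => 2 * RtoC a * Csqexp a (1, t))%C t by move=> t; apply: rcont_scal; exact: gc.
have c2 : forall t, rcont (fun t => 2 * RtoC a * q * Kf a q t)%C t by move=> t; apply: rcont_scal; exact: Kf_cont.
have c12 : forall t, rcont (fun t => 2 * RtoC a * Csqexp a (1, t) + 2 * RtoC a * q * Kf a q t)%C t by move=> t; exact: rcont_plus.
have i12 := isI_plus c1 c2 ig ik.
have i3 := isI_minus c12 (proj1 d2) i12 (isI_II d2).
have c3 : forall t, rcont (fun t => 2 * RtoC a * Csqexp a (1, t) + 2 * RtoC a * q * Kf a q t - Kf2 a q t)%C t. { move=> t. apply: rcont_minus; [exact: c12 | exact: (proj1 d2)]. }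
have i4 := isI_scal Ci c3 i3.
have der : forall t, rderiv (Kf a q) t (Ci * (2 * RtoC a * Csqexp a (1, t) + 2 * RtoC a * q * Kf a q t - Kf2 a q t))%C.
{ move=> t. have n := @wq_neq q t hq.
  have dd : cderiv (fun w => Csqexp a w * / (w - q))%C (1, t) (2 * RtoC a * (1, t) * Csqexp a (1, t) * / ((1, t) - q) + Csqexp a (1, t) * (- / (((1, t) - q) * ((1, t) - q)) * (1 - 0)))%C.
  { apply: (@cderiv_mult (Csqexp a) (fun w => / (w - q))%C); first exact: Csqexp_deriv.
    apply: (@cderiv_comp (fun w => / w)%C (fun w => w - q)%C); [exact: cderiv_minus (cderiv_id _) (cderiv_const _ _) | exact: cderiv_inv]. }
  apply: rderiv_eq (@rderiv_comp (fun w => Csqexp a w * / (w - q))%C (fun t => (1, t)) t _ _ (vline_rderiv 1 t) dd) _.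
  rewrite /Kf2 /Kf. field. exact: n. }
have c4 : forall t, rcont (fun t => Ci * (2 * RtoC a * Csqexp a (1, t) + 2 * RtoC a * q * Kf a q t - Kf2 a q t))%C t by move=> t; apply: rcont_scal; exact: c3.
have z := isI_FTC der c4 (dom_small d1).
have e := isI_unique i4 z. 
have ci : Ci <> RtoC 0. { move=> e2. have := f_equal Im e2. rewrite /=. lra. }
have e3 : (2 * RtoC a * RtoC (gam a) + 2 * RtoC a * q * Kq a q - II (Kf2 a q))%C = RtoC 0.
{ set X := (_ - II _)%C in e *. replace X with (/ Ci * (Ci * X))%C by (field; exact: ci). rewrite e. ring. }
replace (II (Kf2 a q)) with (2 * RtoC a * RtoC (gam a) + 2 * RtoC a * q * Kq a q - (2 * RtoC a * RtoC (gam a) + 2 * RtoC a * q * Kq a q - II (Kf2 a q)))%C by ring.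
rewrite e3. ring.
Qed.

Lemma Csqexp_inv (a : R) (q : C) : (Csqexp a q * Csqexp (- a) q)%C = RtoC 1.
Proof. rewrite /Csqexp -Cexp_plus -Cexp_0. congr Cexp. rewrite RtoC_opp. ring. Qed.

(** The inhomogeneous term 2a gam a cancels in K(q) + K(-q), so this sum solves F' = 2a q F and is a
    multiple of e^(a q^2). It plays the part of a residue computation. *)
Lemma Kq_sym (a : R) (q : C) : 0 < a -> -1 < Re q < 1 -> (Kq a q + Kq a (- q))%C = (2 * Kq a (RtoC 0) * Csqexp a q)%C.
Proof.
move=> ha hq. pose U z := -1 < Re z < 1. pose Fm z := ((Kq a z + Kq a (- z)) * Csqexp (- a) z)%C.
have cU : convexC U. { apply: (@halfplane_re_convex (fun x => -1 < x < 1)) => x y t hx hy ht.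
  have cv : forall p r, 0 < p -> 0 < r -> 0 < p + t * (r - p). { move=> p r hp hr. nra. }
  have c1 := cv (1 - x) (1 - y) ltac:(lra) ltac:(lra). have c2 := cv (1 + x) (1 + y) ltac:(lra) ltac:(lra). lra. }
have dF : forall z, U z -> cderiv Fm z (RtoC 0).
{ move=> z [h1 h2]. have h3 : Re (- z)%C < 1 by rewrite re_opp; lra.
  have d1 := Kq_deriv0 ha h2. have d2 : cderiv (fun z => Kq a (- z)%C) z (II (Kf2 a (- z)%C) * - (1))%C.
  { apply: (@cderiv_comp (Kq a) (fun z => - z)%C); [exact: cderiv_opp (cderiv_id _) | exact: Kq_deriv0]. }
  apply: cderiv_eq (cderiv_mult (cderiv_plus d1 d2) (Csqexp_deriv (- a) z)) _.
  rewrite !Kq_parts // RtoC_opp. ring. }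
have c := constant_convex cU dF (a := q) (b := RtoC 0) hq ltac:(rewrite /U re_RtoC; lra).
have c0 : Fm (RtoC 0) = (2 * Kq a (RtoC 0))%C.
{ rewrite /Fm. have -> : (- RtoC 0)%C = RtoC 0 by ring. have -> : Csqexp (- a) (RtoC 0) = RtoC 1. { rewrite /Csqexp -Cexp_0. congr Cexp. ring. }
  replace (RtoC 2) with (RtoC 1 + RtoC 1)%C by (rewrite -RtoC_plus; congr RtoC; ring). ring. }
rewrite -c0 -c /Fm -Cmult_assoc (Cmult_comm (Csqexp (- a) q)) Csqexp_inv. ring.
Qed.

Lemma isI_cauchy : isI (fun t => RtoC (1 / (1 + t ^ 2))) (RtoC PI).
Proof.
move=> e he. have [M [M0 h]] := atan_lim (e := e / 3) ltac:(lra). exists M. split => // a b ha hb.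
have i := is_RInt_atan 1 a b.
have eI : CInt (fun t => RtoC (1 / (1 + t ^ 2))) a b = RtoC (1 * (atan b - atan a)).
{ apply: is_CInt_unique. apply/is_CInt_pair. split => //=. have := is_RInt_const (V := R_NormedModule) a b 0. by rewrite scal_zero_r. }
rewrite eI -RtoC_minus Cmod_R. have h1 := h b hb. have h2 := h (- a) ltac:(lra). rewrite atan_opp in h2.
have b1 := atan_bound b. have b2 := atan_bound a. apply: Rabs_def1; lra.
Qed.

Lemma rcont_Re (f : R -> C) : (forall t, rcont f t) -> forall t, rcont (fun t => RtoC (Re (f t))) t.
Proof.
move=> h t e he. case: (h t e he) => d [hd H]. exists d. split => // u hu. apply: Rle_lt_trans (H u hu).
rewrite -RtoC_minus Cmod_R -re_minus. exact: re_le_Cmod.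
Qed.

(* Since K' = 2a (gam a + q K), the function K(q) e^(-a q^2) grows by 2a gam(a) times half a Gaussian integral from -oo to 0. *)
Lemma Kq_0 (a : R) : 0 < a -> Kq a (RtoC 0) = RtoC PI.
Proof.
move=> ha. have hp := PI_RGT_0. have [K [K0 hK]] := gauss1_bound ha.
pose P t := (Csqexp (- a) (RtoC t) * Kq a (RtoC t))%C. pose h t := RtoC (exp (- a * t ^ 2)).
have er : forall b t, Csqexp b (RtoC t) = RtoC (exp (b * t ^ 2)). { move=> b t. rewrite /Csqexp -!RtoC_mult Cexp_RtoC. congr (RtoC (exp _)). ring. }
have dP : forall t, t <= 0 -> rderiv P t (RtoC (2 * a * gam a) * h t)%C.
{ move=> t ht. have h1 : Re (RtoC t) < 1 by rewrite re_RtoC; lra.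
  have dt : rderiv RtoC t (RtoC 1). { apply: (rderiv_RtoC (g := fun x => x)). exact: is_derive_id. }
  apply: rderiv_eq (@rderiv_comp (fun z => Csqexp (- a) z * Kq a z)%C RtoC t _ _ dt (cderiv_mult (Csqexp_deriv (- a) (RtoC t)) (Kq_deriv0 ha h1))) _.
  rewrite Kq_parts // /h -er RtoC_opp !RtoC_mult. ring. }
have ch : forall t, rcont h t by exact: rcont_gauss.
have half : forall Y, 0 <= Y -> is_CInt h (- Y) Y ((P 0 - P (- Y)%R) / RtoC (a * gam a))%C.
{ move=> Y hY. have g0 : a * gam a <> 0. { apply: Rmult_integral_contrapositive_currified; first lra. rewrite gam_val //. apply: Rgt_not_eq. apply: sqrt_lt_R0. exact: Rdiv_lt_0_compat. }
  have i := @is_CInt_FTC P (fun t => RtoC (2 * a * gam a) * h t)%C (- Y) 0 ltac:(lra) (fun t ht => dP t (proj2 ht)) (fun t _ => rcont_scal _ (ch t)).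
  have i1 := is_CInt_scal (c := (/ RtoC (2 * a * gam a))%C) i.
  have n2 : RtoC (2 * a * gam a) <> RtoC 0 by move=> /RtoC_inj; lra. have n1 : RtoC (a * gam a) <> RtoC 0 by move=> /RtoC_inj; lra.
  have i2 : is_CInt h (- Y) 0 (/ RtoC (2 * a * gam a) * (P 0 - P (- Y)%R))%C. { apply: (is_CInt_ext _ _ i1); first lra. move=> t _. field. exact: n2. }
  have i3 := @is_CInt_comp_lin h (-1) 0 0 Y (- (/ RtoC (2 * a * gam a) * (P 0 - P (- Y)%R)))%C.
  rewrite Rmult_0_r Rplus_0_l Rplus_0_r (_ : -1 * Y = - Y) in i3; last ring.
  have i4 := is_CInt_scal (c := (- (1))%C) (i3 (is_RInt_swap (V := C_R_NormedModule) _ _ _ _ i2)).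
  have i5 : is_CInt h 0 Y (/ RtoC (2 * a * gam a) * (P 0 - P (- Y)%R))%C.
  { replace (/ RtoC (2 * a * gam a) * (P 0 - P (- Y)%R))%C with (- (1) * - (/ RtoC (2 * a * gam a) * (P 0 - P (- Y)%R)))%C by ring. apply: (is_CInt_ext hY _ i4) => t _. rewrite /h (_ : (-1 * t + 0) ^ 2 = t ^ 2); [ring | ring]. }
  have := is_CInt_Chasles i2 i5. congr is_CInt. rewrite !RtoC_mult. field. split; move=> /RtoC_inj e; apply: g0; rewrite e; ring. }
set g := gam a in half. have g0 : 0 < g by rewrite /g gam_val //; apply: sqrt_lt_R0; exact: Rdiv_lt_0_compat.
have e : P 0 = RtoC (a * g * g).
{ have ag : 0 < a * g by exact: Rmult_lt_0_compat. apply: Ceq_of_eps => e he. set d := e / (2 * (a * g)). have d0 : 0 < d by apply: Rdiv_lt_0_compat; lra.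
  case: (isI_gauss ha d0) => M [M0 HM]. set Y := M + 2 * K * PI / e. have q0 : 0 <= 2 * K * PI / e. { apply: Rdiv_le_0_compat => //. apply: Rmult_le_pos; lra. }
  have Y0 : 0 <= Y by rewrite /Y; lra. have := HM (- Y) Y ltac:(rewrite /Y; lra) ltac:(rewrite /Y; lra). rewrite (is_CInt_unique (half Y Y0)) -/g => b1.
  have hr : Re (RtoC (- Y)) < 1 by rewrite re_RtoC; lra.
  have p1 : 0 < 1 + Y by lra. have hm : 1 + Y <= 1 - Re (RtoC (- Y)) by rewrite re_RtoC; lra.
  have b2 := isI_bound (Kf_dom hK K0 p1 hm) (isI_Kq ha hr).
  have b3 : Cmod (P (- Y)%R) <= e / 2.
  { rewrite /P er Cmod_mult Cmod_RtoC_pos; last by left; exact: exp_pos. have x1 : exp (- a * (- Y) ^ 2) <= 1 by rewrite -exp_0; apply: exp_le; have := pow2_ge_0 (- Y); nra.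
    have c0 := Cmod_ge_0 (Kq a (RtoC (- Y))). apply: Rle_trans (_ : K / (1 + Y) * PI <= _); first by have := exp_pos (- a * (- Y) ^ 2); nra.
    have -> : K / (1 + Y) * PI = K * PI / (1 + Y) by field; lra. apply/Rle_div_l; first lra. have : e * (2 * K * PI / e) = 2 * K * PI by field; lra. rewrite /Y. nra. }
  have n1 : RtoC (a * g) <> RtoC 0 by move=> /RtoC_inj; lra.
  have -> : (P 0 - RtoC (a * g * g))%C = (RtoC (a * g) * ((P 0 - P (- Y)%R) / RtoC (a * g) - RtoC g) + P (- Y)%R)%C by rewrite (RtoC_mult (a * g) g); field.
  apply: Rle_trans (Cmod_triangle _ _) _. rewrite Cmod_mult Cmod_RtoC_pos; last lra. have := Rmult_lt_compat_l _ _ _ ag b1. have -> : a * g * d = e / 2 by rewrite /d; field; lra. lra. }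
have gg : a * g * g = PI. { rewrite /g gam_val // Rmult_assoc sqrt_sqrt; first by field; lra. left. exact: Rdiv_lt_0_compat. }
rewrite gg in e. rewrite -e /P er. have -> : - a * 0 ^ 2 = 0 by ring. rewrite exp_0. ring.
Qed.

(** 2w / (w^2 - q^2) = 1 / (w - q) + 1 / (w + q), the symmetric combination evaluated by
    [Kq_sym]. *)
Lemma pole_integral (a : R) (q : C) : 0 < a -> -1 < Re q < 1 ->
  isI (fun t => Csqexp a (1, t) * (2 * (1, t) / ((1, t) * (1, t) - q * q)))%C (2 * RtoC PI * Csqexp a q)%C.
Proof.
move=> ha hq. have h2 : Re (- q)%C < 1. { have -> : Re (- q)%C = - Re q by case: q {hq}. lra. } have h1 : Re q < 1 by lra.
have s := isI_plus (fun t => Kf_cont a t h1) (fun t => Kf_cont a t h2) (isI_Kq ha h1) (isI_Kq ha h2).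
rewrite Kq_sym // Kq_0 // in s. apply: isI_ext s => t. rewrite /Kf.
have n1 := @wq_neq q t h1. have n2 := @wq_neq (- q)%C t h2. have n2' : ((1, t) + q)%C <> RtoC 0. { move=> e. apply: n2. rewrite -e. ring. }
have e : ((1, t) * (1, t) - q * q)%C = (((1, t) - q) * ((1, t) + q))%C by ring. rewrite e. replace (RtoC 2) with (RtoC 1 + RtoC 1)%C by (rewrite -RtoC_plus; congr RtoC; ring). field. by split.
Qed.

(** * Hermite functions as contour integrals *)

Definition Jint (a : R) (m : nat) (u : R) (t : R) : C := ((1, t) ^ m * Csqexp a (1, t) * Cexp (- (RtoC u * (1, t))))%C.
(** The integral produced by one Dirichlet series term, with u = log n. *)
Definition J (a : R) (m : nat) (u : R) : C := II (Jint a m u).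

Lemma Jint_cont (a : R) (m : nat) (u t : R) : rcont (Jint a m u) t.
Proof.
apply: (@line_cont (fun w => w ^ m * Csqexp a w * Cexp (- (RtoC u * w)))%C 1) => z _.
apply: ccont_mult; first exact: pow_gauss_ccont. apply: (@ccont_comp Cexp (fun w => - (RtoC u * w))%C).
- apply: ccont_opp. apply: ccont_mult; [exact: ccont_const | exact: ccont_id].
- exact: cderiv_ccont (Cexp_cderiv _).
Qed.

Lemma Jint_dom (a : R) (m : nat) : 0 < a -> exists K, 0 <= K /\ forall u, dom (Jint a m u) (K * exp (- u)).
Proof.
move=> ha. have [K [K0 h]] := pow_gauss_bound m ha. exists K. split => // u. split; first by move=> t; exact: Jint_cont.
move=> t. have t2 := pow2_ge_0 t. rewrite /Jint Cmod_mult Cmod_Cexp. have -> : Re (- (RtoC u * (1, t)))%C = - u by rewrite /=; ring.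
have -> : K * exp (- u) / (1 + t ^ 2) = K / (1 + t ^ 2) * exp (- u) by field; lra.
apply: Rmult_le_compat_r; first by left; exact: exp_pos. apply: h. lra.
Qed.

Lemma isI_J (a : R) (m : nat) (u : R) : 0 < a -> isI (Jint a m u) (J a m u).
Proof. move=> ha. have [K [K0 h]] := Jint_dom m ha. exact: isI_II (h u). Qed.

(** Completing the square amounts to moving the line to Re w = 1 - u / (2a). *)
Lemma J_0 (a u : R) : 0 < a -> J a 0 u = RtoC (gam a * exp (- u ^ 2 / (4 * a))).
Proof.
move=> ha. apply: II_eq. have h := isI_gauss_line (1 - u / (2 * a)) ha.
have c : forall t, rcont (fun t => Csqexp a (1 - u / (2 * a), t)) t. { apply: (@line_cont (Csqexp a)) => z _. exact: cderiv_ccont (Csqexp_deriv a z). }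
have h2 := isI_scal (RtoC (exp (- u ^ 2 / (4 * a)))) c h. rewrite -RtoC_mult (Rmult_comm (exp _) (gam a)) in h2.
apply: isI_ext h2 => t. rewrite /Jint /Csqexp -Cexp_RtoC -Cexp_plus Cmult_1_l -Cexp_plus. congr Cexp.
rewrite /RtoC /Cmult /Cplus /Copp /=. congr (_, _); field; lra.
Qed.

Lemma Jint_parts (a : R) (m : nat) (u t : R) :
  rderiv (Jint a (S m) u) t (Ci * (RtoC (INR (S m)) * Jint a m u t + 2 * RtoC a * Jint a (S (S m)) u t - RtoC u * Jint a (S m) u t))%C.
Proof.
have d3 : cderiv (fun w => Cexp (- (RtoC u * w))%C) (1, t) (Cexp (- (RtoC u * (1, t))) * (- (0 * (1, t) + RtoC u * 1)))%C.
{ apply: (@cderiv_comp Cexp (fun w => - (RtoC u * w))%C); last exact: Cexp_cderiv. apply: cderiv_opp. exact: cderiv_mult (cderiv_const _ _) (cderiv_id _). }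
have d := cderiv_mult (cderiv_mult (cderiv_pow m (1, t)) (Csqexp_deriv a (1, t))) d3.
apply: rderiv_eq (@rderiv_comp _ (fun t => (1, t)) t _ _ (vline_rderiv 1 t) d) _.
rewrite /Jint. change ((1, t) ^ S (S m))%C with ((1, t) * ((1, t) * (1, t) ^ m))%C. change ((1, t) ^ S m)%C with ((1, t) * (1, t) ^ m)%C. ring.
Qed.

Lemma Jint_parts0 (a u t : R) : rderiv (Jint a 0 u) t (Ci * (2 * RtoC a * Jint a 1 u t - RtoC u * Jint a 0 u t))%C.
Proof.
have d3 : cderiv (fun w => Cexp (- (RtoC u * w))%C) (1, t) (Cexp (- (RtoC u * (1, t))) * (- (0 * (1, t) + RtoC u * 1)))%C.
{ apply: (@cderiv_comp Cexp (fun w => - (RtoC u * w))%C); last exact: Cexp_cderiv. apply: cderiv_opp. exact: cderiv_mult (cderiv_const _ _) (cderiv_id _). }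
have d := cderiv_mult (cderiv_mult (cderiv_const (RtoC 1) (1, t)) (Csqexp_deriv a (1, t))) d3.
apply: rderiv_eq (@rderiv_comp _ (fun t => (1, t)) t _ _ (vline_rderiv 1 t) d) _. rewrite /Jint /=. ring.
Qed.

Lemma Ci_cancel (x : C) : (Ci * x)%C = RtoC 0 -> x = RtoC 0.
Proof. move=> h. have ci : Ci <> RtoC 0. { move=> e2. have := f_equal Im e2. rewrite /=. lra. } replace x with (/ Ci * (Ci * x))%C by (field; exact: ci). rewrite h. ring. Qed.

Lemma J_rec (a : R) (m : nat) (u : R) : 0 < a -> (2 * RtoC a * J a (S (S m)) u)%C = (RtoC u * J a (S m) u - RtoC (INR (S m)) * J a m u)%C.
Proof.
move=> ha. have c := @Jint_cont a. have cs : forall k m t, rcont (fun t => k * Jint a m u t)%C t by move=> k m' t; apply: rcont_scal; exact: c.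
have i1 := isI_scal (RtoC (INR (S m))) (c m u) (isI_J m u ha). have i2 := isI_scal (2 * RtoC a)%C (c (S (S m)) u) (isI_J _ u ha). have i3 := isI_scal (RtoC u) (c (S m) u) (isI_J _ u ha).
have cp : forall t, rcont (fun t => RtoC (INR (S m)) * Jint a m u t + 2 * RtoC a * Jint a (S (S m)) u t)%C t by move=> t; apply: rcont_plus; exact: cs.
have cm : forall t, rcont (fun t => RtoC (INR (S m)) * Jint a m u t + 2 * RtoC a * Jint a (S (S m)) u t - RtoC u * Jint a (S m) u t)%C t by move=> t; apply: rcont_minus; [exact: cp | exact: cs].
have i4 := isI_scal Ci cm (isI_minus cp (cs _ _) (isI_plus (cs _ _) (cs _ _) i1 i2) i3).
have [K [K0 hd]] := Jint_dom (S m) ha.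
have z := isI_FTC (Jint_parts a m u) (fun t => rcont_scal Ci (cm t)) (dom_small (hd u)).
have e := Ci_cancel (isI_unique i4 z).
replace (2 * RtoC a * J a (S (S m)) u)%C with (RtoC (INR (S m)) * J a m u + 2 * RtoC a * J a (S (S m)) u - RtoC u * J a (S m) u + (RtoC u * J a (S m) u - RtoC (INR (S m)) * J a m u))%C by ring. rewrite e. ring.
Qed.

Lemma J_rec0 (a u : R) : 0 < a -> (2 * RtoC a * J a 1 u)%C = (RtoC u * J a 0 u)%C.
Proof.
move=> ha. have c := @Jint_cont a. have cs : forall k m t, rcont (fun t => k * Jint a m u t)%C t by move=> k m' t; apply: rcont_scal; exact: c.
have i2 := isI_scal (2 * RtoC a)%C (c 1%nat u) (isI_J _ u ha). have i3 := isI_scal (RtoC u) (c 0%nat u) (isI_J _ u ha).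
have cm : forall t, rcont (fun t => 2 * RtoC a * Jint a 1 u t - RtoC u * Jint a 0 u t)%C t by move=> t; apply: rcont_minus; exact: cs.
have i4 := isI_scal Ci cm (isI_minus (cs _ _) (cs _ _) i2 i3).
have [K [K0 hd]] := Jint_dom 0 ha.
have z := isI_FTC (Jint_parts0 a u) (fun t => rcont_scal Ci (cm t)) (dom_small (hd u)).
have e := Ci_cancel (isI_unique i4 z).
replace (2 * RtoC a * J a 1 u)%C with (2 * RtoC a * J a 1 u - RtoC u * J a 0 u + RtoC u * J a 0 u)%C by ring. rewrite e. ring.
Qed.

(** Hermite polynomials through their three-term recursion, the form in which integration by parts
    on [J] delivers them; [Hermite_Hp] identifies them with the derivative definition. *)
Fixpoint Hp (m : nat) (y : R) : R :=
  match m with O => 1 | S m' => match m' with O => 2 * y | S m'' => 2 * y * Hp m' y - 2 * INR m' * Hp m'' y end end.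

Lemma Hp_SS (m : nat) (y : R) : Hp (S (S m)) y = 2 * y * Hp (S m) y - 2 * INR (S m) * Hp m y.
Proof. by []. Qed.

(** Induction on two consecutive indices: with u = 2 sqrt(a) y the recursion of [J] becomes that of
    [Hp]. *)
Lemma J_val (a : R) (m : nat) (u : R) : 0 < a -> J a m u = RtoC (gam a * exp (- u ^ 2 / (4 * a)) * Hp m (u / (2 * sqrt a)) / (2 * sqrt a) ^ m).
Proof.
move=> ha. have r0 : 0 < sqrt a by exact: sqrt_lt_R0. have ra : sqrt a * sqrt a = a by apply: sqrt_sqrt; lra.
have can : forall x y : C, (2 * RtoC a * x)%C = (2 * RtoC a * y)%C -> x = y.
{ move=> x y h. have n : (2 * RtoC a)%C <> RtoC 0. { rewrite -RtoC_mult. apply: RtoC_neq. lra. } rewrite -(Cmult_1_l x) -(Cinv_l _ n) -Cmult_assoc h Cmult_assoc Cinv_l // Cmult_1_l //. }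
set y := u / (2 * sqrt a). set g := gam a * exp (- u ^ 2 / (4 * a)).
suff H : J a m u = RtoC (g * Hp m y / (2 * sqrt a) ^ m) /\ J a (S m) u = RtoC (g * Hp (S m) y / (2 * sqrt a) ^ (S m)) by exact: (proj1 H).
have s2 : forall n, (2 * sqrt a) ^ n <> 0 by move=> n; apply: pow_nonzero; lra.
elim: m => [|m [IH1 IH2]].
- have j0 := J_0 u ha. rewrite -/g in j0. split. { rewrite j0. congr RtoC. rewrite /=. field. }
  apply: can. rewrite J_rec0 // j0 -!RtoC_mult. congr RtoC. rewrite /= /y. move: r0 ra. clearbody g. set r := sqrt a. move=> r0 ra. rewrite -ra. field. lra.
- split => //. apply: can. rewrite J_rec // IH1 IH2 -!RtoC_mult -RtoC_minus. congr RtoC. rewrite Hp_SS.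
  change ((2 * sqrt a) ^ S (S m)) with (2 * sqrt a * (2 * sqrt a * (2 * sqrt a) ^ m)). change ((2 * sqrt a) ^ S m) with (2 * sqrt a * (2 * sqrt a) ^ m).
  have uy : u = y * (2 * sqrt a) by rewrite /y; field; lra. rewrite uy. move: r0 ra s2. clearbody g y. set r := sqrt a. move=> r0 ra s2. rewrite -ra. field. split; [exact: s2 | lra].
Qed.

Lemma Hp_odd0 (k : nat) : Hp (2 * k + 1) 0 = 0.
Proof.
elim: k => [|k IH]; first by rewrite /=; ring. have -> : (2 * S k + 1 = S (S (2 * k + 1)))%nat by lia. rewrite Hp_SS IH. ring.
Qed.

Lemma odd_moment (a : R) (k : nat) : 0 < a -> isI (fun t => (1, t) ^ (2 * k + 1) * Csqexp a (1, t))%C (RtoC 0).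
Proof.
move=> ha. have h := isI_J (2 * k + 1) 0 ha. rewrite J_val // in h.
have e0 : 0 / (2 * sqrt a) = 0 by lra. rewrite e0 Hp_odd0 in h.
have e1 : gam a * exp (- 0 ^ 2 / (4 * a)) * 0 / (2 * sqrt a) ^ (2 * k + 1) = 0 by lra. rewrite e1 in h.
apply: isI_ext h => t. rewrite /Jint. have -> : (- (RtoC 0 * (1, t)))%C = RtoC 0 by ring. rewrite Cexp_0. ring.
Qed.

(** On the imaginary axis w^(2k) = (-1)^k t^(2k); the sign is compensated so that [Fk] equals the
    nonnegative weight [hk] there. *)
Definition Fk (a : R) (k : nat) (w : C) : C := (RtoC ((-1) ^ k) * (w ^ (2 * k) * Csqexp a w))%C.
Definition hk (a : R) (k : nat) (t : R) : R := t ^ (2 * k) * exp (- a * t ^ 2).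

Lemma pole_cont (a : R) (k : nat) (q : C) : -1 < Re q < 1 -> forall t, rcont (fun t => (1, t) ^ (2 * k) * Csqexp a (1, t) * (2 * (1, t) / ((1, t) * (1, t) - q * q)))%C t.
Proof.
move=> hq. apply: (@line_cont (fun w => w ^ (2 * k) * Csqexp a w * (2 * w / (w * w - q * q)))%C 1) => z hz.
apply: ccont_mult; first exact: pow_gauss_ccont. apply: ccont_mult; first by apply: ccont_mult; [exact: ccont_const | exact: ccont_id].
apply: (@ccont_comp (fun w => / w)%C (fun w => w * w - q * q)%C).
- apply: ccont_minus; last exact: ccont_const. apply: ccont_mult; exact: ccont_id.
- apply: ccont_inv. have -> : (z * z - q * q)%C = ((z - q) * (z + q))%C by ring. apply: Cmult_neq_0 => e; have := f_equal Re e; rewrite ?re_minus ?re_plus /=; move: hz hq; rewrite /Re; lra.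
Qed.

(** Induction through w^2 = (w^2 - q^2) + q^2: the first summand cancels the denominator and leaves
    an odd Gaussian moment, which is 0. *)
Lemma pole_integral_k (a : R) (k : nat) (q : C) : 0 < a -> -1 < Re q < 1 ->
  isI (fun t => (1, t) ^ (2 * k) * Csqexp a (1, t) * (2 * (1, t) / ((1, t) * (1, t) - q * q)))%C (2 * RtoC PI * ((q * q) ^ k * Csqexp a q))%C.
Proof.
move=> ha hq. elim: k => [|k IH].
- have -> : (2 * RtoC PI * ((q * q) ^ 0 * Csqexp a q))%C = (2 * RtoC PI * Csqexp a q)%C by rewrite /=; ring.
  apply: isI_ext (pole_integral ha hq) => t. rewrite /=. ring.
- have cp := pole_cont a k hq. have h1 := isI_scal (q * q)%C cp IH.
  have co : forall t, rcont (fun t => (1, t) ^ (2 * k + 1) * Csqexp a (1, t))%C t. { apply: (@line_cont (fun w => w ^ (2 * k + 1) * Csqexp a w)%C 1) => z _. exact: pow_gauss_ccont. }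
  have h2 := isI_scal (RtoC 2) co (odd_moment k ha).
  have h3 := isI_plus (fun t => rcont_scal (q * q)%C (cp t)) (fun t => rcont_scal (RtoC 2) (co t)) h1 h2.
  have e : (q * q * (2 * RtoC PI * ((q * q) ^ k * Csqexp a q)) + RtoC 2 * RtoC 0)%C = (2 * RtoC PI * ((q * q) ^ S k * Csqexp a q))%C.
  { change ((q * q) ^ S k)%C with (q * q * (q * q) ^ k)%C. ring. }
  rewrite e in h3. apply: isI_ext h3 => t.
  have -> : (2 * S k = S (S (2 * k)))%nat by lia. have -> : (2 * k + 1 = S (2 * k))%nat by lia.
  change ((1, t) ^ S (S (2 * k)))%C with ((1, t) * ((1, t) * (1, t) ^ (2 * k)))%C. change ((1, t) ^ S (2 * k))%C with ((1, t) * (1, t) ^ (2 * k))%C.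
  have n : ((1, t) * (1, t) - q * q)%C <> RtoC 0.
  { have -> : ((1, t) * (1, t) - q * q)%C = (((1, t) - q) * ((1, t) + q))%C by ring. apply: Cmult_neq_0 => z; have := f_equal Re z; rewrite ?re_minus ?re_plus /=; move: hq; rewrite /Re; lra. }
  field. exact: n.
Qed.

Lemma Fk_pole (a : R) (k : nat) (q : C) (x : R) : 0 < a -> -1 < Re q < 1 -> (q * q)%C = RtoC x ->
  isI (fun t => Fk a k (1, t) * (2 * (1, t) / ((1, t) * (1, t) - RtoC x)))%C (RtoC (2 * PI * ((- x) ^ k * exp (a * x)))).
Proof.
move=> ha hq hx. have h := isI_scal (RtoC ((-1) ^ k)) (pole_cont a k hq) (pole_integral_k k ha hq).
have e : (RtoC ((-1) ^ k) * (2 * RtoC PI * ((q * q) ^ k * Csqexp a q)))%C = RtoC (2 * PI * ((- x) ^ k * exp (a * x))).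
{ have ec : Cexp (RtoC a * RtoC x) = RtoC (exp (a * x)) by rewrite -RtoC_mult Cexp_RtoC.
  rewrite /Csqexp hx ec -RtoC_pow -!RtoC_mult. congr RtoC. have -> : (- x) ^ k = (-1) ^ k * x ^ k by rewrite -Rpow_mult_distr; congr (_ ^ _); ring. ring. }
rewrite e in h. apply: isI_ext h => t. rewrite /Fk hx. ring.
Qed.

(** The pole q = i g lies on the imaginary axis, well inside the strip |Re q| < 1, and there q^2 =
    -g^2 produces the weight at g. *)
Lemma Fk_zero (a : R) (k : nat) (g : R) : 0 < a ->
  isI (fun t => Fk a k (1, t) * (2 * (1, t) / ((1, t) * (1, t) + RtoC (g ^ 2))))%C (RtoC (2 * PI * hk a k g)).
Proof.
move=> ha. have h := @Fk_pole a k (0, g) (- g ^ 2) ha ltac:(rewrite /=; lra) _. 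
have {h} h := h ltac:(rewrite /RtoC /Cmult /=; congr (_, _); ring).
have e : 2 * PI * ((- - g ^ 2) ^ k * exp (a * - g ^ 2)) = 2 * PI * hk a k g.
{ rewrite /hk. have -> : - - g ^ 2 = g ^ 2 by ring. rewrite pow_mult. congr (_ * (_ * exp _)). ring. }
rewrite e in h. apply: isI_ext h => t. rewrite RtoC_opp. congr (_ * (_ / _))%C. ring.
Qed.

Lemma Fk_bound (a : R) (k m : nat) : 0 < a -> exists K, 0 <= K /\ forall c t, 0 <= c <= 1 -> Cmod (Fk a k (c, t)) * Cmod (c, t) ^ m <= K / (1 + t ^ 2).
Proof.
move=> ha. have [K [K0 h]] := pow_gauss_bound (2 * k + m) ha. exists K. split => // c t hc.
rewrite /Fk Cmod_mult Cmod_R -RPow_abs Rabs_m1 pow1 Rmult_1_l. apply: Rle_trans (h c t hc).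
rewrite !Cmod_mult !Cmod_pow pow_add. right. ring.
Qed.

Lemma Fk_holo (a : R) (k : nat) (z : C) : exists l, cderiv (Fk a k) z l.
Proof.
have [l hl] : exists l, cderiv (fun w => w ^ (2 * k))%C z l.
{ case: (2 * k)%nat => [|n]; first by exists (RtoC 0); exact: (@cderiv_ext_loc (fun _ => RtoC 1) _ _ _ 1 Rlt_0_1 (fun _ _ => eq_refl) (cderiv_const _ _)). eexists. exact: cderiv_pow. }
eexists. apply: cderiv_scal. apply: cderiv_mult hl (Csqexp_deriv a z).
Qed.

Lemma Fk_0 (a : R) (k : nat) (t : R) : Fk a k (0, t) = RtoC (hk a k t).
Proof.
rewrite /Fk /hk. have -> : ((0, t) ^ (2 * k))%C = RtoC ((- t ^ 2) ^ k).
{ rewrite Cpow_mult_r RtoC_pow. congr (_ ^ _)%C. rewrite /= Cmult_1_r /RtoC /Cmult /=. congr (_, _); ring. }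
have -> : Csqexp a (0, t) = RtoC (exp (- a * t ^ 2)). { rewrite /Csqexp -Cexp_RtoC. congr Cexp. rewrite /RtoC /Cmult /=. congr (_, _); ring. }
rewrite -!RtoC_mult. congr RtoC. have -> : (- t ^ 2) ^ k = (-1) ^ k * t ^ (2 * k) by rewrite pow_mult -Rpow_mult_distr; congr (_ ^ _); ring.
have e : (-1) ^ k * (-1) ^ k = 1. { rewrite -Rpow_mult_distr. have -> : -1 * -1 = 1 by ring. exact: pow1. }
rewrite -Rmult_assoc -Rmult_assoc e. ring.
Qed.

(** * Explicit formula *)

Lemma Cser_re (a : nat -> C) (l : C) : Cser a l -> is_series (fun n => Re (a n)) (Re l).
Proof.
move=> h. apply/Cser_RtoC => e he. case: (h e he) => N HN. exists N => n hn. apply: Rle_lt_trans (HN n hn).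
have -> : Csum (fun n => RtoC (Re (a n))) n = RtoC (Re (Csum a n)).
{ elim: n {hn} => [|n IH] //. rewrite [LHS]/= IH. change (Csum a (S n)) with (Csum a n + a n)%C. by rewrite re_plus RtoC_plus. }
rewrite -RtoC_minus Cmod_R -re_minus. exact: re_le_Cmod.
Qed.

Definition pterm (a : R) (k n : nat) : R :=
  (-1) ^ k * (Lam n * exp (- lnS n / 2)) * (gam a * exp (- lnS n ^ 2 / (4 * a)) * Hp (2 * k) (lnS n / (2 * sqrt a)) / (2 * sqrt a) ^ (2 * k)).

(** With s = 1/2 + w, n^(-s) = n^(-1/2) e^(-w log n). On Re w = 1 the terms are dominated by
    Lambda(n) n^(-3/2), so termwise integration applies. *)
Lemma prime_integral (a : R) (k : nat) : 0 < a ->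
  ex_series (pterm a k) /\ isI (fun t => Fk a k (1, t) * LC (RtoC (1/2) + (1, t)))%C (RtoC (Series (pterm a k))).
Proof.
move=> ha. have [K [K0 hd]] := Jint_dom (2 * k) ha.
pose f n t := (RtoC ((-1) ^ k * (Lam n * exp (- lnS n / 2))) * Jint a (2 * k) (lnS n) t)%C.
have fd : forall n, dom (f n) (K * (Lam n * exp (- (3/2) * lnS n))).
{ move=> n. split; first by move=> t; apply: rcont_scal; exact: Jint_cont. move=> t. have t2 := pow2_ge_0 t. have [l0 _] := Lam_bound n.
  rewrite /f Cmod_mult Cmod_R !Rabs_mult -RPow_abs Rabs_m1 pow1 Rmult_1_l (Rabs_pos_eq (Lam n)) // (Rabs_pos_eq (exp _)); last by left; exact: exp_pos.
  have -> : K * (Lam n * exp (- (3/2) * lnS n)) / (1 + t ^ 2) = Lam n * exp (- lnS n / 2) * (K * exp (- lnS n) / (1 + t ^ 2)).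
  { have -> : - (3/2) * lnS n = - lnS n / 2 + - lnS n by field. rewrite exp_plus. field. lra. }
  apply: Rmult_le_compat_l; last exact: (proj2 (hd (lnS n))). apply: Rmult_le_pos => //. left. exact: exp_pos. }
have ms : ex_series (fun n => K * (Lam n * exp (- (3/2) * lnS n))). { apply: (ex_series_scal_l K). apply: Lam_ex. lra. }
have fi : forall n, isI (f n) (RtoC (pterm a k n)).
{ move=> n. have := isI_scal (RtoC ((-1) ^ k * (Lam n * exp (- lnS n / 2)))) (@Jint_cont a (2 * k) (lnS n)) (isI_J (2 * k) (lnS n) ha).
  by rewrite J_val // -RtoC_mult. }
have fs : forall t, Cser (fun n => f n t) (Fk a k (1, t) * LC (RtoC (1/2) + (1, t)))%C.
{ move=> t. have h := LC_ser (s := (RtoC (1/2) + (1, t))%C) ltac:(rewrite re_plus /=; lra).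
  apply: Cser_ext (Cser_scal (Fk a k (1, t)) h) => n. rewrite /f /Lt /Fk /Jint /zterm.
  have -> : (- ((RtoC (1/2) + (1, t)) * RtoC (lnS n)))%C = (RtoC (- lnS n / 2) + - (RtoC (lnS n) * (1, t)))%C.
  { rewrite /RtoC /Cplus /Cmult /Copp /=. congr (_, _); field. }
  rewrite Cexp_plus Cexp_RtoC !RtoC_mult. ring. }
have [L [hL [hI _]]] := isI_series fd ms fs fi.
have rs := Cser_re hL. have rs2 : is_series (pterm a k) (Re L) by apply: is_series_ext rs => n.
have eL : L = RtoC (Re L). { apply: Cser_unique hL _. exact/Cser_RtoC. }
split; first by exists (Re L). rewrite (is_series_unique _ _ rs2) -eL. exact: hI.
Qed.

(** [Dc] is regular for Re s > 0, so the line may move from Re s = 3/2 to the critical line, its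
    linear growth being absorbed by the Gaussian. There [Fk] is real, and the real part retains only
    Re [Dc]. *)
Lemma arch_integral (a : R) (k : nat) : 0 < a -> exists l,
  isI (fun t => Fk a k (1, t) * Dc (RtoC (1/2) + (1, t)))%C l /\ isI (fun t => RtoC (hk a k t * Re (Dc (1/2, t)))) (RtoC (Re l)) /\
  (forall t, rcont (fun t => Fk a k (1, t) * Dc (RtoC (1/2) + (1, t)))%C t).
Proof.
move=> ha. pose G w := (Fk a k w * Dc (RtoC (1/2) + w))%C.
have hol : forall z, 0 <= Re z -> exists l, cderiv G z l.
{ move=> z hz. have [l hl] := Fk_holo a k z. have [m hm] := @Dc_holo (RtoC (1/2) + z)%C ltac:(rewrite re_plus re_RtoC; lra).
  eexists. apply: cderiv_mult hl _. apply: (@cderiv_comp Dc (fun w => RtoC (1/2) + w)%C) hm. exact: cderiv_plus (cderiv_const _ _) (cderiv_id _). }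
have [K0 [K00 h0]] := Fk_bound k 0 ha. have [K1 [K10 h1]] := Fk_bound k 1 ha.
set D := Series (fun n => / INR (S n) ^ 2). have D0 : 0 <= D. { apply: Series_pos ex_series_inv_sq => n. left. apply: Rinv_0_lt_compat. have := INR_S_pos n. nra. }
set c0 := Rabs (ln PI / 2) + 9 * D. have c00 : 0 <= c0. { have := Rabs_pos (ln PI / 2). rewrite /c0. lra. }
have gb : forall c t, 0 <= c <= 1 -> Cmod (G (c, t)) <= (c0 * K0 + 4 * D * K1) / (1 + t ^ 2).
{ move=> c t hc. rewrite /G Cmod_mult. set s := (RtoC (1/2) + (c, t))%C. have rs : Re s = 1/2 + c by rewrite /s re_plus re_RtoC.
  have b := Dc_bound (s := s) ltac:(lra). rewrite -/D in b.
  have sm : Cmod s <= 1/2 + Cmod (c, t). { apply: Rle_trans (Cmod_triangle _ _) _. rewrite Cmod_RtoC_pos; lra. }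
  have r2 : 2 / Re s <= 4. { apply/Rle_div_l; lra. }
  have db : Cmod (Dc s) <= c0 + 4 * D * Cmod (c, t). { apply: Rle_trans b _. rewrite /c0. nra. }
  have q0 := h0 c t hc. have q1 := h1 c t hc. rewrite pow_1 in q1. rewrite /= Rmult_1_r in q0. rewrite -/(t ^ 2) in q0. have f0 := Cmod_ge_0 (Fk a k (c, t)).
  apply: Rle_trans (Rmult_le_compat_l _ _ _ f0 db) _.
  have e1 : c0 * Cmod (Fk a k (c, t)) <= c0 * (K0 / (1 + t ^ 2)) by nra.
  have e2 : 4 * D * (Cmod (Fk a k (c, t)) * Cmod (c, t)) <= 4 * D * (K1 / (1 + t ^ 2)) by nra.
  lra. }
have cont : forall c, 0 <= c -> forall t, rcont (fun t => G (c, t)) t.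
{ move=> c hc. apply: (@line_cont G c) => z hz. have [l hl] := hol z ltac:(lra). exact: cderiv_ccont hl. }
have d1 : dom (fun t => G (1, t)) (c0 * K0 + 4 * D * K1). { split; [apply: cont; lra | move=> t; apply: gb; lra]. }
exists (II (fun t => G (1, t))). have i1 := isI_II d1. split; first exact: i1. split; last by move=> t; apply: (cont 1); lra.
have sh := proj2 (@line_shift G 0 1 (c0 * K0 + 4 * D * K1) (II (fun t => G (1, t))) ltac:(lra) (fun z hz => hol z (proj1 hz)) gb) i1.
have r := isI_re (cont 0 (Rle_refl 0)) sh.
apply: isI_ext r => t. congr RtoC. rewrite /G Fk_0. have -> : (RtoC (1/2) + (0, t))%C = (1/2, t) by rewrite /RtoC /Cplus /=; congr (_, _); ring.
case: (Dc (1/2, t)) => x y /=. ring.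
Qed.

Section Transform.
Variables (zeta : C -> C) (rho : nat -> C).
Hypothesis Hz : is_Riemann_zeta zeta.
Hypothesis RH : Riemann_hypothesis zeta.
Hypothesis Hs : all_nontrivial_zeros_simple zeta.
Hypothesis Hr : upper_zero_enumeration zeta rho.

(** As |w|, |w - i g| and |w + i g| are at least 1, the last two are at least g / (2 |w|). The
    summable decay 1 / g^2 is thus bought with |w|^3, which [Fk_bound] absorbs. *)
Lemma zero_kernel_bound (g t : R) : 0 < g -> Cmod (2 * (1, t) / ((1, t) * (1, t) + RtoC (g ^ 2))) <= 8 * Cmod (1, t) ^ 3 / g ^ 2.
Proof.
move=> hg. set w : C := (1, t). set p : C := (0, g).
have e : (w * w + RtoC (g ^ 2))%C = ((w - p) * (w + p))%C by rewrite /w /p /RtoC /Cmult /Cplus /Cminus /Copp /=; congr (_, _); ring.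
have ge1 : forall z : C, Re z = 1 -> 1 <= Cmod z. { move=> z hz. have := re_le_Cmod z. rewrite hz Rabs_R1. lra. }
have w1 : 1 <= Cmod w by apply: ge1. have m1 : 1 <= Cmod (w - p) by apply: ge1; rewrite re_minus /=; ring. have m2 : 1 <= Cmod (w + p) by apply: ge1; rewrite re_plus /=; ring.
have pm : Cmod p = g. { have -> : p = (RtoC g * Ci)%C by rewrite /p /RtoC /Cmult /=; congr (_, _); ring. rewrite Cmod_mult Cmod_Ci Cmod_RtoC_pos; lra. }
have a1 : g <= 2 * (Cmod (w - p) * Cmod w). { have := Cmod_triangle_minus w (w - p). have -> : (w - (w - p))%C = p by ring. rewrite pm. nra. }
have a2 : g <= 2 * (Cmod (w + p) * Cmod w). { have := Cmod_triangle_minus (w + p) w. have -> : (w + p - w)%C = p by ring. rewrite pm. nra. }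
have n1 : (w - p)%C <> RtoC 0 by apply/Cmod_gt_0; lra. have n2 : (w + p)%C <> RtoC 0 by apply/Cmod_gt_0; lra.
have g2 : 0 < g ^ 2 by nra.
rewrite e Cmod_div; last exact: Cmult_neq_0. rewrite !Cmod_mult Cmod_RtoC_pos; last lra.
have mp : 0 < Cmod (w - p) * Cmod (w + p) by nra.
apply/Rle_div_l => //. have -> : 8 * Cmod w ^ 3 / g ^ 2 * (Cmod (w - p) * Cmod (w + p)) = 8 * Cmod w ^ 3 * (Cmod (w - p) * Cmod (w + p)) / g ^ 2 by field; lra.
apply: (proj1 (Rle_div_r _ _ _ g2)).
have prod : g * g <= 2 * (Cmod (w - p) * Cmod w) * (2 * (Cmod (w + p) * Cmod w)) by nra.
have -> : 2 * Cmod w * g ^ 2 = 2 * Cmod w * (g * g) by ring.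
apply: Rle_trans (Rmult_le_compat_l (2 * Cmod w) _ _ ltac:(lra) prod) _. right. ring.
Qed.

(** [explicit_logderiv] is integrated against [Fk] along Re w = 1, the pole of zeta being [Fk_pole]
    at q = 1/2. Uniqueness of the integral equates the sum over zeros with the other three
    contributions. *)
Theorem explicit_formula (a : R) (k : nat) : 0 < a -> exists A,
  isI (fun t => RtoC (hk a k t * Re (Dc (1/2, t)))) (RtoC A) /\ ex_series (fun n => hk a k (gm rho n)) /\ ex_series (pterm a k) /\
  2 * PI * Series (fun n => hk a k (gm rho n)) = 2 * PI * ((- (1/4)) ^ k * exp (a / 4)) + A - Series (pterm a k).
Proof.
move=> ha. have [l [il [ih cl]]] := arch_integral k ha. have [pe ip] := prime_integral k ha.
have [K [K0 hK]] := Fk_bound k 3 ha.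
pose f n t := (Fk a k (1, t) * (2 * (1, t) / ((1, t) * (1, t) + RtoC (gm rho n ^ 2))))%C.
have gp := gm_pos Hr.
have nz : forall n z, Re z = 1 -> (z * z + RtoC (gm rho n ^ 2))%C <> RtoC 0.
{ move=> n [x y] /= -> e. have e1 := f_equal Re e. have e2 := f_equal Im e. rewrite /= in e1 e2. have y0 : y = 0 by lra. rewrite y0 in e1. nra. }
have cf : forall n t, rcont (f n) t.
{ move=> n. apply: (@line_cont (fun w => Fk a k w * (2 * w / (w * w + RtoC (gm rho n ^ 2))))%C 1) => z hz.
  have [m hm] := Fk_holo a k z. apply: ccont_mult; first exact: cderiv_ccont hm. apply: ccont_mult; first by apply: ccont_mult; [exact: ccont_const | exact: ccont_id].
  apply: (@ccont_comp (fun w => / w)%C (fun w => w * w + RtoC (gm rho n ^ 2))%C); last by apply: ccont_inv; exact: nz.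
  apply: ccont_plus; [apply: ccont_mult; exact: ccont_id | exact: ccont_const]. }
have fd : forall n, dom (f n) (8 * K * / gm rho n ^ 2).
{ move=> n. split; first exact: cf. move=> t. have g2 : 0 < gm rho n ^ 2 by apply: pow_lt.
  rewrite /f Cmod_mult. apply: Rle_trans (Rmult_le_compat_l _ _ _ (Cmod_ge_0 _) (zero_kernel_bound t (gp n))) _.
  have -> : Cmod (Fk a k (1, t)) * (8 * Cmod (1, t) ^ 3 / gm rho n ^ 2) = 8 * / gm rho n ^ 2 * (Cmod (Fk a k (1, t)) * Cmod (1, t) ^ 3) by lra.
  have -> : 8 * K * / gm rho n ^ 2 / (1 + t ^ 2) = 8 * / gm rho n ^ 2 * (K / (1 + t ^ 2)) by lra.
  apply: Rmult_le_compat_l; last by apply: hK; lra. have := Rinv_0_lt_compat _ g2. lra. }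
have ms : ex_series (fun n => 8 * K * / gm rho n ^ 2) by apply: (ex_series_scal_l (8 * K)); exact: (gm2_ex Hz RH Hs Hr).
pose S w := (2 * w / (w * w - RtoC (1/4)) + Dc (RtoC (1/2) + w) - LC (RtoC (1/2) + w))%C.
have fs : forall t, Cser (fun n => f n t) (Fk a k (1, t) * S (1, t))%C.
{ move=> t. apply: (Cser_scal (Fk a k (1, t))). apply: (explicit_logderiv Hz RH Hs Hr). rewrite /=. lra. }
have [L [hL [hI _]]] := isI_series fd ms fs (fun n => Fk_zero k (gm rho n) ha).
have hq : (RtoC (1/2) * RtoC (1/2))%C = RtoC (1/4). { rewrite -RtoC_mult. congr RtoC. field. }
have q1 : -1 < Re (RtoC (1/2)) < 1 by rewrite re_RtoC; lra.
have i1 := Fk_pole k ha q1 hq.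
have c1 : forall t, rcont (fun t => Fk a k (1, t) * (2 * (1, t) / ((1, t) * (1, t) - RtoC (1/4))))%C t.
{ have c0 := pole_cont a k q1. move=> t. have := rcont_scal (RtoC ((-1) ^ k)) (c0 t). move=> c e he. case: (c e he) => d [hd H]. exists d. split => // u hu. have := H u hu. rewrite /Fk hq.
  have as1 : forall x y z v : C, (x * (y * z * v) = x * (y * z) * v)%C by move=> x y z v; ring. by rewrite !as1. }
have c12 : forall t, rcont (fun t => Fk a k (1, t) * (2 * (1, t) / ((1, t) * (1, t) - RtoC (1/4))) + Fk a k (1, t) * Dc (RtoC (1/2) + (1, t)))%C t by move=> t; apply: rcont_plus; [exact: c1 | exact: cl].
have c3 : forall t, rcont (fun t => Fk a k (1, t) * LC (RtoC (1/2) + (1, t)))%C t.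
{ apply: (@line_cont (fun w => Fk a k w * LC (RtoC (1/2) + w))%C 1) => z hz. have [m hm] := Fk_holo a k z. apply: ccont_mult; first exact: cderiv_ccont hm.
  have [m2 hm2] := @LC_holo (RtoC (1/2) + z)%C ltac:(rewrite re_plus re_RtoC; lra).
  apply: (@ccont_comp LC (fun w => RtoC (1/2) + w)%C); [exact: ccont_plus (ccont_const _ _) (ccont_id _) | exact: cderiv_ccont hm2]. }
have i3 := isI_minus c12 c3 (isI_plus c1 cl i1 il) ip.
have eL : L = (RtoC (2 * PI * ((- (1/4)) ^ k * exp (a * (1/4)))) + l - RtoC (Series (pterm a k)))%C.
{ apply: isI_unique hI _. apply: isI_ext i3 => t. rewrite /S. ring. }
have rs := Cser_re hL. have rs2 : is_series (fun n => 2 * PI * hk a k (gm rho n)) (Re L) by apply: is_series_ext rs => n.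
have pp := PI_RGT_0.
have rs3 : is_series (fun n => hk a k (gm rho n)) (/ (2 * PI) * Re L).
{ apply: is_series_ext (is_series_scal_l (/ (2 * PI)) _ _ rs2) => n. rewrite /scal /= /mult /=. field. lra. }
exists (Re l). split => //. split; first by exists (/ (2 * PI) * Re L). split => //.
rewrite (is_series_unique _ _ rs3) eL re_minus re_plus !re_RtoC. have -> : a * (1/4) = a / 4 by field. field. lra.
Qed.

End Transform.

(** * Moments and the Gamma function *)

Definition dHp (m : nat) (y : R) : R := match m with O => 0 | S n => 2 * INR (S n) * Hp n y end.

Lemma Hp_S (m : nat) (y : R) : Hp (S m) y = 2 * y * Hp m y - dHp m y.
Proof. case: m => [|m]; first by rewrite /=; ring. by rewrite Hp_SS. Qed.

Lemma Hp_derive (m : nat) (y : R) : is_derive (Hp m) y (dHp m y).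
Proof.
suff H : (forall y, is_derive (Hp m) y (dHp m y)) /\ forall y, is_derive (Hp (S m)) y (dHp (S m) y) by exact: (proj1 H y).
elim: m {y} => [|m [IH1 IH2]].
- split=> y; rewrite /=; auto_derive => //; ring.
- split => // y. apply: (is_derive_ext (fun y => 2 * y * Hp (S m) y - 2 * INR (S m) * Hp m y)); first by move=> t; rewrite Hp_SS.
  have d1 : is_derive (fun y => 2 * y) y 2 by auto_derive => //; ring.
  have d2 := is_derive_mult _ _ _ _ _ d1 (IH2 y) Rmult_comm. have d3 := is_derive_scal _ _ (2 * INR (S m)) _ (IH1 y).
  have d4 := is_derive_minus _ _ _ _ _ d2 d3. have e : minus (plus (mult 2 (Hp (S m) y)) (mult (2 * y) (dHp (S m) y))) (2 * INR (S m) * dHp m y) = dHp (S (S m)) y; last by rewrite -e.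
  change (2 * Hp (S m) y + 2 * y * dHp (S m) y + - (2 * INR (S m) * dHp m y) = 2 * INR (S (S m)) * Hp (S m) y).
  change (dHp (S m) y) with (2 * INR (S m) * Hp m y). rewrite (S_INR (S m)) Hp_S. ring.
Qed.

(** By induction the m-th derivative of e^(-y^2) is (-1)^m H_m e^(-y^2), through H_(m+1) = 2y H_m -
    H_m'. *)
Lemma Hermite_Hp (m : nat) (x : R) : Hermite m x = Hp m x.
Proof.
have D : forall m x, Derive_n (fun y => exp (- y ^ 2)) m x = (-1) ^ m * Hp m x * exp (- x ^ 2).
{ elim=> [|n IH] y; first by rewrite /=; ring.
  rewrite [LHS]/= (Derive_ext _ _ _ IH). apply: is_derive_unique.
  have d1 : is_derive (fun y => exp (- y ^ 2)) y (- (2 * y) * exp (- y ^ 2)) by auto_derive => //; rewrite /=; ring.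
  have d2 := is_derive_mult _ _ _ _ _ (is_derive_scal _ _ ((-1) ^ n) _ (Hp_derive n y)) d1 Rmult_comm.
  have e : plus (mult ((-1) ^ n * dHp n y) (exp (- y ^ 2))) (mult ((-1) ^ n * Hp n y) (- (2 * y) * exp (- y ^ 2))) = (-1) ^ S n * Hp (S n) y * exp (- y ^ 2); last by rewrite -e.
  rewrite /plus /mult Hp_S. change ((-1) ^ S n) with (-1 * (-1) ^ n). rewrite /=. ring. }
rewrite /Hermite D exp_Ropp. have e : (-1) ^ m * (-1) ^ m = 1. { rewrite -Rpow_mult_distr. have -> : -1 * -1 = 1 by ring. exact: pow1. }
have p := exp_pos (x ^ 2). have -> : (- 1) ^ m * exp (x ^ 2) * ((-1) ^ m * Hp m x * / exp (x ^ 2)) = ((-1) ^ m * (-1) ^ m) * Hp m x by field; lra. rewrite e. ring.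
Qed.

Definition mom (a : R) (k : nat) : R := Re (II (fun t => RtoC (hk a k t))).

Lemma hk_dom (a : R) (k : nat) : 0 < a -> exists K, dom (fun t => RtoC (hk a k t)) K.
Proof.
move=> ha. have [K [K0 h]] := Fk_bound k 0 ha. exists K. split.
- move=> t. apply: rcont_RtoC_diff. rewrite /hk. auto_derive => //.
- move=> t. have := h 0 t ltac:(lra). by rewrite Fk_0 /= !Rmult_1_r.
Qed.

Lemma isI_mom (a : R) (k : nat) : 0 < a -> isI (fun t => RtoC (hk a k t)) (RtoC (mom a k)).
Proof. move=> ha. have [K h] := hk_dom k ha. exact: isI_real h. Qed.

Lemma hk_ext0 (a t : R) : hk a 0 t = exp (- a * t ^ 2).
Proof. rewrite /hk /=. ring. Qed.

Lemma mom_0 (a : R) : 0 < a -> mom a 0 = gam a.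
Proof.
move=> ha. apply: RtoC_inj. apply: isI_unique (isI_mom 0 ha) _. apply: isI_ext (isI_gauss ha) => t. by rewrite hk_ext0.
Qed.

Lemma hk_S (a : R) (k : nat) (t : R) : hk a (S k) t = t ^ 2 * hk a k t.
Proof. rewrite /hk. have -> : (2 * S k = 2 + 2 * k)%nat by lia. rewrite pow_add. ring. Qed.

Lemma hk_pos (a : R) (k : nat) (t : R) : 0 <= hk a k t.
Proof. rewrite /hk. apply: Rmult_le_pos; last by left; exact: exp_pos. rewrite pow_mult. apply: pow_le. exact: pow2_ge_0. Qed.

(** The function t^(2k+1) e^(-a t^2) vanishes at both ends, and its derivative combines the weights
    of index k and k + 1. *)
Lemma mom_rec (a : R) (k : nat) : 0 < a -> mom a (S k) = (INR k + 1/2) / a * mom a k.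
Proof.
move=> ha. have [K [K0 hK]] := gauss_dom (2 * k + 2) ha.
pose F t := t ^ (2 * k + 1) * exp (- a * t ^ 2).
pose f t := (2 * INR k + 1) * hk a k t - 2 * a * hk a (S k) t.
have dF : forall t, is_derive F t (f t).
{ move=> t. rewrite /F /f hk_S /hk. have -> : (2 * k + 1 = S (2 * k))%nat by lia. auto_derive => //. rewrite -/(pow t) /Init.Nat.pred. 
  have -> : match (2 * k)%nat with 0%nat => 1 | S _ => INR (2 * k) + 1 end = 2 * INR k + 1. { case e : (2 * k)%nat => [|n]; rewrite -?e ?mult_INR /=; try ring. have : k = 0%nat by lia. move=> ->. rewrite /=. ring. }
  change (k + (k + 0))%nat with (2 * k)%nat. change (t * (t * 1)) with (t ^ 2). ring. }
have df : forall t, ex_derive f t. { move=> t. rewrite /f /hk. auto_derive. by []. }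
have bF : forall t, Rabs (F t) * (1 + t ^ 2) <= K.
{ move=> t. have t2 := pow2_ge_0 t. rewrite /F Rabs_mult (Rabs_pos_eq (exp _)); last by left; exact: exp_pos. apply: Rle_trans (hK t).
  rewrite -RPow_abs. have a1 : Rabs t <= 1 + t ^ 2. { rewrite -(pow2_abs t). nra. }
  have p : Rabs t ^ (2 * k + 1) <= (1 + t ^ 2) ^ (2 * k + 1) by apply: pow_incr; split => //; exact: Rabs_pos.
  have -> : (2 * k + 2 = S (2 * k + 1))%nat by lia. change ((1 + t ^ 2) ^ S (2 * k + 1)) with ((1 + t ^ 2) * (1 + t ^ 2) ^ (2 * k + 1)).
  have e := exp_pos (- a * t ^ 2). have -> : Rabs t ^ (2 * k + 1) * exp (- a * t ^ 2) * (1 + t ^ 2) = (1 + t ^ 2) * exp (- a * t ^ 2) * Rabs t ^ (2 * k + 1) by ring.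
  have -> : (1 + t ^ 2) * (1 + t ^ 2) ^ (2 * k + 1) * exp (- a * t ^ 2) = (1 + t ^ 2) * exp (- a * t ^ 2) * (1 + t ^ 2) ^ (2 * k + 1) by ring.
  apply: Rmult_le_compat_l => //. apply: Rmult_le_pos; lra. }
have z := isI_FTC_real dF df bF.
have c : forall k t, rcont (fun t => RtoC (hk a k t)) t by move=> j t; apply: rcont_RtoC_diff; rewrite /hk; auto_derive.
have i := isI_minus (fun t => rcont_scal (RtoC (2 * INR k + 1)) (c k t)) (fun t => rcont_scal (RtoC (2 * a)) (c (S k) t)) (isI_scal _ (c k) (isI_mom k ha)) (isI_scal _ (c (S k)) (isI_mom (S k) ha)).
have i2 : isI (fun t => RtoC (f t)) (RtoC (2 * INR k + 1) * RtoC (mom a k) - RtoC (2 * a) * RtoC (mom a (S k)))%C.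
{ apply: isI_ext i => t. by rewrite /f RtoC_minus !RtoC_mult. }
have := isI_unique z i2. rewrite -!RtoC_mult -RtoC_minus => /RtoC_inj e.
have e2 : 2 * a * mom a (S k) = (2 * INR k + 1) * mom a k by lra.
have -> : mom a (S k) = (2 * a * mom a (S k)) / (2 * a) by field; lra. rewrite e2. field. lra.
Qed.

(** The product of 1/2, 3/2, ..., k - 1/2, that is Gamma(k + 1/2) / sqrt pi. *)
Fixpoint Qm (k : nat) : R := match k with O => 1 | S n => (INR n + 1/2) * Qm n end.

Lemma Qm_pos (k : nat) : 0 < Qm k.
Proof. elim: k => [|k IH] /=; first lra. apply: Rmult_lt_0_compat => //. have := pos_INR k. lra. Qed.

Lemma mom_val (a : R) (k : nat) : 0 < a -> mom a k = gam a * Qm k / a ^ k.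
Proof.
move=> ha. elim: k => [|k IH]; first by rewrite mom_0 //=; field. rewrite mom_rec // IH /=. field. split; [apply: pow_nonzero; lra | lra].
Qed.

Lemma Rpower_half (k : nat) (t : R) : 0 < t -> Rpower t (INR k + 1/2 - 1) = t ^ k / sqrt t.
Proof.
move=> ht. have -> : INR k + 1/2 - 1 = INR k + - (/ 2) by field. rewrite Rpower_plus Rpower_Ropp Rpower_pow // Rpower_sqrt //.
Qed.

(** Substitution t = x^2. Since [hk] is even, [G x], the integral over [-x, x], has derivative 2 hk,
    and Euler's integral over [a, b] is G(sqrt b) - G(sqrt a). *)
Lemma Gamma_half (k : nat) : Gamma (INR k + 1/2) = mom 1 k.
Proof.
pose h := hk 1 k. have ch : forall x, continuous h x. { move=> x. apply: ex_derive_continuous. rewrite /h /hk. auto_derive. by []. }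
have ih : forall a b, is_RInt h a b (RInt h a b). { move=> a b. apply: (RInt_correct (V := R_CompleteNormedModule)). apply: (ex_RInt_continuous (V := R_CompleteNormedModule)) => z _. exact: ch. }
pose P x := RInt h 0 x. have dP : forall x, is_derive P x (h x).
{ move=> x. apply: (is_derive_RInt h P 0); last exact: ch. by exists (mkposreal 1 Rlt_0_1) => y _; exact: ih. }
pose G x := P x - P (- x). have G0 : G 0 = 0 by rewrite /G Ropp_0; ring.
have dG : forall x, is_derive G x (2 * h x).
{ move=> x. have d2 : is_derive (fun x => P (- x)) x (- 1 * h (- x)). { apply: (is_derive_comp P Ropp); first exact: dP. by auto_derive => //; ring. }
  have d := is_derive_minus _ _ _ _ _ (dP x) d2. have e : minus (h x) (- 1 * h (- x)) = 2 * h x; last by rewrite -e.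
  rewrite /minus /plus /opp /= /h /hk !(pow_mult _ 2 k). have -> : (- x) ^ 2 = x ^ 2 by ring. ring. }
have lim : forall e, 0 < e -> exists M, 0 <= M /\ forall x, M <= x -> Rabs (G x - mom 1 k) < e.
{ move=> e he. case: (isI_mom k Rlt_0_1 he) => M [M0 H]. exists M. split => // x hx. have := H (- x) x ltac:(lra) hx.
  have -> : CInt (fun t => RtoC (hk 1 k t)) (- x) x = RtoC (G x).
  { apply: is_CInt_unique. apply/is_CInt_pair. split => /=; last by have := is_RInt_const (V := R_NormedModule) (- x) x 0; rewrite scal_zero_r.
    have i := is_RInt_Chasles _ _ _ _ _ _ (is_RInt_swap _ _ _ _ (ih 0 (- x))) (ih 0 x).
    have e2 : plus (opp (RInt h 0 (- x))) (RInt h 0 x) = G x by rewrite /plus /opp /= /G /P; ring. rewrite -e2. exact: i. }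
  by rewrite -RtoC_minus Cmod_R. }
pose f t := Rpower t (INR k + 1/2 - 1) * exp (- t).
have if_ : forall a b, 0 < a -> 0 < b -> is_RInt f a b (G (sqrt b) - G (sqrt a)).
{ move=> a b ha hb. have pos : forall t, Rmin a b <= t -> 0 < t. { move=> t ht. have : 0 < Rmin a b by apply: Rmin_glb_lt. lra. }
  apply: (is_RInt_derive (fun t => G (sqrt t))) => t [ht _]; have tp := pos t ht.
  - have s := sqrt_lt_R0 _ tp. have ds : is_derive sqrt t (/ (2 * sqrt t)) by apply: is_derive_Reals_sqrt || (auto_derive => //; field; lra).
    have d := is_derive_comp _ _ _ _ _ (dG (sqrt t)) ds. have e : scal (/ (2 * sqrt t)) (2 * h (sqrt t)) = f t; last by rewrite -e.
    rewrite /f Rpower_half // /scal /= /mult /= /h /hk pow_mult. have -> : sqrt t ^ 2 = t by rewrite pow2_sqrt //; lra. have -> : -1 * t = - t by ring. field. lra.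
  - apply: (continuous_mult (K := R_AbsRing)).
    + apply: ex_derive_continuous. rewrite /Rpower. auto_derive. by [].
    + apply: ex_derive_continuous. auto_derive. by []. }
suff H : is_RInt_gen (V := R_NormedModule) f (at_right 0) (Rbar_locally p_infty) (mom 1 k) by rewrite /Gamma; exact: (is_RInt_gen_unique (V := R_CompleteNormedModule) f (mom 1 k) H).
rewrite /is_RInt_gen /filterlimi /filter_le /filtermapi => Pf [[e he] hP].
have [M [M0 hM]] := lim (e/2) ltac:(lra).
have c0 : continuous G 0 by apply: ex_derive_continuous; exists (2 * h 0); exact: dG.
have q : locally 0 (fun x => ball 0 (e/2) (G x)). { have e2 : 0 < e/2 by lra. apply: c0. rewrite G0. by exists (mkposreal _ e2). }
case: q => d hd.
(* The square root turns a < d^2 into sqrt a < d and b > M^2 + 1 into sqrt b >= M; the 1 keeps b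
   positive when M = 0. *)
apply: (Filter_prod _ _ _ (fun a => 0 < a < d ^ 2) (fun b => M ^ 2 + 1 < b)).
- have d2 : 0 < d ^ 2 by apply: pow_lt; exact: cond_pos. exists (mkposreal _ d2) => y hy y0. split => //. move: hy. rewrite /ball /= /AbsRing_ball /abs /minus /plus /opp /= => hy. rewrite Ropp_0 Rplus_0_r in hy. have := Rle_abs y. lra.
- by exists (M ^ 2 + 1).
- move=> a b [a0 ad] hb. have b0 : 0 < b by nra. exists (G (sqrt b) - G (sqrt a)). split; first exact: if_.
  apply: hP. have s1 : M <= sqrt b. { rewrite -(sqrt_pow2 M) //. apply: sqrt_le_1_alt. lra. }
  have s2 : sqrt a < d. { rewrite -(sqrt_pow2 d); last by left; exact: cond_pos. apply: sqrt_lt_1_alt. lra. }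
  have h1 := hM _ s1. have h2 : Rabs (G (sqrt a)) < e/2. { have := hd (sqrt a). rewrite /ball /= /AbsRing_ball /abs /minus /plus /opp /= Ropp_0 !Rplus_0_r => H. apply: H. rewrite Rabs_pos_eq //. exact: sqrt_pos. }
  rewrite /ball /= /AbsRing_ball /abs /minus /plus /opp /=. have -> : G (sqrt b) - G (sqrt a) + - mom 1 k = (G (sqrt b) - mom 1 k) + - G (sqrt a) by ring.
  apply: Rle_lt_trans (Rabs_triang _ _) _. rewrite Rabs_Ropp. lra.
Qed.

(** * Asymptotics of the digamma function *)

Lemma ln_1p_bounds (x : R) : 0 <= x -> x - x ^ 2 / 2 <= ln (1 + x) <= x.
Proof.
move=> hx. split; last first. { have h := exp_ineq1_le x. rewrite -{2}(ln_exp x). apply: ln_le; lra. }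
have d : forall t, 0 <= t <= x -> is_derive (fun t => ln (1 + t) - t + t ^ 2 / 2) t (t ^ 2 / (1 + t)).
{ move=> t ht. auto_derive; first lra. rewrite /=. field. lra. }
have [c [hc e]] := @MVT_gen (fun t => ln (1 + t) - t + t ^ 2 / 2) 0 x (fun t => t ^ 2 / (1 + t))
  ltac:(rewrite Rmin_left // Rmax_right // => t ht; apply: d; lra)
  ltac:(rewrite Rmin_left // Rmax_right // => t ht; apply: ex_derive_continuous || apply/continuity_pt_filterlim; apply: ex_derive_continuous; eexists; exact: d).
rewrite Rmin_left // Rmax_right // in hc. rewrite Rplus_0_r ln_1 in e.
have : 0 <= c ^ 2 / (1 + c) by apply: Rdiv_le_0_compat; [exact: pow2_ge_0 | lra]. nra.
Qed.

(** |z + 2|^2 = |z|^2 (1 + x) with x / 4 = Re(1/z) + 1 / |z|^2. For Re z >= 1/2, x <= 12 / |z|, so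
    the quadratic term x^2 / 8 of the logarithm costs 144 / 8 = 18. *)
Lemma log_increment (z : C) : 1/2 <= Re z -> Rabs (ln (Cmod (z + 2)) / 2 - ln (Cmod z) / 2 - Re (/ z)) <= 18 / Cmod z ^ 2.
Proof.
move=> hz. set m := Cmod z. have rm : Re z <= m by apply: Rle_trans (Rle_abs _) (re_le_Cmod z). have m0 : 1/2 <= m by lra.
have sq : forall y : C, Cmod y ^ 2 = Re y ^ 2 + Im y ^ 2. { case=> p q. rewrite /Cmod pow2_sqrt //=. nra. }
have m2 : 0 < m ^ 2 by nra.
have e2 : Cmod (z + 2) ^ 2 = m ^ 2 * (1 + (4 * Re z + 4) / m ^ 2). { have -> : m ^ 2 * (1 + (4 * Re z + 4) / m ^ 2) = m ^ 2 + (4 * Re z + 4) by field; lra. rewrite sq (sq z). case: z {hz m rm m0 sq m2} => p q /=. ring. }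
set x := (4 * Re z + 4) / m ^ 2 in e2. have x0 : 0 <= x by apply: Rdiv_le_0_compat; lra.
have m1 : 0 < Cmod (z + 2). { have := re_le_Cmod (z + 2). rewrite re_plus re_RtoC. have := Rle_abs (Re z + 2). lra. }
have ei : Re (/ z) = Re z / m ^ 2. { rewrite (sq z). case: z {hz m rm m0 m2 e2 x x0 m1} => p q /=. by []. }
have l2 : forall y, 0 < y -> ln (y ^ 2) = 2 * ln y. { move=> y hy. by rewrite ln_pow. }
have el : ln (Cmod (z + 2)) / 2 - ln m / 2 = ln (1 + x) / 4.
{ have h : 2 * ln (Cmod (z + 2)) = 2 * ln m + ln (1 + x). { rewrite -!l2 //; last lra. rewrite e2 ln_mult //. lra. } lra. }
rewrite el ei. have [b1 b2] := ln_1p_bounds x0.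
have xe : x / 4 = Re z / m ^ 2 + / m ^ 2 by rewrite /x; field; lra.
have x12 : x <= 12 / m. { rewrite /x. apply/Rle_div_l => //. have -> : 12 / m * m ^ 2 = 12 * m by field; lra. lra. }
have xx : x ^ 2 <= 144 / m ^ 2. { have -> : 144 / m ^ 2 = (12 / m) ^ 2 by field; lra. by apply: pow_incr. } apply: Rabs_le. lra.
Qed.

(** Each term of the digamma series is, by [log_increment], nearly an increment of a telescoping sum
    of logarithms; the errors 18 / |s + 2j|^2 add up to O(1 / |s|), uniformly up to the line Re s =
    1/2. *)
Lemma Dc_re (s : C) : 1/2 <= Re s -> Rabs (Re (Dc s) - ln (Cmod s / (2 * PI)) / 2) <= 90 / Cmod s.
Proof.
move=> hs. set T := Cmod s. have rT : Re s <= T by apply: Rle_trans (Rle_abs _) (re_le_Cmod s). have hp := PI_RGT_0.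
have sq : forall y : C, Cmod y ^ 2 = Re y ^ 2 + Im y ^ 2. { case=> p q. rewrite /Cmod pow2_sqrt //=. nra. }
pose z (N : nat) := (s + RtoC (2 * INR N))%C.
have rz : forall N, Re (z N) = Re s + 2 * INR N by move=> N; rewrite /z re_plus re_RtoC.
have mz : forall N, T + 2 * INR N <= 2 * Cmod (z N) /\ (T + 2 * INR N) ^ 2 <= 2 * Cmod (z N) ^ 2.
{ move=> N. have n0 := pos_INR N. have e : (T + 2 * INR N) ^ 2 <= 2 * Cmod (z N) ^ 2.
  { rewrite (sq (z N)) rz. have -> : Im (z N) = Im s by rewrite /z im_plus /=; ring. have := sq s. rewrite -/T => sT. have := pow2_ge_0 (T - 2 * INR N). nra. }
  split => //. have := Cmod_ge_0 (z N). nra. }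
have part : forall N, Rabs (Re (Csum (fun j => Dterm j s) N) - (ln (INR (S N)) / 2 + ln T / 2 - ln (Cmod (z N)) / 2)) <= 90 * (/ T - / (T + 2 * INR N)).
{ elim=> [|N IH].
  - have -> : z 0%nat = s by rewrite /z /= Rmult_0_r; ring. rewrite -/T /= ln_1 !Rmult_0_r Rplus_0_r. have -> : 0 - (0 / 2 + ln T / 2 - ln T / 2) = 0 by field. rewrite Rabs_R0. lra.
  - have n0 := pos_INR N. have [q1 q2] := mz N. have zs : z (S N) = (z N + 2)%C. { rewrite /z S_INR. have -> : 2 * (INR N + 1) = 2 * INR N + 2 by ring. rewrite RtoC_plus. ring. }
    have inc := @log_increment (z N) ltac:(rewrite rz; lra). rewrite -zs in inc.
    have m2 : 0 < (T + 2 * INR N) ^ 2 by nra.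
    (* With y = |s| + 2N, |z_N|^2 >= y^2 / 2 reduces the error to 36 / y^2. Comparison with 90 (1/y
       - 1/(y + 2)) means 180 y >= 36 (y + 2), that is y >= 1/2, which fixes the constant 90. *)
    have b1 : 18 / Cmod (z N) ^ 2 <= 90 * (/ (T + 2 * INR N) - / (T + 2 * INR (S N))).
    { rewrite S_INR. apply: Rle_trans (_ : 36 / (T + 2 * INR N) ^ 2 <= _).
      - apply/Rle_div_l; first by lra. have -> : 36 / (T + 2 * INR N) ^ 2 * Cmod (z N) ^ 2 = 36 * Cmod (z N) ^ 2 / (T + 2 * INR N) ^ 2 by field; lra. apply: (proj1 (Rle_div_r _ _ _ m2)). lra.
      - apply/Rle_div_l => //. set y := T + 2 * INR N in m2 *. have y0 : 1/2 <= y by rewrite /y; lra. have -> : T + 2 * (INR N + 1) = y + 2 by rewrite /y; ring.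
        have -> : 90 * (/ y - / (y + 2)) * y ^ 2 = 180 * y / (y + 2) by field; lra. apply: (proj1 (Rle_div_r _ _ _ _)); lra. }
    have ed : Re (Dterm N s) = Dl N - Re (/ z N) by rewrite /Dterm re_minus re_RtoC.
    change (Csum (fun j => Dterm j s) (S N)) with (Csum (fun j => Dterm j s) N + Dterm N s)%C. rewrite re_plus ed /Dl ln_div; try exact: INR_S_pos.
    set A := Re (Csum _ _) in IH *. set l1 := ln (INR (S N)) in IH *. set l2 := ln (INR (S (S N))). set r := Re (/ z N) in inc *. set c1 := ln (Cmod (z N)) in inc IH *. set c2 := ln (Cmod (z (S N))) in inc *.
    have -> : A + ((l2 - l1) / 2 - r) - (l2 / 2 + ln T / 2 - c2 / 2) = (A - (l1 / 2 + ln T / 2 - c1 / 2)) + (c2 / 2 - c1 / 2 - r) by field.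
    apply: Rle_trans (Rabs_triang _ _) _. lra. }
have tail : forall N, (1 <= N)%nat -> Rabs (ln (INR (S N)) / 2 - ln (Cmod (z N)) / 2 + ln 2 / 2) <= (T + 1) * / INR N.
{ move=> N hN. have n1 : 1 <= INR N by apply: (le_INR 1). have up : Cmod (z N) <= T + 2 * INR N. { apply: Rle_trans (Cmod_triangle _ _) _. rewrite Cmod_RtoC_pos; [rewrite /T; lra | lra]. }
  have lo : 2 * INR N <= Cmod (z N). { have := re_le_Cmod (z N). rewrite rz. have := Rle_abs (Re s + 2 * INR N). lra. }
  have m0 : 0 < Cmod (z N) by lra. have S1 : INR (S N) = INR N + 1 by rewrite S_INR. have i := Rinv_0_lt_compat (INR N) ltac:(lra).
  have e : ln (INR (S N)) / 2 - ln (Cmod (z N)) / 2 + ln 2 / 2 = ln (2 * (INR N + 1) / Cmod (z N)) / 2. { rewrite ln_div; try lra. rewrite ln_mult ?S1; lra. }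
  have l1 : ln (2 * (INR N + 1) / Cmod (z N)) <= / INR N.
  { rewrite -(ln_exp (/ INR N)). apply: ln_le; first by apply: Rdiv_lt_0_compat; lra. apply: Rle_trans (exp_ineq1_le _). apply/Rle_div_l => //.
    apply: Rle_trans (Rmult_le_compat_l (1 + / INR N) _ _ ltac:(lra) lo). right. field. lra. }
  have l2 : - ((T + 1) * / INR N) <= ln (2 * (INR N + 1) / Cmod (z N)).
  { have q : ln (Cmod (z N) / (2 * (INR N + 1))) <= (T + 1) * / INR N.
    { rewrite -(ln_exp ((T + 1) * / INR N)). apply: ln_le; first by apply: Rdiv_lt_0_compat; lra. apply: Rle_trans (exp_ineq1_le _). apply/Rle_div_l; first lra.
      have : (1 + (T + 1) * / INR N) * (2 * (INR N + 1)) = 2 * INR N + 2 + 2 * (T + 1) + 2 * (T + 1) * / INR N by field; lra. move=> ->. have : 0 <= (T + 1) * / INR N by nra. lra. }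
    rewrite ln_div in q; try lra. rewrite ln_div; lra. }
  rewrite e. have : / INR N <= (T + 1) * / INR N by nra. move=> h3. apply: Rabs_le. lra. }
apply: le_epsilon => e he. have hs0 : 0 < Re s by lra. have e2 : 0 < e/2 by lra. case: (@Dc_ser s hs0 (e/2) e2) => N0 H0.
have [N1 [_ h1]] := nfloor_ex (2 * (T + 1) / e) ltac:(apply: Rdiv_le_0_compat; lra).
set N := (N0 + S N1)%nat. have cN := H0 N ltac:(rewrite /N; lia). have pN := part N. have tN := tail N ltac:(rewrite /N; lia).
have nN : 2 * (T + 1) / e <= INR N. { apply: Rle_trans (_ : INR N1 + 1 <= _); first lra. rewrite -S_INR. apply: le_INR. rewrite /N. lia. }
have N1p : 0 < INR N. { apply: Rlt_le_trans nN. apply: Rdiv_lt_0_compat; lra. }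
have te : (T + 1) * / INR N <= e/2. { apply/Rle_div_l => //. move/Rle_div_l: nN. move=> q. lra. }
have r := re_le_Cmod (Csum (fun j => Dterm j s) N - (Dc s - RtoC (- ln PI / 2))). rewrite !re_minus re_RtoC in r.
rewrite ln_div; try lra. rewrite ln_mult; try lra.
have i : 0 < / (T + 2 * INR N) by apply: Rinv_0_lt_compat; lra.
have cN' := Rle_lt_trans _ _ _ r cN. move/Rabs_def2: cN' => cN'. have pb := proj1 (Rabs_le_between _ _) pN. have tb := proj1 (Rabs_le_between _ _) tN. rewrite -/T in pb. apply: Rabs_le. lra.
Qed.

(** * Comparison of weights *)

Lemma ln_1p_cubic (y : R) : Rabs y <= 1/2 -> Rabs (ln (1 + y) - y + y ^ 2 / 2) <= 2 * Rabs y ^ 3.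
Proof.
move=> hy.
have d : forall t, Rabs t <= 1/2 -> is_derive (fun t => ln (1 + t) - t + t ^ 2 / 2) t (t ^ 2 / (1 + t)).
{ move=> t /Rabs_le_between ht. auto_derive; first lra. rewrite /=. field. lra. }
have rg : forall t, Rmin 0 y <= t <= Rmax 0 y -> Rabs t <= Rabs y.
{ move=> t ht. move: ht. rewrite /Rmin /Rmax. case: (Rle_dec 0 y) => h ht; [rewrite !Rabs_pos_eq | rewrite !Rabs_left1]; lra. }
have [c [hc e]] := @MVT_gen (fun t => ln (1 + t) - t + t ^ 2 / 2) 0 y (fun t => t ^ 2 / (1 + t))
  ltac:(move=> t ht; apply: d; have := rg t ltac:(lra); lra)
  ltac:(move=> t ht; apply/continuity_pt_filterlim; apply: ex_derive_continuous; eexists; apply: d; have := rg t ht; lra).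
have cy := rg c hc. have cb := proj1 (Rabs_le_between _ _) (Rle_trans _ _ _ cy hy).
rewrite Rplus_0_r ln_1 in e. have -> : ln (1 + y) - y + y ^ 2 / 2 = c ^ 2 / (1 + c) * y by lra.
rewrite Rabs_mult. have -> : 2 * Rabs y ^ 3 = (2 * Rabs y ^ 2) * Rabs y by ring. apply: Rmult_le_compat_r; first exact: Rabs_pos.
have c2 : c ^ 2 <= Rabs y ^ 2. { rewrite -(pow2_abs c). apply: pow_incr. split => //. exact: Rabs_pos. }
rewrite Rabs_pos_eq; last by apply: Rdiv_le_0_compat; [exact: pow2_ge_0 | lra].
apply/Rle_div_l; first lra. nra.
Qed.

Lemma exp_diff (A B M : R) : A <= M -> B <= M -> Rabs (exp A - exp B) <= Rabs (A - B) * exp M.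
Proof.
have H : forall A B, B <= A -> A <= M -> 0 <= exp A - exp B <= (A - B) * exp M.
{ move=> {}A {}B h hA. have e1 := exp_le h. have e2 := exp_le hA. have p := exp_pos A. split; first lra.
  have i := exp_ineq1_le (B - A). have -> : exp B = exp A * exp (B - A) by rewrite -exp_plus; congr exp; ring. nra. }
move=> hA hB. case: (Rle_dec B A) => h.
- have [h1 h2] := H A B h hA. rewrite !Rabs_pos_eq; lra.
- have [h1 h2] := H B A ltac:(lra) hB. rewrite !Rabs_left1; lra.
Qed.

(* [hk] rescaled to have its maximum 1 at x = 1. *)
Definition pk (k : nat) (x : R) : R := exp (INR k) * hk (INR k) k x.

Lemma pk_exp (k : nat) (x : R) : 0 < x -> pk k x = exp (INR k * (2 * ln x - x ^ 2 + 1)).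
Proof.
move=> hx. rewrite /pk /hk -(Rpower_pow _ _ hx) /Rpower -!exp_plus mult_INR. congr exp. rewrite /=. ring.
Qed.

Lemma pk_pos (k : nat) (x : R) : 0 <= pk k x.
Proof. rewrite /pk. apply: Rmult_le_pos; [left; exact: exp_pos | exact: hk_pos]. Qed.

Lemma pk_0 (k : nat) : pk (S k) 0 = 0.
Proof. rewrite /pk hk_S. ring. Qed.

Lemma pk_even (k : nat) (x : R) : pk k (- x) = pk k x.
Proof. rewrite /pk /hk !(pow_mult _ 2 k). have -> : (- x) ^ 2 = x ^ 2 by ring. by []. Qed.

Lemma ln_le_minus1 (x : R) : 0 < x -> ln x <= x - 1.
Proof. move=> h. have := exp_ineq1_le (ln x). rewrite exp_ln //. lra. Qed.

(** log x <= x - 1 bounds the exponent k (2 log x - x^2 + 1) by -k (x - 1)^2. At x = 0 the weight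
    vanishes because k >= 1. *)
Lemma pk_le (k : nat) (x : R) : (1 <= k)%nat -> 0 <= x -> pk k x <= exp (- INR k * (x - 1) ^ 2).
Proof.
case: k => [|k]; first lia. move=> _ hx. case: (Rle_lt_or_eq_dec _ _ hx) => [p|<-]; last by rewrite pk_0; left; exact: exp_pos.
rewrite pk_exp //. apply: exp_le. have := ln_le_minus1 p. have := INR_S_pos k. nra.
Qed.

(** With y = x - 1 the exponent of [pk] is -2k y^2 + O(k |y|^3) near 1, and both exponents lie below
    -k y^2. For |y| >= 1/2 the prefactor 8 k |y|^3 is at least 1 and the bound is trivial. *)
Lemma pk_diff (k : nat) (x : R) : (1 <= k)%nat -> 0 <= x ->
  Rabs (pk k x - exp (- (2 * INR k) * (x - 1) ^ 2)) <= 8 * INR k * Rabs (x - 1) ^ 3 * exp (- INR k * (x - 1) ^ 2).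
Proof.
move=> hk1 hx. have k1 : 1 <= INR k by apply: (le_INR 1). set y := x - 1. have ya := Rabs_pos y. have y3 : 0 <= Rabs y ^ 3 by nra.
set M := exp (- INR k * y ^ 2).
have gM : exp (- (2 * INR k) * y ^ 2) <= M by apply: exp_le; nra. have g0 := exp_pos (- (2 * INR k) * y ^ 2).
case: (Rle_dec (1/2) (Rabs y)) => h.
- have pM := pk_le hk1 hx. rewrite -/y -/M in pM. have p0 := pk_pos k x.
  have : Rabs (pk k x - exp (- (2 * INR k) * y ^ 2)) <= M by apply: Rabs_le; lra. move=> q. apply: Rle_trans q _.
  have : 1 <= 8 * Rabs y ^ 3 by nra. move=> q. have : 1 <= 8 * INR k * Rabs y ^ 3 by nra. nra.
- have hy : Rabs y <= 1/2 by lra. have yb := proj1 (Rabs_le_between _ _) hy. have xp : 0 < x by rewrite /y in yb; lra.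
  have c := ln_1p_cubic hy. have xe : 1 + y = x by rewrite /y; ring. rewrite xe in c.
  rewrite pk_exp //. have -> : INR k * (2 * ln x - x ^ 2 + 1) = INR k * (2 * (ln x - y + y ^ 2 / 2) - 2 * y ^ 2) by nra.
  have ln1 := ln_le_minus1 xp. apply: Rle_trans (exp_diff (M := - INR k * y ^ 2) _ _) _.
  + nra. + nra.
  + rewrite -/M. apply: Rmult_le_compat_r; first lra.
    have -> : INR k * (2 * (ln x - y + y ^ 2 / 2) - 2 * y ^ 2) - - (2 * INR k) * y ^ 2 = 2 * INR k * (ln x - y + y ^ 2 / 2) by ring.
    rewrite Rabs_mult Rabs_pos_eq; last lra. have : 0 <= INR k * Rabs y ^ 3 by nra.
    have := Rmult_le_compat_l (2 * INR k) _ _ ltac:(lra) c. lra.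
Qed.

(** A Lorentz profile of width k^(-1/2): it majorizes the Gaussians in play and can be summed over
    the zeros through the real part of the partial fractions. *)
Definition lor (k : nat) (v x : R) : R := 1 / (1 + INR k * (x - v) ^ 2).

Lemma lor_den (k : nat) (v x : R) : 0 < 1 + INR k * (x - v) ^ 2.
Proof. have := pos_INR k. have := pow2_ge_0 (x - v). nra. Qed.

Lemma lor_pos (k : nat) (v x : R) : 0 < lor k v x.
Proof. apply: Rdiv_lt_0_compat; [lra | exact: lor_den]. Qed.

Lemma exp_lor (k : nat) (v x c : R) : 1 <= c -> exp (- (c * INR k) * (x - v) ^ 2) <= lor k v x.
Proof.
move=> hc. have d := lor_den k v x. have k0 := pos_INR k. have y2 := pow2_ge_0 (x - v). apply: (proj1 (Rle_div_r _ _ _ d)).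
apply: Rle_trans (_ : exp (- (INR k * (x - v) ^ 2)) * exp (INR k * (x - v) ^ 2) <= _).
- apply: Rmult_le_compat; [left; exact: exp_pos | lra | | exact: exp_ineq1_le]. apply: exp_le. have : 0 <= INR k * (x - v) ^ 2 by nra. nra.
- rewrite -exp_plus Rplus_opp_l exp_0. lra.
Qed.

Lemma sqrt_k (k : nat) : (1 <= k)%nat -> 1 <= sqrt (INR k) /\ sqrt (INR k) * sqrt (INR k) = INR k.
Proof.
move=> h. have k1 : 1 <= INR k by apply: (le_INR 1). split; last by apply: sqrt_sqrt; lra. rewrite -sqrt_1. by apply: sqrt_le_1_alt.
Qed.

(** In the variable z = sqrt k |x - 1| the bound of [pk_diff] is 8 k^(-1/2) z^3 e^(-z^2), and the
    Gaussian absorbs z^3 (1 + z^2). *)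
Lemma pk_lor : exists C, 0 <= C /\ forall k x, (1 <= k)%nat -> 0 <= x ->
  Rabs (pk k x - exp (- (2 * INR k) * (x - 1) ^ 2)) <= C / sqrt (INR k) * lor k 1 x.
Proof.
have [K [K0 hK]] := gauss_dom 3 Rlt_0_1. exists (8 * K). split; first lra. move=> k x hk1 hx. have [s1 s2] := sqrt_k hk1.
apply: Rle_trans (pk_diff hk1 hx) _. have d := lor_den k 1 x. set s := sqrt (INR k) in s1 s2 *. set y := Rabs (x - 1).
have y2 : (x - 1) ^ 2 = y ^ 2 by rewrite pow2_abs. rewrite /lor y2 in d *. have h := hK (s * y).
have e1 : (s * y) ^ 2 = INR k * y ^ 2 by nra.
have -> : 8 * K / s * (1 / (1 + INR k * y ^ 2)) = 8 * K / (s * (1 + INR k * y ^ 2)) by field; split; lra.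
apply: (proj1 (Rle_div_r _ _ _ _)); first by apply: Rmult_lt_0_compat; lra.
have -> : 8 * INR k * y ^ 3 * exp (- INR k * y ^ 2) * (s * (1 + INR k * y ^ 2)) = 8 * ((s * y) ^ 3 * (1 + INR k * y ^ 2) * exp (- INR k * y ^ 2)) by nra.
apply: Rmult_le_compat_l; first lra. apply: Rle_trans h. rewrite e1. have -> : -1 * (INR k * y ^ 2) = - INR k * y ^ 2 by ring.
apply: Rmult_le_compat_r; first by left; exact: exp_pos. set z := s * y in e1 *.
rewrite -e1. have : z ^ 3 <= (1 + z ^ 2) ^ 2. { nra. } move=> q. have -> : (1 + z ^ 2) ^ 3 = (1 + z ^ 2) ^ 2 * (1 + z ^ 2) by ring. apply: Rmult_le_compat_r; lra.
Qed.

Lemma rcont_of_ex (f : R -> R) : (forall t, ex_derive f t) -> forall t, rcont (fun t => RtoC (f t)) t.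
Proof. move=> h t. exact: rcont_RtoC_diff. Qed.

Lemma isI_lor (k : nat) (v : R) : (1 <= k)%nat -> isI (fun x => RtoC (lor k v x)) (RtoC (PI / sqrt (INR k))).
Proof.
move=> hk1. have [s1 s2] := sqrt_k hk1. set s := sqrt (INR k) in s1 s2 *.
have c1 : forall t, rcont (fun t => RtoC (1 / (1 + t ^ 2))) t. { apply: rcont_of_ex => t. auto_derive. have := pow2_ge_0 t. rewrite /=. lra. }
have i1 := @isI_comp_aff _ 1 (- (s * v)) _ (or_introl eq_refl) c1 isI_cauchy.
have c2 : forall t, rcont (fun t => RtoC (1 / (1 + (1 * t + - (s * v)) ^ 2))) t. { apply: rcont_of_ex => t. auto_derive. have := pow2_ge_0 (1 * t + - (s * v)). rewrite /=. lra. }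
have i2 := isI_scale (s := s) ltac:(lra) c2 i1.
have c3 : forall t, rcont (fun t => RtoC s * RtoC (1 / (1 + (1 * (s * t) + - (s * v)) ^ 2)))%C t. { move=> t. apply: rcont_scal. apply: rcont_RtoC_diff. auto_derive. have := pow2_ge_0 (1 * (s * t) + - (s * v)). rewrite /=. lra. }
have i3 := isI_scal (RtoC (/ s)) c3 i2. rewrite -RtoC_mult (Rmult_comm (/ s) PI) in i3. apply: isI_ext i3 => t. rewrite -!RtoC_mult. congr RtoC.
rewrite /lor -s2. field. have := pow2_ge_0 (s * (t - v)). split; lra.
Qed.

Lemma isI_gauss_shift (k : nat) (v : R) : (1 <= k)%nat -> isI (fun x => RtoC (exp (- (2 * INR k) * (x - v) ^ 2))) (RtoC (gam (2 * INR k))).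
Proof.
move=> hk1. have k1 : 1 <= INR k by apply: (le_INR 1). have i := @isI_comp_aff _ 1 (- v) _ (or_introl eq_refl) (rcont_gauss (2 * INR k)) (isI_gauss (a := 2 * INR k) ltac:(lra)).
apply: isI_ext i => t. congr (RtoC (exp (_ * _ ^ 2))). ring.
Qed.

Definition Pk (k : nat) : R := exp (INR k) * mom (INR k) k.

Lemma isI_pk (k : nat) : (1 <= k)%nat -> isI (fun x => RtoC (pk k x)) (RtoC (Pk k)).
Proof.
move=> hk1. have k1 : 1 <= INR k by apply: (le_INR 1). have c : forall t, rcont (fun t => RtoC (hk (INR k) k t)) t by apply: rcont_of_ex => t; rewrite /hk; auto_derive.
rewrite /Pk RtoC_mult. apply: isI_ext (isI_scal (RtoC (exp (INR k))) c (isI_mom k (a := INR k) ltac:(lra))) => t. by rewrite /pk RtoC_mult.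
Qed.

Lemma gam_pos (a : R) : 0 < a -> 0 < gam a.
Proof. move=> h. rewrite gam_val //. apply: sqrt_lt_R0. apply: Rdiv_lt_0_compat => //. exact: PI_RGT_0. Qed.

Lemma mom_pos (a : R) (k : nat) : 0 < a -> 0 < mom a k.
Proof. move=> h. rewrite mom_val //. apply: Rdiv_lt_0_compat; last exact: pow_lt. apply: Rmult_lt_0_compat; [exact: gam_pos | exact: Qm_pos]. Qed.

Lemma Pk_pos (k : nat) : (1 <= k)%nat -> 0 < Pk k.
Proof. move=> h. have k1 : 1 <= INR k by apply: (le_INR 1). apply: Rmult_lt_0_compat; [exact: exp_pos | apply: mom_pos; lra]. Qed.

Lemma isI_abs_le (f g : R -> R) (l m : R) : (forall t, rcont (fun t => RtoC (f t)) t) -> (forall t, rcont (fun t => RtoC (g t)) t) ->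
  (forall t, Rabs (f t) <= g t) -> isI (fun t => RtoC (f t)) (RtoC l) -> isI (fun t => RtoC (g t)) (RtoC m) -> Rabs l <= m.
Proof.
move=> cf cg h hf hg. have b := fun t => proj1 (Rabs_le_between _ _) (h t).
have h1 : l <= m. { apply: (isI_re_le cf cg _ hf hg) => t. exact: (proj2 (b t)). }
have h2 : Re (RtoC (-1) * RtoC m)%C <= Re (RtoC l). { apply: (isI_re_le (fun t => rcont_scal (RtoC (-1)) (cg t)) cf _ (isI_scal (RtoC (-1)) cg hg) hf) => t. rewrite -RtoC_mult !re_RtoC. have := b t. lra. }
rewrite -RtoC_mult !re_RtoC in h2. apply: Rabs_le. lra.
Qed.

(** The even weight has bumps at 1 and -1, each compared with its Gaussian; on either half-line the
    Gaussian of the opposite bump is at most e^(-k) <= k^(-1/2) times a Lorentz profile. Error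
    height k^(-1/2) times Lorentz mass pi k^(-1/2) is O(1/k). *)
Lemma Pk_asymp : exists C, 0 <= C /\ forall k, (1 <= k)%nat -> Rabs (Pk k - 2 * gam (2 * INR k)) <= C / INR k.
Proof.
have [C [C0 hC]] := pk_lor. have hp := PI_RGT_0. exists (2 * PI * (C + 1)). split; first by apply: Rmult_le_pos; lra. move=> k hk1. have [s1 s2] := sqrt_k hk1. set s := sqrt (INR k) in s1 s2 hC *.
pose f x := pk k x - exp (- (2 * INR k) * (x - 1) ^ 2) - exp (- (2 * INR k) * (x - -1) ^ 2). pose g x := (C + 1) / s * (lor k 1 x + lor k (-1) x).
have half : forall x, 0 <= x -> Rabs (f x) <= g x.
{ move=> x hx. rewrite /f /g. apply: Rle_trans (Rabs_triang _ _) _. rewrite Rabs_Ropp (Rabs_pos_eq (exp _)); last by left; exact: exp_pos.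
  have h1 := hC k x hk1 hx. rewrite -/s in h1. have l1 := lor_pos k 1 x. have l2 := lor_pos k (-1) x. have si : 0 < / s by apply: Rinv_0_lt_compat; lra.
  have h2 : exp (- (2 * INR k) * (x - -1) ^ 2) <= / s * lor k (-1) x.
  { have -> : - (2 * INR k) * (x - -1) ^ 2 = - INR k * (x - -1) ^ 2 + - (1 * INR k) * (x - -1) ^ 2 by ring. rewrite exp_plus.
    apply: Rmult_le_compat; try (left; exact: exp_pos); last by apply: exp_lor; lra.
    apply: Rle_trans (_ : exp (- INR k) <= _); first by apply: exp_le; nra. rewrite exp_Ropp. apply: Rinv_le_contravar; first lra. have := exp_ineq1_le (INR k). nra. }
  have e : (C + 1) / s * (lor k 1 x + lor k (-1) x) = C / s * lor k 1 x + / s * lor k 1 x + C / s * lor k (-1) x + / s * lor k (-1) x by field; lra. rewrite e.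
  have : 0 <= / s * lor k 1 x by nra. have : 0 <= C / s * lor k (-1) x. { apply: Rmult_le_pos; last lra. apply: Rmult_le_pos; lra. } lra. }
have fe : forall x, f (- x) = f x. { move=> x. rewrite /f pk_even. have -> : (- x - 1) ^ 2 = (x - -1) ^ 2 by ring. have -> : (- x - -1) ^ 2 = (x - 1) ^ 2 by ring. ring. }
have ge : forall x, g (- x) = g x. { move=> x. rewrite /g /lor. have -> : (- x - 1) ^ 2 = (x - -1) ^ 2 by ring. have -> : (- x - -1) ^ 2 = (x - 1) ^ 2 by ring. ring. }
have all : forall x, Rabs (f x) <= g x. { move=> x. case: (Rle_dec 0 x) => h; first exact: half. rewrite -fe -ge. apply: half. lra. }
have cp : forall t, rcont (fun t => RtoC (pk k t)) t by apply: rcont_of_ex => t; rewrite /pk /hk; auto_derive.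
have cg : forall v t, rcont (fun x => RtoC (exp (- (2 * INR k) * (x - v) ^ 2))) t by move=> v; apply: rcont_of_ex => t; auto_derive.
have cl : forall v t, rcont (fun x => RtoC (lor k v x)) t by move=> v; apply: rcont_of_ex => t; rewrite /lor; auto_derive; have := lor_den k v t; rewrite /= /Rminus; lra.
have i1 := isI_minus (fun t => rcont_minus (cp t) (cg 1 t)) (cg (-1)) (isI_minus cp (cg 1) (isI_pk hk1) (isI_gauss_shift 1 hk1)) (isI_gauss_shift (-1) hk1).
rewrite -!RtoC_minus in i1. have i2 : isI (fun x => RtoC (f x)) (RtoC (Pk k - gam (2 * INR k) - gam (2 * INR k))) by apply: isI_ext i1 => t; rewrite /f !RtoC_minus.
have j1 := isI_scal (RtoC ((C + 1) / s)) (fun t => rcont_plus (cl 1 t) (cl (-1) t)) (isI_plus (cl 1) (cl (-1)) (isI_lor 1 hk1) (isI_lor (-1) hk1)).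
rewrite -RtoC_plus -RtoC_mult -/s in j1. have j2 : isI (fun x => RtoC (g x)) (RtoC ((C + 1) / s * (PI / s + PI / s))) by apply: isI_ext j1 => t; rewrite /g RtoC_mult RtoC_plus.
have r := isI_abs_le _ _ all i2 j2. have -> : Pk k - 2 * gam (2 * INR k) = Pk k - gam (2 * INR k) - gam (2 * INR k) by ring.
have -> : 2 * PI * (C + 1) / INR k = (C + 1) / s * (PI / s + PI / s) by rewrite -s2; field; lra. apply: r.
- apply: rcont_of_ex => t. rewrite /f /pk /hk. auto_derive. by [].
- apply: rcont_of_ex => t. rewrite /g /lor. auto_derive. have := lor_den k 1 t. have := lor_den k (-1) t. rewrite /= /Rminus. lra.
Qed.

Lemma finite_max (f : nat -> R) (K : nat) : exists M, 0 <= M /\ forall k, (k <= K)%nat -> f k <= M.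
Proof.
elim: K => [|K [M [M0 h]]].
- exists (Rmax 0 (f 0%nat)). split; first exact: Rmax_l. move=> k hk. have -> : k = 0%nat by lia. exact: Rmax_r.
- exists (Rmax M (f (S K))). split; first by apply: Rle_trans M0 (Rmax_l _ _). move=> k hk. case: (Nat.eq_dec k (S K)) => [->|ne]; first exact: Rmax_r. apply: Rle_trans (h k _) (Rmax_l _ _). lia.
Qed.

(** As 2 gam(2k) sqrt(k / (2 pi)) = 1, [Pk_asymp] is a relative error O(k^(-1/2)), against a
    normalization of size k^(1/2). *)
Lemma norm_asymp : exists C, 0 <= C /\ forall k, (1 <= k)%nat -> Rabs (sqrt (INR k / (2 * PI)) - / Pk k) <= C.
Proof.
have [C [C0 hC]] := Pk_asymp. have hp := PI_RGT_0. have [K [_ hK]] := nfloor_ex (C ^ 2) (pow2_ge_0 C).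
(* For k >= C^2 the error C / k is at most gam(2k), which keeps [Pk] above gam(2k); the finitely
   many smaller k are covered by a maximum. *)
have [M [M0 hM]] := finite_max (fun k => Rabs (sqrt (INR k / (2 * PI)) - / Pk k)) K.
exists (M + C). split; first lra. move=> k hk1. case: (Nat.le_gt_cases k K) => hkK; first by have := hM k hkK; lra.
have k1 : 1 <= INR k by apply: (le_INR 1). have kC : C ^ 2 <= INR k. { apply: Rle_trans (_ : INR K + 1 <= _); first lra. rewrite -S_INR. apply: le_INR. lia. }
set r := sqrt (INR k / (2 * PI)). have r0 : 0 < r by apply: sqrt_lt_R0; apply: Rdiv_lt_0_compat; lra.
have rr : r * r = INR k / (2 * PI) by apply: sqrt_sqrt; apply: Rdiv_le_0_compat; lra.
have g0 := gam_pos (a := 2 * INR k) ltac:(lra).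
have rg : 2 * gam (2 * INR k) * r = 1.
{ rewrite gam_val; last lra. rewrite Rmult_assoc /r -sqrt_mult; try by apply: Rdiv_le_0_compat; lra. have -> : PI / (2 * INR k) * (INR k / (2 * PI)) = (1/2) * (1/2) by field; lra. rewrite sqrt_square; lra. }
have P0 := Pk_pos hk1. have b := proj1 (Rabs_le_between _ _) (hC k hk1).
have small : C / INR k <= gam (2 * INR k).
{ apply/Rle_div_l; first lra. have : C * (2 * r) <= INR k.
  { apply: Rsqr_incr_0_var; last lra. rewrite !Rsqr_pow2. have -> : (C * (2 * r)) ^ 2 = C ^ 2 * (4 * (r * r)) by ring. rewrite rr. have q : 4 * (INR k / (2 * PI)) <= INR k. { have -> : 4 * (INR k / (2 * PI)) = 2 * INR k / PI by field; lra. apply/Rle_div_l; first lra. have := PI2_3_2. nra. }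
    apply: Rle_trans (Rmult_le_compat_l _ _ _ (pow2_ge_0 C) q) _. nra. }
  move=> q. have -> : C = C * (2 * r) * gam (2 * INR k) by nra. rewrite (Rmult_comm (gam _)). apply: Rmult_le_compat_r; lra. }
have -> : r - / Pk k = r * (Pk k - 2 * gam (2 * INR k)) / Pk k. { have : r * (Pk k - 2 * gam (2 * INR k)) = r * Pk k - 1 by lra. move=> ->. field. lra. }
rewrite Rabs_div; last lra. rewrite Rabs_mult (Rabs_pos_eq r) ?(Rabs_pos_eq (Pk k)); try lra. apply/Rle_div_l => //.
apply: Rle_trans (_ : C * gam (2 * INR k) <= _); last by apply: Rmult_le_compat; lra.
apply: Rle_trans (Rmult_le_compat_l _ _ _ (Rlt_le _ _ r0) (hC k hk1)) _.
have e : r * (C / INR k) = C * gam (2 * INR k) * (2 * (r * r) / INR k) by rewrite -{1}(Rmult_1_l r) -rg; field; lra. rewrite e rr.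
have -> : 2 * (INR k / (2 * PI)) / INR k = / PI by field; lra. have : / PI <= 1. { rewrite -Rinv_1. apply: Rinv_le_contravar; first lra. have := PI2_3_2. lra. } move=> q. have : 0 <= C * gam (2 * INR k) by nra. nra.
Qed.

(** * The archimedean term and sums over zeros *)

(** This majorant is chosen because its square x^2 - 2 + x^(-2) has averages against the weight that
    are ratios of moments. *)
Lemma abs_ln (x : R) : 0 < x -> Rabs (ln x) <= Rabs (x - / x).
Proof.
have H : forall y, 1 <= y -> Rabs (ln y) <= Rabs (y - / y).
{ move=> y hy. have l0 : 0 <= ln y. { rewrite -ln_1. apply: ln_le; lra. } have i : / y <= 1. { rewrite -Rinv_1. apply: Rinv_le_contravar; lra. }
  rewrite !Rabs_pos_eq; try lra. have := ln_le_minus1 (x := y) ltac:(lra). lra. }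
move=> hx. case: (Rle_dec 1 x) => h; first exact: H. have i : 1 <= / x. { rewrite -Rinv_1. apply: Rinv_le_contravar; lra. }
have := H _ i. rewrite ln_Rinv // Rabs_Ropp Rinv_inv Rabs_minus_sym. by [].
Qed.

Lemma Dc_line_cont (t : R) : rcont (fun t => RtoC (Re (Dc (1/2, t)))) t.
Proof.
apply: rcont_Re. apply: (@line_cont Dc (1/2)) => z hz. have [l hl] := @Dc_holo z ltac:(lra). exact: cderiv_ccont hl.
Qed.

(** Every error is expressed through t^(-2), 1 and t^2, which the moments of [hk] average exactly.
    The inequality 2w <= s w^2 + 1/s brings the modulus from [abs_ln] to this form; [s] is free. *)
Lemma arch_pointwise (xi s t : R) : 1 <= xi -> 0 < s -> t <> 0 ->
  Rabs (Re (Dc (1/2, t)) - ln (xi / (2 * PI)) / 2) <= (45 * xi + 1/16) / t ^ 2 + 45 / xi + (s * (t ^ 2 / xi ^ 2 - 2 + xi ^ 2 / t ^ 2) + / s) / 4.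
Proof.
move=> hxi hs ht. have hp := PI_RGT_0. have t2 : 0 < t ^ 2 by have := Rsqr_pos_lt t ht; rewrite Rsqr_pow2.
set T := Cmod (1/2, t). have at0 : 0 < Rabs t by exact: Rabs_pos_lt. set v := Rabs t in at0. have v2 : t ^ 2 = v ^ 2 by rewrite pow2_abs.
have Tsq : T ^ 2 = v ^ 2 * (1 + / (4 * v ^ 2)). { have e : (1/2) ^ 2 + t ^ 2 = v ^ 2 * (1 + / (4 * v ^ 2)) by rewrite v2; field; lra. rewrite /T /Cmod pow2_sqrt; [exact: e | change (0 <= (1/2) ^ 2 + t ^ 2); lra]. }
have Tv : v <= T. { have := im_le_Cmod (1/2, t). by []. } have T0 : 0 < T by lra.
have d1 := @Dc_re (1/2, t) ltac:(rewrite /=; lra). rewrite -/T in d1.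
have d2 : 90 / T <= 45 * (xi / v ^ 2 + / xi).
{ apply: Rle_trans (_ : 90 / v <= _). { apply: Rmult_le_compat_l; first lra. exact: Rinv_le_contravar. }
  have iv : 0 < / v by exact: Rinv_0_lt_compat. have ix : 0 < / xi by apply: Rinv_0_lt_compat; lra.
  have q := pow2_ge_0 (xi * / v - 1). have -> : 90 / v = 45 * (2 * / v) by field; lra. apply: Rmult_le_compat_l; first lra.
  have -> : xi / v ^ 2 + / xi = 2 * / v + (xi * / v - 1) ^ 2 * / xi by field; lra. have : 0 <= (xi * / v - 1) ^ 2 * / xi by apply: Rmult_le_pos; lra. lra. }
have vv : 0 < v ^ 2 by rewrite -v2.
have l2 : forall y, 0 < y -> ln (y ^ 2) = 2 * ln y. { move=> y hy. by rewrite ln_pow. }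
have i4 : 0 < / (4 * v ^ 2) by apply: Rinv_0_lt_compat; lra.
have eT : 2 * ln T = 2 * ln v + ln (1 + / (4 * v ^ 2)). { rewrite -!l2 // Tsq ln_mult //. lra. }
have [_ lb] := ln_1p_bounds (Rlt_le _ _ i4). have lb0 : 0 <= ln (1 + / (4 * v ^ 2)). { rewrite -ln_1. apply: ln_le; lra. }
have ie : / (4 * v ^ 2) = / v ^ 2 / 4 by field; lra.
have vx : 0 < v / xi by apply: Rdiv_lt_0_compat; lra.
have lx := abs_ln vx. rewrite ln_div in lx; try lra.
have am : Rabs (v / xi - / (v / xi)) <= (s * (v ^ 2 / xi ^ 2 - 2 + xi ^ 2 / v ^ 2) + / s) / 2.
{ set w := Rabs _. have w2 : v ^ 2 / xi ^ 2 - 2 + xi ^ 2 / v ^ 2 = w ^ 2 by rewrite /w pow2_abs; field; lra. rewrite w2.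
  have q := pow2_ge_0 (s * w - 1). have is0 : 0 < / s by exact: Rinv_0_lt_compat. have -> : s * w ^ 2 + / s = 2 * w + (s * w - 1) ^ 2 * / s by field; lra. have : 0 <= (s * w - 1) ^ 2 * / s by apply: Rmult_le_pos; lra. lra. }
rewrite ln_div in d1; try lra. rewrite ln_div; try lra. rewrite v2.
have b1 := proj1 (Rabs_le_between _ _) d1. have b2 := proj1 (Rabs_le_between _ _) (Rle_trans _ _ _ lx am).
have e1 : (45 * xi + 1/16) / v ^ 2 = 45 * (xi / v ^ 2) + / v ^ 2 / 16 by field; lra. have e2 : 45 / xi = 45 * / xi by []. rewrite e1 e2. apply: Rabs_le. lra.
Qed.

(** Average of [arch_pointwise] with s the square root of n = k + 1: the mean of t^2 / xi^2 - 2 +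
    xi^2 / t^2 is of size 1/n, so both terms in s are of size n^(-1/2). The index [S k] makes the
    weight times t^(-2) a weight again. *)
Lemma arch_asymp (xi A : R) (k : nat) : 1 <= xi -> isI (fun t => RtoC (hk (INR (S k) / xi ^ 2) (S k) t * Re (Dc (1/2, t)))) (RtoC A) ->
  Rabs (A / mom (INR (S k) / xi ^ 2) (S k) - ln (xi / (2 * PI)) / 2) <= 136 / xi + / sqrt (INR (S k)).
Proof.
move=> hxi hA. have x2 : 0 < xi ^ 2 by nra. have n1 : 1 <= INR (S k) by rewrite S_INR; have := pos_INR k; lra. set n := INR (S k) in hA n1 *.
set a := n / xi ^ 2 in hA *. have ha : 0 < a by apply: Rdiv_lt_0_compat; lra. have [s1 s2] := @sqrt_k (S k) ltac:(lia). rewrite -/n in s1 s2. set s := sqrt n in s1 s2 *.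
set L := ln (xi / (2 * PI)) / 2. have m0 := mom_pos (S k) ha. set m := mom a (S k) in m0 *.
pose al := 45 * xi + 1/16 + s * xi ^ 2 / 4. pose be := 45 / xi - s / 2 + / s / 4. pose ga := s / xi ^ 2 / 4.
pose dl t := Re (Dc (1/2, t)). pose g t := al * hk a k t + be * hk a (S k) t + ga * hk a (S (S k)) t.
have c : forall j t, rcont (fun t => RtoC (hk a j t)) t by move=> j; apply: rcont_of_ex => t; rewrite /hk; auto_derive.
have cs : forall z j t, rcont (fun t => RtoC z * RtoC (hk a j t))%C t by move=> z j t; apply: rcont_scal; exact: c.
have cgd : forall t, rcont (fun t => RtoC (g t)) t by apply: rcont_of_ex => t; rewrite /g /hk; auto_derive.
have ig : isI (fun t => RtoC (g t)) (RtoC (al * mom a k + be * m + ga * mom a (S (S k)))).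
{ have i := isI_plus (fun t => rcont_plus (cs al k t) (cs be (S k) t)) (cs ga (S (S k))) (isI_plus (cs al k) (cs be (S k)) (isI_scal _ (c k) (isI_mom k ha)) (isI_scal _ (c (S k)) (isI_mom (S k) ha))) (isI_scal _ (c (S (S k))) (isI_mom (S (S k)) ha)).
  rewrite -!RtoC_mult -!RtoC_plus in i. apply: isI_ext i => t. by rewrite -!RtoC_mult -!RtoC_plus. }
have cf0 : forall t, rcont (fun t => RtoC (hk a (S k) t) * RtoC (dl t))%C t by move=> t; apply: rcont_mult; [exact: c | exact: Dc_line_cont].
have hA' : isI (fun t => RtoC (hk a (S k) t) * RtoC (dl t))%C (RtoC A) by apply: isI_ext hA => t; rewrite RtoC_mult.
pose f t := hk a (S k) t * dl t - L * hk a (S k) t.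
have iF : isI (fun t => RtoC (f t)) (RtoC (A - L * m)).
{ rewrite RtoC_minus RtoC_mult. apply: isI_ext (isI_minus cf0 (cs L (S k)) hA' (isI_scal (RtoC L) (c (S k)) (isI_mom (S k) ha))) => t. by rewrite /f RtoC_minus !RtoC_mult. }
have cf : forall t, rcont (fun t => RtoC (f t)) t.
{ move=> t e he. case: (rcont_minus (cf0 t) (cs L (S k) t) he) => d [hd H]. exists d. split => // u hu. have := H u hu. by rewrite /f !RtoC_minus !RtoC_mult. }
have pt : forall t, Rabs (f t) <= g t.
{ move=> t. rewrite /f. have h0 := hk_pos a k t. case: (Req_dec t 0) => [->|ht].
  - rewrite /g !hk_S. have -> : 0 ^ 2 * hk a k 0 * dl 0 - L * (0 ^ 2 * hk a k 0) = 0 by ring. rewrite Rabs_R0. have al0 : 0 <= al. { have : 0 <= s * xi ^ 2 by apply: Rmult_le_pos; lra. rewrite /al. lra. }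
    have := hk_pos a k 0. move=> q. have : 0 <= al * hk a k 0 by apply: Rmult_le_pos. lra.
  - have b := @arch_pointwise xi s t hxi ltac:(lra) ht. rewrite -/L -/(dl t) in b. have t2 : 0 < t ^ 2 by have := Rsqr_pos_lt t ht; rewrite Rsqr_pow2.
    rewrite /g !hk_S. set H := hk a k t in h0 *. have -> : t ^ 2 * H * dl t - L * (t ^ 2 * H) = t ^ 2 * H * (dl t - L) by ring.
    rewrite Rabs_mult Rabs_pos_eq; last by apply: Rmult_le_pos; lra. apply: Rle_trans (Rmult_le_compat_l _ _ _ _ b) _; first by apply: Rmult_le_pos; lra.
    right. rewrite /al /be /ga. field. lra. }
have ub := isI_abs_le cf cgd pt iF ig.
have e0 : al * mom a k = al * (n / (xi ^ 2 * (n - 1/2))) * m. { rewrite /m mom_rec // /a. have -> : INR k = n - 1 by rewrite /n S_INR; ring. field. lra. }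
have e2 : ga * mom a (S (S k)) = ga * ((n + 1/2) * xi ^ 2 / n) * m. { rewrite mom_rec // -/m -/n /a. field. lra. }
(* 45 xi + 1/16 <= (91/2) xi and n / (n - 1/2) <= 2 give 91 + 45 = 136; the terms in s add up to at
   most 1/(4s) + 1/(2s). *)
have tot : al * (n / (xi ^ 2 * (n - 1/2))) + be + ga * ((n + 1/2) * xi ^ 2 / n) <= 136 / xi + / s.
{ have -> : al * (n / (xi ^ 2 * (n - 1/2))) + be + ga * ((n + 1/2) * xi ^ 2 / n) = (45 * xi + 1/16) / xi ^ 2 * (n / (n - 1/2)) + 45 / xi + / s / 4 + s * ((/ (2 * n - 1) + / (2 * n)) / 4).
  { rewrite /al /be /ga. field. lra. }
  have q1 : n / (n - 1/2) <= 2 by apply/Rle_div_l; lra. have q2 : (45 * xi + 1/16) / xi ^ 2 <= 91/2 / xi. { apply/Rle_div_l => //. have -> : 91/2 / xi * xi ^ 2 = 91/2 * xi by field; lra. lra. }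
  have ix : 0 < / xi by apply: Rinv_0_lt_compat; lra. have q0 : 0 <= (45 * xi + 1/16) / xi ^ 2 by apply: Rdiv_le_0_compat; lra.
  have i1 : / (2 * n - 1) <= / n by apply: Rinv_le_contravar; lra. have i2 : / (2 * n) <= / n by apply: Rinv_le_contravar; lra.
  have q3 : s * ((/ (2 * n - 1) + / (2 * n)) / 4) <= / s / 2. { apply: Rle_trans (_ : s * (/ n / 2) <= _). { apply: Rmult_le_compat_l; lra. } right. rewrite -s2. field. lra. }
  have q4 : (45 * xi + 1/16) / xi ^ 2 * (n / (n - 1/2)) <= 91/2 / xi * 2. { apply: Rmult_le_compat => //. apply: Rdiv_le_0_compat; lra. }
  have is0 : 0 < / s by apply: Rinv_0_lt_compat; lra. have e5 : 91/2 / xi = 91/2 * / xi by []. have e6 : 45 / xi = 45 * / xi by []. have e7 : 136 / xi = 136 * / xi by []. lra. }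
rewrite e0 e2 in ub. set X := al * (n / (xi ^ 2 * (n - 1/2))) in ub tot. set Y := ga * ((n + 1/2) * xi ^ 2 / n) in ub tot.
have -> : A / m - L = (A - L * m) / m by field; lra. apply: Rle_trans tot. rewrite Rabs_div; last lra. rewrite (Rabs_pos_eq m); last lra. apply/Rle_div_l => //. lra.
Qed.

(** * Lorentz sums over the zeros *)

Section ZeroSum.
Variables (zeta : C -> C) (rho : nat -> C).
Hypothesis Hz : is_Riemann_zeta zeta.
Hypothesis RH : Riemann_hypothesis zeta.
Hypothesis Hs : all_nontrivial_zeros_simple zeta.
Hypothesis Hr : upper_zero_enumeration zeta rho.

Definition zlor (sg xi : R) (n : nat) : R := 1 / (1 + ((gm rho n - xi) / sg) ^ 2).

Lemma zlor_pos (sg xi : R) (n : nat) : 0 < zlor sg xi n.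
Proof. apply: Rdiv_lt_0_compat; first lra. have := pow2_ge_0 ((gm rho n - xi) / sg). lra. Qed.

(** 2w / (w^2 + g^2) = 1 / (w - i g) + 1 / (w + i g). The real part of the first summand is the
    Lorentz term divided by sg; that of the second is positive and is dropped. *)
Lemma zlor_series (sg xi : R) : 1 <= sg -> let w : C := (sg, xi) in
  ex_series (zlor sg xi) /\ Series (zlor sg xi) <= sg * Re (2 * w / (w * w - RtoC (1/4)) + Dc (RtoC (1/2) + w) - LC (RtoC (1/2) + w))%C.
Proof.
move=> hs w. have h := Cser_re (explicit_logderiv Hz RH Hs Hr (w := w) ltac:(rewrite /=; lra)). set R0 := Re _ in h *.
have b : forall n, 0 <= zlor sg xi n <= sg * Re (2 * w / (w * w + RtoC (gm rho n ^ 2)))%C.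
{ move=> n. split; first by left; exact: zlor_pos. set g := gm rho n.
  have d1 : 0 < sg ^ 2 + (g - xi) ^ 2 by have := pow2_ge_0 (g - xi); nra. have d2 : 0 < sg ^ 2 + (g + xi) ^ 2 by have := pow2_ge_0 (g + xi); nra.
  pose p1 : C := (sg, xi - g). pose p2 : C := (sg, xi + g).
  have n1 : p1 <> RtoC 0. { move=> e. have q : sg = 0 := f_equal Re e. lra. } have n2 : p2 <> RtoC 0. { move=> e. have q : sg = 0 := f_equal Re e. lra. }
  have e : (2 * w / (w * w + RtoC (g ^ 2)))%C = (/ p1 + / p2)%C.
  { have e1 : (w * w + RtoC (g ^ 2))%C = (p1 * p2)%C by rewrite /p1 /p2 /w /RtoC /Cmult /Cplus /=; congr (_, _); ring.
    have e2 : (2 * w)%C = (p1 + p2)%C by rewrite /p1 /p2 /w /RtoC /Cmult /Cplus /=; congr (_, _); ring.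
    rewrite e1 e2. field. by split. }
  rewrite e re_plus. have -> : Re (/ p1) = sg / (sg ^ 2 + (g - xi) ^ 2). { rewrite /=. congr (_ / _). ring. }
  have -> : Re (/ p2) = sg / (sg ^ 2 + (g + xi) ^ 2). { rewrite /=. congr (_ / _). ring. }
  have -> : zlor sg xi n = sg * (sg / (sg ^ 2 + (g - xi) ^ 2)) by rewrite /zlor -/g; field; lra.
  have p : 0 <= sg / (sg ^ 2 + (g + xi) ^ 2) by apply: Rdiv_le_0_compat; lra. apply: Rmult_le_compat_l; lra. }
have hs2 : is_series (fun n => sg * Re (2 * w / (w * w + RtoC (gm rho n ^ 2)))%C) (sg * R0) by exact: (is_series_scal_l sg _ _ h).
split; first by apply: (ex_series_pos_le b); exists (sg * R0). rewrite -(is_series_unique _ _ hs2). apply: Series_le => //. by exists (sg * R0).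
Qed.

(** At Re s = 1/2 + sg >= 3/2 the Dirichlet series is at most L0, the pole term at most 3, and Re
    [Dc] at most log(xi) / 2 + 90. As log xi >= 1 for xi >= 3, the total is at most (94 + L0) log
    xi. *)
Lemma zlor_bound : exists C, 0 <= C /\ forall sg xi, 3 <= xi -> 1 <= sg <= xi -> Series (zlor sg xi) <= C * (sg * ln xi).
Proof.
set L0 := Series (fun n => Lam n * exp (- (3/2) * lnS n)). have L00 : 0 <= L0. { apply: Series_pos; last by apply: Lam_ex; lra. move=> n. apply: Rmult_le_pos; [exact: (proj1 (Lam_bound n)) | left; exact: exp_pos]. }
exists (94 + L0). split; first lra. move=> sg xi hxi hs. set w : C := (sg, xi). have hp := PI2_3_2.
have [_ h] := zlor_series xi (proj1 hs). rewrite -/w in h. apply: Rle_trans h _.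
have lx : 1 <= ln xi. { rewrite -(ln_exp 1). apply: ln_le; first exact: exp_pos. apply: Rle_trans exp_le_3 _. lra. }
have -> : (94 + L0) * (sg * ln xi) = sg * ((94 + L0) * ln xi) by ring. apply: Rmult_le_compat_l; first lra.
have w1 : 1 <= Cmod w. { apply: Rle_trans (re_le_Cmod w). have := Rle_abs sg. rewrite /=. lra. }
have wx : xi <= Cmod w. { apply: Rle_trans (im_le_Cmod w). have := Rle_abs xi. rewrite /=. lra. }
have wu : Cmod w <= 2 * xi. { have -> : w = (RtoC sg + RtoC xi * Ci)%C by rewrite /w /RtoC /Cmult /Cplus /=; congr (_, _); ring. apply: Rle_trans (Cmod_triangle _ _) _. rewrite Cmod_mult Cmod_Ci !Cmod_RtoC_pos; lra. }
set s := (RtoC (1/2) + w)%C. have rs : Re s = 1/2 + sg by rewrite /s re_plus re_RtoC.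
have su : Cmod s <= 3 * xi. { apply: Rle_trans (Cmod_triangle _ _) _. rewrite Cmod_RtoC_pos; lra. }
have sl : 3/2 <= Cmod s. { apply: Rle_trans (re_le_Cmod s). have := Rle_abs (Re s). lra. }
rewrite re_minus re_plus.
have t1 : Re (2 * w / (w * w - RtoC (1/4)))%C <= 3.
{ apply: Rle_trans (Rle_abs _) _. apply: Rle_trans (re_le_Cmod _) _. have lb := Cmod_triangle_inv (w * w) (RtoC (1/4)). rewrite Cmod_mult Cmod_RtoC_pos in lb; last lra.
  have n0 : (w * w - RtoC (1/4))%C <> RtoC 0 by apply/Cmod_gt_0; nra.
  rewrite Cmod_div // Cmod_mult Cmod_RtoC_pos; last lra. apply/Rle_div_l; nra. }
have t2 : Re (Dc s) <= ln xi / 2 + 90.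
{ have d := proj1 (Rabs_le_between _ _) (Dc_re (s := s) ltac:(lra)). have l : ln (Cmod s / (2 * PI)) <= ln xi. { apply: ln_le. { apply: Rdiv_lt_0_compat; lra. } apply/Rle_div_l; nra. }
  have : 90 / Cmod s <= 90 by apply/Rle_div_l; lra. lra. }
have t3 : - Re (LC s) <= L0. { have := LC_bound (s := s) (x := 3/2) ltac:(lra) ltac:(lra). have := re_le_Cmod (LC s). have := Rle_abs (- Re (LC s)). rewrite Rabs_Ropp -/L0. lra. }
nra.
Qed.

End ZeroSum.

(** * Error term *)

Section Assembly.
Variables (zeta : C -> C) (rho : nat -> C).
Hypothesis Hz : is_Riemann_zeta zeta.
Hypothesis RH : Riemann_hypothesis zeta.
Hypothesis Hs : all_nontrivial_zeros_simple zeta.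
Hypothesis Hr : upper_zero_enumeration zeta rho.

Variables (xi : R) (k : nat).
Hypothesis hxi : 0 < xi.
Hypothesis hk1 : (1 <= k)%nat.

Let a := INR k / xi ^ 2.
Let x (n : nat) := gm rho n / xi.

Let k1 : 1 <= INR k.
Proof. by apply: (le_INR 1). Qed.

Let x2 : 0 < xi ^ 2.
Proof. exact: pow_lt. Qed.

Let a0 : 0 < a.
Proof. apply: Rdiv_lt_0_compat; [lra | exact: x2]. Qed.

Lemma mom_scaled : mom a k = xi * xi ^ (2 * k) * exp (- INR k) * Pk k.
Proof.
have kp : INR k ^ k <> 0 by apply: pow_nonzero; lra. have xp : xi ^ (2 * k) <> 0 by apply: pow_nonzero; lra.
rewrite /Pk !mom_val //; try lra. have eg : gam a = xi * gam (INR k).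
{ rewrite !gam_val //; try lra. have -> : PI / a = xi * xi * (PI / INR k) by rewrite /a; field; lra. rewrite sqrt_mult; [|nra|apply: Rdiv_le_0_compat; [left; exact: PI_RGT_0 | lra]]. rewrite sqrt_square; lra. }
have ea : a ^ k = INR k ^ k / xi ^ (2 * k). { rewrite /a /Rdiv Rpow_mult_distr pow_inv pow_mult. by []. }
rewrite eg ea exp_Ropp. have e := exp_pos (INR k). field. repeat split => //; lra.
Qed.

Lemma hk_scaled (t : R) : hk a k t = xi ^ (2 * k) * exp (- INR k) * pk k (t / xi).
Proof.
have xp : xi ^ (2 * k) <> 0 by apply: pow_nonzero; lra.
rewrite /pk /hk /Rdiv Rpow_mult_distr pow_inv. have -> : - INR k * (t * / xi) ^ 2 = - a * t ^ 2 by rewrite /a; field; lra.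
have e : exp (- INR k) * exp (INR k) = 1 by rewrite -exp_plus Rplus_opp_l exp_0.
have -> : xi ^ (2 * k) * exp (- INR k) * (exp (INR k) * (t ^ (2 * k) * / xi ^ (2 * k) * exp (- a * t ^ 2))) = (exp (- INR k) * exp (INR k)) * (t ^ (2 * k) * exp (- a * t ^ 2)) by field. rewrite e. ring.
Qed.

Lemma zero_term_eq (n : nat) : zero_term (gm rho) xi k n = exp (- (2 * INR k) * (x n - 1) ^ 2).
Proof. rewrite /zero_term /x. congr exp. field. lra. Qed.

(** The origin of [c2]: Gamma(k + 1/2) = sqrt pi [Qm k], the scaling (2 sqrt a)^(2k) = 4^k a^k of
    [J_val] supplies 4^(-k), the sign is that of [Fk], and gam a cancels against the same factor in
    [mom a k]. *)
Lemma prime_term_eq (n : nat) : c2 k * prime_term xi k (S n) = pterm a k n / (2 * PI * mom a k).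
Proof.
have hp := PI_RGT_0. have q := Qm_pos k. have g1 := gam_val Rlt_0_1. rewrite Rdiv_1_r in g1. have sp := sqrt_lt_R0 _ hp.
have spp : sqrt PI * sqrt PI = PI by apply: sqrt_sqrt; lra. have sk := sqrt_k hk1.
have sx : sqrt a = sqrt (INR k) / xi. { rewrite /a sqrt_div_alt //. by rewrite sqrt_pow2 //; lra. }
rewrite /c2 Gamma_half mom_val; last lra. rewrite g1 pow1 mom_val // /prime_term /pterm Hermite_Hp -/(Lam n) -/(lnS n).
have -> : lnS n / (2 * sqrt a) = xi * (lnS n / (2 * sqrt (INR k))) by rewrite sx; field; lra.
have -> : - lnS n ^ 2 / (4 * a) = - (xi ^ 2 / (4 * INR k)) * lnS n ^ 2 by rewrite /a; field; lra.
have -> : exp (- lnS n / 2) = / sqrt (INR (S n)).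
{ have np := INR_S_pos n. have e : exp (lnS n / 2) = sqrt (INR (S n)). { rewrite -[in RHS](exp_ln _ np) -/(lnS n). have -> : exp (lnS n) = exp (lnS n / 2) * exp (lnS n / 2) by rewrite -exp_plus; congr exp; field. rewrite sqrt_square //. left. exact: exp_pos. }
  rewrite -e -exp_Ropp. congr exp. field. }
set X := exp (- (xi ^ 2 / _) * _). set Y := Hp _ _. have sn : 0 < sqrt (INR (S n)) by apply: sqrt_lt_R0; exact: INR_S_pos.
have g0 := gam_pos a0. have ak : 0 < a ^ k by apply: pow_lt.
have e4 : (2 * sqrt a) ^ (2 * k) = 4 ^ k * a ^ k. { rewrite pow_mult -Rpow_mult_distr. congr (_ ^ _). have -> : (2 * sqrt a) ^ 2 = 4 * (sqrt a * sqrt a) by ring. rewrite sqrt_sqrt //. lra. }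
have e1 : (- 1 / 4) ^ k = (-1) ^ k / 4 ^ k by rewrite /Rdiv Rpow_mult_distr pow_inv.
have p4 : 0 < 4 ^ k by apply: pow_lt; lra. rewrite e4 e1.
have -> : 1 / (2 * sqrt PI) * ((-1) ^ k / 4 ^ k / (sqrt PI * Qm k / 1)) = (-1) ^ k / 4 ^ k / (2 * (sqrt PI * sqrt PI) * Qm k) by field; lra. rewrite spp. field. lra.
Qed.

(** A window of width sg >= xi / sqrt k contains the scaled one: |gm - xi| / sg is at most sqrt k |x
    - 1|. *)
Lemma zlor_le (sg : R) (n : nat) : 1 <= sg -> xi <= sg * sqrt (INR k) -> lor k 1 (x n) <= zlor rho sg xi n.
Proof.
move=> h1 h2. rewrite /lor /zlor. have [s1 s2] := sqrt_k hk1. have d : 0 <= ((gm rho n - xi) / sg) ^ 2 by exact: pow2_ge_0.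
apply: Rmult_le_compat_l; first lra. apply: Rinv_le_contravar; first lra. apply: Rplus_le_compat_l.
have -> : ((gm rho n - xi) / sg) ^ 2 = xi ^ 2 / sg ^ 2 * (x n - 1) ^ 2 by rewrite /x; field; lra. apply: Rmult_le_compat_r; first exact: pow2_ge_0.
apply/Rle_div_l; first nra. rewrite -s2. have -> : sqrt (INR k) * sqrt (INR k) * sg ^ 2 = (sg * sqrt (INR k)) ^ 2 by ring. apply: pow_incr. lra.
Qed.

Lemma lor_ex : ex_series (fun n => lor k 1 (x n)).
Proof.
have [s1 s2] := sqrt_k hk1. have p : 0 < xi / sqrt (INR k) by apply: Rdiv_lt_0_compat; lra.
(* The width must be at least 1 and at least xi / sqrt k; the sum of the two serves for every xi >
   0. *)
have [h _] := zlor_series Hz RH Hs Hr xi (sg := 1 + xi / sqrt (INR k)) ltac:(lra).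
apply: ex_series_pos_le h => n. split; first by left; exact: lor_pos. apply: zlor_le; first lra.
have : xi / sqrt (INR k) * sqrt (INR k) = xi by field; lra. nra.
Qed.

Lemma zero_ex : ex_series (zero_term (gm rho) xi k).
Proof.
apply: ex_series_pos_le lor_ex => n. rewrite zero_term_eq. split; first by left; exact: exp_pos. apply: exp_lor. lra.
Qed.

Lemma c2_neq0 : c2 k <> 0.
Proof.
rewrite /c2 Gamma_half. have m := mom_pos k Rlt_0_1. have sp := sqrt_lt_R0 _ PI_RGT_0. have q : (- 1 / 4) ^ k <> 0 by apply: pow_nonzero; lra.
apply: Rmult_integral_contrapositive_currified; first by apply: Rgt_not_eq; apply: Rdiv_lt_0_compat; lra. apply: Rmult_integral_contrapositive_currified => //. apply: Rinv_neq_0_compat. lra.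
Qed.

Lemma prime_ex : ex_series (fun n => prime_term xi k (S n)) /\ c2 k * Series (fun n => prime_term xi k (S n)) = Series (pterm a k) / (2 * PI * mom a k).
Proof.
have [pe _] := prime_integral k a0. have c := c2_neq0. split.
- apply: (ex_series_ext (fun n => / (c2 k * (2 * PI * mom a k)) * pterm a k n)); last by apply: (ex_series_scal_l (/ (c2 k * (2 * PI * mom a k)))).
  move=> n. have e := prime_term_eq n. have m := mom_pos k a0. have hp := PI_RGT_0. have -> : prime_term xi k (S n) = / c2 k * (c2 k * prime_term xi k (S n)) by field. rewrite e. have f : forall p q c : R, c <> 0 -> q <> 0 -> / (c * q) * p = / c * (p / q) by move=> *; field. apply: f => //. have := Rmult_lt_0_compat _ _ hp m. lra.
- rewrite -Series_scal_l /Rdiv -Series_scal_r. apply: Series_ext => n. exact: prime_term_eq.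
Qed.

(** Division of the explicit formula by 2 pi times the mass of the weight leaves three errors: the
    exchange of weight and normalization ([main]), the pole of zeta ([pole]) and the archimedean
    average ([arch]). *)
Lemma error_bound (C1 C2 Z : R) : 2 <= xi -> 0 <= C1 -> 0 <= C2 ->
  (forall y, 0 <= y -> Rabs (pk k y - exp (- (2 * INR k) * (y - 1) ^ 2)) <= C1 / sqrt (INR k) * lor k 1 y) ->
  Rabs (sqrt (INR k / (2 * PI)) - / Pk k) <= C2 -> Series (fun n => lor k 1 (x n)) <= Z ->
  Rabs (S_sum (gm rho) xi k - (1 / (4 * PI) * ln (xi / (2 * PI)) - c2 k * Series (fun n => prime_term xi k (S n)))) <=
  (C1 + C2) * Z / xi + (1 + C2) * sqrt (INR k) / xi ^ 2 + (136 / xi + / sqrt (INR k)).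
Proof.
move=> hxi2 C10 C20 hC1 hC2 hZ. have hp := PI_RGT_0. have hp2 := PI2_3_2. have [s1 s2] := sqrt_k hk1. set s := sqrt (INR k) in s1 s2 hC1 *.
have P0 := Pk_pos hk1. set r := sqrt (INR k / (2 * PI)) in hC2 *. have r0 : 0 <= r by exact: sqrt_pos.
have rs : r <= s. { apply: sqrt_le_1_alt. apply/Rle_div_l; nra. }
have [A [hA [he [pe ef]]]] := explicit_formula Hz RH Hs Hr k a0.
have m0 := mom_pos k a0. set m := mom a k in m0 *. have em : m = xi * xi ^ (2 * k) * exp (- INR k) * Pk k by exact: mom_scaled.
set w := xi ^ (2 * k) * exp (- INR k). have w0 : 0 < w by apply: Rmult_lt_0_compat; [exact: pow_lt | exact: exp_pos].
have ew : m = xi * w * Pk k by rewrite em /w; ring.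
have ez : Series (fun n => hk a k (gm rho n)) = w * Series (fun n => pk k (x n)). { rewrite -Series_scal_l. apply: Series_ext => n. exact: hk_scaled. }
have [_ pr] := prime_ex. rewrite -/m in pr. rewrite pr.
have pke : ex_series (fun n => pk k (x n)). { apply: (ex_series_ext (fun n => / w * hk a k (gm rho n))); last by apply: (ex_series_scal_l (/ w)). move=> n. rewrite hk_scaled -/w /x. have f : forall p q : R, 0 < p -> / p * (p * q) = q by move=> p q h; field; lra. exact: f. }
have xn0 : forall n, 0 <= x n by move=> n; apply: Rdiv_le_0_compat => //; left; exact: (gm_pos Hr).
set Sp := Series (fun n => pk k (x n)) in ez. set Sz := Series (zero_term (gm rho) xi k).
set Sl := Series (fun n => lor k 1 (x n)) in hZ. have lx := lor_ex.
have Sp0 : 0 <= Sp by apply: Series_pos pke => n; exact: pk_pos.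
have SpL : Sp <= Sl. { apply: Series_le lx => n. split; first exact: pk_pos. apply: Rle_trans (pk_le hk1 (xn0 n)) _. have := @exp_lor k 1 (x n) 1 ltac:(lra). by rewrite Rmult_1_l. }
have Sl0 : 0 <= Sl by lra.
have dz : Rabs (Sz - Sp) <= C1 / s * Sl.
{ rewrite /Sz /Sp -Series_minus //; last exact: zero_ex. rewrite /Sl -Series_scal_l.
  have le : forall n, Rabs (zero_term (gm rho) xi k n - pk k (x n)) <= C1 / s * lor k 1 (x n) by move=> n; rewrite zero_term_eq Rabs_minus_sym; exact: hC1.
  have ee : ex_series (fun n => Rabs (zero_term (gm rho) xi k n - pk k (x n))). { apply: (@ex_series_pos_le _ (fun n => C1 / s * lor k 1 (x n))); last exact: (ex_series_scal_l (C1 / s)). move=> n. split; [exact: Rabs_pos | exact: le]. }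
  apply: Rle_trans (Series_Rabs _ ee) _. apply: Series_le; last exact: (ex_series_scal_l (C1 / s)). move=> n. split; [exact: Rabs_pos | exact: le]. }
(* r (Sz - Sp) is the change of shape, where the k^(-1/2) of [pk_lor] cancels r <= sqrt k; (r - 1 /
   Pk) Sp is the change of normalization, bounded by C2. *)
have main : Rabs (1 / xi * r * Sz - Sp / (xi * Pk k)) <= (C1 + C2) * Z / xi.
{ have -> : 1 / xi * r * Sz - Sp / (xi * Pk k) = (r * (Sz - Sp) + (r - / Pk k) * Sp) / xi by field; lra.
  rewrite Rabs_div; last lra. rewrite (Rabs_pos_eq xi); last lra. apply: Rmult_le_compat_r; first by left; apply: Rinv_0_lt_compat; lra.
  apply: Rle_trans (Rabs_triang _ _) _. rewrite !Rabs_mult (Rabs_pos_eq r) // (Rabs_pos_eq Sp) //.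
  have q1 : r * Rabs (Sz - Sp) <= C1 * Sl. { apply: Rle_trans (_ : s * (C1 / s * Sl) <= _). { apply: Rmult_le_compat => //. exact: Rabs_pos. } right. field. lra. }
  have q2 : Rabs (r - / Pk k) * Sp <= C2 * Sl by apply: Rmult_le_compat => //; exact: Rabs_pos. have : (C1 + C2) * Sl <= (C1 + C2) * Z by nra. lra. }
have pole : Rabs ((- (1/4)) ^ k * exp (a / 4) / m) <= (1 + C2) * s / xi ^ 2.
{ have ip : / Pk k <= (1 + C2) * s. { have := proj1 (Rabs_le_between _ _) hC2. have : C2 <= C2 * s by nra. lra. }
  rewrite Rabs_div; last lra. rewrite (Rabs_pos_eq m); last lra. rewrite Rabs_mult -RPow_abs Rabs_Ropp (Rabs_pos_eq (1/4)); last lra. rewrite (Rabs_pos_eq (exp _)); last by left; exact: exp_pos.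
  have e14 : exp (/ (4 * xi ^ 2)) <= 4/3.
  { have q : / (4 * xi ^ 2) <= / 16 by apply: Rinv_le_contravar; nra. apply: Rle_trans (exp_le q) _. have := exp_ineq1_le (- / 16). rewrite exp_Ropp => h. have p := exp_pos (/ 16).
    have := Rmult_le_compat_l _ _ _ (Rlt_le _ _ p) h. rewrite Rinv_r; lra. }
  (* For xi >= 2 the base of this k-th power is at most (1/4)(4/3)(3) = 1, so 4^(-k) compensates the
     e^k hidden in 1 / mom. *)
  have ub : (1/4) ^ k * exp (a / 4) * exp (INR k) <= 1.
  { have -> : (1/4) ^ k * exp (a / 4) * exp (INR k) = (1/4 * (exp (/ (4 * xi ^ 2)) * exp 1)) ^ k.
    { rewrite !Rpow_mult_distr -!(Rpower_pow k (exp _)); try exact: exp_pos. rewrite /Rpower !ln_exp Rmult_assoc. congr (_ * (exp _ * exp _)); rewrite /a; field; lra. }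
    apply: Rle_trans (_ : 1 ^ k <= _); last by rewrite pow1; lra. apply: pow_incr. have e3 := exp_le_3. have p1 := exp_pos 1. have p2 := exp_pos (/ (4 * xi ^ 2)). split. { nra. }
    have : exp (/ (4 * xi ^ 2)) * exp 1 <= 4/3 * 3 by nra. lra. }
  have xk : xi ^ 2 <= xi ^ (2 * k) by apply: Rle_pow; [lra | lia]. have xkp : 0 < xi ^ (2 * k) by lra.
  apply: Rle_trans (_ : / Pk k / (xi * xi ^ (2 * k)) <= _).
  - apply/Rle_div_l => //. have -> : / Pk k / (xi * xi ^ (2 * k)) * m = exp (- INR k). { rewrite em. field. lra. }
    rewrite exp_Ropp. have p := exp_pos (INR k). have -> : / exp (INR k) = 1 / exp (INR k) by field; lra. by apply: (proj1 (Rle_div_r _ _ _ p)).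
  - have i0 : 0 < / Pk k by exact: Rinv_0_lt_compat. apply: Rmult_le_compat => //; first lra. { left. apply: Rinv_0_lt_compat. nra. } apply: Rinv_le_contravar; nra. }
have arch : Rabs (A / m / (2 * PI) - 1 / (4 * PI) * ln (xi / (2 * PI))) <= 136 / xi + / s.
{ have kS : k = S (k - 1) by lia. have h := @arch_asymp xi A (k - 1) ltac:(lra). rewrite -kS -/a -/m -/s in h. have {h} h := h hA. have -> : A / m / (2 * PI) - 1 / (4 * PI) * ln (xi / (2 * PI)) = (A / m - ln (xi / (2 * PI)) / 2) / (2 * PI) by field; lra.
  rewrite Rabs_div; last lra. rewrite (Rabs_pos_eq (2 * PI)); last lra. apply/Rle_div_l; first lra. have : 0 <= 136 / xi + / s by apply: Rle_trans (Rabs_pos _) h. nra. }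
have eq : Sp / (xi * Pk k) = (- (1/4)) ^ k * exp (a / 4) / m + A / m / (2 * PI) - Series (pterm a k) / (2 * PI * m).
{ have q : 2 * PI * (w * Sp) = 2 * PI * ((- (1/4)) ^ k * exp (a / 4)) + A - Series (pterm a k) by rewrite -ez.
  have -> : Sp / (xi * Pk k) = 2 * PI * (w * Sp) / (2 * PI * m) by rewrite ew; field; lra. rewrite q. field. lra. }
have -> : S_sum (gm rho) xi k - (1 / (4 * PI) * ln (xi / (2 * PI)) - Series (pterm a k) / (2 * PI * m)) =
  (1 / xi * r * Sz - Sp / (xi * Pk k)) + (- (1/4)) ^ k * exp (a / 4) / m + (A / m / (2 * PI) - 1 / (4 * PI) * ln (xi / (2 * PI))).
{ rewrite eq /S_sum -/r -/Sz. ring. }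
apply: Rle_trans (Rabs_triang _ _) _. apply: Rplus_le_compat => //. apply: Rle_trans (Rabs_triang _ _) _. exact: Rplus_le_compat.
Qed.

End Assembly.

Lemma final_error (zeta : C -> C) (rho : nat -> C) : is_Riemann_zeta zeta -> Riemann_hypothesis zeta -> all_nontrivial_zeros_simple zeta -> upper_zero_enumeration zeta rho ->
  exists A, forall xi k, 3 <= xi -> (1 <= k)%nat ->
  Rabs (S_sum (gm rho) xi k - (1 / (4 * PI) * ln (xi / (2 * PI)) - c2 k * Series (fun n => prime_term xi k (S n)))) <=
  A * ((sqrt (INR k) / xi ^ 2 + exp (- (sqrt (INR k) / xi))) * ln xi).
Proof.
move=> Hz RH Hs Hr. have [C1 [C10 hC1]] := pk_lor. have [C2 [C20 hC2]] := norm_asymp. have [C3 [C30 hC3]] := zlor_bound Hz RH Hs Hr.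
set B := (C1 + C2) * C3. have B0 : 0 <= B by apply: Rmult_le_pos; lra.
exists (3 * (B + (1 + C2) + 137)). move=> xi k hxi hk1. have x0 : 0 < xi by lra. have x2 : 0 < xi ^ 2 by nra. have [s1 s2] := sqrt_k hk1.
have lx : 1 <= ln xi. { rewrite -(ln_exp 1). apply: ln_le; first exact: exp_pos. apply: Rle_trans exp_le_3 _. lra. } have isq : 0 < / sqrt (INR k) by apply: Rinv_0_lt_compat; lra.
have zb : forall sg, 1 <= sg <= xi -> xi <= sg * sqrt (INR k) -> Series (fun n => lor k 1 (gm rho n / xi)) <= C3 * (sg * ln xi).
{ move=> sg h1 h2. apply: Rle_trans (hC3 sg xi hxi h1). apply: Series_le; last exact: (proj1 (zlor_series Hz RH Hs Hr xi (proj1 h1))).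
  move=> n. split; first by left; exact: lor_pos. apply: zlor_le => //; lra. }
have eb := fun Z => error_bound Hz RH Hs Hr x0 hk1 (Z := Z) ltac:(lra) C10 C20 (fun y => hC1 k y hk1) (hC2 k hk1).
set s := sqrt (INR k) in s1 s2 isq zb eb *. set e := exp (- (s / xi)). have e0 : 0 < e by exact: exp_pos. have sx : 0 < s / xi ^ 2 by apply: Rdiv_lt_0_compat; lra.
case: (Rle_dec xi s) => hc.
(* Here sg = 1: the sum over zeros is O(log xi), and both 1 / xi and 1 / sqrt k are at most sqrt k /
   xi^2. *)
- have z := zb 1 ltac:(lra) ltac:(lra). apply: Rle_trans (eb _ z) _.
  have q1 : / xi <= s / xi ^ 2. { apply: (proj1 (Rle_div_r _ _ _ x2)). have -> : / xi * xi ^ 2 = xi by field; lra. exact: hc. }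
  have q2 : / s <= / xi by apply: Rinv_le_contravar.
  set D := s / xi ^ 2 in sx q1 *. have -> : (C1 + C2) * (C3 * (1 * ln xi)) / xi = B * ln xi * / xi by rewrite /B /Rdiv; ring. have -> : (1 + C2) * s / xi ^ 2 = (1 + C2) * D by rewrite /D /Rdiv; ring.
  have b1 : B * ln xi * / xi <= B * ln xi * D by apply: Rmult_le_compat_l => //; apply: Rmult_le_pos; lra.
  have b2 : (1 + C2) * D <= (1 + C2) * D * ln xi by have : 0 <= (1 + C2) * D; [apply: Rmult_le_pos; lra | nra].
  have b3 : 136 / xi + / s <= 137 * D * ln xi by nra.
  have b4 : 0 <= (B + (1 + C2) + 137) * (D * ln xi) by nra. have b5 : 0 <= 3 * (B + (1 + C2) + 137) * (e * ln xi) by nra. lra.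
(* Here sg = xi / sqrt k, which lies in [1, xi]. Every part is O(log xi), and sqrt k < xi gives
   exp(-sqrt k / xi) >= 1/e >= 1/3, the source of the factor 3. *)
- have sg1 : 1 <= xi / s by apply: (proj1 (Rle_div_r _ _ _ _)); lra. have sgx : xi / s <= xi by apply/Rle_div_l; [lra | nra].
  have z := zb (xi / s) (conj sg1 sgx) ltac:(right; field; lra). apply: Rle_trans (eb _ z) _.
  have e3 : 1 <= 3 * e. { have : / 3 <= e. { apply: Rle_trans (_ : exp (- 1) <= _). { rewrite exp_Ropp. apply: Rinv_le_contravar; [exact: exp_pos | exact: exp_le_3]. } apply: exp_le. have : s / xi <= 1 by apply/Rle_div_l; lra. lra. } lra. }
  have -> : (C1 + C2) * (C3 * (xi / s * ln xi)) / xi = B * ln xi * / s by rewrite /B; field; lra. have is1 : / s <= 1 by nra. have ix1 : / xi <= 1. { rewrite -Rinv_1. apply: Rinv_le_contravar; lra. }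
  have bl : 0 <= B * ln xi by nra. have b1 : B * ln xi * / s <= B * ln xi by nra.
  have d1 : s / xi ^ 2 <= 1 by apply/Rle_div_l; nra. have b2 : (1 + C2) * s / xi ^ 2 <= (1 + C2) * ln xi by nra.
  have T0 : 0 <= (B + (1 + C2) + 137) * ln xi by nra.
  have p1 : 0 <= 3 * ((B + (1 + C2) + 137) * ln xi) * (s / xi ^ 2) by nra. have p2 : (B + (1 + C2) + 137) * ln xi * 1 <= (B + (1 + C2) + 137) * ln xi * (3 * e) by nra. lra.
Qed.

From mathcomp Require Import all_boot.

Theorem theorem1 (zeta : C -> C) (Hzeta : is_Riemann_zeta zeta)
  (RH : Riemann_hypothesis zeta) (Hsimple : all_nontrivial_zeros_simple zeta)
  (rho : nat -> C) (Hrho : upper_zero_enumeration zeta rho) :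
  let gamma := fun n : nat => Im (rho n) in
  (forall (xi : R) (k : nat), 0 < xi -> (1 <= k)%N ->
     ex_series (zero_term gamma xi k) /\
     ex_series (fun n : nat => prime_term xi k n.+1)) /\
  exists E : R -> nat -> R,
    (forall (xi : R) (k : nat), 0 < xi -> (1 <= k)%N ->
       S_sum gamma xi k =
         1 / (4 * PI) * ln (xi / (2 * PI))
         - c2 k * Series (fun n : nat => prime_term xi k n.+1)
         + E xi k) /\
    (exists A xi0 : R, forall (xi : R) (k : nat), xi0 <= xi -> (1 <= k)%N ->
       Rabs (E xi k) <=
         A * ((sqrt (INR k) / xi ^ 2 + exp (- (sqrt (INR k) / xi))) * ln xi)).
Proof.
move=> gamma; split.
- move=> xi k hxi /leP hk. split; first exact: (zero_ex Hzeta RH Hsimple Hrho hxi hk).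
  by have [h _] := prime_ex hxi hk.
(* E is defined as the difference, so the identity is immediate and the content is the estimate,
   valid from xi = 3 on. *)
- exists (fun xi k => S_sum gamma xi k - (1 / (4 * PI) * ln (xi / (2 * PI)) - c2 k * Series (fun n => prime_term xi k n.+1))).
  split; first by move=> xi k _ _; ring.
  have [A hA] := final_error Hzeta RH Hsimple Hrho.
  exists A, 3 => xi k hxi /leP hk. exact: hA.
Qed.
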